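(* (1) Let $\Delta$ be any Euclidean building of one of the types $A_n, B_n, C_n$, ordered in a standard way. Then any group acting freely and cocompactly on $\Delta$ by order-preserving automorphisms admits a biautomatic structure. (2) If $\Delta$ is any Euclidean building of one of the types $A_n, B_n, C_n$, then any group acting freely and cocompactly on $\Delta$ is virtually biautomatic, that is, it has a finite index subgroup possessing a biautomatic structure.
   Context: **Root systems and Coxeter complexes.** Let $\Phi$ be a reduced, irreducible, crystallographic root system spanning a Euclidean space $V$ of dimension $n$, with Weyl group $W$. Let $\mathbb{Z}\Phi^\#=\{\lambda\in V: (\lambda,\alpha)\in\mathbb{Z}\ \forall \alpha\in\Phi\}$ be the coweight lattice. For $\alpha\in\Phi,k\in\mathbb{Z}$ let $H_{\alpha,k}=\{\lambda\in V:(\lambda,\alpha)=k\}$ (the walls). The walls triangulate $V$; the resulting piecewise Euclidean simplicial complex is $\Sigma_\Phi$, and its top-dimensional closed simplices are called alcoves. The extended affine Weyl group $\widehat{W_a}=\mathbb{Z}\Phi^\#\rtimes W$ (generated by translations by $\mathbb{Z}\Phi^\#$ and by $W$) acts on $\Sigma_\Phi$ by simplicial isometries. A Euclidean Coxeter complex is a simplicial structure $\Sigma$ on a Euclidean space $V'$ that is the image of some $\Sigma_\Phi$ under an affine isometry $V\to V'$; all notions (walls, $\widehat{W_a}$, etc.) are transported by this isometry. A vertex $x$ is special if for every wall there is a parallel wall passing through $x$. **Buildings.** A Euclidean building is a simplicial piecewise Euclidean complex $\Delta$ that is the union of a family of subcomplexes (apartments) such that: (B0) there is a Euclidean Coxeter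 complex $\Sigma_0$ such that each apartment is simplicially isometric to $\Sigma_0$; (B1) any two simplices of $\Delta$ lie in a common apartment; (B2) if two apartments $\Sigma,\Sigma'$ share a top-dimensional simplex, there is an isomorphism (simplicial isometry) $\Sigma\to\Sigma'$ fixing $\Sigma\cap\Sigma'$ pointwise. $\Delta$ is of type $A_n$, $B_n$, $C_n$ if $\Sigma_0\cong\Sigma_\Phi$ with $\Phi$ of that type. A vertex of $\Delta$ is special if it is special in some (equivalently any) apartment containing it. **Orderings.** A directed edge of $\Delta^{(1)}$ is special if its origin is a special vertex, and quasi-special if it lies on a line segment $[x,y]\subset\Delta^{(1)}$ with $x,y$ special vertices. Special edges are quasi-special. An ordering of a Euclidean Coxeter complex $\Sigma$ of dimension $n$ is a function $\tau$ from the set of quasi-special edges to $\{1,\dots,n\}$ such that: 1) for each alcove $\langle x,x_1,\dots,x_n\rangle$ with $x$ a special vertex, $\tau$ is bijective on $\{[x,x_1],\dots,[x,x_n]\}$; 2) $\tau$ is $\widehat{W_a}$-invariant; 3) for any line segment $[x,y]\subset\Sigma^{(1)}$ with special end points, $\tau$ is constant on the quasi-special edges lying on $[x,y]$ and directed from $x$ to $y$. An ordering of a Euclidean building $\Delta$ of dimension $n$ is a function from its quasi-special edges to $\{1,\dots,n\}$ restricting to an ordering on each apartment. An ordering is determined by its values on the edges of one alcove starting at one special vertex of it, and these values may be prescribed by an arbitrary bijection. An automorphism $g$ of $\Delta$ (a simplicial isometry) is order-preserving if $\tau(ge)=\tau(e)$ for all quasi-special edges $e$. **Standard ordering.** Let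 $\Pi=\{\alpha_1,\dots,\alpha_n\}$ be a simple system numbered as in Bourbaki: $A_n$: $\alpha_i=\varepsilon_{i-1}-\varepsilon_i$ ($1\le i\le n$) in $\mathbb{R}^{n+1}$ with basis $\varepsilon_0,\dots,\varepsilon_n$; $B_n$ ($n\ge2$): $\alpha_i=\varepsilon_i-\varepsilon_{i+1}$ ($i<n$), $\alpha_n=\varepsilon_n$; $C_n$ ($n\ge 2$): $\alpha_i=\varepsilon_i-\varepsilon_{i+1}$ ($i<n$), $\alpha_n=2\varepsilon_n$. Let $\bar\omega_1^\vee,\dots,\bar\omega_n^\vee$ be the dual basis, $(\bar\omega_i^\vee,\alpha_j)=\delta_{ij}$ (fundamental coweights), and $\tilde\alpha=\sum c_i\alpha_i$ the highest root. The standard alcove of $\Sigma_\Phi$ has vertices $0$ and $\bar\omega_i^\vee/c_i$, $i=1,\dots,n$. The standard ordering of the building is the ordering obtained by identifying an apartment simplicially and isometrically with $\Sigma_\Phi$ and giving the edge $[0,\bar\omega_i^\vee/c_i]$ of the standard alcove the value $i$. **Groups.** Groups act by simplicial isometries; the action is cocompact if there are finitely many cells modulo the group. A biautomatic structure on a group $G$ with finite generating set $A=A^{-1}$ is a regular language $L\subset A^*$ mapping onto $G$ such that for some $k$, any two paths in the Cayley graph labelled by words of $L$ whose initial points are at distance at most one and whose end points are at distance at most one stay at distance $\le k$ at every time $t=0,1,2,\dots$ (paths being extended to be constant after their end). *)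

(* Defs.v *)
From HB Require Import structures.
From mathcomp Require Import all_boot all_order all_algebra.
From mathcomp Require Import finmap.
From mathcomp Require Import classical_sets reals.

Set Implicit Arguments.
Unset Strict Implicit.
Unset Printing Implicit Defensive.

Import Order.TTheory GRing.Theory Num.Theory.
Local Open Scope ring_scope.

(** * Euclidean geometry *)

Definition dot (R : realType) (m : nat) (u v : 'rV[R]_m) : R :=
  \sum_j u 0 j * v 0 j.

Definition edist (R : realType) (m : nat) (u v : 'rV[R]_m) : R :=
  Num.sqrt (dot (u - v) (u - v)).

Definition segment (R : realType) (m : nat) (x y : 'rV[R]_m) : set 'rV[R]_m :=
  [set p | exists2 t : R, 0 <= t <= 1 & p = x + t *: (y - x)].

Definition affinely_independent (R : realType) (T : choiceType) (m : nat)
    (s : {fset T}) (p : T -> 'rV[R]_m) : Prop :=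
  forall a : T -> R,
    \sum_(x <- s) a x = 0 -> \sum_(x <- s) a x *: p x = 0 ->
    forall x, x \in s -> a x = 0.

(** * Piecewise Euclidean simplicial complexes *)

(** A simplicial complex with vertex set [T] is given by the vertex sets of its
    simplices.  The Euclidean metric of a simplex is determined by its edge
    lengths, so the piecewise Euclidean structure is recorded by [len];
    the values of [len] on pairs that do not span a simplex are irrelevant. *)
Record peComplex (R : realType) (T : choiceType) : Type := PeComplex {
  simplex : set {fset T};
  len : T -> T -> R;
  simplex_neq0 : forall s, simplex s -> s != fset0;
  simplex_sub : forall s t : {fset T},
    simplex s -> (t `<=` s)%fset -> t != fset0 -> simplex t;
  simplex_vertex : forall x : T, simplex [fset x]%fset;
  simplex_euclidean : forall s, simplex s ->
    exists (m : nat) (p : T -> 'rV[R]_m),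
      affinely_independent s p /\
      forall x y, x \in s -> y \in s -> len x y = edist (p x) (p y)
}.

(** A simplicial isometry between two sets of simplices [K], [K'], each closed
    under faces, is given by its effect on vertices. *)
Definition simplicial_isometry (R : realType) (T U : choiceType)
    (K : set {fset T}) (l : T -> T -> R)
    (K' : set {fset U}) (l' : U -> U -> R) (f : T -> U) : Prop :=
  [/\ forall x y, K [fset x]%fset -> K [fset y]%fset -> f x = f y -> x = y,
      forall s', K' s' <-> exists2 s, K s & s' = [fset f x | x in s]%fset
    & forall x y, K [fset x; y]%fset -> l' (f x) (f y) = l x y].

(** The points of the geometric realization, in barycentric coordinates. *)
Definition realization (R : realType) (T : choiceType) (D : peComplex R T) :
    set (T -> R) :=
  [set p | exists s : {fset T},
    [/\ simplex D s, forall x, x \in s -> 0 < p x,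
        forall x, x \notin s -> p x = 0 & \sum_(x <- s) p x = 1]].

(** * The Coxeter complex of a root system *)

Definition span_of (R : realType) (m : nat) (Phi : set 'rV[R]_m) :
    set 'rV[R]_m :=
  [set v | exists (s : seq 'rV[R]_m) (a : 'rV[R]_m -> R),
     (forall r, r \in s -> Phi r) /\ v = \sum_(r <- s) a r *: r].

Definition coweight_lattice (R : realType) (m : nat) (Phi : set 'rV[R]_m) :
    set 'rV[R]_m :=
  [set v | span_of Phi v /\
     forall r, Phi r -> exists k : int, dot v r = k%:~R].

Definition wall (R : realType) (m : nat) (Phi : set 'rV[R]_m)
    (r : 'rV[R]_m) (k : int) : set 'rV[R]_m :=
  [set v | span_of Phi v /\ dot v r = k%:~R].

(** The cell of [x] consists of the points lying, for every wall, on the same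
    side of it as [x] (or on it, if [x] is); its closure is obtained by
    weakening the strict inequalities. *)
Definition closed_cell (R : realType) (m : nat) (Phi : set 'rV[R]_m)
    (x : 'rV[R]_m) : set 'rV[R]_m :=
  [set y | span_of Phi y /\ forall r (k : int), Phi r ->
     (dot x r <= k%:~R -> dot y r <= k%:~R) /\
     (k%:~R <= dot x r -> k%:~R <= dot y r)].

Definition coxeter_vertex (R : realType) (m : nat) (Phi : set 'rV[R]_m) :
    set 'rV[R]_m :=
  [set x | span_of Phi x /\ forall y, closed_cell Phi x y -> y = x].

(** [s] is the set of vertices of a closed cell. *)
Definition coxeter_simplex (R : realType) (m : nat) (Phi : set 'rV[R]_m) :
    set {fset 'rV[R]_m} :=
  [set s | exists2 x, span_of Phi x &
     forall y, y \in s <-> coxeter_vertex Phi y /\ closed_cell Phi x y].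

(** [x] is special if for every wall a parallel wall passes through [x]; in
    the direction of [r], these are the [wall Phi r k]. *)
Definition coxeter_special (R : realType) (m : nat) (Phi : set 'rV[R]_m) :
    set 'rV[R]_m :=
  [set x | coxeter_vertex Phi x /\
     forall r, Phi r -> exists k : int, wall Phi r k x].

Definition coxeter_edge (R : realType) (m : nat) (Phi : set 'rV[R]_m)
    (u v : 'rV[R]_m) : Prop :=
  u <> v /\ coxeter_simplex Phi [fset u; v]%fset.

Definition coxeter_one_skeleton (R : realType) (m : nat)
    (Phi : set 'rV[R]_m) : set 'rV[R]_m :=
  [set p | coxeter_vertex Phi p \/
     exists u v, coxeter_edge Phi u v /\ segment u v p].

Definition special_segment (R : realType) (m : nat) (Phi : set 'rV[R]_m)
    (x y : 'rV[R]_m) : Prop :=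
  [/\ coxeter_special Phi x, coxeter_special Phi y
    & forall p, segment x y p -> coxeter_one_skeleton Phi p].

Definition coxeter_quasi_special (R : realType) (m : nat)
    (Phi : set 'rV[R]_m) (u v : 'rV[R]_m) : Prop :=
  coxeter_edge Phi u v /\
  exists x y, [/\ special_segment Phi x y, segment x y u & segment x y v].

(** [u] and [v] lie on the segment from [x] to [y], [u] strictly before [v]. *)
Definition directed_along (R : realType) (m : nat)
    (x y u v : 'rV[R]_m) : Prop :=
  exists s t : R, [/\ 0 <= s, s < t, t <= 1,
    u = x + s *: (y - x) & v = x + t *: (y - x)].

Definition reflection (R : realType) (m : nat) (r v : 'rV[R]_m) : 'rV[R]_m :=
  v - (2 * dot v r / dot r r) *: r.

Inductive weyl (R : realType) (m : nat) (Phi : set 'rV[R]_m) :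
    ('rV[R]_m -> 'rV[R]_m) -> Prop :=
| weyl_id : weyl Phi id
| weyl_refl r w : Phi r -> weyl Phi w -> weyl Phi (reflection r \o w).

Definition extended_affine_weyl (R : realType) (m : nat)
    (Phi : set 'rV[R]_m) (g : 'rV[R]_m -> 'rV[R]_m) : Prop :=
  exists w l, [/\ weyl Phi w, coweight_lattice Phi l
                & forall v, g v = w v + l].

(** An ordering of the Coxeter complex of dimension [n].  The values are
    indexed by ['I_n] instead of {1, ..., n}, and only those on quasi-special
    edges matter. *)
Definition coxeter_ordering (R : realType) (m n : nat) (Phi : set 'rV[R]_m)
    (tau : 'rV[R]_m -> 'rV[R]_m -> 'I_n) : Prop :=
  [/\ (* bijectivity on the edges of an alcove issuing from a special vertex *)
      forall (s : {fset 'rV[R]_m}) x, coxeter_simplex Phi s ->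
        #|` s| = n.+1 -> x \in s -> coxeter_special Phi x ->
        forall i, exists! y, [/\ y \in s, y <> x & tau x y = i],
      (* invariance *)
      forall g u v, extended_affine_weyl Phi g ->
        coxeter_quasi_special Phi u v -> tau (g u) (g v) = tau u v
    & (* constancy along segments *)
      forall x y u v u' v', special_segment Phi x y ->
        coxeter_edge Phi u v -> directed_along x y u v ->
        coxeter_edge Phi u' v' -> directed_along x y u' v' ->
        tau u v = tau u' v'].

(** * The classical root systems *)

Inductive classical_type : Set := TypeA | TypeB | TypeC.

Definition rank_ok (X : classical_type) (n : nat) : bool :=
  match X with TypeA => (1 <= n)%N | TypeB | TypeC => (2 <= n)%N end.

Definition ambient (X : classical_type) (n : nat) : nat :=
  match X with TypeA => n.+1 | TypeB | TypeC => n end.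

Definition eps (R : realType) (m : nat) (i : nat) : 'rV[R]_m :=
  \row_(j < m) (j == i :> nat)%:R.

(** Bourbaki's bases, all indices being shifted so as to start from 0. *)
Definition bourbaki_simple (R : realType) (X : classical_type) (n : nat)
    (i : 'I_n) : 'rV[R]_(ambient X n) :=
  match X with
  | TypeA => eps R _ i - eps R _ i.+1
  | TypeB => if i.+1 == n then eps R _ i else eps R _ i - eps R _ i.+1
  | TypeC => if i.+1 == n then 2 *: eps R _ i else eps R _ i - eps R _ i.+1
  end.

Definition bourbaki_roots (R : realType) (X : classical_type) (n : nat) :
    set 'rV[R]_(ambient X n) :=
  let e (i : 'I_(ambient X n)) : 'rV[R]_(ambient X n) := eps R _ i in
  match X with
  | TypeA => [set r | exists i j, i != j /\ r = e i - e j]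
  | TypeB => [set r |
      (exists i (a : bool), r = (-1) ^+ a *: e i) \/
      (exists i j (a b : bool),
         i != j /\ r = (-1) ^+ a *: e i + (-1) ^+ b *: e j)]
  | TypeC => [set r |
      (exists i (a : bool), r = (-1) ^+ a *: (2 *: e i)) \/
      (exists i j (a b : bool),
         i != j /\ r = (-1) ^+ a *: e i + (-1) ^+ b *: e j)]
  end.

Arguments bourbaki_roots : clear implicits.

(** A root system of type [X] in a Euclidean space is isometric to a multiple
    [c > 0] of the one above. *)
Definition simple_root (R : realType) (X : classical_type) (n : nat) (c : R)
    (i : 'I_n) : 'rV[R]_(ambient X n) :=
  c *: bourbaki_simple R X i.

Definition roots (R : realType) (X : classical_type) (n : nat) (c : R) :
    set 'rV[R]_(ambient X n) :=
  [set r | exists2 r', bourbaki_roots R X n r' & r = c *: r'].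

Arguments roots : clear implicits.

Definition fundamental_coweights (R : realType) (X : classical_type) (n : nat)
    (c : R) (w : 'I_n -> 'rV[R]_(ambient X n)) : Prop :=
  forall i, span_of (roots R X n c) (w i) /\
            forall j, dot (w i) (simple_root X c j) = (i == j)%:R.

(** [h] lists the coefficients of the highest root in the simple roots. *)
Definition highest_root_coefs (R : realType) (X : classical_type) (n : nat)
    (c : R) (h : 'I_n -> R) : Prop :=
  roots R X n c (\sum_i h i *: simple_root X c i) /\
  forall b : 'I_n -> R, roots R X n c (\sum_i b i *: simple_root X c i) ->
    forall i, b i <= h i.

(** * Euclidean buildings *)

(** [f] identifies the apartment [Sg] with the Coxeter complex; its values
    outside the vertices of [Sg] are irrelevant. *)
Definition chart (R : realType) (T : choiceType) (X : classical_type) (n : nat)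
    (c : R) (D : peComplex R T) (Sg : set {fset T})
    (f : T -> 'rV[R]_(ambient X n)) : Prop :=
  simplicial_isometry Sg (len D)
    (coxeter_simplex (roots R X n c)) (@edist R (ambient X n)) f.

(** A building includes a choice of its family [apts] of apartments. *)
Record euclidean_building (R : realType) (T : choiceType)
    (X : classical_type) (n : nat) (c : R)
    (D : peComplex R T) (apts : set (set {fset T})) : Prop := {
  apt_nonempty : exists Sg, apts Sg;
  apt_subcomplex : forall Sg, apts Sg ->
    (forall s, Sg s -> simplex D s) /\
    (forall s t : {fset T}, Sg s -> (t `<=` s)%fset -> t != fset0 -> Sg t);
  apt_cover : forall s, simplex D s -> exists2 Sg, apts Sg & Sg s;
  apt_chart : forall Sg, apts Sg ->
    exists f : T -> 'rV[R]_(ambient X n), chart c D Sg f;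
  apt_common : forall s t, simplex D s -> simplex D t ->
    exists Sg, [/\ apts Sg, Sg s & Sg t];
  apt_isometry : forall Sg Sg' s, apts Sg -> apts Sg' ->
    Sg s -> Sg' s -> #|` s| = n.+1 ->
    exists f : T -> T,
      simplicial_isometry Sg (len D) Sg' (len D) f /\
      forall x, Sg [fset x]%fset -> Sg' [fset x]%fset -> f x = x
}.

(** The geodesic segments of [D] between vertices are straight segments of
    apartments, so quasi-special edges can be read off in a chart. *)
Definition quasi_special (R : realType) (T : choiceType) (X : classical_type)
    (n : nat) (c : R) (D : peComplex R T) (apts : set (set {fset T}))
    (u v : T) : Prop :=
  exists Sg (f : T -> 'rV[R]_(ambient X n)),
    [/\ apts Sg, chart c D Sg f, Sg [fset u; v]%fset
      & coxeter_quasi_special (roots R X n c) (f u) (f v)].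

Definition building_ordering (R : realType) (T : choiceType)
    (X : classical_type) (n : nat) (c : R) (D : peComplex R T)
    (apts : set (set {fset T})) (tau : T -> T -> 'I_n) : Prop :=
  forall Sg (f : T -> 'rV[R]_(ambient X n)), apts Sg -> chart c D Sg f ->
  exists2 sigma : 'rV[R]_(ambient X n) -> 'rV[R]_(ambient X n) -> 'I_n,
    coxeter_ordering (roots R X n c) sigma &
    forall u v, Sg [fset u; v]%fset ->
      coxeter_quasi_special (roots R X n c) (f u) (f v) ->
      tau u v = sigma (f u) (f v).

Definition standard_ordering (R : realType) (T : choiceType)
    (X : classical_type) (n : nat) (c : R) (D : peComplex R T)
    (apts : set (set {fset T})) (tau : T -> T -> 'I_n) : Prop :=
  building_ordering X c D apts tau /\
  exists Sg (f : T -> 'rV[R]_(ambient X n))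
         (w : 'I_n -> 'rV[R]_(ambient X n)) (h : 'I_n -> R),
    [/\ apts Sg, chart c D Sg f,
        fundamental_coweights c w, highest_root_coefs X c h
      & forall i u v, Sg [fset u; v]%fset ->
          f u = 0 -> f v = (h i)^-1 *: w i -> tau u v = i].

(** * Group actions *)

Definition isometric_action (R : realType) (T : choiceType)
    (D : peComplex R T) (G : groupType) (act : G -> T -> T) : Prop :=
  [/\ forall x, act 1%g x = x,
      forall g h x, act (g * h)%g x = act g (act h x)
    & forall g, simplicial_isometry (simplex D) (len D)
                                    (simplex D) (len D) (act g)].

Definition order_preserving (R : realType) (T : choiceType)
    (X : classical_type) (n : nat) (c : R) (D : peComplex R T)
    (apts : set (set {fset T})) (tau : T -> T -> 'I_n) (g : T -> T) : Prop :=
  forall u v, quasi_special X n c D apts u v -> tau (g u) (g v) = tau u v.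

(** Freeness on the geometric realization, not merely on the vertices. *)
Definition free_action (R : realType) (T : choiceType)
    (D : peComplex R T) (G : groupType) (act : G -> T -> T) : Prop :=
  forall g p, realization D p -> p \o act g^-1%g = p -> g = 1%g.

Definition cocompact_action (R : realType) (T : choiceType)
    (D : peComplex R T) (G : groupType) (act : G -> T -> T) : Prop :=
  exists r : seq {fset T}, forall s, simplex D s ->
    exists t g, [/\ t \in r, simplex D t & s = [fset act g x | x in t]%fset].

(** * Biautomatic groups *)

Definition word_over (G : groupType) (A : {fset G}) (w : seq G) : Prop :=
  forall a, a \in w -> a \in A.

Definition word_value (G : groupType) (w : seq G) : G := (\prod_(a <- w) a)%g.

(** A language over the alphabet [A] accepted by a finite automaton. *)
Definition regular_language (G : groupType) (A : {fset G}) (L : set (seq G)) :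
    Prop :=
  exists (Q : finType) (q0 : Q) (F : {set Q}) (delta : Q -> G -> Q),
    forall w, L w <-> word_over A w /\ foldl delta q0 w \in F.

Definition cayley_dist_le (G : groupType) (A : {fset G}) (k : nat) (g h : G) :
    Prop :=
  exists w, [/\ word_over A w, (size w <= k)%N & h = (g * word_value w)%g].

(** [take t w] is [w] once [t] exceeds its length, so that
    [g * word_value (take t w)] is the position at time [t] of the path
    labelled by [w] starting at [g], constant after its end. *)
Definition biautomatic_structure (G : groupType) (A : {fset G})
    (L : set (seq G)) : Prop :=
  [/\ (forall a, a \in A -> a^-1%g \in A) /\
      (forall g, exists2 w, word_over A w & word_value w = g),
      regular_language A L,
      forall g, exists2 w, L w & word_value w = g
    & exists k : nat, forall g g' w w', L w -> L w' ->
        cayley_dist_le A 1 g g' ->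
        cayley_dist_le A 1 (g * word_value w)%g (g' * word_value w')%g ->
        forall t, cayley_dist_le A k (g * word_value (take t w))%g
                                     (g' * word_value (take t w'))%g].

Definition biautomatic (G : groupType) : Prop :=
  exists (A : {fset G}) (L : set (seq G)), biautomatic_structure A L.

Definition finite_index (G : groupType) (S : {pred G}) : Prop :=
  exists r : seq G, forall g, exists2 t, t \in r & (t^-1 * g)%g \in S.

Definition virtually_biautomatic (G : groupType) : Prop :=
  exists (S : {pred G}) (H : subGroupType S), finite_index S /\ biautomatic H.

(* Main.v *)
From HB Require Import structures.
Require Import Defs.
From mathcomp Require Import all_boot all_order all_algebra.
From mathcomp Require Import finmap perm.
From mathcomp Require Import classical_sets reals boolp zify lra.

Set Implicit Arguments.
Unset Strict Implicit.
Unset Printing Implicit Defensive.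

Import Order.TTheory GRing.Theory Num.Theory.
Local Open Scope ring_scope.

(** Neither the simplices of the building nor its geodesics are combed, but the special vertices (in type A all vertices)
    of one translation class.  In a flat such a class is [Z^N], or [Z^(n+1)] modulo the constant vectors, and carries two
    translation-invariant gauges: the one called [le1] counts steps of a relation [R1] between vertices, the one called
    [leI] counts steps of a coarser relation [RI].  The [leI]-ball of radius [j] about [x] has a unique point
    [le1]-nearest to [y], obtained by truncating the coordinates of [y - x] at [j]; these points, for [j = 0, 1, 2, ...],
    form the path from [x] to [y].

    Such paths are recognised locally: the middle one of three consecutive vertices [u], [v], [w] is nearest to [w] among
    the [RI]-neighbours of [u].  Conversely, if this holds along a path, then by induction the path lies in one apartment
    and is the path of that apartment, so in a group acting freely and cocompactly the paths form a regular language.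
    A retraction of the building onto an apartment, centred at a vertex [z] of it, increases neither gauge and preserves
    the gauge of the difference to [z].  Centred at a truncated point it shows that a point almost nearest to [y] in almost
    the same ball is close to the truncated point, which is the fellow traveller property.

    In types B and C the two relations can be read off from adjacency and edge lengths, so that every automorphism
    respects them.  In type A the relation [R1] joins [z] to [z + e_i], and depends on the cyclic order of the [n+1] types
    of vertices.  The edges [(z, z + e_i)] are those of value 1 in the standard ordering; and the automorphisms that
    preserve all types have finite index, as every automorphism permutes the types. *)

(** * Combings of spaces that are unions of flats *)

(** The group need not preserve the translation class of the base vertex. A path therefore stays in
    the class of its origin, and one further letter leads by an [Nb]-step to the translate of the
    base vertex. Paths in neighbouring classes are compared after transport along [Nb], which
    falsifies both gauges by a bounded amount; hence truncated points must be stable under additive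
    errors ([clip_key], [clip_drop]), not merely unique.

    A step of [RI] is in general not an edge in types B and C, so the origin and two consecutive
    points need not lie in one apartment. The midpoint of the step and a uniqueness condition on it
    make up for the missing edge.

    The axioms of a building provide isometries between apartments, but no coordinates. Retractions
    are well defined only because a simplicial isometry of the flat that fixes the vertices of a
    chamber fixes all vertices. This is proved by propagation from vertex to neighbouring vertex. *)

Inductive walk (T : Type) (R : T -> T -> Prop) : nat -> T -> T -> Prop :=
| walk_refl k x : walk R k x x
| walk_cons k x y z : R x y -> walk R k y z -> walk R k.+1 x z.

Section Walks.
Variables (T : Type) (R : T -> T -> Prop).

Lemma walk1 x y : R x y -> walk R 1 x y.
Proof. by move=> h; apply: walk_cons h (walk_refl _ _ _). Qed.

(** The index is only an upper bound for the number of steps, as [walk_refl] holds at every [k]; so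
    walks can be compared with the gauges of a flat. *)
Lemma walk_mono k l x y : (k <= l)%N -> walk R k x y -> walk R l x y.
Proof.
move=> + w; elim: w l => [k0 x0 l _|k0 x0 y0 z0 h _ IH [//|l] kl].
  exact: walk_refl.
exact: walk_cons h (IH _ kl).
Qed.

Lemma walk_cat k l x y z : walk R k x y -> walk R l y z -> walk R (k + l) x z.
Proof.
elim=> [k0 x0 w|k0 x0 y0 z0 h _ IH w]; first exact: walk_mono (leq_addl _ _) w.
by rewrite addSn; apply: walk_cons h (IH w).
Qed.

Lemma walk_rcons k x y z : walk R k x y -> R y z -> walk R k.+1 x z.
Proof. by move=> w h; rewrite -addn1; apply: walk_cat w (walk1 h). Qed.

Lemma walk0P x y : walk R 0 x y -> x = y.
Proof. by move E: 0%N => k w; case: w E. Qed.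

Lemma walkSP k x y : walk R k.+1 x y -> x = y \/ exists2 z, R x z & walk R k z y.
Proof.
move E: k.+1 => k' w; case: w E => [|k0 x0 y0 z0 h w [->]]; first by left.
by right; exists y0.
Qed.

Lemma walk_sym k x y : (forall x y, R x y -> R y x) -> walk R k x y -> walk R k y x.
Proof.
move=> Rs; elim=> [k0 x0|k0 x0 y0 z0 h _ IH]; first exact: walk_refl.
exact: walk_rcons IH (Rs _ _ h).
Qed.

Lemma walk_map (T' : Type) (R' : T' -> T' -> Prop) (f : T -> T') k x y :
  (forall x y, R x y -> R' (f x) (f y)) -> walk R k x y -> walk R' k (f x) (f y).
Proof.
move=> h; elim=> [k0 x0|k0 x0 y0 z0 r _ IH]; first exact: walk_refl.
exact: walk_cons (h _ _ r) IH.
Qed.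

Lemma walk_closed (P : T -> Prop) k x y :
  (forall x y, P x -> R x y -> P y) -> P x -> walk R k x y -> P y.
Proof. by move=> h + w; elim: w => // k0 x0 y0 z0 r _ IH /h /(_ r). Qed.

Lemma sub_walk (R' : T -> T -> Prop) k x y :
  (forall x y, R x y -> R' x y) -> walk R k x y -> walk R' k x y.
Proof. exact: walk_map. Qed.

End Walks.

Local Notation intvec N := {ffun 'I_N -> int}.

(* [le1] and [leI] say that a gauge of a vector is at most a given number; the
   gauges play the role of the l1 and l-infinity norms, but may be asymmetric
   and may vanish on non-zero vectors. *)
Record flat_model (N : nat) := FlatModel {
  le1 : nat -> intvec N -> Prop;
  leI : nat -> intvec N -> Prop;
  clip : nat -> intvec N -> intvec N;
  key : nat -> nat;
  drop1 : nat;
  le1_mono : forall k l v, (k <= l)%N -> le1 k v -> le1 l v;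
  leI_mono : forall k l v, (k <= l)%N -> leI k v -> leI l v;
  le1_zero : le1 0 0;
  le1D : forall k l u v, le1 k u -> le1 l v -> le1 (k + l) (u + v);
  leID : forall k l u v, leI k u -> leI l v -> leI (k + l) (u + v);
  le1_leI : forall k v, le1 k v -> leI k v;
  le1_0N : forall v, le1 0 v -> le1 0 (- v);
  leI_le1_0 : forall v, leI 0 v -> le1 0 v;
  le1_ex : forall v, exists k, le1 k v;
  clip_leI : forall j y, leI j (clip j y);
  clip_clip : forall i j y, (i <= j)%N -> le1 0 (clip i (clip j y) - clip i y);
  clip_id : forall j y, leI j y -> le1 0 (y - clip j y);
  clip_near : forall j y z k, leI j z -> le1 k (y - z) -> le1 k (y - clip j y);
  key0 : key 0 = 0%N;
  clip_key : forall j y z e, leI (j + e) z ->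
    (forall k, le1 k (y - clip j y) -> le1 (k + e) (y - z)) ->
    le1 (key e) (z - clip j y);
  clip_drop : forall j y k, le1 k (y - clip j.+1 y) -> le1 (k + drop1) (y - clip j y);
  clip_step : forall j y, leI 1 (clip j.+1 y - clip j y);
  clip_grow : forall j y, ~ leI j y -> ~ leI j (clip j.+1 y);
  clip_loc : forall k y w, leI k.+1 y -> ~ leI k y -> leI 1 (w - y) -> ~ le1 0 (w - y) ->
    (forall z, leI 1 (z - clip k y) -> forall m, le1 m (w - z) -> le1 m (w - y)) ->
    le1 0 (y - clip k.+1 w) /\ ~ leI k.+1 w }.

Arguments le1_zero {N} _.
Arguments le1_ex {N} _ _.
Arguments clip_clip {N} _ [i j] _ _.
Arguments key0 {N} _.

Ltac vec_lia :=
  let l := fresh "l" in apply/ffunP => l; rewrite !ffunE;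
  repeat match goal with |- context [fun_of_fin ?f l] =>
    let x := fresh "x" in set x := fun_of_fin f l; move: x => ? end; lia.

Section Combing.
Variables (N : nat) (M : flat_model N) (T : Type).
Local Notation vec := (intvec N).
Local Notation le1 := (@le1 N M).
Local Notation leI := (@leI N M).
Local Notation clip := (@clip N M).
Variables (R1 RI Nb : T -> T -> Prop) (Fr : (vec -> T) -> Prop).
Variable (Wit : T -> T -> T -> Prop).

(* [RI] joins only vertices of one translation class. [Nb] compares the classes; it is coarsely bounded inside each
   of them. [Fr] consists of the coordinatizations of the apartments. Nearness to [w] does not prevent [w] from leaving
   all apartments through the previous points of a path; [Wit] is a local condition that does. *)
Definition same x y := exists k, walk RI k x y.
Definition framed x := exists phi a, Fr phi /\ phi a = x.
Definition nearest u v w := forall z, RI u z -> forall k, walk R1 k z w -> walk R1 k v w.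
Definition turn u v w := [/\ RI v w, v <> w, nearest u v w & Wit u v w].
(** A [turn] involves three consecutive points, so the first step has to be required separately to
    be a proper [RI]-step. *)
Definition comb_path k (p : nat -> T) :=
  ((0 < k)%N -> RI (p 0%N) (p 1%N) /\ p 0%N <> p 1%N) /\
  forall j, (j.+2 <= k)%N -> turn (p j) (p j.+1) (p j.+2).

Record frame_axioms := FrameAxioms {
  RI_refl : forall x, RI x x;
  RI_sym : forall x y, RI x y -> RI y x;
  R1_RI : forall x y, R1 x y -> RI x y;
  frame1 : forall phi a b k, Fr phi -> le1 k (b - a) -> walk R1 k (phi a) (phi b);
  frameI : forall phi a b k, Fr phi -> leI k (b - a) -> walk RI k (phi a) (phi b);
  frame_ex : forall x y, framed x -> same x y ->
    exists phi a b, [/\ Fr phi, phi a = x & phi b = y];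
  frame_retract : forall phi a, Fr phi -> exists rho : T -> vec,
    [/\ forall x y, same (phi a) x -> R1 x y -> le1 1 (rho y - rho x),
        forall x y, same (phi a) x -> RI x y -> leI 1 (rho y - rho x),
        forall b, le1 0 (rho (phi b) - b)
      & forall v k, same (phi a) v -> le1 k (rho v - a) -> walk R1 k (phi a) v] }.

(** The clauses on [Nb] move points and gauges to a neighbouring class at bounded cost. By [extend],
    [Wit] suffices for an apartment that contains the origin, the current end and the next vertex;
    by [frame_turn], truncated points satisfy it. *)
Record combing_axioms := CombingAxioms {
  Nb_sym : forall x y, Nb x y -> Nb y x;
  Nb_framed : forall x y, framed x -> Nb x y -> framed y;
  Nb_lift : forall x z x', framed x -> same x z -> Nb x x' ->
    exists2 z', same x' z' & Nb z z';
  Nb_dist : exists C, forall x x' z z', framed x -> Nb x x' -> Nb z z' ->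
    same x z -> same x' z' ->
    (forall k, walk RI k x' z' -> walk RI (k + C) x z) /\
    (forall k, walk R1 k x' z' -> walk R1 (k + C) x z);
  Nb_proper : forall b, exists C, forall x z, framed x -> same x z -> walk Nb b x z ->
    walk R1 C x z;
  extend : forall phi a b k w, Fr phi -> leI k.+1 (b - a) -> ~ leI k (b - a) ->
    RI (phi b) w -> Wit (phi (a + clip k (b - a))) (phi b) w ->
    exists phi' a' b' c', [/\ Fr phi', phi' a' = phi a, phi' b' = phi b & phi' c' = w];
  frame_turn : forall phi a b j, Fr phi -> ~ leI j.+1 (b - a) ->
    Wit (phi (a + clip j (b - a))) (phi (a + clip j.+1 (b - a)))
        (phi (a + clip j.+2 (b - a))) }.

Hypothesis fa : frame_axioms.
Hypothesis ax : combing_axioms.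

Lemma same_refl x : same x x. Proof. by exists 0%N; apply: walk_refl. Qed.

Lemma same_sym x y : same x y -> same y x.
Proof. by case=> k w; exists k; apply: walk_sym w; apply: (RI_sym fa). Qed.

Lemma same_trans x y z : same x y -> same y z -> same x z.
Proof. by case=> k w [l w']; exists (k + l)%N; apply: walk_cat w w'. Qed.

Lemma RI_same x y : RI x y -> same x y. Proof. by exists 1%N; apply: walk1. Qed.

Lemma walk1_same k x y : walk R1 k x y -> same x y.
Proof. by move=> w; exists k; apply: sub_walk w; apply: (R1_RI fa). Qed.

Lemma walkI1 x y : walk RI 1 x y -> RI x y.
Proof.
move=> w; case: (@walkSP _ _ 0 _ _ w) => [->|[z h w']]; first exact: (RI_refl fa).
by rewrite -(walk0P w').
Qed.

Lemma frame_eq phi a b : Fr phi -> le1 0 (b - a) -> phi a = phi b.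
Proof. by move=> F h; apply: (@walk0P _ R1); apply: (frame1 fa). Qed.

Lemma frame_same phi a b : Fr phi -> same (phi a) (phi b).
Proof.
move=> F; have [k hk] := le1_ex M (b - a).
by exists k; apply: (frameI fa) => //; apply: le1_leI.
Qed.

Lemma framed_frame phi a : Fr phi -> framed (phi a).
Proof. by move=> F; exists phi, a. Qed.

Lemma framed_same x y : framed x -> same x y -> framed y.
Proof. by move=> fx /(frame_ex fa fx) [phi [a [b [F _ <-]]]]; apply: framed_frame. Qed.

Lemma frame_retract_walk phi a : Fr phi -> exists rho : T -> vec,
  [/\ forall x y k, same (phi a) x -> walk R1 k x y -> le1 k (rho y - rho x),
      forall x y k, same (phi a) x -> walk RI k x y -> leI k (rho y - rho x),
      forall b, le1 0 (rho (phi b) - b)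
    & forall v k, same (phi a) v -> le1 k (rho v - a) -> walk R1 k (phi a) v].
Proof.
move=> F; have [rho [h1 hI h0 hw]] := frame_retract fa a F.
exists rho; split=> //.
- move=> x y k + w; elim: w => [k0 x0|k0 x0 y0 z0 r _ IH s].
    by move=> _; rewrite subrr; apply: le1_mono (leq0n _) (le1_zero M).
  have s' : same (phi a) y0 by apply: same_trans s _; apply: walk1_same (walk1 r).
  by have := le1D (h1 _ _ s r) (IH s'); rewrite addrC subrKA add1n.
- move=> x y k + w; elim: w => [k0 x0|k0 x0 y0 z0 r _ IH s].
    by move=> _; rewrite subrr; apply: leI_mono (leq0n _) (le1_leI (le1_zero M)).
  have s' : same (phi a) y0 by apply: same_trans s _; apply: RI_same.
  by have := leID (hI _ _ s r) (IH s'); rewrite addrC subrKA add1n.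
Qed.

Lemma le1_eqv k u v : le1 0 (u - v) -> le1 k v -> le1 k u.
Proof. by move=> h0 h; have := le1D h0 h; rewrite subrK. Qed.

Lemma leI_eqv k u v : le1 0 (u - v) -> leI k v -> leI k u.
Proof. by move=> /le1_leI h0 h; have := leID h0 h; rewrite subrK. Qed.

Lemma le1_eqv0 k u v : le1 0 (v - u) -> le1 k v -> le1 k u.
Proof. by move=> /le1_0N; rewrite opprB; apply: le1_eqv. Qed.

(** A walk may leave the apartment, but a retraction brings it back without lengthening it. Hence
    walks in the building measure the gauge of the flat. *)
Lemma frame_dist phi a b k : Fr phi -> walk R1 k (phi a) (phi b) -> le1 k (b - a).
Proof.
move=> F w; have [rho [h1 _ h0 _]] := frame_retract_walk a F.
have {}h1 := h1 _ _ _ (same_refl _) w.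
have := le1D (le1D (le1_0N (h0 b)) h1) (h0 a).
by rewrite add0n addn0; congr (le1 _ _); vec_lia.
Qed.

Lemma frame_distI phi a b k : Fr phi -> walk RI k (phi a) (phi b) -> leI k (b - a).
Proof.
move=> F w; have [rho [_ h1 h0 _]] := frame_retract_walk a F.
have {}h1 := h1 _ _ _ (same_refl _) w.
have := leID (leID (le1_leI (le1_0N (h0 b))) h1) (le1_leI (h0 a)).
by rewrite add0n addn0; congr (leI _ _); vec_lia.
Qed.

(* Points almost nearest to [phi b] in the [j]-ball about [phi a] are close to the clipped point; retracting from
   the clipped point keeps the distance to it, so this may be checked in the frame. *)
Lemma clip_stable phi a b j e z : Fr phi -> same (phi a) z -> walk RI (j + e) (phi a) z ->
  (forall k, le1 k (b - a - clip j (b - a)) -> walk R1 (k + e) z (phi b)) ->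
  walk R1 (key M e) (phi (a + clip j (b - a))) z.
Proof.
move=> F sz wI w1; set y := b - a; set c := a + clip j y.
have [rho [h1 hI h0 hw]] := frame_retract_walk c F.
have sca : same (phi c) (phi a) by apply: frame_same.
have scz := same_trans sca sz.
apply: hw => //; rewrite /c opprD addrA.
have hIz : leI (j + e) (rho z - a).
  apply: leI_eqv (hI _ _ _ sca wI).
  by have := h0 a; congr (le1 _ _); vec_lia.
apply: clip_key hIz _ => k hk.
have := h1 _ _ _ scz (w1 _ hk); apply: le1_eqv0.
have := h0 b; congr (le1 _ _); rewrite /y; vec_lia.
Qed.

Lemma clip_unique phi a b j z : Fr phi -> same (phi a) z -> walk RI j (phi a) z ->
  (forall k, le1 k (b - a - clip j (b - a)) -> walk R1 k z (phi b)) ->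
  z = phi (a + clip j (b - a)).
Proof.
move=> F sz wI w1; apply/esym; apply: (@walk0P _ R1); rewrite -[X in walk _ X](key0 M).
apply: clip_stable => //; first by rewrite addn0.
by move=> k /w1; rewrite addn0.
Qed.

(** The retraction replaces [z] by a point of the flat, so the truncated point is as near to [phi b]
    as any point of the ball in the whole building, not only in the apartment. *)
Lemma near_frame phi a b j k z : Fr phi -> same (phi a) z -> walk RI j (phi a) z ->
  walk R1 k z (phi b) -> le1 k (b - a - clip j (b - a)).
Proof.
move=> F sz wI w1; have [rho [h1 hI h0 _]] := frame_retract_walk a F.
apply: (@clip_near _ _ _ _ (rho z - a)).
  apply: leI_eqv (hI _ _ _ (same_refl _) wI).
  by have := h0 a; congr (le1 _ _); vec_lia.
apply: le1_eqv0 (h1 _ _ _ sz w1).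
by have := h0 b; congr (le1 _ _); vec_lia.
Qed.

(** By [clip_unique] the truncated point is characterized by distances in the building, which do not
    refer to a frame. *)
Lemma clip_indep phi a b phi' a' b' j : Fr phi -> Fr phi' ->
  phi a = phi' a' -> phi b = phi' b' ->
  phi (a + clip j (b - a)) = phi' (a' + clip j (b' - a')).
Proof.
move=> F F' ea eb; apply: clip_unique => //.
- by rewrite -ea; apply: frame_same.
- rewrite -ea; apply: (frameI fa) => //; rewrite [a + _]addrC addrK; exact: clip_leI.
- move=> k hk; rewrite -eb; apply: (frame1 fa) => //; rewrite opprD addrA.
  apply: (@near_frame phi a b j k (phi' (a' + clip j (b' - a')))) => //.
  + by rewrite ea; apply: frame_same.
  + rewrite ea; apply: (frameI fa) => //; rewrite [a' + _]addrC addrK; exact: clip_leI.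
  + by rewrite eb; apply: (frame1 fa) => //; rewrite opprD addrA.
Qed.

(** Vectors of gauge zero are invisible in the building, so truncation has to respect them; this is
    the exact case [e = 0] of [clip_key]. *)
Lemma clip_eqv i y y' : le1 0 (y - y') -> le1 0 (clip i y - clip i y').
Proof.
move=> h; rewrite -(key0 M).
apply: clip_key; first by rewrite addn0; apply: clip_leI.
move=> k hk; rewrite addn0.
have hh : le1 k (y - clip i y).
  apply: (@clip_near _ _ i y (clip i y')); first exact: clip_leI.
  by apply: le1_eqv hk; have := h; congr (le1 _ _); vec_lia.
by apply: le1_eqv0 hh; have := h; congr (le1 _ _); vec_lia.
Qed.

Theorem comb_path_frame k p : framed (p 0%N) -> comb_path k p ->
  exists phi a b, [/\ Fr phi, phi a = p 0%N, phi b = p k,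
    leI k (b - a) & forall j, (j < k)%N -> ~ leI j (b - a)] /\
    forall j, (j <= k)%N -> p j = phi (a + clip j (b - a)).
Proof.
move=> f0; elim: k => [|k IH] [h1 ht].
  have [phi [a [F e]]] := f0; exists phi, a, a; split; first split=> //.
    by rewrite subrr; apply/le1_leI/le1_zero.
  move=> [|//] _; rewrite -e; apply: frame_eq => //.
  rewrite [a + _]addrC addrK subrr.
  apply: leI_le1_0; exact: clip_leI.
have [|phi [a [b [[F ea eb hk hk'] hp]]]] := IH.
  split; last by move=> j hj; apply: ht; apply: leqW.
  by move=> _; apply: h1.
(* A path with a single step has no turn; any frame containing both points will do. *)
clear IH; case: k h1 ht hk hk' hp eb => [|k] h1 ht hk hk' hp eb.
  have [r01 n01] := h1 isT.
  have [phi' [a' [b' [F' ea' eb']]]] := frame_ex fa f0 (RI_same r01).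
  exists phi', a', b'; split; first split=> //.
  - by apply: (frame_distI F'); rewrite ea' eb'; apply: walk1.
  - case=> // _ /leI_le1_0 /(frame_eq F'); rewrite ea' eb'; exact: n01.
  - case=> [|[|//]] _.
      rewrite -ea'; apply: frame_eq => //; rewrite [a' + _]addrC addrK.
      apply: leI_le1_0; exact: clip_leI.
    rewrite -eb'; apply: frame_eq => //.
    have : leI 1 (b' - a') by apply: (frame_distI F'); rewrite ea' eb'; apply: walk1.
    move/(@clip_id _ M) /le1_0N; congr (le1 _ _); vec_lia.
have [rvw nvw near wit] := ht k (leqnn _).
have eu := hp k (leqnSn _).
(* The new frame contains the start, the current end and the next vertex. The earlier points lie in
   it as well, being truncated points, which do not depend on the frame. *)
have [phi' [a' [b' [c' [F' ea' eb' ec']]]]] : exists phi' a' b' c',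
    [/\ Fr phi', phi' a' = phi a, phi' b' = phi b & phi' c' = p k.+2].
  by apply: (extend ax F hk (hk' _ (leqnn _))); [rewrite eb | rewrite eb -eu].
have hpj j : (j <= k.+1)%N -> p j = phi' (a' + clip j (b' - a')).
  by move=> /hp ->; apply: clip_indep.
have hb : leI k.+1 (b' - a').
  by apply: (frame_distI F'); rewrite ea' eb'; apply: (frameI fa).
have hb' : ~ leI k (b' - a').
  move=> h; apply: (hk' k (leqnn _)); apply: (frame_distI F); rewrite -ea' -eb'.
  exact: (frameI fa).
have hc : leI 1 (c' - b').
  by apply: (frame_distI F'); rewrite eb' ec' eb; apply: walk1.
have hE : c' - a' - (b' - a') = c' - b' by vec_lia.
(* This is the passage from local to global: nearness on the last three points makes the old end a
   truncation of the new one. *)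
have [] := @clip_loc _ M k (b' - a') (c' - a') hb hb'.
- by rewrite hE.
- by rewrite hE => /(frame_eq F'); rewrite eb' ec' eb; apply: nvw.
- move=> z hz m hm; rewrite hE; apply: (frame_dist F'); rewrite eb' ec' eb.
  apply: (near (phi' (a' + z))).
    apply: walkI1; rewrite (hpj k (leqnSn _)); apply: (frameI fa) => //.
    by move: hz; congr (leI _ _); vec_lia.
  rewrite -ec'; apply: (frame1 fa) => //.
  by move: hm; congr (le1 _ _); vec_lia.
move=> hbc hnc.
have hc2 : leI k.+2 (c' - a').
  have := leID hb hc; rewrite addn1; congr (leI _ _).
  vec_lia.
exists phi', a', c'; split; first split=> //; first by rewrite ea'.
  by move=> j hj hjc; apply: hnc; apply: leI_mono hjc.
move=> j; rewrite leq_eqVlt => /orP[/eqP ->|].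
  rewrite -ec'; apply: frame_eq => //.
  have := le1_0N (clip_id hc2); congr (le1 _ _); vec_lia.
rewrite ltnS => hj; rewrite (hpj _ hj); apply: frame_eq => //.
have h1' := clip_clip M (c' - a') hj.
have := le1_0N (le1D (clip_eqv j hbc) h1'); congr (le1 _ _).
vec_lia.
Qed.

Lemma leI_least v : exists k, leI k v /\ forall j, (j < k)%N -> ~ leI j v.
Proof.
have [k0 /le1_leI] := le1_ex M v; elim: k0 => [|k IH] h; first by exists 0%N.
case: (pselect (leI k v)) => [/IH //|hn]; exists k.+1; split=> // j.
by rewrite ltnS => jk hj; apply: hn; apply: leI_mono hj.
Qed.

Theorem comb_path_ex x y : framed x -> same x y ->
  exists k p, [/\ comb_path k p, p 0%N = x & p k = y].
Proof.
move=> fx /(frame_ex fa fx) [phi [a [b [F <- <-]]]].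
(* Minimality of [k] makes consecutive points distinct, by [clip_grow], and supplies the hypothesis
   of [frame_turn]. *)
have [k [hk hk']] := leI_least (b - a).
pose p j := phi (a + clip j (b - a)).
have step j : RI (p j) (p j.+1).
  apply: walkI1; apply: (frameI fa) => //.
  by have := clip_step M j (b - a); congr (leI _ _); vec_lia.
have neq j : (j < k)%N -> p j <> p j.+1.
  move=> jk e; have h0 : walk R1 0 (p j) (p j.+1) by rewrite e; apply: walk_refl.
  apply: (@clip_grow _ M j (b - a)); first exact: hk'.
  apply: leI_eqv (clip_leI M j (b - a)); have := frame_dist F h0.
  by congr (le1 _ _); vec_lia.
exists k, p; split; [split|..].
- by move=> k0; split; [exact: step|exact: neq].
- move=> j jk; split=> //; [exact: neq| |apply: (frame_turn ax) => //; exact: hk'].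
  (* [z] is an arbitrary vertex of the building; being a neighbour of [p j] it lies in the ball of
     radius [j.+1] about [phi a], so [near_frame] applies with target [p j.+2]. *)
  move=> z hz m hm; apply: (frame1 fa) => //.
  have : le1 m (a + clip j.+2 (b - a) - a - clip j.+1 (a + clip j.+2 (b - a) - a)).
    apply: (@near_frame phi _ _ _ _ z) => //.
      apply: same_trans (RI_same hz); exact: frame_same.
    apply: walk_rcons hz; apply: (frameI fa) => //.
    by have := clip_leI M j (b - a); congr (leI _ _); vec_lia.
  rewrite [a + clip _ _ - a](_ : _ = clip j.+2 (b - a)); last by vec_lia.
  apply: le1_eqv; have := clip_clip M (b - a) (leqnSn j.+1).
  by congr (le1 _ _); vec_lia.
- apply: frame_eq => //; have := le1_0N (leI_le1_0 (clip_leI M 0 (b - a))).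
  by congr (le1 _ _); vec_lia.
- by apply: frame_eq => //; have := clip_id hk; congr (le1 _ _); vec_lia.
Qed.

Lemma clip_drop_iter n j y k : le1 k (y - clip (j + n) y) ->
  le1 (k + drop1 M * n) (y - clip j y).
Proof.
elim: n j k => [|n IH] j k; first by rewrite addn0 muln0 addn0.
rewrite -addSnnS => /IH /clip_drop; apply: le1_mono; lia.
Qed.

Lemma Nb_walk_lift b x z x' : framed x -> same x z -> walk Nb b x x' ->
  exists2 z', same x' z' & walk Nb b z z'.
Proof.
move=> + + w; elim: w z => [k x0 z fx s|k x0 y0 z0 h _ IH z fx s].
  by exists z => //; apply: walk_refl.
have [z1 s1 n1] := Nb_lift ax fx s h.
have [z' s' w'] := IH _ (Nb_framed ax fx h) s1.
by exists z' => //; apply: walk_cons n1 w'.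
Qed.

Lemma Nb_walk_framed b x y : framed x -> walk Nb b x y -> framed y.
Proof. by apply: walk_closed => u v fu; apply: (Nb_framed ax). Qed.

(** [z'] is carried back along the walk one [Nb]-step at a time, and each step adds the constant of
    [Nb_dist] to both gauges. *)
Lemma Nb_walk_transport : exists C, forall b x x' z', framed x -> walk Nb b x x' ->
  same x' z' -> exists z, [/\ walk Nb b z z', same x z,
    forall k, walk RI k x' z' -> walk RI (k + b * C) x z
  & forall k, walk R1 k x' z' -> walk R1 (k + b * C) x z].
Proof.
have [C hC] := Nb_dist ax; exists C => b x x' z' fx w.
elim: w z' fx => [k x0 z' fx s|k x0 y0 z0 h w IH z' fx s].
  exists z'; split=> // [|l|l]; [exact: walk_refl|..]; exact: walk_mono (leq_addr _ _).
have fy := Nb_framed ax fx h.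
have [z1 [wz s1 hI h1]] := IH z' fy s.
have [z s2 n2] := Nb_lift ax fy s1 (Nb_sym ax h).
have [gI g1] := hC x0 y0 z z1 fx h (Nb_sym ax n2) s2 s1.
exists z; split=> // [|l /hI /gI|l /h1 /g1]; last 2 first.
- by apply: walk_mono; lia.
- by apply: walk_mono; lia.
exact: walk_cons (Nb_sym ax n2) wz.
Qed.

(** The transported point need not be [z], but both are within [b] steps of [z'], so [Nb_proper]
    bounds the distance between them. *)
Lemma Nb_walk_dist b : exists C, forall x x' z z', framed x -> walk Nb b x x' ->
  walk Nb b z z' -> same x z -> same x' z' ->
  (forall k, walk RI k x' z' -> walk RI (k + C) x z) /\
  (forall k, walk R1 k x' z' -> walk R1 (k + C) x z).
Proof.
have [C hC] := Nb_walk_transport; have [C' hC'] := Nb_proper ax (b + b).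
exists (b * C + C')%N => x x' z z' fx wx wz s s'.
have [z1 [wz1 s1 hI h1]] := hC _ _ _ _ fx wx s'.
have w1 : walk R1 C' z1 z.
  apply: hC'; [exact: framed_same fx s1|exact: same_trans (same_sym s1) s|].
  exact: walk_cat wz1 (walk_sym (Nb_sym ax) wz).
split=> k => [/hI|/h1] w; rewrite addnA; apply: walk_cat w _ => //.
by apply: sub_walk w1; apply: (R1_RI fa).
Qed.

(* [p t] is nearest to [p k] in a ball about [p 0]; transported along [Nb] the points [p' t] have almost the same
   property, so [clip_stable] applies. *)
Theorem comb_fellow_travel b : exists C, forall k k' p p', framed (p 0%N) ->
  comb_path k p -> comb_path k' p' -> walk Nb b (p 0%N) (p' 0%N) ->
  walk Nb b (p k) (p' k') -> forall t, exists2 z,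
    walk R1 C (p (minn t k)) z & walk Nb b z (p' (minn t k')).
Proof.
have [C hC] := Nb_walk_dist b.
(* Transport to the other path and back costs [C] each time, and shrinking the ball there from
   radius [t + C] to [t] costs [drop1 M * C]; the radius about [p 0] grows by [C]. *)
pose e := (C + drop1 M * C + C + C)%N; exists (key M e).
move=> k k' p p' f0 hp hp' w0 wk t.
have f0' := Nb_walk_framed f0 w0.
have [phi [a [c [[F ea ec hk hk'] e1]]]] := comb_path_frame f0 hp.
have [phi' [a' [c' [[F' ea' ec' gk gk'] e1']]]] := comb_path_frame f0' hp'.
(* Truncation beyond the size of a vector changes nothing, so a path kept constant after its end is
   still given by [clip t] at every time [t]. *)
have clamp ph u v l (q : nat -> T) : Fr ph -> ph u = q 0%N -> ph v = q l -> leI l (v - u) ->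
    (forall j, (j <= l)%N -> q j = ph (u + clip j (v - u))) ->
    q (minn t l) = ph (u + clip t (v - u)).
  move=> Fp eu ev hl hq; case: (leqP t l) => [tl|/ltnW lt]; first exact: hq.
  rewrite -ev; apply: frame_eq => //.
  have /clip_id /le1_0N : leI t (v - u) by apply: leI_mono hl.
  by congr (le1 _ _); vec_lia.
rewrite (clamp _ _ _ _ _ F ea ec hk e1) (clamp _ _ _ _ _ F' ea' ec' gk e1').
set z := phi _; set z' := phi' _.
have sz : same (p 0%N) z by rewrite -ea; apply: frame_same.
have sz' : same (p' 0%N) z' by rewrite -ea'; apply: frame_same.
have sy : same (p 0%N) (p k) by rewrite -ea -ec; apply: frame_same.
have sy' : same (p' 0%N) (p' k') by rewrite -ea' -ec'; apply: frame_same.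
have ww0 := walk_sym (Nb_sym ax) w0; have wwk := walk_sym (Nb_sym ax) wk.
(* [zz] represents the point of the second path in the class of the first. It is shown to be almost
   nearest to [p k] in almost the same ball as [z]. *)
have [zz szz wzz] := Nb_walk_lift f0' sz' ww0.
exists zz; last exact: walk_sym (Nb_sym ax) wzz.
have [z2 sz2 wz2] := Nb_walk_lift f0 sz w0.
have wI' : walk RI t (p' 0%N) z'.
  rewrite -ea'; apply: (frameI fa) => //.
  by have := clip_leI M t (c' - a'); congr (leI _ _); vec_lia.
have wI : walk RI t (p 0%N) z.
  rewrite -ea; apply: (frameI fa) => //.
  by have := clip_leI M t (c - a); congr (leI _ _); vec_lia.
have [gI _] := hC _ _ _ _ f0 w0 (walk_sym (Nb_sym ax) wzz) szz sz'.
have [hI _] := hC _ _ _ _ f0' ww0 (walk_sym (Nb_sym ax) wz2) sz2 sz.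
apply: (clip_stable (b := c)) => //.
- by rewrite ea.
- rewrite ea; apply: walk_mono (gI _ wI'); rewrite /e; lia.
move=> m hm; rewrite ec.
have wz : walk R1 m z (p k).
  by rewrite -ec; apply: (frame1 fa) => //; move: hm; congr (le1 _ _); vec_lia.
have fz2 : framed z2 by apply: framed_same f0' sz2.
have s2 : same z2 (p' k') by apply: same_trans (same_sym sz2) sy'.
have s3 : same z (p k) by apply: same_trans (same_sym sz) sy.
have [_ w2] := hC _ _ _ _ fz2 (walk_sym (Nb_sym ax) wz2) wwk s2 s3.
(* Carried over to the second path, [z] becomes a competitor in the ball of radius [t + C]; this
   bounds the distance of the truncated point there, and after shrinking the ball that of [z']. *)
have near2 : le1 (m + C) (c' - a' - clip (t + C) (c' - a')).
  apply: (@near_frame phi' _ _ _ _ z2) => //; first by rewrite ea'.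
    by rewrite ea'; apply: hI.
  by rewrite ec'; apply: w2.
have w3 : walk R1 (m + C + drop1 M * C) z' (p' k').
  rewrite -ec'; apply: (frame1 fa) => //.
  by have := clip_drop_iter near2; congr (le1 _ _); vec_lia.
have s4 : same zz (p k) by apply: same_trans (same_sym szz) sy.
have s5 : same z' (p' k') by apply: same_trans (same_sym sz') sy'.
have fzz : framed zz by apply: framed_same f0 szz.
have [_ w4] := hC _ _ _ _ fzz (walk_sym (Nb_sym ax) wzz) wk s4 s5.
by apply: walk_mono (w4 _ w3); rewrite /e; lia.
Qed.

End Combing.

(** * Regularity and the fellow traveller property *)

Section Automata.
Variables (G : groupType) (S : finType) (step : S -> G -> S -> Prop) (s0 sf : S).

Definition nfa_run (w : seq G) := exists s : nat -> S,
  [/\ s 0%N = s0, s (size w) = sf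
    & forall i, (i < size w)%N -> step (s i) (nth 1%g w i) (s i.+1)].

(** The subset construction. The induction removes the last letter, which [foldl] reads last. *)
Lemma nfa_regular (A : {fset G}) :
  regular_language A [set w | word_over A w /\ nfa_run w].
Proof.
pose delta (X : {set S}) a := [set s' | [exists s in X, `[< step s a s' >]]].
exists {set S}, [set s0], [set X : {set S} | sf \in X], delta => w.
suff H s' : s' \in foldl delta [set s0] w <-> exists s : nat -> S,
    [/\ s 0%N = s0, s (size w) = s'
      & forall i, (i < size w)%N -> step (s i) (nth 1%g w i) (s i.+1)].
  by rewrite inE; split=> -[wA h]; split=> //; apply/H.
elim/last_ind: w s' => [|w a IH] s' /=.
  rewrite inE; split=> [/eqP ->|[s [<- <- _]] //]; by exists (fun=> s0).
rewrite foldl_rcons inE size_rcons; split.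
  case/existsP => s /andP[/IH [t [t0 tw ts]] /asboolP st].
  exists (fun i => if (i <= size w)%N then t i else s'); rewrite ltnn; split=> // i.
  rewrite ltnS nth_rcons; case: ltngtP => // [iw _|-> _]; first by apply: ts.
  by rewrite tw.
case=> s [e0 ew es]; apply/existsP; exists (s (size w)); apply/andP; split.
  apply/IH; exists s; split=> // i iw.
  by have := es i (ltnW iw); rewrite nth_rcons iw.
by apply/asboolP; have := es _ (ltnSn _); rewrite nth_rcons ltnn eqxx ew.
Qed.

End Automata.

Section CombedGroup.
Variables (N : nat) (M : flat_model N) (T : choiceType).
Local Notation vec := {ffun 'I_N -> int}.
Variables (R1 RI Nb : T -> T -> Prop) (Fr : (vec -> T) -> Prop).
Variable (Wit : T -> T -> T -> Prop).
Hypothesis fa : frame_axioms M R1 RI Fr.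
Hypothesis ax : combing_axioms M R1 RI Nb Fr Wit.
Variables (G : groupType) (act : G -> T -> T).
Hypothesis act1 : forall x, act 1%g x = x.
Hypothesis actM : forall g h x, act (g * h)%g x = act g (act h x).
Hypothesis R1_act : forall g x y, R1 x y -> R1 (act g x) (act g y).
Hypothesis RI_act : forall g x y, RI x y -> RI (act g x) (act g y).
Hypothesis Nb_act : forall g x y, Nb x y -> Nb (act g x) (act g y).
Hypothesis Wit_act : forall g x y z, Wit x y z -> Wit (act g x) (act g y) (act g z).
Local Notation framed := (framed Fr).
Local Notation same := (same RI).
Local Notation turn := (turn R1 RI Wit).
Local Notation comb_path := (comb_path R1 RI Wit).
Hypothesis framed_act : forall g x, framed x -> framed (act g x).
Hypothesis act_free : forall g x, framed x -> act g x = x -> g = 1%g.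
Variable (O : seq T).
Hypothesis O_framed : forall o, o \in O -> framed o.
Hypothesis O_cover : forall x, framed x -> exists2 o, o \in O & exists g, x = act g o.
Hypothesis loc_finite : forall x, framed x ->
  exists s : seq T, forall y, RI x y \/ Nb x y -> y \in s.
Hypothesis Nb_connected : forall x y, framed x -> framed y -> exists b, walk Nb b x y.
Hypothesis same_meet : forall x y, framed x -> framed y -> exists2 y', same x y' & Nb y' y.
Variable (x0 : T).
Hypothesis x0O : x0 \in O.

Let link x y := RI x y \/ Nb x y.

Lemma actK g : cancel (act g) (act g^-1%g).
Proof. by move=> x; rewrite -actM mulVg act1. Qed.

Lemma actVK g : cancel (act g^-1%g) (act g).
Proof. by move=> x; rewrite -actM mulgV act1. Qed.

Lemma link_act g x y : link x y -> link (act g x) (act g y).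
Proof. by case=> h; [left; apply: RI_act|right; apply: Nb_act]. Qed.

Lemma link_sym x y : link x y -> link y x.
Proof. by case=> h; [left; apply: (RI_sym fa)|right; apply: (Nb_sym ax)]. Qed.

Lemma walk_act (R : T -> T -> Prop) g k x y :
  (forall x y, R x y -> R (act g x) (act g y)) -> walk R k x y -> walk R k (act g x) (act g y).
Proof. exact: walk_map. Qed.

Lemma turn_act g x y z : turn x y z -> turn (act g x) (act g y) (act g z).
Proof.
case=> h1 h2 h3 h4; split; [exact: RI_act| |move=> t ht k w|exact: Wit_act].
  by move/(can_inj (actK g)).
rewrite -(actVK g z); apply: walk_act; first exact: R1_act.
rewrite actVK; apply: (h3 (act g^-1%g t)); first by rewrite -(actK g x); apply: RI_act.
by rewrite -(actK g z); apply: walk_act w; apply: R1_act.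
Qed.

Lemma comb_path_act g k p : comb_path k p -> comb_path k (fun i => act g (p i)).
Proof.
case=> h1 h2; split=> [/h1 [h3 h4]|j /h2]; last exact: turn_act.
by split; [apply: RI_act|move/(can_inj (actK g))].
Qed.

(** Only finitely many vertices are linked to one of the finitely many representatives, and by
    freeness [g] is determined by [o'] and the vertex [act g o']. Adding inverses makes the alphabet
    symmetric. *)
Lemma letters_ex : exists A : {fset G}, (forall a, a \in A -> a^-1%g \in A) /\
  forall o o' g, o \in O -> o' \in O -> link o (act g o') -> g \in A.
Proof.
have /choice [nb hnb] : forall o, exists s : seq T, o \in O -> forall y, link o y -> y \in s.
  move=> o; case: (boolP (o \in O)) => [/O_framed/loc_finite [s hs]|_]; last by exists [::].
  by exists s.
have /choice [tr htr] : forall oy : T * T, exists g0, oy.1 \in O ->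
    forall g, act g oy.1 = oy.2 -> g = g0.
  move=> [o y] /=; case: (pselect (exists g, act g o = y)) => [[g0 h0]|hn]; last first.
    by exists 1%g => _ g hg; case: hn; exists g.
  exists g0 => oO g hg; have : (g0^-1 * g)%g = 1%g.
    by apply: (act_free (O_framed oO)); rewrite actM hg -h0 actK.
  by move/(congr1 (fun h => (g0 * h)%g)); rewrite mulVKg mulg1.
pose B := [seq tr (o', y) | o' <- O, y <- flatten [seq nb o | o <- O]].
exists (seq_fset tt (B ++ [seq b^-1%g | b <- B])); split.
  move=> a; rewrite !seq_fsetE !mem_cat => /orP[aB|/mapP[b bB ->]].
    by apply/orP; right; apply: map_f.
  by rewrite invgK bB.
move=> o o' g oO o'O h; rewrite seq_fsetE mem_cat; apply/orP; left.
apply/allpairsP; exists (o', act g o') => /=; split=> //; last exact: htr.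
by apply/flattenP; exists (nb o); [apply: map_f|apply: hnb].
Qed.

(** Every vertex of the walk is a translate of a representative, and successive translating elements
    differ by a letter. One more letter may be needed at the end, because one vertex can be written
    as a translate in two ways. *)
Lemma cayley_walk (A : {fset G}) :
  (forall o o' g, o \in O -> o' \in O -> link o (act g o') -> g \in A) ->
  forall k x y, framed x -> walk link k x y -> forall g h o o', o \in O -> o' \in O ->
  x = act g o -> y = act h o' -> cayley_dist_le A k.+1 g h.
Proof.
move=> hA; have hA1 g h o o' : o \in O -> o' \in O -> link (act g o) (act h o') ->
    (g^-1 * h)%g \in A.
  move=> oO o'O /(link_act g^-1%g); rewrite actK -actM; exact: hA.
move=> k x y + w; elim: w => [k0 x1|k0 x1 y1 z1 r w IH] f1 g h o o' oO o'O ex ey.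
  exists [:: (g^-1 * h)%g]; split=> //; last by rewrite /word_value big_seq1 mulVKg.
  move=> a; rewrite inE => /eqP ->; apply: hA1 oO o'O _.
  by rewrite -ex -ey; left; apply: (RI_refl fa).
have f2 : framed y1.
  case: r => r; last exact: (Nb_framed ax f1 r).
  exact: (framed_same fa f1 (RI_same r)).
have [o1 o1O [g1 e1]] := O_cover f2.
have [v [vA vs ve]] := IH f2 g1 h o1 o' o1O o'O e1 ey.
exists ((g^-1 * g1)%g :: v); split=> //.
  move=> a; rewrite inE => /orP[/eqP ->|/vA //]; apply: (hA1 _ _ o o1) => //.
  by rewrite -ex -e1.
by rewrite /word_value big_cons mulgA mulVKg.
Qed.

Lemma cayley_Nb_walk (A : {fset G}) : exists b, forall g h,
  cayley_dist_le A 1 g h -> walk Nb b (act g x0) (act h x0).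
Proof.
have /choice [f hf] : forall a, exists b, walk Nb b x0 (act a x0).
  by move=> a; apply: Nb_connected; [exact: O_framed|apply/framed_act/O_framed].
exists (\max_(a <- A) f a)%N => g h [w [wA sw ->]].
case: w wA sw => [|a [|//]] wA _.
  by rewrite /word_value big_nil mulg1; apply: walk_refl.
rewrite /word_value big_seq1 actM; apply: walk_act; first exact: Nb_act.
apply: walk_mono (hf a); apply: (@leq_bigmax_seq _ _ xpredT f) => //.
by apply: wA; rewrite inE.
Qed.

Section Language.
Variable (A : {fset G}).
Hypothesis A_link : forall o o' g, o \in O -> o' \in O -> link o (act g o') -> g \in A.

(* A state [Some (j, Some (i, a))] means that the last letter read is [a] and that, relative to the group element
   reached, the path is at the vertex [tnth O j] and was before at [act a^-1 (tnth O i)]; [None] is the final state. *)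
Definition lang_state : finType := option ('I_(size O) * option ('I_(size O) * A)).

Definition lang_step (s : lang_state) (a : G) (s' : lang_state) : Prop :=
  match s, s' with
  | Some (j, None), Some (j', Some (i, b)) =>
      [/\ i = j, val b = a, RI (tnth (in_tuple O) j) (act a (tnth (in_tuple O) j'))
        & tnth (in_tuple O) j <> act a (tnth (in_tuple O) j')]
  | Some (j, Some (i0, b0)), Some (j', Some (i, b)) =>
      [/\ i = j, val b = a & turn (act (val b0)^-1%g (tnth (in_tuple O) i0))
             (tnth (in_tuple O) j) (act a (tnth (in_tuple O) j'))]
  | Some (j, _), None => Nb (tnth (in_tuple O) j) (act a x0)
  | _, _ => False
  end.

Lemma x0_ord : exists j0, tnth (in_tuple O) j0 = x0.
Proof. by have /tnthP [j ->] : x0 \in in_tuple O by []; exists j. Qed.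

Definition lang j0 : set (seq G) :=
  [set w | word_over A w /\ nfa_run lang_step (Some (j0, None)) None w].

Local Notation vtx := (tnth (in_tuple O)).

Lemma vtxO j : vtx j \in O. Proof. exact: (mem_tnth j (in_tuple O)). Qed.

Lemma take_step (w : seq G) i : (i < size w)%N ->
  word_value (take i.+1 w) = (word_value (take i w) * nth 1 w i)%g.
Proof. by move=> iw; rewrite (take_nth 1%g) // /word_value -cats1 big_cat big_seq1. Qed.

(** A word has one letter more than its path has steps: the last letter is the [Nb]-step to the
    translate of the base vertex. *)
Lemma lang_path j0 w : vtx j0 = x0 -> lang j0 w -> exists k p o,
  [/\ size w = k.+1, comb_path k p, p 0%N = x0, Nb (p k) (act (word_value w) x0)
    & forall i, (i <= k)%N -> o i \in O /\ p i = act (word_value (take i w)) (o i)].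
Proof.
move=> ej0 [wA [s [e0 ew es]]].
have live i : (i < size w)%N -> exists j t, s i = Some (j, t).
  by move=> /es; case: (s i) => // -[j t]; exists j, t.
(* The empty word is not accepted, because the initial state is not final. *)
case: w wA ew es live => [|a0 w0]; first by rewrite /= e0.
set w := _ :: _ => wA ew es live.
pose j i := if s i is Some (x, _) then x else j0.
pose o i := vtx (j i); pose p i := act (word_value (take i w)) (o i).
have sS i : (i.+1 < size w)%N -> exists b : A, val b = nth 1%g w i /\ s i.+1 = Some (j i.+1, Some (j i, b)).
  move=> iw; have := es _ (ltnW iw); have [j1 [t1 e1]] := live _ (ltnW iw).
  have [j2 [t2 e2]] := live _ iw; rewrite /j e1 e2 /=.
  case: t1 e1 => [[i1 b1]|] e1; case: t2 e2 => [[i2 b2]|] e2 //=.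
  - by case=> -> <- _; exists b2.
  - by case=> -> <- _ _; exists b2.
have rel i (Q : T -> T -> Prop) : (forall g x y, Q x y -> Q (act g x) (act g y)) -> (i < size w)%N ->
    Q (o i) (act (nth 1%g w i) (o i.+1)) -> Q (p i) (p i.+1).
  by move=> hQ iw h; rewrite /p take_step // actM; apply: hQ.
exists (size w0), p, o; split=> //.
- split.
    move=> k0; have [b [eb e1]] := sS 0%N k0; have := es 0%N isT.
    rewrite e0 e1 /= => -[_ _ r n].
    have eo : o 0%N = vtx j0 by rewrite /o /j e0.
    split; first by apply: rel; [exact: RI_act|by []|rewrite eo].
    apply: (rel 0%N (fun x y => x <> y)) => //; last by rewrite eo.
    by move=> g x y hn /(can_inj (actK g)).
  move=> i ik; have [b [eb e1]] := sS i (ltnW ik).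
  have [b' [eb' e2]] := sS i.+1 ik.
  have := es i.+1 (ltnW ik : (i.+1 < size w)%N); rewrite e1 e2 /= => -[_ _ tr].
  have := turn_act (word_value (take i.+1 w)) tr.
  have iw : (i.+1 < size w)%N by exact: ltnW.
  rewrite -actM -actM -take_step // eb take_step; last exact: ltnW.
  by rewrite mulgK -take_step; last exact: ltnW.
- by rewrite /p take0 /word_value big_nil act1 /o /j e0.
- have [j1 [t1 e1]] := live _ (ltnSn _ : (size w0 < size w)%N).
  have := es _ (ltnSn _ : (size w0 < size w)%N); rewrite [s (size w0).+1]ew e1.
  have -> : act (word_value w) x0 =
      act (word_value (take (size w0) w)) (act (nth 1%g w (size w0)) x0).
    by rewrite -actM -take_step // take_oversize.
  have -> : p (size w0) = act (word_value (take (size w0) w)) (vtx j1) by rewrite /p /o /j e1.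
  by case: t1 {e1} => [[? ?]|] h; apply: Nb_act.
- by move=> i _; split=> //; apply: vtxO.
Qed.

Lemma path_lang j0 g k p : vtx j0 = x0 -> framed x0 -> comb_path k p -> p 0%N = x0 ->
  Nb (p k) (act g x0) -> exists2 w, lang j0 w & word_value w = g.
Proof.
move=> ej0 f0 hp p0 pk.
have fp i : (i <= k)%N -> framed (p i).
  case: hp => h1 h2; elim: i => [|[|i] IH] ik; first by rewrite p0.
    by case: (h1 ik) => r _; apply: (framed_same fa (IH _) (RI_same r)).
  by case: (h2 _ ik) => r _ _ _; apply: (framed_same fa (IH (ltnW ik)) (RI_same r)).
have /choice [dj hdj] : forall i, exists gj : G * 'I_(size O),
    (i <= k)%N -> p i = act gj.1 (vtx gj.2).
  move=> i; case: (leqP i k) => ik; last by exists (1%g, j0).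
  have [o oO [h e]] := O_cover (fp i ik).
  have /tnthP [j ej] : o \in in_tuple O by [].
  by exists (h, j) => _; rewrite e ej.
pose j i := if i is i'.+1 then (dj i).2 else j0.
(* The translating elements begin with the identity and end with [g], so the quotients of successive
   ones multiply to [g]. *)
pose h i := if i is i'.+1 then if (i <= k)%N then (dj i).1 else g else 1%g.
have hE i : (i <= k)%N -> p i = act (h i) (vtx (j i)).
  by case: i => [|i] ik; rewrite /h /j ?ik ?p0 ?act1 ?ej0 //; apply: hdj.
pose w := mkseq (fun i => (h i)^-1 * h i.+1)%g k.+1.
have nw i : (i < k.+1)%N -> nth 1%g w i = ((h i)^-1 * h i.+1)%g by exact: nth_mkseq.
have hw i : (i <= k.+1)%N -> word_value (take i w) = h i.
  elim: i => [|i IH] ik; first by rewrite take0 /word_value big_nil.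
  by rewrite take_step ?size_mkseq // IH ?nw // ?mulVKg // ltnW.
have hk1 : h k.+1 = g by rewrite /h ltnn.
have ew : word_value w = g by rewrite -hk1 -hw // take_oversize // size_mkseq.
have loc (Q : T -> T -> Prop) i y : (forall g x y, Q x y -> Q (act g x) (act g y)) -> (i <= k)%N ->
    Q (p i) (act (h i.+1) y) -> Q (vtx (j i)) (act (nth 1%g w i) y).
  move=> hQ ik; rewrite nw // actM hE // => /(hQ (h i)^-1%g); rewrite actK; exact.
have stepR i : (i < k)%N -> RI (p i) (p i.+1).
  by case: hp => h1 h2; case: i => [|i] ik; [case: (h1 ik)|case: (h2 _ ik)].
have wA : word_over A w.
  move=> a /(nthP 1%g) [i]; rewrite size_mkseq ltnS leq_eqVlt => /orP[/eqP ->|ik] <-.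
    apply: (A_link (vtxO (j k)) x0O); right; apply: loc => //; by rewrite hk1.
  apply: (A_link (vtxO (j i)) (vtxO (j i.+1))); left; apply: loc => //; first exact: ltnW.
  by rewrite -hE //; apply: stepR.
exists w => //; split=> //.
have mem i : (i <= k)%N -> nth 1%g w i \in A.
  by move=> ik; apply: wA; apply: mem_nth; rewrite size_mkseq.
pose s i : lang_state := if i is i'.+1 then
    if insub (nth 1%g w i') is Some b then
      if (i <= k)%N then Some (j i, Some (j i', b)) else None
    else None
  else Some (j0, None).
have sS i : (i < k)%N -> exists b : A, val b = nth 1%g w i /\ s i.+1 = Some (j i.+1, Some (j i, b)).
  move=> ik; exists (Sub (nth 1%g w i) (mem i (ltnW ik))); rewrite SubK; split=> //.
  rewrite /s; case: insubP => [b _ eb|]; last by rewrite mem // ltnW.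
  by rewrite ik; congr (Some (_, Some (_, _))); apply: val_inj.
have sk : s k.+1 = None by rewrite /s ltnn; case: insub.
exists s; rewrite size_mkseq; split=> // i; rewrite ltnS leq_eqVlt => /orP[/eqP ->|ik].
  have hN : Nb (vtx (j k)) (act (nth 1%g w k) x0) by apply: loc => //; rewrite hk1.
  rewrite sk; case: (k) sS hN => [|k1] sS hN; first by rewrite /s /=.
  by have [b [_ ->]] := sS k1 (ltnSn _).
have [b [eb e1]] := sS i ik; rewrite e1 /=.
case: i ik e1 eb => [|i] ik e1 eb.
  rewrite /s; split=> //.
    by apply: (loc RI 0%N) => //; rewrite -hE //; apply: stepR.
  apply: (loc (fun x y => x <> y) 0%N) => //; last first.
    by rewrite -hE //; case: hp => h1 _; case: (h1 ik).
  by move=> a x y hn /(can_inj (actK a)).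
have [b' [eb' ->]] := sS i (ltnW ik); split=> //.
case: hp => _ /(_ _ ik) /(turn_act (h i.+1)^-1%g).
have [ik0 ik1] : (i <= k)%N /\ (i.+1 <= k)%N by lia.
rewrite eb' !nw // invgM invgK !actM -(hE i) //.
by rewrite -[act (h i.+2) _](hE i.+2) // (hE i.+1) // actK.
Qed.

End Language.

Theorem combed_biautomatic : biautomatic G.
Proof.
have [A [Asym Alink]] := letters_ex.
have [j0 ej0] := x0_ord.
have f0 : framed x0 by apply: O_framed.
exists A, (lang A j0).
have ex g : exists2 w, lang A j0 w & word_value w = g.
  have fg : framed (act g x0) by apply: framed_act.
  have [y sy ny] := same_meet f0 fg.
  have [k [p [hp e0 ek]]] := comb_path_ex fa ax f0 sy.
  by apply: (path_lang Alink ej0 f0 hp e0); rewrite ek.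
split=> //; last first.
- have [b0 hb0] := cayley_Nb_walk A.
  (* The summand 2 stands for the final [Nb]-steps of the two words. *)
  have [C hC] := comb_fellow_travel fa ax (b0 + 2)%N.
  exists (C + (b0 + 2) + 2).+1 => g g' w w' hw hw' d0 d1 t.
  have [k [p [o [sk hp p0 nk ho]]]] := lang_path ej0 hw.
  have [k' [p' [o' [sk' hp' p0' nk' ho']]]] := lang_path ej0 hw'.
  have w0 : walk Nb (b0 + 2) (act g (p 0%N)) (act g' (p' 0%N)).
    by rewrite p0 p0'; apply: walk_mono (hb0 _ _ d0); rewrite leq_addr.
  have w1 : walk Nb (b0 + 2) (act g (p k)) (act g' (p' k')).
    rewrite addn2; apply: walk_cons (Nb_act g nk) _.
    apply: walk_rcons (Nb_act g' (Nb_sym ax nk')); rewrite -!actM.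
    exact: hb0.
  have [|z wz1 wz2] := hC _ _ _ _ _ (comb_path_act g hp) (comb_path_act g' hp') w0 w1 t.
    by rewrite p0; apply: framed_act.
  (* Up to time [l] the prefix of the word and the point of the path involve the same group element;
     afterwards the word is at its end, one [Nb]-step from the end of the path. *)
  have pos u (l : nat) (q : nat -> T) v (oo : nat -> T) : size v = l.+1 ->
      Nb (q l) (act (word_value v) x0) ->
      (forall i, (i <= l)%N -> oo i \in O /\ q i = act (word_value (take i v)) (oo i)) ->
      exists2 x, x \in O & walk link 1 (act u (q (minn t l))) (act (u * word_value (take t v))%g x).
    move=> sv nl hoo; case: (leqP t l) => tl.
      have [ooO e] := hoo _ tl; exists (oo t) => //.
      by rewrite e -actM; apply: walk_refl.
    exists x0 => //; rewrite take_oversize ?sv // actM; apply: walk1; right; exact: Nb_act.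
  have [x xO wx] := pos g _ _ _ _ sk nk ho.
  have [x' xO' wx'] := pos g' _ _ _ _ sk' nk' ho'.
  have fx : framed (act (g * word_value (take t w))%g x) by apply/framed_act/O_framed.
  apply: (cayley_walk Alink fx _ xO xO' erefl erefl).
  have sub1 a b l : walk R1 l a b -> walk link l a b.
    by apply: sub_walk => u v h; left; apply: (R1_RI fa).
  have sub2 a b l : walk Nb l a b -> walk link l a b by apply: sub_walk => u v h; right.
  have := walk_cat (walk_cat (walk_sym link_sym wx) (walk_cat (sub1 _ _ _ wz1) (sub2 _ _ _ wz2))) wx'.
  by apply: walk_mono; lia.
- exact: nfa_regular.
- split=> // g; have [w [wA _] e] := ex g; by exists w.
Qed.

End CombedGroup.

(** * The model flats *)

Ltac gen_ffun := repeat match goal with |- context [fun_of_fin ?f ?l] =>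
  let x := fresh "x" in set x := fun_of_fin f l; move: x => ? end.

Section SumInt.
Variable N : nat.
Implicit Types (f g : 'I_N -> int).

Lemma sum_le f g : (forall i, f i <= g i) -> \sum_i f i <= \sum_i g i.
Proof. by move=> h; apply: ler_sum => i _; apply: h. Qed.

Lemma sum_drop f g i0 : (forall i, i != i0 -> f i = g i) -> f i0 + 1 = g i0 ->
  \sum_i f i + 1 = \sum_i g i.
Proof.
move=> h h0; rewrite (bigD1 i0) //= [RHS](bigD1 i0) //= -h0 (eq_bigr g) //; lia.
Qed.

Lemma sum_const (c : int) : \sum_(i < N) c = N%:Z * c.
Proof. by rewrite sumr_const card_ord -mulr_natl; congr (_ * _); apply: natz. Qed.

Lemma le_sum_term f i : (forall j, 0 <= f j) -> f i <= \sum_j f j.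
Proof. by move=> h; rewrite (bigD1 i) //= lerDl sumr_ge0. Qed.

Lemma sumD f g : \sum_i (f i + g i) = \sum_i f i + \sum_i g i.
Proof. exact: big_split. Qed.

End SumInt.

(** * Integer vectors with the sum norm and the maximum norm *)

Section ModelBC.
Variable N : nat.
Implicit Types (u v y z w : intvec N).

Definition bc_le1 (k : nat) v := \sum_i `|v i| <= k%:Z.
Definition bc_leI (k : nat) v := forall i, `|v i| <= k%:Z.
Definition trunc (j : nat) (x : int) : int :=
  if x <= - j%:Z then - j%:Z else if j%:Z <= x then j%:Z else x.
Definition bc_clip j v : intvec N := [ffun i => trunc j (v i)].

Ltac tlia := rewrite ?ffunE /trunc; gen_ffun; repeat case: ifP; lia.

Lemma bc_le1_0 v : bc_le1 0 v -> v = 0.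
Proof.
move=> h; apply/ffunP => i; rewrite ffunE; apply/eqP.
by have := le_trans (@le_sum_term _ (fun i => `|v i|) i (fun j => normr_ge0 _)) h; rewrite normr_le0.
Qed.

Lemma bc_near_le j y z i : bc_leI j z ->  `|y i - trunc j (y i)| <= `|y i - z i|.
Proof. by move=> /(_ i); tlia. Qed.

(** Summed over the coordinates this yields [key]: the difference of the two norms contributes at
    most [e], the last term [2 * e * N]. The factor 2 occurs when [z i] overshoots [j] in the
    direction of [y i]. *)
Lemma bc_key_le j e y z i : bc_leI (j + e) z ->
  `|z i - trunc j (y i)| <= `|y i - z i| - `|y i - trunc j (y i)| + (2 * e)%:Z.
Proof. by move=> /(_ i); tlia. Qed.

(** Passing from [y] to [w] can only move coordinates of absolute value [k.+1] outwards. For any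
    other change in a coordinate, making this change alone in [y] gives a point of the unit ball
    about [bc_clip k y] that is nearer to [w]. *)
Lemma bc_loc k y w : bc_leI k.+1 y -> ~ bc_leI k y -> bc_leI 1 (w - y) -> ~ bc_le1 0 (w - y) ->
  (forall z, bc_leI 1 (z - bc_clip k y) -> forall m, bc_le1 m (w - z) -> bc_le1 m (w - y)) ->
  bc_le1 0 (y - bc_clip k.+1 w) /\ ~ bc_leI k.+1 w.
Proof.
move=> hy hy' hw hw' near.
have step i : w i = y i \/ (w i = y i + 1 /\ y i = k.+1%:Z) \/ (w i = y i - 1 /\ y i = - k.+1%:Z).
  case: (eqVneq (w i) (y i)) => [|ne]; [by left|right].
  apply: contrapT => hn.
  pose z : intvec N := [ffun j => if j == i then w i else y j].
  have hz : bc_leI 1 (z - bc_clip k y).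
    move=> j; rewrite !ffunE; case: eqP => [->|_].
      by have := hw i; have := hy i; rewrite !ffunE; move: hn ne; tlia.
    by have := hy j; tlia.
  pose m := absz (\sum_j `|w j - z j|).
  have em : \sum_j `|w j - z j| = m%:Z by rewrite /m gez0_abs // sumr_ge0.
  have := near z hz m; rewrite /bc_le1.
  rewrite (eq_bigr (fun j => `|w j - z j|)); last by move=> j _; rewrite !ffunE.
  rewrite em lexx (eq_bigr (fun j => `|w j - y j|)); last by move=> j _; rewrite !ffunE.
  move/(_ isT); rewrite -em -(@sum_drop _ (fun j => `|w j - z j|) (fun j => `|w j - y j|) i); first by move: (\sum_i0 _) => s; lia.
    by move=> j /negPf ji; rewrite !ffunE ji.
  by rewrite !ffunE eqxx subrr normr0 add0r; have := hw i; rewrite !ffunE; move: ne; gen_ffun; lia.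
have [i0 hi0] : exists i, w i <> y i.
  apply: contrapT => hn; apply: hw'; rewrite /bc_le1 big1 // => i _; rewrite !ffunE.
  by apply/eqP; rewrite normr_eq0 subr_eq0; apply/eqP; apply: contrapT => h; apply: hn; exists i.
split.
  rewrite /bc_le1 big1 // => i _; rewrite !ffunE; have := hy i; have := step i; tlia.
by move=> /(_ i0); have := step i0; lia.
Qed.

(** [drop1] is [N] because each coordinate of the truncated vector changes by at most one. The
    definition is transparent, since later proofs use the gauges of the model by conversion. *)
Definition modelBC : flat_model N.
Proof.
apply: (@FlatModel N bc_le1 bc_leI bc_clip (fun e => e + 2 * e * N)%N N) => //.
- by move=> k l v kl h; apply: le_trans h _; lia.
- by move=> k l v kl h i; have := h i; lia.
- by rewrite /bc_le1 big1 // => i _; rewrite ffunE normr0.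
- move=> k l u v hu hv; rewrite /bc_le1 PoszD; apply: le_trans (lerD hu hv).
  by rewrite -sumD; apply: sum_le => i; rewrite ffunE ler_normD.
- by move=> k l u v hu hv i; have := hu i; have := hv i; rewrite ffunE; gen_ffun; lia.
- by move=> k v h i; apply: le_trans (@le_sum_term _ (fun i => `|v i|) i _) h => j; apply: normr_ge0.
- by move=> v /bc_le1_0 ->; rewrite oppr0 /bc_le1 big1 // => i _; rewrite ffunE normr0.
- by move=> v h; rewrite /bc_le1 big1 // => i _; apply/eqP; rewrite normr_eq0; have := h i; lia.
- move=> v; exists (absz (\sum_i `|v i|)); rewrite /bc_le1 gez0_abs // sumr_ge0 // => i _.
- by move=> j y i; rewrite ffunE; tlia.
- by move=> i j y ij; rewrite /bc_le1 big1 // => l _; rewrite !ffunE; tlia.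
- by move=> j y h; rewrite /bc_le1 big1 // => l _; rewrite !ffunE; have := h l; tlia.
- move=> j y z k hz; apply: le_trans; apply: sum_le => i; rewrite !ffunE; exact: bc_near_le.
- move=> j y z e hz h.
  pose s := \sum_i `|(y - bc_clip j y) i|.
  have s0 : 0 <= s by apply: sumr_ge0.
  have /h h1 : bc_le1 (absz s) (y - bc_clip j y) by rewrite /bc_le1 gez0_abs.
  have : \sum_i `|(z - bc_clip j y) i| <=
      \sum_i (`|(y - z) i| + ((- 1) * `|(y - bc_clip j y) i| + (2 * e)%:Z)).
    apply: sum_le => i; rewrite !ffunE; have := @bc_key_le j e y z i hz; gen_ffun; lia.
  rewrite 2!sumD sum_const -mulr_sumr -/s; move: h1; rewrite /bc_le1 PoszD gez0_abs //.
  move: (s) (\sum_i _) (\sum_i _) => s' a b; rewrite !PoszD !PoszM; lia.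
- move=> j y k h; rewrite /bc_le1 PoszD; have := sum_const N 1; rewrite mulr1 => {1}<-.
  apply: le_trans (lerD h (lexx _)); rewrite -sumD; apply: sum_le => i; rewrite !ffunE; tlia.
- by move=> j y i; rewrite !ffunE; tlia.
- by move=> j y h h'; apply: h => i; have := h' i; rewrite ffunE; tlia.
- exact: bc_loc.
Defined.

End ModelBC.

(** * Integer vectors modulo constants, with an asymmetric sum gauge *)

Section ModelA.
Variable n : nat.
Local Notation N := n.+1.
Implicit Types (u v y z w : intvec N).

Definition vmin v : int := v [arg min_(i < ord0) v i]%O.

Lemma vminP v : (exists i, v i = vmin v) /\ forall i, vmin v <= v i.
Proof.
rewrite /vmin; case: arg_minP => // i _ h; split; first by exists i.
by move=> j; apply: h.
Qed.

Lemma vmin_eq v i0 : (forall i, v i0 <= v i) -> vmin v = v i0.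
Proof. by case: (vminP v) => [[i <-] h] /(_ i); have := h i0; lia. Qed.

(* Vectors are considered modulo the constant ones. *)
Definition a_le1 (k : nat) v := \sum_i (v i - vmin v) <= k%:Z.
Definition a_leI (k : nat) v := forall i j, v i - v j <= k%:Z.
Definition a_clip (j : nat) v : intvec N :=
  [ffun i => if v i - vmin v <= j%:Z then v i - vmin v else j%:Z].

Ltac gen_int := gen_ffun; repeat match goal with |- context [vmin ?v] =>
  let x := fresh "x" in set x := vmin v; move: x => ? end.
Ltac clia := repeat case: ifP; lia.

Lemma a_le1I k c v : (forall i, c <= v i) -> \sum_i (v i - c) <= k%:Z -> a_le1 k v.
Proof.
move=> h; apply: le_trans; apply: sum_le => i.
by case: (vminP v) => [[j <-] _]; have := h j; lia.
Qed.

Lemma a_le1_0I v : (forall i j, v i = v j) -> a_le1 0 v.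
Proof.
by move=> h; rewrite /a_le1 big1 // => i _; case: (vminP v) => [[j <-] _]; rewrite (h i j) subrr.
Qed.

Lemma a_le1_0 v : a_le1 0 v -> forall i j, v i = v j.
Proof.
move=> h; have [_ h0] := vminP v; suff H i : v i = vmin v by move=> i j; rewrite !H.
have : v i - vmin v <= 0.
  apply: le_trans h; apply: (@le_sum_term _ (fun i => v i - vmin v)) => j.
  by rewrite subr_ge0.
by have := h0 i; gen_int; lia.
Qed.

Lemma a_leI_vmin k v : (forall i, v i - vmin v <= k%:Z) -> a_leI k v.
Proof.
by move=> h i j; have := h i; have := (vminP v).2 j; gen_int; lia.
Qed.

Lemma vmin_clip j y : vmin (a_clip j y) = 0 /\ exists i0, y i0 = vmin y.
Proof.
have [[i0 e0] h0] := vminP y.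
have e : a_clip j y i0 = 0 by rewrite ffunE e0 subrr lez_nat.
split; last by exists i0.
rewrite (@vmin_eq _ i0) ?e // => i; rewrite ffunE.
by have := h0 i; gen_int; clia.
Qed.

Lemma a_le1_clip k j y :
  a_le1 k (y - a_clip j y) <-> \sum_i (y i - vmin y - a_clip j y i) <= k%:Z.
Proof.
have [_ [i0 e0]] := vmin_clip j y; have [_ h0] := vminP y.
rewrite /a_le1; suff -> : vmin (y - a_clip j y) = vmin y.
  by rewrite (eq_bigr (fun i => y i - vmin y - a_clip j y i)) // => i _; rewrite !ffunE; gen_int; clia.
rewrite (@vmin_eq _ i0) => [|i]; rewrite !ffunE.
  by rewrite e0; gen_int; clia.
by have := h0 i; rewrite e0; gen_int; clia.
Qed.

(* [d] is the constant that makes [z + d] lie below [y - vmin y] and touch it. *)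
Lemma a_le1_normal j y z : a_leI j z -> exists d, [/\
  forall i, z i + d <= y i - vmin y, forall i, z i + d <= j%:Z
  & forall k, a_le1 k (y - z) <-> \sum_i (y i - vmin y - (z i + d)) <= k%:Z].
Proof.
move=> hz; exists (vmin (y - z) - vmin y).
have [_ h0] := vminP (y - z); have [[i0 e0] h1] := vminP y.
have hd i : z i + (vmin (y - z) - vmin y) <= y i - vmin y.
  by have := h0 i; rewrite !ffunE; gen_int; lia.
split=> // [i|k].
  have := hd i0; have := hz i i0; rewrite e0; gen_int; lia.
rewrite /a_le1 (eq_bigr (fun i => y i - vmin y - (z i + (vmin (y - z) - vmin y)))) // => i _.
by rewrite !ffunE; gen_int; lia.
Qed.

(** After normalization the numbers [a_clip j y i - (z i + d) + e] are non-negative with sum at most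
    [N.+1 * e]. Hence each is at most that, which bounds the spread of [z - a_clip j y] in each of
    the [N] coordinates. *)
Lemma a_key j y z e : a_leI (j + e) z ->
  (forall k, a_le1 k (y - a_clip j y) -> a_le1 (k + e) (y - z)) ->
  a_le1 (N * N.+1 * e) (z - a_clip j y).
Proof.
move=> hz h; have [d [hd1 hd2 hd]] := @a_le1_normal _ y z hz.
pose s := \sum_i (y i - vmin y - a_clip j y i).
have s0 : 0 <= s.
  apply: sumr_ge0 => i _; rewrite ffunE; gen_int; clia.
have /h /hd h1 : a_le1 (absz s) (y - a_clip j y) by apply/a_le1_clip; rewrite gez0_abs.
have ge i : 0 <= a_clip j y i - (z i + d) + e%:Z.
  by have := hd1 i; have := hd2 i; rewrite ffunE; gen_int; clia.
have sle : \sum_i (a_clip j y i - (z i + d) + e%:Z) <= (N.+1 * e)%N%:Z.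
  have e1 : \sum_i (a_clip j y i - (z i + d) + e%:Z) =
      \sum_i (y i - vmin y - (z i + d)) + (- s + N%:Z * e%:Z).
    rewrite -(sum_const N e) /s -sumrN -2!sumD; apply: eq_bigr => i _.
    by rewrite ffunE; gen_int; clia.
  rewrite e1; move: h1; rewrite PoszD gez0_abs //; move: s0; move: (s) (\sum_i _).
  by move=> *; lia.
have up i := le_trans (le_sum_term i ge) sle.
apply: (@a_le1I _ (- d - (N * e)%N%:Z)) => [i|].
  by have := up i; rewrite !ffunE; gen_int; clia.
apply: (@le_trans _ _ (\sum_(i < N) (N.+1 * e)%N%:Z)); first apply: sum_le => i.
  by have := ge i; rewrite !ffunE; gen_int; clia.
by rewrite sum_const -PoszM lez_nat mulnA.
Qed.

(** As in [bc_loc], but modulo constants: apart from the common shift [d], only coordinates lying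
    [k.+1] above the minimum of [y] may grow. If another one grew, raising it by one in [y] would
    give a competitor nearer to [w]. *)
Lemma a_loc k y w : a_leI k.+1 y -> ~ a_leI k y -> a_leI 1 (w - y) -> ~ a_le1 0 (w - y) ->
  (forall z, a_leI 1 (z - a_clip k y) -> forall m, a_le1 m (w - z) -> a_le1 m (w - y)) ->
  a_le1 0 (y - a_clip k.+1 w) /\ ~ a_leI k.+1 w.
Proof.
move=> hy hy' hw hw' near.
have [[l0 el0] hl0] := vminP (w - y); have [[i0 ei0] hi0] := vminP y.
set d := vmin (w - y) in el0 hl0; set c := vmin y in ei0 hi0.
have step01 i : w i = y i + d \/ w i = y i + d + 1.
  by have := hw i l0; rewrite el0; have := hl0 i; rewrite !ffunE; clear; gen_int; lia.
have step i : w i = y i + d \/ (w i = y i + d + 1 /\ y i = c + k.+1%:Z).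
  case: (step01 i) => [|wi]; [by left|right; split=> //].
  apply: contrapT => hn.
  pose z : intvec N := [ffun j => if j == i then y i + 1 else y j].
  have hz : a_leI 1 (z - a_clip k y).
    have B j : c <= (z - a_clip k y) j <= c + 1.
      rewrite !ffunE -/c; have := hy j i0; rewrite ei0; have := hi0 j.
      case: eqP => [->|_]; last by clear; gen_int; clia.
      by move: hn; clear; gen_int; clia.
    by move=> a b; have := B a; have := B b; clear; gen_int; lia.
  have ne : l0 != i.
    by apply/eqP => e; move: el0; rewrite e !ffunE wi; clear; gen_int; lia.
  pose m := absz (\sum_j (w j - z j - d)).
  have nn j : 0 <= w j - z j - d.
    rewrite ffunE; case: eqP => [->|_]; first by rewrite wi; clear; gen_int; lia.
    by case: (step01 j) => ->; clear; gen_int; lia.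
  have em : \sum_j (w j - z j - d) = m%:Z by rewrite /m gez0_abs // sumr_ge0.
  have /(near z hz) : a_le1 m (w - z).
    apply: (@a_le1I m d) => [j|].
      by have := nn j; rewrite !ffunE; clear; gen_int; lia.
    by rewrite -em; apply: sum_le => j; rewrite !ffunE.
  rewrite /a_le1 -/d -em -(@sum_drop _ (fun j => w j - z j - d) (fun j => (w - y) j - d) i); first by clear; move: (\sum_i0 _) => s; lia.
    by move=> j /negPf ji; rewrite !ffunE ji.
  by rewrite !ffunE eqxx wi; clear; gen_int; lia.
have [i1 hi1] : exists i, w i = y i + d + 1.
  apply: contrapT => hn; apply: hw'; apply: a_le1_0I => i j; rewrite !ffunE.
  have S a : w a = y a + d by case: (step01 a) => // e; case: hn; exists a.
  by rewrite !S; clear; gen_int; lia.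
have wi0 : w i0 = c + d.
  by have := step i0; rewrite ei0; clear; gen_int; lia.
have ew : vmin w = c + d.
  rewrite -wi0; apply: vmin_eq => i; rewrite wi0.
  by have := hi0 i; case: (step01 i) => ->; clear; gen_int; lia.
split.
  apply: a_le1_0I.
  suff S i : (y - a_clip k.+1 w) i = c by move=> i j; rewrite !S.
  rewrite !ffunE ew; have := hy i i0; rewrite ei0; have := step i; have := hi0 i.
  by clear; gen_int; clia.
move=> /(_ i1 i0); rewrite wi0 hi1; have := step i1; rewrite hi1.
by clear; gen_int; lia.
Qed.

Definition modelA : flat_model N.
Proof.
apply: (@FlatModel N a_le1 a_leI a_clip (fun e => N * N.+1 * e)%N N).
- by move=> k l v kl h; apply: le_trans h _; rewrite lez_nat.
- by move=> k l v kl h i j; apply: le_trans (h i j) _; rewrite lez_nat.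
- by apply: a_le1_0I => i j; rewrite !ffunE.
- move=> k l u v hu hv; have [[i ei] hi] := vminP u; have [[j ej] hj] := vminP v.
  apply: (@a_le1I _ (vmin u + vmin v)) => [l0|].
    by have := hi l0; have := hj l0; rewrite ffunE; clear; gen_int; lia.
  rewrite PoszD; apply: le_trans (lerD hu hv); rewrite -sumD; apply: sum_le => l0.
  by rewrite ffunE; clear; gen_int; lia.
- by move=> k l u v hu hv i j; have := hu i j; have := hv i j; rewrite !ffunE; clear; gen_int; lia.
- move=> k v h; apply: a_leI_vmin => i; apply: le_trans h.
  apply: (@le_sum_term _ (fun i => v i - vmin v)) => j; rewrite subr_ge0; exact: (vminP v).2.
- by move=> v /a_le1_0 h; apply: a_le1_0I => i j; rewrite !ffunE (h i j).
- by move=> v h; apply: a_le1_0I => i j; have := h i j; have := h j i; gen_int; lia.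
- move=> v; exists (absz (\sum_i (v i - vmin v))); rewrite /a_le1 gez0_abs // sumr_ge0 // => i _.
  by rewrite subr_ge0; apply: (vminP v).2.
- move=> j y a b; have := (vminP y).2 a; have := (vminP y).2 b.
  by rewrite !ffunE; clear; gen_int; clia.
- move=> i j y ij; apply: a_le1_0I.
  suff S a : (a_clip i (a_clip j y) - a_clip i y) a = 0 by move=> a b; rewrite !S.
  have [e _] := vmin_clip j y; rewrite !ffunE e; move: ij; clear.
  by rewrite ?ffunE; gen_int; clia.
- move=> j y h; apply: a_le1_0I; have [[i0 e0] h0] := vminP y.
  suff S a : (y - a_clip j y) a = vmin y by move=> a b; rewrite !S.
  by have := h a i0; rewrite !ffunE e0; clear; gen_int; clia.
- move=> j y z k hz; have [d [h1 h2 h3]] := a_le1_normal y hz.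
  move/h3 => h; apply/a_le1_clip; apply: le_trans h; apply: sum_le => i.
  by have := h1 i; have := h2 i; rewrite !ffunE; clear; gen_int; clia.
- by rewrite muln0.
- exact: a_key.
- move=> j y k /a_le1_clip h; apply/a_le1_clip.
  rewrite PoszD; have := sum_const N 1; rewrite mulr1 => {1}<-.
  apply: le_trans (lerD h (lexx _)); rewrite -sumD; apply: sum_le => i.
  by rewrite !ffunE; clear; gen_int; clia.
- move=> j y a b; have := (vminP y).2 a; have := (vminP y).2 b.
  by rewrite !ffunE; clear; gen_int; clia.
- move=> j y h h'; apply: h; have [_ [i0 e0]] := vmin_clip j y.
  apply: a_leI_vmin => i; have := h' i i0; have := (vminP y).2 i.
  by rewrite !ffunE e0; clear; gen_int; clia.
- exact: a_loc.
Defined.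

End ModelA.

(** * Apartments and retractions *)

Section SimplicialComplexes.
Local Open Scope fset_scope.

Definition vx (U : choiceType) (K : set {fset U}) (x : U) : Prop := K [fset x].

Definition faces (U : choiceType) (K : set {fset U}) : Prop :=
  (forall s, K s -> s != fset0) /\
  (forall s t : {fset U}, K s -> t `<=` s -> t != fset0 -> K t).

Lemma fset1_neq0 (U : choiceType) (x : U) : [fset x] != fset0.
Proof. by apply/fset0Pn; exists x; rewrite inE. Qed.

Lemma faces_vx (U : choiceType) (K : set {fset U}) s x : faces K -> K s -> x \in s -> vx K x.
Proof. by move=> [_ h] Ks xs; apply: h Ks _ (fset1_neq0 x); rewrite fsub1set. Qed.

Lemma faces_pair (U : choiceType) (K : set {fset U}) s x y : faces K -> K s ->
  x \in s -> y \in s -> K [fset x; y].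
Proof.
move=> [_ h] Ks xs ys; apply: h Ks _ _; first by apply/fsubsetP => z; rewrite !inE => /orP[]/eqP ->.
by apply/fset0Pn; exists x; rewrite !inE eqxx.
Qed.

Lemma imfset1 (U V : choiceType) (f : U -> V) x : [fset f z | z in [fset x]] = [fset f x].
Proof.
apply/fsetP => y; rewrite inE; apply/imfsetP/eqP => /= [[z]|->].
  by rewrite inE => /eqP ->.
by exists x; rewrite ?inE.
Qed.

Lemma imfset2 (U V : choiceType) (f : U -> V) x y :
  [fset f z | z in [fset x; y]] = [fset f x; f y].
Proof.
apply/fsetP => w; rewrite !inE; apply/imfsetP/orP => /= [[z]|[]/eqP ->].
- by rewrite !inE => /orP[]/eqP -> ->; rewrite eqxx; [left|right].
- by exists x; rewrite ?inE ?eqxx.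
- by exists y; rewrite ?inE ?eqxx ?orbT.
Qed.

Section SimplicialIsometry.
Variables (R : realType) (U V : choiceType).
Variables (K : set {fset U}) (l : U -> U -> R) (K' : set {fset V}) (l' : V -> V -> R).
Variable (f : U -> V).
Hypothesis fK : faces K.
Hypothesis hf : simplicial_isometry K l K' l' f.

Lemma si_inj x y : vx K x -> vx K y -> f x = f y -> x = y.
Proof. by case: hf => h _ _; apply: h. Qed.

Lemma si_simplex s : K s -> K' [fset f x | x in s].
Proof. by case: hf => _ h _ Ks; apply/h; exists s. Qed.

Lemma si_vx x : vx K x -> vx K' (f x).
Proof. by move/si_simplex; rewrite imfset1. Qed.

Lemma si_pair x y : K [fset x; y] -> K' [fset f x; f y].
Proof. by move/si_simplex; rewrite imfset2. Qed.

Lemma si_len x y : K [fset x; y] -> l' (f x) (f y) = l x y.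
Proof. by case: hf => _ _ h; apply: h. Qed.

Lemma si_surj y : vx K' y -> exists2 x, vx K x & f x = y.
Proof.
case: hf => _ h _ /h [s Ks e].
have : y \in [fset y] by rewrite inE.
rewrite e => /imfsetP [x /= xs ->]; exists x => //; exact: faces_vx Ks xs.
Qed.

Lemma si_simplexV s : (forall x, x \in s -> vx K x) -> K' [fset f x | x in s] -> K s.
Proof.
case: hf => inj h _ sv /h [t Kt e]; suff -> : s = t by [].
apply/fsetP => x; apply/idP/idP => xs.
  have : f x \in [fset f x | x in s] by apply/imfsetP; exists x.
  rewrite e => /imfsetP [y /= yt exy].
  by rewrite (inj _ _ (sv _ xs) (faces_vx fK Kt yt) exy).
have : f x \in [fset f x | x in t] by apply/imfsetP; exists x.
rewrite -e => /imfsetP [y /= ys exy].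
by rewrite (inj _ _ (faces_vx fK Kt xs) (sv _ ys) exy).
Qed.

Lemma si_pairV x y : vx K x -> vx K y -> K' [fset f x; f y] -> K [fset x; y].
Proof.
move=> vX vY h; apply: si_simplexV; last by rewrite imfset2.
by move=> z; rewrite !inE => /orP[]/eqP ->.
Qed.

Lemma si_card s : K s -> #|` [fset f x | x in s]| = #|` s|.
Proof.
move=> Ks; rewrite card_in_imfset //= => x y xs ys.
by apply: si_inj; apply: faces_vx Ks _.
Qed.

Lemma si_faces : faces K'.
Proof.
case: hf => inj h _; split=> [s' /h [s Ks ->]|s' t'].
  have /fset0Pn [x xs] := fK.1 _ Ks; apply/fset0Pn; exists (f x); exact: in_imfset.
move=> /h [s Ks ->] ts t0.
pose t := [fset x in s | f x \in t'].
have et : t' = [fset f x | x in t].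
  apply/fsetP => y; apply/idP/imfsetP => /= [yt|[x]].
    have /imfsetP [x /= xs e] := fsubsetP ts _ yt.
    by exists x => //; rewrite !inE /= xs -e.
  by rewrite !inE /= => /andP[_ xt] ->.
apply/h; exists t => //; apply: fK.2 Ks _ _; first by apply/fsubsetP => x; rewrite !inE /= => /andP[].
have /fset0Pn [y] := t0; rewrite et => /imfsetP [x /= xt _].
by apply/fset0Pn; exists x.
Qed.

Lemma si_inv (u0 : U) : exists g, [/\ simplicial_isometry K' l' K l g,
  forall x, vx K x -> g (f x) = x & forall y, vx K' y -> f (g y) = y].
Proof.
have /choice [g hg] : forall y, exists x, vx K' y -> vx K x /\ f x = y.
  move=> y; case: (pselect (vx K' y)) => [/si_surj [x vX e]|hn]; last by exists u0.
  by exists x.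
have gf x : vx K x -> g (f x) = x.
  by move=> vX; have [v e] := hg _ (si_vx vX); apply: si_inj.
exists g; split=> // [|y /hg [] //]; split.
- by move=> x y /hg [_ ex] /hg [_ ey] e; rewrite -ex -ey e.
- move=> s; split=> [Ks|[s' Ks' ->]].
    exists [fset f x | x in s]; first exact: si_simplex.
    apply/fsetP => x; apply/idP/imfsetP => /= [xs|[y /imfsetP [z /= zs ->] ->]].
      exists (f x); first exact: in_imfset.
      by rewrite gf //; apply: faces_vx Ks xs.
    by rewrite gf //; apply: faces_vx Ks zs.
  have fK' := si_faces.
  apply: si_simplexV => [x /imfsetP [y /= ys ->]|].
    by have [] := hg y (faces_vx fK' Ks' ys).
  suff -> : [fset f x | x in [fset g x | x in s']] = s' by [].
  apply/fsetP => y; apply/imfsetP/idP => /= [[x /imfsetP [z /= zs ->] ->]|ys].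
    by rewrite (hg z (faces_vx fK' Ks' zs)).2.
  by exists (g y); [exact: in_imfset|rewrite (hg y (faces_vx fK' Ks' ys)).2].
- move=> x y Kxy; have fK' := si_faces.
  have vX : vx K' x by apply: faces_vx Kxy _; rewrite ?inE ?eqxx.
  have vY : vx K' y by apply: faces_vx Kxy _; rewrite ?inE ?eqxx ?orbT.
  have [gx ex] := hg _ vX; have [gy ey] := hg _ vY.
  by rewrite -si_len ?ex ?ey //; apply: si_pairV; rewrite ?ex ?ey.
Qed.

End SimplicialIsometry.

Lemma si_comp (R : realType) (U V W : choiceType) (K : set {fset U}) (l : U -> U -> R)
    (K' : set {fset V}) (l' : V -> V -> R) (K'' : set {fset W}) (l'' : W -> W -> R) f g :
  simplicial_isometry K l K' l' f -> simplicial_isometry K' l' K'' l'' g ->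
  simplicial_isometry K l K'' l'' (g \o f).
Proof.
move=> hf hg; split.
- move=> x y vX vY /(si_inj hg (si_vx hf vX) (si_vx hf vY)); exact: (si_inj hf).
- have E s : [fset (g \o f) x | x in s] = [fset g y | y in [fset f x | x in s]].
    apply/fsetP => z; apply/imfsetP/imfsetP => /= [[x xs ->]|[y /imfsetP [x /= xs ->] ->]].
      by exists (f x) => //; apply: in_imfset.
    by exists x.
  move=> s; case: hf hg => _ hf2 _ [_ hg2 _]; split.
    by move/hg2 => [s' /hf2 [s0 K0 ->] ->]; exists s0; rewrite ?E.
  case=> s0 K0 ->; apply/hg2; exists [fset f x | x in s0]; rewrite ?E //.
  by apply/hf2; exists s0.
- by move=> x y Kxy; rewrite /= (si_len hg) ?(si_len hf) //; apply: (si_pair hf).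
Qed.

Section Apartments.
Variables (R : realType) (X : classical_type) (n : nat) (c : R).
Variables (T : choiceType) (D : peComplex R T) (apts : set (set {fset T})).
Hypothesis hD : euclidean_building X n c D apts.
Variable t0 : T.
Local Notation F := ('rV[R]_(ambient X n)).
Local Notation CS := (coxeter_simplex (Defs.roots R X n c)).
Local Notation chart := (@Defs.chart R T X n c D).
Local Notation flat_isometry := (simplicial_isometry CS (@edist R (ambient X n)) CS (@edist R (ambient X n))).
Local Notation apt_isometry Sg Sg' := (simplicial_isometry Sg (len D) Sg' (len D)).

Lemma D_faces : faces (simplex D).
Proof. by split=> [s|s t]; [apply: simplex_neq0|apply: simplex_sub]. Qed.

Lemma apt_faces Sg : apts Sg -> faces Sg.
Proof.
move=> h; have [h1 h2] := apt_subcomplex hD h; split=> // s /h1; exact: simplex_neq0.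
Qed.

Lemma apt_simplex Sg s : apts Sg -> Sg s -> simplex D s.
Proof. by move=> h; apply: (apt_subcomplex hD h).1. Qed.

Lemma CS_faces : faces CS.
Proof.
have [Sg hS] := apt_nonempty hD; have [f hf] := apt_chart hD hS.
exact: si_faces (apt_faces hS) hf.
Qed.

Lemma chart_inv Sg f : apts Sg -> chart Sg f -> exists g : F -> T,
  [/\ simplicial_isometry CS (@edist R (ambient X n)) Sg (len D) g,
      forall x, vx Sg x -> g (f x) = x & forall y, vx CS y -> f (g y) = y].
Proof. by move=> hS hf; apply: si_inv (apt_faces hS) hf t0. Qed.

Lemma chart_comp Sg Sg' f g : chart Sg' f -> apt_isometry Sg Sg' g -> chart Sg (f \o g).
Proof. by move=> hf hg; apply: si_comp hg hf. Qed.

Lemma chart_change Sg f f' : apts Sg -> chart Sg f -> chart Sg f' ->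
  exists2 h, flat_isometry h & forall x, vx Sg x -> h (f x) = f' x.
Proof.
move=> hS hf hf'; have [g [hg e1 e2]] := chart_inv hS hf.
exists (f' \o g); first exact: si_comp hg hf'.
by move=> x vX /=; rewrite e1.
Qed.

Definition flat_chamber (Q : {fset F}) := CS Q /\ #|` Q| = n.+1.

(** A chart is determined only up to symmetries of the flat; rigidity of a chamber makes it unique
    once its values on that chamber are given. *)
Definition rigid (Q : {fset F}) := forall h, flat_isometry h -> (forall q, q \in Q -> h q = q) ->
  forall p, vx CS p -> h p = p.

Lemma chart_preim Sg f Q : apts Sg -> chart Sg f -> CS Q ->
  exists2 C, Sg C & Q = [fset f x | x in C].
Proof. by move=> hS [_ h _] /h [C SC e]; exists C. Qed.

(* The retraction onto an apartment, centred at a chamber, read in a chart of that apartment. *)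
Theorem retraction Sg f C : apts Sg -> chart Sg f -> Sg C ->
  flat_chamber [fset f x | x in C] -> rigid [fset f x | x in C] ->
  exists rho : T -> F,
    (forall Sg' f', apts Sg' -> chart Sg' f' -> Sg' C -> (forall x, x \in C -> f' x = f x) ->
      forall v, vx Sg' v -> rho v = f' v) /\
    (forall s, simplex D s -> exists Sg' f', [/\ apts Sg', chart Sg' f', Sg' C, Sg' s
      & forall x, x \in C -> f' x = f x]).
Proof.
move=> hS hf SC [_ cC] rig.
have {}cC : #|` C| = n.+1 by rewrite -cC (si_card (apt_faces hS) hf).
have ex s : simplex D s -> exists Sg' f', [/\ apts Sg', chart Sg' f', Sg' C, Sg' s
      & forall x, x \in C -> f' x = f x].
  move=> Ds; have [S' [hS' S'C S's]] := apt_common hD (apt_simplex hS SC) Ds.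
  have [g [hg g1]] := Defs.apt_isometry hD hS' hS S'C SC cC.
  exists S', (f \o g); split=> //; first exact: chart_comp hf hg.
  move=> x xC /=; rewrite g1 //; [exact: (faces_vx (apt_faces hS') S'C xC)|exact: (faces_vx (apt_faces hS) SC xC)].
(* The two charts are compared on [S1] by means of the isometry [g], which fixes [C] and [v]. They
   differ by an isometry of the flat that fixes the chamber, hence all vertices. *)
have uniq S1 f1 S2 f2 v : apts S1 -> chart S1 f1 -> S1 C -> (forall x, x \in C -> f1 x = f x) ->
    apts S2 -> chart S2 f2 -> S2 C -> (forall x, x \in C -> f2 x = f x) ->
    vx S1 v -> vx S2 v -> f1 v = f2 v.
  move=> h1 hf1 S1C e1 h2 hf2 S2C e2 v1 v2.
  have [g [hg g1]] := Defs.apt_isometry hD h1 h2 S1C S2C cC.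
  have [h hh he] := chart_change h1 hf1 (chart_comp hf2 hg).
  have := he v v1; rewrite /= g1 // => <-; apply/esym.
  apply: rig => //; last exact: (si_vx hf1 v1).
  move=> q /imfsetP [x /= xC ->]; rewrite -e1 // he; last exact: (faces_vx (apt_faces h1) S1C xC).
  by rewrite /= g1 ?e1 ?e2 //; [exact: (faces_vx (apt_faces h1) S1C xC)|exact: (faces_vx (apt_faces h2) S2C xC)].
have /choice [rho hrho] : forall v, exists p, forall Sg' f', apts Sg' -> chart Sg' f' -> Sg' C ->
    (forall x, x \in C -> f' x = f x) -> vx Sg' v -> p = f' v.
  move=> v; have [S1 [f1 [h1 hf1 S1C v1 e1]]] := ex [fset v] (@simplex_vertex _ _ D v).
  exists (f1 v) => S2 f2 h2 hf2 S2C e2 v2; exact: (uniq S1 f1 S2 f2).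
exists rho; split=> // S' f' h' hf' SC' e' v; exact: hrho.
Qed.

(** The retraction agrees with [f] on the vertices of [s] and maps [s] onto a simplex of the flat,
    so [s] is already a simplex of [Sg]. *)
Lemma apt_full Sg f C s : apts Sg -> chart Sg f -> Sg C ->
  flat_chamber [fset f x | x in C] -> rigid [fset f x | x in C] ->
  simplex D s -> (forall x, x \in s -> vx Sg x) -> Sg s.
Proof.
move=> hS hf SC fC rC Ds sv; have [rho [h1 h2]] := retraction hS hf SC fC rC.
have [S' [f' [hS' hf' S'C S's e]]] := h2 s Ds.
apply: (si_simplexV (apt_faces hS) hf) => //.
suff -> : [fset f x | x in s] = [fset f' x | x in s] by apply: (si_simplex hf' S's).
apply: eq_in_imfset => // x /= xs.
rewrite -(h1 Sg f) //; last exact: sv.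
by apply: (h1 S' f') => //; apply: (faces_vx (apt_faces hS') S's xs).
Qed.

End Apartments.

End SimplicialComplexes.

(** * The flats of types B and C *)

Section Dot.
Variables (R : realType) (m : nat).
Implicit Types u v w : 'rV[R]_m.

Lemma dotDr v u w : dot v (u + w) = dot v u + dot v w.
Proof. by rewrite /dot -big_split; apply: eq_bigr => j _ /=; rewrite mxE mulrDr. Qed.

Lemma dotZr v a u : dot v (a *: u) = a * dot v u.
Proof. by rewrite /dot mulr_sumr; apply: eq_bigr => j _ /=; rewrite mxE mulrCA. Qed.

Lemma dotNr v u : dot v (- u) = - dot v u.
Proof. by rewrite -scaleN1r dotZr mulN1r. Qed.

Lemma dot_eps v (i : 'I_m) : dot v (eps R m i) = v 0 i.
Proof.
rewrite /dot (bigD1 i) //= mxE eqxx mulr1 big1 ?addr0 // => j ji.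
by rewrite mxE [(_ == _)%N](negPf _) ?mulr0 //.
Qed.

Lemma row_eps_sum v : v = \sum_(i < m) v 0 i *: eps R m i.
Proof.
apply/rowP => j; rewrite summxE (bigD1 j) //= !mxE eqxx mulr1 big1 ?addr0 // => i ij.
by rewrite !mxE eq_sym [(_ == _)%N](negPf _) ?mulr0 //.
Qed.

(** The coefficients in [span_of] depend on the vector and not on an index, so indices with equal
    vectors are collected first. *)
Lemma span_sum (I : finType) (Phi : set 'rV[R]_m) (g : I -> 'rV[R]_m) (b : I -> R) :
  (forall i, Phi (g i)) -> span_of Phi (\sum_i b i *: g i).
Proof.
move=> hg; exists (undup [seq g i | i <- enum I]), (fun r => \sum_(i | g i == r) b i); split.
  by move=> r; rewrite mem_undup => /mapP [i _ ->].
rewrite (eq_bigr (fun r => \sum_(i | g i == r) b i *: g i)); last first.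
  by move=> r _; rewrite scaler_suml; apply: eq_bigr => i /eqP ->.
rewrite (eq_bigr (fun r => \sum_i if g i == r then b i *: g i else 0)); last first.
  by move=> r _; rewrite big_mkcond.
rewrite exchange_big; apply: eq_bigr => i _ /=.
have gi : g i \in undup [seq g i | i <- enum I].
  by rewrite mem_undup; apply: map_f; rewrite mem_enum.
rewrite (bigD1_seq (g i) gi (undup_uniq _)) /= eqxx big1 ?addr0 // => r.
by rewrite eq_sym => /negPf ->.
Qed.

End Dot.

Definition side (R : realType) (a b k : R) := (a <= k -> b <= k) /\ (k <= a -> k <= b).

Definition sg (R : realType) (a : bool) : R := (-1) ^+ a.
Arguments sg {R} a.

(** * Closed cells of types B and C in scaled coordinates *)

Section Cells.
Variables (R : realType) (n : nat) (kap : int).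
Implicit Types (X Y : 'I_n -> R).

(** The coordinates are those of the flat multiplied by [2 * c]. Roots with two non-zero coordinates
    then give walls at the even integers in both types, the others at the multiples of [kap], which
    is 1 in type C and 2 in type B. *)
Definition cell X Y :=
  (forall i a (k : int), side (sg a * X i) (sg a * Y i) (kap * k)%:~R) /\
  (forall i j a b (k : int), i != j ->
     side (sg a * X i + sg b * X j) (sg a * Y i + sg b * Y j) (2 * k)%:~R).

Local Notation re z := (fun i => (z i)%:~R : R).

Lemma side_shift (a b k l : R) : side a b k <-> side (a + l) (b + l) (k + l).
Proof. by rewrite /side !lerD2r. Qed.

Lemma sg_sg (a b : bool) : sg a * sg b = sg (a (+) b) :> R.
Proof. by rewrite /sg signr_addb. Qed.

Lemma sg_int (a : bool) : sg a = ((-1) ^+ a : int)%:~R :> R.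
Proof. by rewrite /sg; case: a; rewrite ?expr1 ?expr0 ?mulrN1z. Qed.

(* Of the reflections fixing a special vertex [z], only the sign changes [e] are used. *)
Lemma cell_move (z : 'I_n -> int) (e : 'I_n -> bool) X Y :
  (forall i, exists u, z i = kap * u) -> (forall i j, (2 %| z i - z j)%Z) ->
  cell (fun i => (z i)%:~R + sg (e i) * X i) (fun i => (z i)%:~R + sg (e i) * Y i) <-> cell X Y.
Proof.
move=> z1 z2.
have E (a e0 : bool) (t x : R) : sg a * (t + sg e0 * x) = sg (a (+) e0) * x + sg a * t.
  by rewrite mulrDr mulrA sg_sg addrC.
have S1 i a (k : int) (x y : R) : side (sg (a (+) e i) * x) (sg (a (+) e i) * y) (kap * k)%:~R <->
    side (sg a * ((z i)%:~R + sg (e i) * x)) (sg a * ((z i)%:~R + sg (e i) * y))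
      (kap * (k + (-1) ^+ a * (z i %/ kap)%Z))%:~R.
  rewrite !E; have -> : (kap * (k + (-1) ^+ a * (z i %/ kap)%Z))%:~R =
      (kap * k)%:~R + sg a * (z i)%:~R :> R.
    have [u eu] := z1 i; rewrite sg_int -intrM -intrD mulrDr; congr (_ + _)%:~R.
    rewrite mulrCA; congr (_ * _); rewrite eu; case: (eqVneq kap 0) => [->|k0]; first by rewrite !mul0r.
    by rewrite mulrC mulKz // mulrC.
  exact: side_shift.
have S2 i j a b (k : int) (x y x' y' : R) :
    side (sg (a (+) e i) * x + sg (b (+) e j) * x') (sg (a (+) e i) * y + sg (b (+) e j) * y') (2 * k)%:~R <->
    side (sg a * ((z i)%:~R + sg (e i) * x) + sg b * ((z j)%:~R + sg (e j) * x'))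
      (sg a * ((z i)%:~R + sg (e i) * y) + sg b * ((z j)%:~R + sg (e j) * y'))
      (2 * (k + (((-1) ^+ a * z i + (-1) ^+ b * z j) %/ 2)%Z))%:~R.
  rewrite !E; have -> : (2 * (k + (((-1) ^+ a * z i + (-1) ^+ b * z j) %/ 2)%Z))%:~R =
      (2 * k)%:~R + (sg a * (z i)%:~R + sg b * (z j)%:~R) :> R.
    rewrite !sg_int -!intrM -!intrD mulrDr; congr (_ + _)%:~R.
    by have := z2 i j; case: a; case: b; rewrite ?expr1 ?expr0; lia.
  set l := sg a * _ + sg b * _; rewrite (side_shift _ _ _ l).
  have A u v (t1 t2 : R) : u + sg a * t1 + (v + sg b * t2) = u + v + (sg a * t1 + sg b * t2) by lra.
  by rewrite !A.
have bb (a e0 : bool) : (a (+) e0) (+) e0 = a by case: a; case: e0.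
split=> -[h1 h2]; split.
- move=> i a k; have := h1 i (a (+) e i) (k + (-1) ^+ (a (+) e i) * (z i %/ kap)%Z).
  by move/(iffRL (S1 _ _ _ _ _)); rewrite bb.
- move=> i j a b k ij.
  have := h2 i j (a (+) e i) (b (+) e j) (k + (((-1) ^+ (a (+) e i) * z i + (-1) ^+ (b (+) e j) * z j) %/ 2)%Z) ij.
  by move/(iffRL (S2 _ _ _ _ _ _ _ _ _)); rewrite !bb.
- move=> i a k; have := h1 i (a (+) e i) (k - (-1) ^+ a * (z i %/ kap)%Z).
  by move/(iffLR (S1 _ _ _ _ _)); rewrite subrK.
- move=> i j a b k ij.
  have := h2 i j (a (+) e i) (b (+) e j) (k - (((-1) ^+ a * z i + (-1) ^+ b * z j) %/ 2)%Z) ij.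
  by move/(iffLR (S2 _ _ _ _ _ _ _ _ _)); rewrite subrK.
Qed.

(* Every real is rounded to a nearest even integer, except that odd integers are kept; this is compatible with all
   the walls, so the rounded point lies in the closed cell of the given one. *)
Definition round2 (t : R) : int :=
  let f := Num.floor t in
  if t == f%:~R then f else if (2 %| f)%Z then f else f + 1.

Lemma round2P t : (t = (round2 t)%:~R) \/
  [/\ (2 %| round2 t)%Z, t < (round2 t)%:~R + 1 & (round2 t)%:~R - 1 < t].
Proof.
rewrite /round2; have h1 := floor_le t; have h2 := floorD1_gt t.
case: eqP => [|/eqP ne]; [by left|right].
have lt : (Num.floor t)%:~R < t by rewrite lt_neqAle eq_sym ne.
case: ifP => ev; rewrite ?intrD; split=> //; move: h2; rewrite ?intrD; try lra.
by move: ev; lia.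
Qed.

Lemma int_le_of_lt (p q : int) : (p%:~R < q%:~R + 1 :> R) -> p <= q.
Proof. by rewrite -[1]/(1%:~R) -intrD ltr_int; lia. Qed.

Lemma side_near (S : R) (H K : int) : S - 1 < H%:~R -> H%:~R < S + 1 -> side S H%:~R K%:~R.
Proof.
move=> h1 h2; split=> h; rewrite ler_int; apply: int_le_of_lt.
  by apply: lt_le_trans h2 _; rewrite lerD2r.
by apply: le_lt_trans h _; rewrite -ltrBlDr.
Qed.

Lemma side_near_even (S : R) (H k : int) : (2 %| H)%Z -> S - 2 < H%:~R -> H%:~R < S + 2 ->
  side S H%:~R (2 * k)%:~R.
Proof.
move=> ev h1 h2; split=> h; rewrite ler_int.
  have : H <= 2 * k + 1; last by move: ev; lia.
  by apply: int_le_of_lt; rewrite intrD; move: h h2; set x := (2 * k)%:~R; lra.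
have : 2 * k <= H + 1; last by move: ev; lia.
by apply: int_le_of_lt; rewrite intrD; move: h h1; set x := (2 * k)%:~R; lra.
Qed.

Lemma round_cell X : cell X (fun i => (round2 (X i))%:~R).
Proof.
split=> [i a k|i j a b k ij].
  rewrite !sg_int -intrM; apply: side_near; rewrite intrM -sg_int /sg.
    by case: (round2P (X i)) => [<-|[_ h1 h2]]; case: a; rewrite ?expr1 ?expr0; lra.
  by case: (round2P (X i)) => [<-|[_ h1 h2]]; case: a; rewrite ?expr1 ?expr0; lra.
have E : sg a * (round2 (X i))%:~R + sg b * (round2 (X j))%:~R =
    ((-1) ^+ a * round2 (X i) + (-1) ^+ b * round2 (X j))%:~R :> R.
  by rewrite intrD !intrM !sg_int.
case: (round2P (X i)) (round2P (X j)) => [e1|[ev1 h1 h2]] [e2|[ev2 h3 h4]].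
- by rewrite -e1 -e2.
- rewrite E; apply: side_near; rewrite -E -e1 /sg; case: a {E}; case: b; rewrite ?expr1 ?expr0; lra.
- rewrite E; apply: side_near; rewrite -E -e2 /sg; case: a {E}; case: b; rewrite ?expr1 ?expr0; lra.
- rewrite E; apply: side_near_even; rewrite -?E /sg.
  + by case: a {E}; case: b; rewrite ?expr1 ?expr0; lia.
  + by case: a {E}; case: b; rewrite ?expr1 ?expr0; lra.
  + by case: a {E}; case: b; rewrite ?expr1 ?expr0; lra.
Qed.

Lemma int_tri (k : int) : (k%:~R <= -1 :> R) \/ k%:~R = 0 :> R \/ 1 <= k%:~R :> R.
Proof.
have : (k <= -1) \/ k = 0 \/ 1 <= k by lia.
case=> [h|[->|h]]; [left|by right; left|right; right]; last by rewrite -[1]/(1%:~R) ler_int.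
by rewrite -[-1]/((-1)%:~R) ler_int.
Qed.

(** The values of the wall functionals are small here, so the index of a wall enters only through
    the trichotomy [int_tri]; what remains is linear arithmetic over the reals. *)
Lemma star_single (t A K q : R) e : (K <= -1) \/ K = 0 \/ 1 <= K -> q = 1 \/ q = 2 ->
  0 < t -> t < 1 -> 0 <= A -> A <= q -> side (sg e * t) (sg e * A) (q * K).
Proof.
move=> hk hq t0 t1 A0 Aq; rewrite /side /sg.
by case: hq Aq => -> Aq; case: e; rewrite ?expr0 ?expr1; case: hk => [hk|[->|hk]]; split=> hh; lra.
Qed.

Lemma star_pair (t t' A B K : R) e f : (K <= -1) \/ K = 0 \/ 1 <= K ->
  (t' <= t -> B <= A) -> (t <= t' -> A <= B) -> A + B <= 2 -> 0 <= A -> 0 <= B ->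
  (t <= 0 -> A = 0) -> (t' <= 0 -> B = 0) -> 0 <= t -> t < 1 -> 0 <= t' -> t' < 1 ->
  side (sg e * t + sg f * t') (sg e * A + sg f * B) (2 * K).
Proof.
move=> hk le1 le2 s2 A0 B0 tz tz' t0 t1 t0' t1'; rewrite /side /sg.
case: e; case: f; rewrite ?expr0 ?expr1; case: hk => [hk|[->|hk]]; split=> hh;
  do ?[by clear le1 le2 tz tz'; lra].
- have {}tz := tz ltac:(clear le1 le2 tz tz'; lra).
  have {}tz' := tz' ltac:(clear le1 le2 tz'; lra).
  by clear le1 le2; lra.
- suff : B <= A by clear le1 le2 tz tz'; lra.
  by apply: le1; clear -hh; lra.
- suff : A <= B by clear le1 le2 tz tz'; lra.
  by apply: le2; clear -hh; lra.
- suff : A <= B by clear le1 le2 tz tz'; lra.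
  by apply: le2; clear -hh; lra.
- suff : B <= A by clear le1 le2 tz tz'; lra.
  by apply: le1; clear -hh; lra.
- have {}tz := tz ltac:(clear le1 le2 tz tz'; lra).
  have {}tz' := tz' ltac:(clear le1 le2 tz'; lra).
  by clear le1 le2; lra.
Qed.

Hypothesis kap12 : kap = 1 \/ kap = 2.

Definition star_point (t : 'I_n -> R) (a : 'I_n -> int) :=
  (forall i, [/\ 0 <= a i, a i <= kap & t i = 0 -> a i = 0]) /\
  (forall i j, i != j -> a i + a j <= 2 /\ (t j <= t i -> a j <= a i)).

(** Cells at the origin in the positive orthant suffice, because [cell_move] carries them to every
    special vertex and every pattern of signs. *)
Lemma cell0P t a : (forall i, 0 <= t i < 1) -> cell t (re a) <-> star_point t a.
Proof.
move=> ht; split=> [[h1 h2]|[h1 h2]]; split.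
- move=> i; have /andP[t0 t1] := ht i; split.
  + by have := (h1 i false 0).2; rewrite mulr0 /sg expr0 !mul1r ler0z; apply.
  + have := (h1 i false 1).1; rewrite mulr1 /sg expr0 !mul1r ler_int; apply.
    by case: kap12 => ->; lra.
  + have := (h1 i false 0).1; have := (h1 i false 0).2.
    rewrite mulr0 /sg expr0 !mul1r ler0z lerz0 => g1 g2 e; move: g1 g2; rewrite e lexx.
    by move=> /(_ isT) g1 /(_ isT) g2; lia.
- move=> i j ij; have /andP[t0 t1] := ht i; have /andP[t0' t1'] := ht j; split.
  + have := (h2 i j false false 1 ij).1; rewrite mulr1 /sg expr0 !mul1r -intrD ler_int; apply; lra.
  + have := (h2 i j false true 0 ij).2; rewrite mulr0 /sg expr0 expr1 !mul1r !mulN1r -intrB ler0z => g hh.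
    by have : 0 <= a i - a j; [apply: g; lra|lia].
- move=> i e k; have /andP[t0 t1] := ht i; have [a0 ak tz] := h1 i.
  have a0' : 0 <= (a i)%:~R :> R by rewrite ler0z.
  have ak' : (a i)%:~R <= kap%:~R :> R by rewrite ler_int.
  rewrite intrM; case: (eqVneq (t i) 0) => [e0|ne].
    by rewrite e0 (tz e0).
  have tp : 0 < t i by rewrite lt_neqAle eq_sym ne.
  have hk := int_tri k.
  have kK : kap%:~R = 1 :> R \/ kap%:~R = 2 :> R by case: kap12 => ->; [left|right].
  exact: star_single.
- move=> i j e f k ij; have /andP[t0 t1] := ht i; have [a0 ak tz] := h1 i.
  have /andP[t0' t1'] := ht j; have [b0 bk tz'] := h1 j.
  have [s2 le1] := h2 i j ij; have ji : j != i by rewrite eq_sym.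
  have [_ le2] := h2 j i ji.
  have {}le1 : t j <= t i -> (a j)%:~R <= (a i)%:~R :> R by move=> /le1; rewrite ler_int.
  have {}le2 : t i <= t j -> (a i)%:~R <= (a j)%:~R :> R by move=> /le2; rewrite ler_int.
  have {}s2 : (a i)%:~R + (a j)%:~R <= 2 :> R by rewrite -intrD -[2]/(2%:~R) ler_int.
  have {}a0 : 0 <= (a i)%:~R :> R by rewrite ler0z.
  have {}b0 : 0 <= (a j)%:~R :> R by rewrite ler0z.
  have {}tz : t i <= 0 -> (a i)%:~R = 0 :> R.
    by move=> h; rewrite tz //; apply/eqP; rewrite eq_le h t0.
  have {}tz' : t j <= 0 -> (a j)%:~R = 0 :> R.
    by move=> h; rewrite tz' //; apply/eqP; rewrite eq_le h t0'.
  have hk := int_tri k.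
  by rewrite intrM; apply: star_pair.
Qed.

End Cells.

(** * Integral coordinates for the complexes of types B and C *)

Section FlatBC.
Variables (n : nat) (isB : bool).
Local Notation vec := {ffun 'I_n -> int}.
Implicit Types z w b : vec.

(* In coordinates scaled so that all vertices are integral, the complexes of types B and C differ only in that
   in type B a vertex cannot have exactly one odd coordinate. *)
Definition bc_vertex z := isB -> forall i, ~~ (2 %| z i)%Z -> exists2 j, j != i & ~~ (2 %| z j)%Z.

Definition bc_special z := (forall i j, (2 %| z i - z j)%Z) /\ (isB -> forall i, (2 %| z i)%Z).

(** The second alternative is the edge of type B whose midpoint would have a single odd coordinate
    and so is not a vertex. *)
Definition bc_edge z w :=
  (forall i, `|w i - z i| <= 1) /\
  (forall i j, w i <> z i -> w j <> z j -> (2 %| z i - z j)%Z) \/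
  [/\ isB, forall i, (2 %| z i)%Z
    & exists2 i, `|w i - z i| = 2 & forall j, j != i -> w j = z j].

Definition sqn z : int := \sum_i z i ^+ 2.

Definition unitvec i (x : int) : vec := [ffun j => if j == i then x else 0].

(** The vertices of an alcove at the origin. In type B the first unit vector is not a vertex, and
    its double takes its place. *)
Definition chain k : vec :=
  [ffun i : 'I_n => if isB && (k == 1%N) then (if i == 0%N :> nat then 2 else 0)
                    else ((i < k)%N)%:Z].

(** An interface that lets types B and C be treated by the same proofs; [unit k] is the length of a
    vector whose scaled square norm is [k]. *)
Record bc_flat (R : realType) (m : nat) (Phi : set 'rV[R]_m) (emb : vec -> 'rV[R]_m) (unit : nat -> R) : Prop := BCFlat {
  emb_inj : injective emb;
  bc_vertexP : forall p, coxeter_vertex Phi p <-> exists2 z, bc_vertex z & p = emb z;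
  bc_dist : forall z w k, edist (emb z) (emb w) = unit k <-> sqn (z - w) = k%:Z;
  bc_bound : forall s z w, coxeter_simplex Phi s -> emb z \in s -> emb w \in s -> bc_edge z w;
  bc_star : forall z b b', bc_special z -> (forall i, `|b i| <= 1) ->
    (forall i, b' i = 0 \/ b' i = b i) -> (exists i, b' i <> 0) ->
    (isB -> exists i j, [/\ i != j, b' i <> 0 & b' j <> 0]) ->
    coxeter_simplex Phi [fset emb z; emb (z + b')%R; emb (z + b)%R]%fset;
  bc_double : forall z i x, isB -> bc_special z -> `|x| = 2 ->
    coxeter_simplex Phi [fset emb z; emb (z + unitvec i x)%R]%fset;
  bc_chamber : forall z, bc_special z ->
    coxeter_simplex Phi [fset emb (z + chain (nat_of_ord k))%R | k in 'I_n.+1]%fset /\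
    #|` [fset emb (z + chain (nat_of_ord k))%R | k in 'I_n.+1]%fset| = n.+1 }.

Lemma bc_special_vertex z : bc_special z -> bc_vertex z.
Proof. by move=> [_ h] B i; rewrite (h B). Qed.

Section Construct.
Variables (R : realType) (c : R) (Phi : set 'rV[R]_n).
Hypothesis c0 : 0 < c.
Let kap : int := if isB then 2 else 1.
Hypothesis hcell : forall x y, (forall r (k : int), Phi r ->
     (dot x r <= k%:~R -> dot y r <= k%:~R) /\ (k%:~R <= dot x r -> k%:~R <= dot y r)) <->
  cell kap (fun i => 2 * c * x 0 i) (fun i => 2 * c * y 0 i).
Hypothesis hspan : forall v, span_of Phi v.

Lemma kap12 : kap = 1 \/ kap = 2. Proof. by rewrite /kap; case: isB; [right|left]. Qed.

Definition pt (X : 'I_n -> R) : 'rV[R]_n := \row_i (X i / (2 * c)).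
Definition bc_emb z : 'rV[R]_n := pt (fun i => (z i)%:~R).

Lemma c2 : 2 * c != 0. Proof. by rewrite mulf_neq0 ?pnatr_eq0 ?gt_eqF. Qed.

Lemma ptK X i : 2 * c * pt X 0 i = X i.
Proof. by rewrite mxE mulrCA mulfV ?mulr1 ?c2. Qed.

Lemma pt_surj (x : 'rV[R]_n) : x = pt (fun i => 2 * c * x 0 i).
Proof. by apply/rowP => i; rewrite mxE [2 * c * _]mulrC mulfK ?c2. Qed.

Lemma pt_inj X Y : pt X = pt Y -> X = Y.
Proof. by move=> e; apply/funext => i; rewrite -ptK e ptK. Qed.

Lemma bc_emb_inj : injective bc_emb.
Proof.
move=> z w /pt_inj e; apply/ffunP => i; have := congr1 (fun f => f i) e.
by move=> /eqP; rewrite eqr_int => /eqP.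
Qed.

Lemma closed_cellP X Y : closed_cell Phi (pt X) (pt Y) <-> cell kap X Y.
Proof.
have eX Z : (fun i => 2 * c * pt Z 0 i) = Z by apply/funext => i; rewrite ptK.
by rewrite -{2}(eX X) -{2}(eX Y) -hcell; split=> [[_ h]|h]; [|split].
Qed.

(** A coordinate divisible by [kap] is fixed by a wall through [z] in its own direction. An odd
    coordinate in type B is fixed by the walls in the directions [x_i + x_j] and [x_i - x_j], where
    [j] is a second odd coordinate. *)
Lemma cell_int_vertex z (Y : 'I_n -> R) : bc_vertex z ->
  cell kap (fun i => (z i)%:~R) Y -> Y = (fun i => (z i)%:~R).
Proof.
move=> hz [h1 h2]; apply/funext => i.
have one u : z i = kap * u -> Y i = (z i)%:~R.
  move=> e; have := h1 i false u; rewrite /side /sg expr0 !mul1r -e lexx => -[/(_ isT) g1 /(_ isT) g2].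
  by apply/eqP; rewrite eq_le g1 g2.
case: (boolP isB) => B; last by apply: (one (z i)); rewrite /kap (negPf B) mul1r.
case: (boolP (2 %| z i)%Z) => [/dvdzP [u e]|odd]; first by apply: (one u); rewrite /kap B e mulrC.
have [j ji oj] := hz B i odd.
have ij : i != j by rewrite eq_sym.
have := h2 i j false false ((z i + z j) %/ 2)%Z ij.
have := h2 i j false true ((z i - z j) %/ 2)%Z ij.
have -> : 2 * ((z i + z j) %/ 2)%Z = z i + z j by move: odd oj; lia.
have -> : 2 * ((z i - z j) %/ 2)%Z = z i - z j by move: odd oj; lia.
rewrite /side /sg expr0 expr1 !mul1r !mulN1r !intrD !intrN !lexx.
move=> [/(_ isT) g1 /(_ isT) g2] [/(_ isT) g3 /(_ isT) g4].
by lra.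
Qed.

Lemma bc_emb_vertexP p : coxeter_vertex Phi p <-> exists2 z, bc_vertex z & p = bc_emb z.
Proof.
split=> [[_ hp]|[z hz ->]]; last first.
  split=> // y; rewrite (pt_surj y) => /closed_cellP /(cell_int_vertex hz) ->.
  by [].
rewrite (pt_surj p) in hp *; set X := fun i => _ in hp *.
pose z : vec := [ffun i => round2 (X i)].
have eX : X = fun i => (z i)%:~R.
  apply: pt_inj; apply/esym; apply: hp; apply/closed_cellP.
  have := @round_cell R n kap X; congr cell; apply/funext => i; by rewrite ffunE.
exists z; last by rewrite eX.
move=> B i odd; apply: contrapT => hn.
have ev j : j != i -> (2 %| z j)%Z.
  by move=> ji; apply: contrapT => /negP h; apply: hn; exists j.
(* If [z i] were the only odd coordinate, raising it by one would lead to another point of the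
   closed cell. *)
suff : pt (fun j => (z j + (j == i)%:Z)%:~R) = pt X.
  rewrite eX => /pt_inj /(congr1 (fun f => f i)) /eqP; rewrite eqr_int eqxx; lia.
apply: hp; apply/closed_cellP; rewrite eX; split.
  move=> j a k; rewrite /kap B /side /sg; case: eqP => [->|_]; last by rewrite addr0.
  by case: a; rewrite ?expr0 ?expr1 ?mul1r ?mulN1r -?intrN !ler_int; move: odd; lia.
move=> j l a b k jl; rewrite /side /sg.
have hj := ev j; have hl := ev l.
case: (eqVneq j i) jl hj hl => [->|ji]; case: (eqVneq l i) => [->|li]; rewrite ?eqxx //= => jl hj hl.
- have {}hl := hl isT; case: a; case: b; rewrite ?expr0 ?expr1 ?mul1r ?mulN1r -?intrN -!intrD !ler_int; move: odd hl; lia.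
- have {}hj := hj isT; case: a; case: b; rewrite ?expr0 ?expr1 ?mul1r ?mulN1r -?intrN -!intrD !ler_int; move: odd hj; lia.
- by rewrite !addr0.
Qed.

Definition bc_unit (k : nat) : R := Num.sqrt k%:R / (2 * c).

Lemma bc_emb_dist z w k : edist (bc_emb z) (bc_emb w) = bc_unit k <-> sqn (z - w) = k%:Z.
Proof.
have -> : edist (bc_emb z) (bc_emb w) = Num.sqrt (sqn (z - w))%:~R / (2 * c).
  rewrite /edist; have -> : dot (bc_emb z - bc_emb w) (bc_emb z - bc_emb w) =
      (sqn (z - w))%:~R * ((2 * c)^-1) ^+ 2.
    rewrite /dot /sqn raddf_sum mulr_suml; apply: eq_bigr => i _.
    by rewrite !mxE !ffunE /= !expr2 intrM !intrB -mulrBl mulrACA.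
  rewrite sqrtrM ?ler0z; last by apply: sumr_ge0 => i _; apply: sqr_ge0.
  by rewrite sqrtr_sqr ger0_norm // invr_ge0 mulr_ge0 ?ler0n ?ltW.
have s0 : 0 <= sqn (z - w) by apply: sumr_ge0 => i _; apply: sqr_ge0.
split=> [/(mulIf (invr_neq0 c2)) /eqP|->]; last by [].
rewrite eqr_sqrt ?ler0z ?ler0n // -[k%:R]/((k%:Z)%:~R) eqr_int => /eqP //.
Qed.

(* The value at [X] of a wall functional lies between two consecutive walls, and so do its values at the vertices of the cell of [X]. *)
Lemma side_pinch (S : R) (q : int) : 0 < q -> exists u, forall (x : int),
  (forall k : int, side S x%:~R (q * k)%:~R) -> q * u <= x <= q * u + q.
Proof.
move=> q0; have q0' : 0 < q%:~R :> R by rewrite ltr0z.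
exists (Num.floor (S / q%:~R)) => x h; set u := Num.floor _.
have h1 : (q * u)%:~R <= S.
  by rewrite intrM mulrC -ler_pdivlMr // floor_le.
have h2 : S <= (q * (u + 1))%:~R.
  by rewrite intrM mulrC -ler_pdivrMr // ltW // floorD1_gt.
have := (h u).2 h1; have := (h (u + 1)).1 h2; rewrite !ler_int mulrDr mulr1 => -> ->.
by [].
Qed.

(** In each of the directions [x_i], [x_i + x_j] and [x_i - x_j] both vertices lie between the same
    two consecutive walls; comparing these strips leaves only the two kinds of edges. *)
Lemma bc_emb_bound s z w : coxeter_simplex Phi s -> bc_emb z \in s -> bc_emb w \in s -> bc_edge z w.
Proof.
move=> [x _ hs] /hs [_ hz] /hs [_ hw].
rewrite (pt_surj x) in hz hw; move/closed_cellP: hz => [z1 z2]; move/closed_cellP: hw => [w1 w2].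
have k0 : 0 < kap by case: kap12 => ->.
have one i : exists u, (kap * u <= z i <= kap * u + kap) /\ (kap * u <= w i <= kap * u + kap).
  have [u hu] := side_pinch (2 * c * x 0 i) k0; exists u.
  split; apply: hu => k; [have := z1 i false k|have := w1 i false k]; by rewrite /sg expr0 !mul1r.
have two i j : i != j -> exists u v, [/\ 2 * u <= z i + z j <= 2 * u + 2, 2 * u <= w i + w j <= 2 * u + 2,
    2 * v <= z i - z j <= 2 * v + 2 & 2 * v <= w i - w j <= 2 * v + 2].
  move=> ij; have [u hu] := side_pinch (2 * c * x 0 i + 2 * c * x 0 j) (isT : 0 < 2 :> int).
  have [v hv] := side_pinch (2 * c * x 0 i - 2 * c * x 0 j) (isT : 0 < 2 :> int).
  exists u, v; split; [apply: hu|apply: hu|apply: hv|apply: hv] => k.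
  - by have := z2 i j false false k ij; rewrite /sg expr0 !mul1r -intrD.
  - by have := w2 i j false false k ij; rewrite /sg expr0 !mul1r -intrD.
  - by have := z2 i j false true k ij; rewrite /sg expr0 expr1 !mul1r !mulN1r -intrB.
  - by have := w2 i j false true k ij; rewrite /sg expr0 expr1 !mul1r !mulN1r -intrB.
have par i j : i != j -> `|w i - z i| = 1 -> `|w j - z j| = 1 -> (2 %| z i - z j)%Z.
  by move=> /two [u [v [h1 h2 h3 h4]]]; move: h1 h2 h3 h4; gen_ffun; lia.
case: (pselect (exists i, `|w i - z i| = 2)) => [[i e]|hn].
  have B : isB.
    by apply: contraT => B; have [u [hz hw]] := one i; move: e hz hw; rewrite /kap (negPf B); gen_ffun; lia.
  have ot j : j != i -> w j = z j /\ (2 %| z j)%Z.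
    move=> ji; have [u [v [h1 h2 h3 h4]]] := two _ _ ji; have [u' [h5 h6]] := one i.
    by move: e h1 h2 h3 h4 h5 h6; rewrite /kap B; gen_ffun; lia.
  right; split=> // [j|]; last by exists i => // j /ot [].
  case: (eqVneq j i) => [->|/ot [] //]; have [u [hz hw]] := one i.
  by move: e hz hw; rewrite /kap B; gen_ffun; lia.
left; have le1 i : `|w i - z i| <= 1.
  have [u [hz hw]] := one i; have : `|w i - z i| <> 2 by move=> e; apply: hn; exists i.
  by move: hz hw; case: kap12 => ->; gen_ffun; lia.
split=> // i j wi wj; case: (eqVneq i j) => [->|ij]; first by rewrite subrr dvdz0.
apply: par => //; [have := le1 i; move: wi|have := le1 j; move: wj]; gen_ffun; lia.
Qed.

Lemma star_simplex z (e : 'I_n -> bool) (t : 'I_n -> R) s : bc_special z -> (forall i, 0 <= t i < 1) ->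
  (forall p, p \in s <-> exists a : vec, [/\ star_point kap t a,
     bc_vertex (z + [ffun i => (-1) ^+ e i * a i]) & p = bc_emb (z + [ffun i => (-1) ^+ e i * a i])]) ->
  coxeter_simplex Phi s.
Proof.
move=> sz t01 hs; exists (pt (fun i => (z i)%:~R + sg (e i) * t i)); first exact: hspan.
have z1 i : exists u, z i = kap * u.
  case: (boolP isB) => B; last by exists (z i); rewrite /kap (negPf B) mul1r.
  by have /dvdzP [u eu] := sz.2 B i; exists u; rewrite /kap B mulrC.
have key a : cell kap (fun i => (z i)%:~R + sg (e i) * t i)
    (fun i => ((z + [ffun i => (-1) ^+ e i * a i]) i)%:~R) <-> star_point kap t a.
  have -> : (fun i => ((z + [ffun i => (-1) ^+ e i * a i]) i)%:~R) =
      (fun i => (z i)%:~R + sg (e i) * (a i)%:~R) :> ('I_n -> R).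
    by apply/funext => i; rewrite !ffunE intrD intrM sg_int.
  apply: iff_trans (cell_move e t (fun i => (a i)%:~R) z1 sz.1) _.
  exact: (cell0P kap12).
move=> p; rewrite hs; split=> [[a [ha va ->]]|[/bc_emb_vertexP [w vw ->] /closed_cellP h]].
  by split; [apply/bc_emb_vertexP; exists (z + [ffun i => (-1) ^+ e i * a i])|apply/closed_cellP/key].
pose a : vec := [ffun i => (-1) ^+ e i * (w i - z i)].
have ew : w = z + [ffun i => (-1) ^+ e i * a i].
  by apply/ffunP => i; rewrite !ffunE mulrA -signr_addb addbb expr0 mul1r addrC subrK.
by exists a; split; rewrite -?ew //; apply/key; rewrite -ew.
Qed.

Definition star_level (l : 'I_n -> nat) (a : vec) :=
  (forall i, [/\ 0 <= a i, a i <= kap & l i = 0%N -> a i = 0]) /\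
  (forall i j, i != j -> a i + a j <= 2 /\ ((l j <= l i)%N -> a j <= a i)).

(** Only the order of the coordinates of [t] and the set of vanishing ones matter, so integral
    levels divided by a strict upper bound will do. *)
Lemma level_simplex z (e : 'I_n -> bool) (l : 'I_n -> nat) q s : bc_special z -> (forall i, (l i < q)%N) ->
  (forall p, p \in s <-> exists a : vec, [/\ star_level l a,
     bc_vertex (z + [ffun i => (-1) ^+ e i * a i]) & p = bc_emb (z + [ffun i => (-1) ^+ e i * a i])]) ->
  coxeter_simplex Phi s.
Proof.
move=> sz lq hs; apply: (@star_simplex z e (fun i => (l i)%:R / q%:R)) => // [i|p].
  have q0 : 0 < q%:R :> R by rewrite ltr0n; apply: leq_ltn_trans (leq0n _) (lq i).
  by rewrite divr_ge0 ?ler0n //= ltr_pdivrMr // mul1r ltr_nat.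
rewrite hs; suff E a : star_level l a <-> star_point kap (fun i => (l i)%:R / q%:R : R) a.
  by split=> -[a [h1 h2 h3]]; exists a; split=> //; apply/E.
have qi (i : 'I_n) : 0 < q%:R :> R by rewrite ltr0n; apply: leq_ltn_trans (leq0n _) (lq i).
split=> -[h1 h2]; split=> [i|i j ij].
- have [? ? h] := h1 i; split=> // /eqP.
  by rewrite mulf_eq0 invr_eq0 [q%:R == _]gt_eqF ?(qi i) // orbF pnatr_eq0 => /eqP.
- have [h3 h4] := h2 i j ij; split=> //.
  by rewrite ler_pM2r ?invr_gt0 ?(qi i) // ler_nat.
- have [? ? h] := h1 i; split=> // l0; apply: h; by rewrite l0 mul0r.
- have [h3 h4] := h2 i j ij; split=> // lji; apply: h4.
  by rewrite ler_pM2r ?invr_gt0 ?(qi i) // ler_nat.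
Qed.

Lemma bc_emb_star z b b' : bc_special z -> (forall i, `|b i| <= 1) ->
    (forall i, b' i = 0 \/ b' i = b i) -> (exists i, b' i <> 0) ->
    (isB -> exists i j, [/\ i != j, b' i <> 0 & b' j <> 0]) ->
    coxeter_simplex Phi [fset bc_emb z; bc_emb (z + b')%R; bc_emb (z + b)%R]%fset.
Proof.
move=> sz hb hb' [i1 hi1] hB.
pose e i := b i < 0.
(* With [q = 3] the levels give, up to the signs [e], the barycentre of [z], [z + b'] and [z + b]:
   the offset is 2/3 on the support of [b'], 1/3 on the rest of that of [b], and 0 elsewhere. *)
pose l i := (if b' i != 0 then 2 else if b i != 0 then 1 else 0)%N.
pose A1 : vec := [ffun i => `|b' i|]; pose A2 : vec := [ffun i => `|b i|].
have E0 : z + [ffun i => (-1) ^+ e i * (0 : vec) i] = z.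
  by apply/ffunP => i; rewrite !ffunE mulr0 addr0.
have E1 : z + [ffun i => (-1) ^+ e i * A1 i] = z + b'.
  apply/ffunP => i; rewrite !ffunE /e; congr (_ + _); have := hb' i; have := hb i.
  by case: (ltrP (b i) 0); rewrite ?expr1 ?expr0; gen_ffun; lia.
have E2 : z + [ffun i => (-1) ^+ e i * A2 i] = z + b.
  apply/ffunP => i; rewrite !ffunE /e; congr (_ + _); have := hb i.
  by case: (ltrP (b i) 0); rewrite ?expr1 ?expr0; gen_ffun; lia.
have vz (u : vec) : isB -> (forall i, b' i <> 0 -> (u i = 1 \/ u i = -1)) -> bc_vertex (z + u).
  move=> B hu _ i; rewrite ffunE; have := sz.2 B.
  have [i2 [j2 [ij h2 h3]]] := hB B => ev.
  case: (eqVneq i2 i) => ne; [exists j2|exists i2] => //; rewrite ?ffunE.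
  - by rewrite -ne eq_sym.
  - by have := hu _ h3; have := ev j2; gen_ffun; lia.
  - by have := hu _ h2; have := ev i2; gen_ffun; lia.
have vs (u : vec) : (forall i, b' i <> 0 -> (u i = 1 \/ u i = -1)) -> bc_vertex (z + u).
  by case: (boolP isB) => B hu; [exact: vz|move=> B'; rewrite B' in B].
have lP i : (b' i <> 0 /\ l i = 2%N) \/ (b' i = 0 /\ b i <> 0 /\ l i = 1%N) \/
    (b' i = 0 /\ b i = 0 /\ l i = 0%N).
  rewrite /l; case: eqP => e1 /=; last by left.
  by right; case: eqP => e2 /=; [right|left].
have kge : 1 <= kap by case: kap12 => ->.
apply: (@level_simplex z e l 3) => // [i|p].
  by case: (lP i) => [[_ ->]|[[_ [_ ->]]|[_ [_ ->]]]].
rewrite !inE; split.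
  move=> /orP[/orP[]|] /eqP ->; [exists 0|exists A1|exists A2].
  - rewrite E0; split=> //; last exact: bc_special_vertex.
    by split=> [i|i j _]; rewrite !ffunE; split=> //; case: kap12 => ek; rewrite ?ek.
  - rewrite E1; split=> //; last by apply: vs => i; have := hb' i; have := hb i; gen_ffun; lia.
    split=> [i|i j _]; rewrite !ffunE.
      have := hb' i; have := hb i; have := lP i; move: (l i); gen_ffun => l0 H1 H2 H3.
      by move: kge H1 H2 H3; move: (kap) => kap' *; split; lia.
    have := hb' i; have := hb i; have := lP i; have := hb' j; have := hb j; have := lP j.
    by move: (l i) (l j); gen_ffun => l0 l1 H1 H2 H3 H4 H5 H6; split; lia.
  - rewrite E2; split=> //; last by apply: vs => i; have := hb' i; have := hb i; gen_ffun; lia.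
    split=> [i|i j _]; rewrite !ffunE.
      have := hb' i; have := hb i; have := lP i; move: (l i); gen_ffun => l0 H1 H2 H3.
      by move: kge H1 H2 H3; move: (kap) => kap' *; split; lia.
    have := hb' i; have := hb i; have := lP i; have := hb' j; have := hb j; have := lP j.
    by move: (l i) (l j); gen_ffun => l0 l1 H1 H2 H3 H4 H5 H6; split; lia.
case=> a [[h1 h2] va ->].
have le i j : (l j <= l i)%N -> a j <= a i.
  by case: (eqVneq i j) => [->//|ij]; apply: (h2 i j ij).2.
have eq i j : l i = l j -> a i = a j.
  by move=> lij; apply/le_anti; rewrite !le ?lij.
have l1 : l i1 = 2%N by case: (lP i1) => [[_ ->]|[[]|[]]].
have a01 : a i1 = 0 \/ a i1 = 1.
  have [a0 ak _] := h1 i1.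
  case: (boolP isB) => B; last by move: ak; rewrite /kap (negPf B); lia.
  have [i2 [j2 [ij h3 h4]]] := hB B.
  have li2 : l i2 = 2%N by case: (lP i2) => [[_ ->]|[[]|[]]].
  have lj2 : l j2 = 2%N by case: (lP j2) => [[_ ->]|[[]|[]]].
  have := (h2 _ _ ij).1; rewrite (eq i2 i1) ?l1 // (eq j2 i1) ?l1 //; lia.
have top i : a i <= a i1.
  by apply: le; rewrite l1; case: (lP i) => [[_ ->]|[[_ [_ ->]]|[_ [_ ->]]]].
have a0 i : 0 <= a i by case: (h1 i).
have az i : l i = 0%N -> a i = 0 by case: (h1 i).
case: a01 => ai1.
  suff -> : a = 0 by rewrite E0 eqxx.
  by apply/ffunP => i; rewrite ffunE; have := top i; have := a0 i; rewrite ai1; gen_ffun; lia.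
have a2 i : l i = 2%N -> a i = 1 by move=> li; rewrite (eq i i1) ?l1.
case: (pselect (exists2 j0, l j0 = 1%N & a j0 = 1)) => [[j0 lj0 aj0]|hn].
  suff -> : a = A2 by rewrite E2 eqxx !orbT.
  apply/ffunP => i; rewrite ffunE; have := hb' i; have := hb i.
  case: (lP i) => [[n1 /a2 ->]|[[n1 [n2 li]]|[n1 [n2 /az ->]]]]; [by move: n1; gen_ffun; lia| |by rewrite n2].
  by rewrite (eq i j0) ?li // aj0; move: n2; gen_ffun; lia.
suff -> : a = A1 by rewrite E1 eqxx orbT.
apply/ffunP => i; rewrite ffunE; have := hb' i; have := hb i.
case: (lP i) => [[n1 /a2 ->]|[[n1 [n2 li]]|[n1 [n2 /az ->]]]]; rewrite ?n1 //; first by move: n1; gen_ffun; lia.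
have : a i <> 1 by move=> e1; apply: hn; exists i.
by have := top i; have := a0 i; rewrite ai1; gen_ffun; lia.
Qed.

(** With level 1 at [i] alone the cell has the integral points given by [a i = 0, 1, 2], and the
    middle one is not a vertex in type B. *)
Lemma bc_emb_double z i x : isB -> bc_special z -> `|x| = 2 ->
  coxeter_simplex Phi [fset bc_emb z; bc_emb (z + unitvec i x)%R]%fset.
Proof.
move=> B sz hx; pose e (j : 'I_n) := x < 0.
pose A : vec := unitvec i 2.
have E0 : z + [ffun i => (-1) ^+ e i * (0 : vec) i] = z.
  by apply/ffunP => j; rewrite !ffunE mulr0 addr0.
have E1 : z + [ffun i => (-1) ^+ e i * A i] = z + unitvec i x.
  apply/ffunP => j; rewrite !ffunE /e; congr (_ + _); case: eqP; rewrite ?mulr0 // => _.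
  by case: (ltrP x 0); rewrite ?expr1 ?expr0; lia.
have even (u : vec) : (forall j, (2 %| u j)%Z) -> bc_vertex (z + u).
  by move=> hu _ j; rewrite ffunE; have := sz.2 B j; have := hu j; gen_ffun; lia.
have k2 : kap = 2 by rewrite /kap B.
apply: (@level_simplex z e (fun j => (j == i)%N) 2) => // [j|p]; first by case: eqP.
rewrite !inE; split.
  move=> /orP[] /eqP ->; [exists 0|exists A].
  - rewrite E0; split=> //; last exact: bc_special_vertex.
    by split=> [j|j l _]; rewrite !ffunE; split=> //; rewrite k2.
  - rewrite E1; split=> //; last by apply: even => j; rewrite ffunE; case: eqP; lia.
    split=> [j|j l jl]; rewrite !ffunE ?k2; first by case: eqP.
    by case: (eqVneq j i) => [ej|ji]; case: (eqVneq l i) => [el|li] //; move: jl; rewrite ej el eqxx.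
case=> a [[h1 h2] va ->].
have aj j : j != i -> a j = 0 by move=> /negPf ji; have [_ _] := h1 j; apply; rewrite ji.
have [a0 ak _] := h1 i.
have ne1 : a i <> 1.
  move=> e1; have [|j ji] := va B i; rewrite !ffunE ?e1.
    by have := sz.2 B i; case: (e i); rewrite ?expr1 ?expr0; gen_ffun; lia.
  by rewrite aj // mulr0 addr0 sz.2.
have [ai|ai] : a i = 0 \/ a i = 2 by move: ak a0 ne1; rewrite k2; gen_ffun; lia.
  suff -> : a = 0 by rewrite E0 eqxx.
  by apply/ffunP => j; rewrite ffunE; case: (eqVneq j i) => [->|/aj].
suff -> : a = A by rewrite E1 eqxx orbT.
by apply/ffunP => j; rewrite ffunE; case: (eqVneq j i) => [->|/aj].
Qed.

Lemma chain_diff k k' : (k < k' <= n)%N -> chain k <> chain k'.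
Proof.
move=> /andP[kk kn] /ffunP /(_ (Ordinal (leq_trans kk kn))); rewrite !ffunE /=.
rewrite ltnn kk; case: isB => //=; case: (eqVneq k 1%N) => [e1|k1] /=;
  case: (eqVneq k' 1%N) => e //=; case: (eqVneq k 0%N) => k0 //; move: kk; lia.
Qed.

Lemma chainP (k : nat) (i : 'I_n) :
  (isB /\ k = 1%N /\ (i = 0%N :> nat /\ chain k i = 2 \/ i <> 0%N :> nat /\ chain k i = 0)) \/
  (~ (isB /\ k = 1%N) /\ ((i < k)%N /\ chain k i = 1 \/ (k <= i)%N /\ chain k i = 0)).
Proof.
rewrite !ffunE; case: (boolP isB) => B /=; case: (eqVneq k 1%N) => e.
- by left; split=> //; split=> //; case: eqP => h; [left|right].
- by right; split=> [[_ /eqP]|]; [rewrite (negPf e)|case: ltnP => h; [left|right]].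
- by right; split=> [[]//|]; case: ltnP => h; [left|right].
- by right; split=> [[]//|]; case: ltnP => h; [left|right].
Qed.

Lemma bc_emb_chamber z : bc_special z ->
  coxeter_simplex Phi [fset bc_emb (z + chain (nat_of_ord k))%R | k in 'I_n.+1]%fset /\
  #|` [fset bc_emb (z + chain (nat_of_ord k))%R | k in 'I_n.+1]%fset| = n.+1.
Proof.
move=> sz; split; last first.
  rewrite card_imfset /=; first by rewrite -cardE card_ord.
  move=> k k' /bc_emb_inj /addrI e; apply/val_inj/eqP; rewrite /= eqn_leq.
  have := ltn_ord k; have := ltn_ord k'; rewrite !ltnS => kn kn'.
  by apply/andP; split; rewrite leqNgt; apply/negP => lt; [apply: (@chain_diff k' k)|apply: (@chain_diff k k')]; rewrite ?lt.
pose e (j : 'I_n) := false.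
have E (a : vec) : z + [ffun i => (-1) ^+ e i * a i] = z + a.
  by apply/ffunP => j; rewrite !ffunE expr0 mul1r.
have kge : 1 <= kap by case: kap12 => ->.
(* Strictly decreasing positive levels describe a point in the interior of the alcove. *)
apply: (@level_simplex z e (fun j => (n - j)%N) n.+1) => // [j|p]; first by rewrite ltnS leq_subr.
split.
  move=> /imfsetP [k /= _ ->]; exists (chain k); rewrite E; have := ltn_ord k; rewrite ltnS => kn; split=> //.
    split=> [i|i j ij].
      have := ltn_ord i; have := chainP k i; rewrite /kap; move: (chain k i) => x.
      by case: isB => h1 h2; split; lia.
    have /eqP ij' : nat_of_ord i != j by [].
    have := ltn_ord i; have := ltn_ord j; have := chainP k i; have := chainP k j.
    by move: (chain k i) (chain k j) => x y h1 h2 h3 h4; split; lia.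
  move=> B i; rewrite !ffunE; have := sz.2 B; rewrite B /= => ev.
  case: (eqVneq (nat_of_ord k) 1%N) => [ek|ek] h.
    by exfalso; have := ev i; move: h; case: eqP; gen_ffun; lia.
  have ik : (i < k)%N by have := ev i; move: h; case: ltnP => //; gen_ffun; lia.
  have k2 : (1 < k)%N by lia.
  have n1 : (1 < n)%N by lia.
  pose j : 'I_n := if i == 0%N :> nat then Ordinal n1 else Ordinal (ltnW n1).
  exists j; first by apply/eqP => /(congr1 val); rewrite /j; case: eqP => /= e1 e2; lia.
  rewrite !ffunE B /= (negPf ek); have -> : (j < k)%N by rewrite /j; case: eqP => _ /=; lia.
  by have := ev j; gen_ffun; lia.
case=> a [[h1 h2] va ->]; rewrite E in va *.
have dec (i j : 'I_n) : (i <= j)%N -> a j <= a i.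
  case: (eqVneq i j) => [->//|ij] le; apply: (h2 i j ij).2; lia.
(* The least such [k] counts the non-zero coordinates of [a], which come first because [a] is
   non-increasing. *)
have exk : exists k, [forall i : 'I_n, (k <= i)%N ==> (a i == 0)].
  by exists n; apply/forallP => i; rewrite leqNgt ltn_ord.
case: (ex_minnP exk) => k /forallP hk mink.
have kn : (k <= n)%N by apply: mink; apply/forallP => i; rewrite leqNgt ltn_ord.
have az (i : 'I_n) : (k <= i)%N -> a i = 0 by move=> ki; have /implyP /(_ ki) /eqP := hk i.
have ap (i : 'I_n) : (i < k)%N -> 1 <= a i.
  move=> ik; have [a0 _ _] := h1 i; suff : a i <> 0 by move: a0; gen_ffun; lia.
  move=> ai; have : (k <= i)%N; last by rewrite leqNgt ik.
  apply: mink; apply/forallP => j; apply/implyP => ij; have := dec _ _ ij; have [b0 _ _] := h1 j.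
  by rewrite ai; move: b0; gen_ffun; lia.
apply/imfsetP; exists (Ordinal (kn : (k < n.+1)%N)) => //=; congr (bc_emb (z + _)).
apply/ffunP => i; rewrite !ffunE; have [a0 ak _] := h1 i.
case: (boolP isB) => B /=; last first.
  by case: ltnP => [/ap|/az]; move: ak; rewrite /kap (negPf B); gen_ffun; lia.
have k2 : kap = 2 by rewrite /kap B.
case: (eqVneq k 1%N) => [ek|ek].
  case: eqP => ei; last by apply: az; rewrite ek; lia.
  have := ap i; rewrite ek ei => /(_ isT) a1; suff : a i <> 1 by move: a1 ak; rewrite k2; gen_ffun; lia.
  move=> e1; have [|j ji] := va B i; rewrite !ffunE ?e1.
    by have := sz.2 B i; gen_ffun; lia.
  rewrite (az j) ?addr0 ?sz.2 // ek; have /eqP : nat_of_ord j != i by []; rewrite ei; lia.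
case: ltnP => [ik|/az //]; have n1 : (1 < n)%N by lia.
pose j : 'I_n := if i == 0%N :> nat then Ordinal n1 else Ordinal (ltnW n1).
have ij : i != j by apply/eqP => /(congr1 val); rewrite /j; case: eqP => /= e1 e2; lia.
have jk : (j < k)%N by rewrite /j; case: eqP => _ /=; lia.
by have := (h2 i j ij).1; have := ap _ ik; have := ap _ jk; gen_ffun; lia.
Qed.

Lemma bc_emb_flat : bc_flat Phi bc_emb bc_unit.
Proof.
split; [exact: bc_emb_inj|exact: bc_emb_vertexP|exact: bc_emb_dist|exact: bc_emb_bound|exact: bc_emb_star|exact: bc_emb_double|exact: bc_emb_chamber].
Qed.

End Construct.
End FlatBC.

Section ClassicalFlats.
Variables (R : realType) (n : nat) (c : R).
Hypothesis c0 : 0 < c.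

Lemma side2 (a b k : R) : side a b k <-> side (2 * a) (2 * b) (2 * k).
Proof. by rewrite /side !ler_pM2l. Qed.

Lemma span_C (v : 'rV[R]_n) : span_of (Defs.roots R TypeC n c) v.
Proof.
have -> : v = \sum_i (v 0 i / (c * 2)) *: (c *: ((-1) ^+ false *: (2 *: eps R n i))).
  rewrite {1}[v]row_eps_sum; apply: eq_bigr => i _.
  by rewrite expr0 scale1r !scalerA -mulrA divfK // mulf_neq0 ?pnatr_eq0 ?gt_eqF.
apply: span_sum => i; eexists; last by []; by left; exists i, false.
Qed.

Lemma span_B (v : 'rV[R]_n) : span_of (Defs.roots R TypeB n c) v.
Proof.
have -> : v = \sum_i (v 0 i / c) *: (c *: ((-1) ^+ false *: eps R n i)).
  rewrite {1}[v]row_eps_sum; apply: eq_bigr => i _.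
  by rewrite expr0 scale1r !scalerA divfK // gt_eqF.
apply: span_sum => i; eexists; last by []; by left; exists i, false.
Qed.

Lemma cell_C (x y : 'rV[R]_n) : (forall r (k : int), Defs.roots R TypeC n c r ->
     (dot x r <= k%:~R -> dot y r <= k%:~R) /\ (k%:~R <= dot x r -> k%:~R <= dot y r)) <->
  cell 1 (fun i => 2 * c * x 0 i) (fun i => 2 * c * y 0 i).
Proof.
have E1 (v : 'rV[R]_n) (i : 'I_n) (a : bool) : dot v (c *: ((-1) ^+ a *: (2 *: eps R n i))) = sg a * (2 * c * v 0 i).
  by rewrite !dotZr dot_eps /sg; lra.
have E2 (v : 'rV[R]_n) (i j : 'I_n) (a b : bool) : 2 * dot v (c *: ((-1) ^+ a *: eps R n i + (-1) ^+ b *: eps R n j)) =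
    sg a * (2 * c * v 0 i) + sg b * (2 * c * v 0 j).
  by rewrite dotZr dotDr !dotZr !dot_eps /sg; lra.
split=> [h|[h1 h2] r k [r' hr ->]].
  split=> [i a k|i j a b k ij].
    have hr : Defs.roots R TypeC n c (c *: ((-1) ^+ a *: (2 *: eps R n i))).
      by eexists; last by []; left; exists i, a.
    by rewrite mul1r -!E1; exact: (h _ k hr).
  have hr : Defs.roots R TypeC n c (c *: ((-1) ^+ a *: eps R n i + (-1) ^+ b *: eps R n j)).
    by eexists; last by []; right; exists i, j, a, b.
  by rewrite -!E2 intrM; apply: (iffLR (side2 _ _ _)); exact: (h _ k hr).
case: hr => [[i [a ->]]|[i [j [a [b [ij ->]]]]]].
  by have := h1 i a k; rewrite mul1r -!E1.
by apply: (iffRL (side2 _ _ _)); rewrite !E2; have := h2 i j a b k ij; rewrite intrM.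
Qed.

Lemma cell_B (x y : 'rV[R]_n) : (forall r (k : int), Defs.roots R TypeB n c r ->
     (dot x r <= k%:~R -> dot y r <= k%:~R) /\ (k%:~R <= dot x r -> k%:~R <= dot y r)) <->
  cell 2 (fun i => 2 * c * x 0 i) (fun i => 2 * c * y 0 i).
Proof.
have E1 (v : 'rV[R]_n) (i : 'I_n) (a : bool) : 2 * dot v (c *: ((-1) ^+ a *: eps R n i)) = sg a * (2 * c * v 0 i).
  by rewrite !dotZr dot_eps /sg; lra.
have E2 (v : 'rV[R]_n) (i j : 'I_n) (a b : bool) : 2 * dot v (c *: ((-1) ^+ a *: eps R n i + (-1) ^+ b *: eps R n j)) =
    sg a * (2 * c * v 0 i) + sg b * (2 * c * v 0 j).
  by rewrite dotZr dotDr !dotZr !dot_eps /sg; lra.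
split=> [h|[h1 h2] r k [r' hr ->]].
  split=> [i a k|i j a b k ij].
    have hr : Defs.roots R TypeB n c (c *: ((-1) ^+ a *: eps R n i)).
      by eexists; last by []; left; exists i, a.
    by rewrite -!E1 intrM; apply: (iffLR (side2 _ _ _)); exact: (h _ k hr).
  have hr : Defs.roots R TypeB n c (c *: ((-1) ^+ a *: eps R n i + (-1) ^+ b *: eps R n j)).
    by eexists; last by []; right; exists i, j, a, b.
  by rewrite -!E2 intrM; apply: (iffLR (side2 _ _ _)); exact: (h _ k hr).
case: hr => [[i [a ->]]|[i [j [a [b [ij ->]]]]]].
  by apply: (iffRL (side2 _ _ _)); rewrite !E1; have := h1 i a k; rewrite intrM.
by apply: (iffRL (side2 _ _ _)); rewrite !E2; have := h2 i j a b k ij; rewrite intrM.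
Qed.

Lemma flat_C : bc_flat false (Defs.roots R TypeC n c) (@bc_emb n R c) (bc_unit c).
Proof. by apply: bc_emb_flat => //; [exact: cell_C|exact: span_C]. Qed.

Lemma flat_B : bc_flat true (Defs.roots R TypeB n c) (@bc_emb n R c) (bc_unit c).
Proof. by apply: bc_emb_flat => //; [exact: cell_B|exact: span_B]. Qed.

End ClassicalFlats.

Lemma sum_le_eq n (f g : 'I_n -> int) : (forall i, f i <= g i) -> \sum_i f i = \sum_i g i ->
  forall i, f i = g i.
Proof.
move=> h e i; have := @le_sum_term n (fun i => g i - f i) i.
have -> : \sum_j (g j - f j) = 0 by rewrite sumrB e subrr.
by have := h i; move: (f i) (g i) => x y xy hh; have := hh (fun j => ltac:(by rewrite subr_ge0; apply: h)); lia.
Qed.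

Section Sqn.
Variable n : nat.
Implicit Types b : {ffun 'I_n -> int}.

Lemma sqn_full b : (forall i, `|b i| = 1) -> sqn b = n%:Z.
Proof.
move=> h; rewrite /sqn (eq_bigr (fun=> 1)) => [|i _]; first by rewrite sum_const mulr1.
by rewrite -(real_normK (num_real _)) h expr1n.
Qed.

Lemma sqn_fullE b : (forall i, `|b i| <= 1) -> sqn b = n%:Z -> forall i, `|b i| = 1.
Proof.
move=> h e i; have := @sum_le_eq n (fun i => b i ^+ 2) (fun=> 1).
rewrite sum_const mulr1 => H; have := H _ e i; rewrite expr2 => /(_ _) H1.
have hh j : b j ^+ 2 <= 1 by rewrite expr2; have := h j; gen_ffun; nia.
by have := H1 hh; gen_ffun; nia.
Qed.

Lemma sqn_unitvec i x : sqn (unitvec i x : {ffun 'I_n -> int}) = x * x.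
Proof.
rewrite /sqn (bigD1 i) //= ffunE eqxx big1 ?addr0 ?expr2 // => j /negPf ji.
by rewrite ffunE ji expr0n.
Qed.

Lemma sqn_one b : sqn b = 1 -> exists2 i, `|b i| = 1 & forall j, j != i -> b j = 0.
Proof.
move=> e; have [i bi] : exists i, b i <> 0.
  apply: contrapT => hn; move: e; rewrite /sqn big1 // => i _.
  by rewrite [b i](_ : _ = 0) ?expr0n //; apply: contrapT => h; apply: hn; exists i.
have H := @sum_le_eq n (fun j => if j == i then 1 else 0) (fun j => b j ^+ 2).
have {}H : forall j, (if j == i then 1 else 0) = b j ^+ 2.
  apply: H => [j|]; last by rewrite -/(sqn b) e (bigD1 i) //= eqxx big1 // => j /negPf ->.
  by case: eqP => [->|_]; rewrite expr2; move: bi; gen_ffun; nia.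
exists i; first by have := H i; rewrite eqxx expr2; gen_ffun; nia.
by move=> j /negPf ji; have := H j; rewrite ji expr2; gen_ffun; nia.
Qed.

Lemma sqn_support b : sqn b = 4 -> (forall i, `|b i| <= 1) -> (2 < n)%N.
Proof.
move=> e h; have : sqn b <= n%:Z; last by rewrite e; lia.
have := sum_const n 1; rewrite mulr1 => <-; apply: sum_le => i; rewrite expr2.
by have := h i; gen_ffun; nia.
Qed.

End Sqn.

(** * Relations read off from adjacency and edge lengths *)

Section Relations.
Variables (R : realType) (isB : bool) (n : nat) (unit : nat -> R).

Section OneComplex.
Variables (U : choiceType) (K : set {fset U}) (l : U -> U -> R).

Definition adj x y := K [fset x; y]%fset /\ x <> y.
Definition elen k x y := adj x y /\ l x y = unit k.

(* In the flat these say: [x] is special (and, in type B, not merely special for type C); [m] is [x] plus a sign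
   vector; [m] is [x] plus a vector with entries 0, 1, -1, [k] of them non-zero; [y - x] has entries 0, 2, -2;
   [y - x] is 0 or twice a signed basis vector. *)
Definition sp x := (exists y, elen n x y) /\
  (isB -> (exists y, elen 4 x y) /\ ~ exists y, elen 1 x y).
Definition relM k x m := [/\ sp x, elen k x m & isB -> ~ sp m].
Definition relI x y := x = y \/ exists2 m, relM n x m & relM n y m.
Definition rel1 x y := x = y \/ [/\ sp x, sp y, relI x y
  & adj x y \/ exists2 m, elen 1 x m & elen 1 y m].

Lemma adj_sym x y : adj x y -> adj y x.
Proof. by case=> h n0; split; [rewrite fsetUC|move=> e; apply: n0]. Qed.

Lemma relI_sym x y : relI x y -> relI y x.
Proof. by case=> [->|[m h1 h2]]; [left|right; exists m]. Qed.

Lemma rel1_relI x y : rel1 x y -> relI x y.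
Proof. by case=> [->|[]//]; left. Qed.

Lemma elen_vx k x y : faces K -> elen k x y -> vx K x /\ vx K y.
Proof.
by move=> fK [[Kxy _] _]; split; apply: faces_vx fK Kxy _; rewrite !inE eqxx ?orbT.
Qed.

End OneComplex.

Section Iso.
Variables (U V : choiceType) (K : set {fset U}) (l : U -> U -> R) (K' : set {fset V}) (l' : V -> V -> R).
Variable h : U -> V.
Hypothesis fK : faces K.
Hypothesis hh : simplicial_isometry K l K' l' h.

Lemma si_adj x y : adj K x y -> adj K' (h x) (h y) /\ l' (h x) (h y) = l x y.
Proof.
move=> [Kxy ne]; have vX : vx K x by apply: faces_vx fK Kxy _; rewrite !inE eqxx.
have vY : vx K y by apply: faces_vx fK Kxy _; rewrite !inE eqxx orbT.
by split; [split; [exact: (si_pair hh)|move/(si_inj hh vX vY)]|exact: (si_len hh)].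
Qed.

Lemma si_adjV x y : vx K x -> vx K y -> adj K' (h x) (h y) -> adj K x y.
Proof. by move=> vX vY [k ne]; split; [exact: (si_pairV fK hh)|move=> e; apply: ne; rewrite e]. Qed.

Lemma si_elen k x y : elen K l k x y -> elen K' l' k (h x) (h y).
Proof. by case=> /si_adj [a e] e'; split; rewrite ?e. Qed.

Lemma si_elenV k x q : vx K x -> elen K' l' k (h x) q -> exists2 y, elen K l k x y & q = h y.
Proof.
move=> vX [[k' ne] e]; have vq : vx K' q.
  by apply: faces_vx (si_faces fK hh) k' _; rewrite !inE eqxx orbT.
have [y vY ey] := si_surj fK hh vq; exists y => //; rewrite -ey in k' ne e.
have a : adj K x y by apply: si_adjV.
by split=> //; rewrite -e (si_adj a).2.
Qed.

Lemma si_sp x : vx K x -> sp K l x <-> sp K' l' (h x).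
Proof.
move=> vX; split=> -[[y e] hB]; split.
- by exists (h y); apply: si_elen.
- move=> /hB [[y4 e4] no]; split; first by exists (h y4); apply: si_elen.
  by case=> q /(si_elenV vX) [y1 e1 _]; apply: no; exists y1.
- by have [y' e' _] := si_elenV vX e; exists y'.
- move=> /hB [[y4 /(si_elenV vX) [q4 e4 _]] no]; split; first by exists q4.
  by case=> q e1; apply: no; exists (h q); apply: si_elen.
Qed.

End Iso.

Section Map.
Variables (U V : choiceType) (K : set {fset U}) (l : U -> U -> R) (K' : set {fset V}) (l' : V -> V -> R).
Variable h : U -> V.
Hypothesis fK : faces K.
Hypothesis h_adj : forall x y, adj K x y -> adj K' (h x) (h y) /\ l' (h x) (h y) = l x y.
Hypothesis h_sp : forall x, vx K x -> (sp K l x <-> sp K' l' (h x)).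

(** The hypotheses of this section hold for simplicial isometries and also for retractions, which
    need not be injective. *)
Lemma elen_map k x y : elen K l k x y -> elen K' l' k (h x) (h y).
Proof. by case=> /h_adj [a e] e'; split; rewrite ?e. Qed.

Lemma relM_map k x m : relM K l k x m -> relM K' l' k (h x) (h m).
Proof.
case=> s e b; have [vX vM] := elen_vx fK e; split; [exact/h_sp|exact: elen_map|].
by move=> B /(iffRL (h_sp vM)); apply: (b B).
Qed.

Lemma relI_map x y : relI K l x y -> relI K' l' (h x) (h y).
Proof. by case=> [->|[m a b]]; [left|right; exists (h m); apply: relM_map]. Qed.

Lemma rel1_map x y : rel1 K l x y -> rel1 K' l' (h x) (h y).
Proof.
case=> [->|[s1 s2 i a]]; [by left|right].
have [[y1 e1] _] := s1; have [[y2 e2] _] := s2.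
have [vX _] := elen_vx fK e1; have [vY _] := elen_vx fK e2.
split; [exact/h_sp|exact/h_sp|exact: relI_map|].
case: a => [/h_adj [a _]|[m b1 b2]]; [by left|right].
by exists (h m); apply: elen_map.
Qed.

End Map.
End Relations.

Lemma special_add n isB (z b : {ffun 'I_n -> int}) : bc_special isB z -> (forall i, (2 %| b i)%Z) -> bc_special isB (z + b).
Proof.
move=> [h1 h2] hb; split=> [i j|B i]; rewrite !ffunE.
  by have := h1 i j; have := hb i; have := hb j; gen_ffun; lia.
by have := h2 B i; have := hb i; gen_ffun; lia.
Qed.

Lemma unitvec_ind n (P : {ffun 'I_n -> int} -> Prop) : P 0 ->
  (forall v i s, `|s| = 1 -> P v -> P (v + unitvec i s)) -> forall v, P v.
Proof.
move=> P0 PS v; have [k hk] : exists k, \sum_i `|v i| <= k%:Z.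
  by exists (absz (\sum_i `|v i|)); rewrite gez0_abs // sumr_ge0.
elim: k v hk => [|k IH] v hk.
  suff -> : v = 0 by [].
  by apply: (@bc_le1_0 n).
case: (pselect (exists i, v i <> 0)) => [[i vi]|hn]; last first.
  suff -> : v = 0 by [].
  by apply/ffunP => i; rewrite ffunE; apply: contrapT => h; apply: hn; exists i.
pose s := if 0 < v i then 1 else -1 : int.
have -> : v = (v - unitvec i s) + unitvec i s by rewrite subrK.
apply: PS; first by rewrite /s; case: ifP.
apply: IH; have := @sum_drop n (fun j => `|(v - unitvec i s) j|) (fun j => `|v j|) i.
move=> H; suff : \sum_j `|(v - unitvec i s) j| + 1 = \sum_j `|v j|.
  by move: hk; rewrite -addn1 PoszD; move: (\sum_j _) (\sum_j _) => a b; lia.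
apply: H => [j /negPf ji|]; rewrite !ffunE ?ji ?subr0 // eqxx.
by move: vi; rewrite /s; case: ifP; gen_ffun; lia.
Qed.

(** * The relations in the flat, and rigidity of its chambers *)

Section FlatRelations.
Variables (R : realType) (isB : bool) (n m : nat) (Phi : set 'rV[R]_m).
Local Notation vec := {ffun 'I_n -> int}.
Variables (emb : vec -> 'rV[R]_m) (unit : nat -> R).
Hypothesis hflat : bc_flat isB Phi emb unit.
Local Notation CS := (coxeter_simplex Phi).
Local Notation ed := (@edist R m).
Hypothesis fCS : faces CS.
Hypothesis n0 : (0 < n)%N.
Hypothesis nB : isB -> (1 < n)%N.
Local Notation special := (@bc_special n isB).
Local Notation vertex := (@bc_vertex n isB).
Local Notation fadj := (adj CS).
Local Notation felen := (elen unit CS ed).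
Local Notation fsp := (sp isB n unit CS ed).
Local Notation frelM := (relM isB n unit CS ed).
Local Notation frelI := (relI isB n unit CS ed).
Local Notation frel1 := (rel1 isB n unit CS ed).
Implicit Types z w x y b : vec.

Lemma CS_vertexP p : vx CS p <-> exists2 z, vertex z & p = emb z.
Proof.
rewrite -(bc_vertexP hflat); split=> [[x sx hx]|vp].
  by have /hx [] : p \in [fset p]%fset by rewrite inE.
have [_ hp] := vp; have [sp' _] := vp.
exists p => // y; rewrite inE; split=> [/eqP ->|[_ /hp ->//]].
by split=> //; split=> // r k _; split.
Qed.

Lemma CS_vertex z : vx CS (emb z) -> vertex z.
Proof. by move=> /CS_vertexP [w vw /(emb_inj hflat) ->]. Qed.

Lemma fadj_edge z w : fadj (emb z) (emb w) -> [/\ bc_edge isB z w, vertex z, vertex w & z <> w].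
Proof.
move=> [h ne]; split.
- by apply: (bc_bound hflat h); rewrite !inE eqxx ?orbT.
- by apply: CS_vertex; apply: faces_vx fCS h _; rewrite !inE eqxx.
- by apply: CS_vertex; apply: faces_vx fCS h _; rewrite !inE eqxx orbT.
- by move=> e; apply: ne; rewrite e.
Qed.

Lemma felen_sqn k z w : felen k (emb z) (emb w) <-> fadj (emb z) (emb w) /\ sqn (z - w) = k%:Z.
Proof. by rewrite /elen; split=> -[a]; rewrite (bc_dist hflat). Qed.

Lemma vx_emb p : vx CS p -> exists z, p = emb z.
Proof. by move=> /CS_vertexP [z _ ->]; exists z. Qed.

Lemma star_pair0 z b : special z -> (forall i, `|b i| <= 1) -> (exists i, b i <> 0) ->
  (isB -> exists i j, [/\ i != j, b i <> 0 & b j <> 0]) -> fadj (emb z) (emb (z + b)).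
Proof.
move=> sz hb [i bi] hB; split.
  have := @bc_star _ _ _ _ _ _ _ hflat z b b sz hb (fun=> or_intror erefl) (ex_intro _ i bi) hB.
  by move=> h; apply: faces_pair fCS h _ _; rewrite !inE eqxx ?orbT.
by move/(emb_inj hflat) => e; apply: bi; move/ffunP: e => /(_ i); rewrite ffunE; gen_ffun; lia.
Qed.

Lemma two_ords : isB -> exists i j : 'I_n, i != j.
Proof. by move=> /nB n1; exists (Ordinal n0), (Ordinal n1). Qed.

Lemma star_full z b : special z -> (forall i, `|b i| = 1) -> felen n (emb z) (emb (z + b)).
Proof.
move=> sz hb; apply/felen_sqn; split.
  apply: star_pair0 => // [i||/two_ords [i [j ij]]]; first by rewrite hb.
    by exists (Ordinal n0) => e; have := hb (Ordinal n0); rewrite e.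
  by exists i, j; split=> // e; [have := hb i|have := hb j]; rewrite e.
by apply: sqn_full => i; have := hb i; rewrite !ffunE; gen_ffun; lia.
Qed.

(** A vector of square norm [n] with entries at most 1 in absolute value has no zero entry; an edge
    of this kind forces all coordinates of [z] to have the same parity. *)
Lemma flat_sp z : vertex z -> fsp (emb z) <-> special z.
Proof.
move=> vz; pose one : vec := [ffun=> 1]; have one1 i : `|one i| = 1 by rewrite ffunE.
split=> [[[p ep] hB]|sz]; last first.
  split; first by exists (emb (z + one)); apply: star_full.
  move=> B; split.
    exists (emb (z + unitvec (Ordinal n0) 2)); apply/felen_sqn; split; last first.
      have -> : z - (z + unitvec (Ordinal n0) 2) = unitvec (Ordinal n0) (-2); last by rewrite sqn_unitvec.
      by apply/ffunP => i; rewrite !ffunE; case: eqP; gen_ffun; lia.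
    split; first exact: (bc_double hflat).
    move/(emb_inj hflat)/ffunP/(_ (Ordinal n0)); rewrite !ffunE eqxx; gen_ffun; lia.
  case=> p ep; have [_ /vx_emb [w e]] := elen_vx fCS ep; move: ep; rewrite e => /felen_sqn [/fadj_edge [_ _ vw _]].
  move/sqn_one => [i hi hj]; have [|j ji] := vw B i.
    by move: hi; have := sz.2 B i; rewrite !ffunE; gen_ffun; lia.
  by have := hj j ji; have := sz.2 B j; rewrite !ffunE; gen_ffun; lia.
have [_ /vx_emb [w e]] := elen_vx fCS ep; move: ep; rewrite e => /felen_sqn [/fadj_edge [ed_ _ _ _]] sq.
case: ed_ => [[d1 par]|[B ev _]]; last by split=> // i j; have := ev i; have := ev j; gen_ffun; lia.
have full i : `|w i - z i| = 1.
  have := @sqn_fullE n (z - w) _ sq i; rewrite !ffunE => /(_ _) H.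
  have H1 : forall j, `|(z - w) j| <= 1 by move=> j; have := d1 j; rewrite !ffunE; gen_ffun; lia.
  by have := H H1; gen_ffun; lia.
have unif i j : (2 %| z i - z j)%Z.
  by apply: par => e0; [have := full i|have := full j]; rewrite e0 subrr.
(* In type B odd coordinates must still be excluded. The edge of square length 4 would have entries
   at most 1, which forces [n > 2]; but then [z] also has an edge of square length 1, contrary to
   [sp]. *)
split=> // B i; apply: contrapT => odd; have [[p4 e4] no1] := hB B; apply: no1.
have [_ /vx_emb [w4 e4']] := elen_vx fCS e4; move: e4; rewrite e4' => /felen_sqn [/fadj_edge [ed4 _ _ _]] sq4.
case: ed4 => [[d4 _]|[_ ev _]]; last by case: odd.
have n2 : (2 < n)%N by apply: sqn_support sq4 _ => j; have := d4 j; rewrite !ffunE; gen_ffun; lia.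
pose i0 := Ordinal n0; pose i1 : 'I_n := Ordinal (ltnW n2); pose i2 : 'I_n := Ordinal n2.
have sz1 : special (z - one).
  by split=> [j k|_ j]; rewrite !ffunE; [have := unif j k|have := unif i j; move: odd]; gen_ffun; lia.
pose b : vec := one - unitvec i0 1.
have := @bc_star _ _ _ _ _ _ _ hflat (z - one) one b sz1.
have -> : z - one + one = z by rewrite subrK.
have -> : z - one + b = z - unitvec i0 1 by rewrite /b addrA subrK.
move=> H; have {}H := H (fun i => ltac:(by rewrite one1)).
have hb j : b j = if j == i0 then 0 else 1 by rewrite !ffunE; case: eqP.
have {}H := H (fun i => ltac:(by rewrite hb ffunE; case: eqP => _; [left|right])).
have h1 : exists i, b i <> 0 by exists i1; rewrite hb.
have h2 : isB -> exists i j, [/\ i != j, b i <> 0 & b j <> 0].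
  by move=> _; exists i1, i2; rewrite !hb.
have {}H := H h1 h2.
exists (emb (z - unitvec i0 1)); apply/felen_sqn; split; last first.
  by rewrite opprB addrC subrK sqn_unitvec.
split; first by apply: faces_pair fCS H _ _; rewrite !inE eqxx ?orbT.
by move/(emb_inj hflat)/ffunP/(_ i0); rewrite !ffunE eqxx; gen_ffun; lia.
Qed.

Lemma flat_spE p : fsp p -> exists2 z, special z & p = emb z.
Proof.
move=> h; have [[y e] _] := h; have [vp _] := elen_vx fCS e.
have [z ez] := vx_emb vp; rewrite ez in h vp *; exists z => //; apply/flat_sp => //.
exact: CS_vertex.
Qed.

Lemma flat_relM k x w : frelM k (emb x) (emb w) <->
  [/\ special x, vertex w, forall i, `|w i - x i| <= 1, x <> w & sqn (x - w) = k%:Z].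
Proof.
split.
  case=> /flat_spE [x' sx /(emb_inj hflat) ex] /felen_sqn [/fadj_edge [ed_ vx' vw ne]] sq hB.
  (* An edge of the second kind ends at a special vertex, which the last clause of [relM]
     excludes. *)
  rewrite -ex in sx; split=> //; case: ed_ => [[]//|[B ev [i di dj]]].
  case: (hB B); apply/flat_sp => //; split=> [j l|_ j].
    have D a : (2 %| w a)%Z.
      by have := ev a; case: (eqVneq a i) => [->|/dj ->//]; move: di; gen_ffun; lia.
    by have := D j; have := D l; gen_ffun; lia.
  by have := ev j; case: (eqVneq j i) => [->|/dj ->//]; move: di; gen_ffun; lia.
case=> sx vw d1 ne sq; have [i hi] : exists i, w i <> x i.
  apply: contrapT => hn; apply: ne; apply/ffunP => i; apply: contrapT => h; apply: hn; exists i => e.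
  by apply: h.
have oddi j : isB -> w j <> x j -> ~~ (2 %| w j)%Z.
  by move=> B; have := sx.2 B j; have := d1 j; gen_ffun; lia.
have ew : w = x + (w - x) by rewrite addrC subrK.
split; first by apply/flat_sp => //; apply: bc_special_vertex.
  apply/felen_sqn; split=> //; rewrite ew; apply: star_pair0 => // [j||B].
  - by rewrite !ffunE; exact: d1.
  - by exists i; rewrite !ffunE; move: hi; gen_ffun; lia.
  - have [j ji oj] := vw B i (oddi _ B hi); exists i, j; rewrite eq_sym; split=> //; rewrite !ffunE.
      by move: hi; gen_ffun; lia.
    by have := sx.2 B j; move: oj; gen_ffun; lia.
by move=> B /(iffLR (flat_sp vw)) [_ /(_ B i)]; apply/negP/oddi.
Qed.
Lemma full_vertex z b : special z -> (forall i, `|b i| = 1) -> vertex (z + b).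
Proof. by move=> sz /(star_full sz) /(elen_vx fCS) [_ /CS_vertex]. Qed.

Lemma flat_relM_full x w : frelM n (emb x) (emb w) <-> special x /\ forall i, `|w i - x i| = 1.
Proof.
rewrite flat_relM; split=> [[sx vw d ne sq]|[sx d]].
  split=> // i; have H : forall j, `|(x - w) j| <= 1 by move=> j; have := d j; rewrite !ffunE; gen_ffun; lia.
  by have := sqn_fullE H sq i; rewrite !ffunE; gen_ffun; lia.
split=> // [|i||].
- have -> : w = x + (w - x) by rewrite addrC subrK.
  by apply: full_vertex => // i; rewrite !ffunE.
- by rewrite d.
- by move=> e; have := d (Ordinal n0); rewrite e subrr.
- by apply: sqn_full => i; have := d i; rewrite !ffunE; gen_ffun; lia.
Qed.

Lemma relM_emb k p q : frelM k p q -> exists x w, p = emb x /\ q = emb w.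
Proof.
by case=> _ /(elen_vx fCS) [/vx_emb [x ex] /vx_emb [w ew]] _; exists x, w.
Qed.

Lemma flat_relI x y : frelI (emb x) (emb y) <-> x = y \/
  [/\ special x, special y & forall i, `|y i - x i| = 0 \/ `|y i - x i| = 2].
Proof.
split.
  case=> [/(emb_inj hflat)|[p hx hy]]; [by left|right].
  have [x' [w [_ ew]]] := relM_emb hx; rewrite ew in hx hy.
  have [sx dx] := iffLR (flat_relM_full _ _) hx; have [sy dy] := iffLR (flat_relM_full _ _) hy.
  by split=> // i; have := dx i; have := dy i; gen_ffun; lia.
case=> [->|[sx sy d]]; [by left|right].
exists (emb (x + [ffun i => if y i - x i == -2 then -1 else 1])); apply/flat_relM_full; split=> // i; rewrite !ffunE.
  by case: eqP => _; gen_ffun; lia.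
by have := d i; case: eqP; gen_ffun; lia.
Qed.

(** Special vertices that differ by twice a unit vector are adjacent in type B; in type C their
    midpoint is a vertex at square distance 1 from both. Hence the two alternatives in [rel1]. *)
Lemma flat_rel1 x y : frel1 (emb x) (emb y) <-> x = y \/
  [/\ special x, special y & exists i t, `|t| = 2 /\ y = x + unitvec i t].
Proof.
have sub0 i t : y = x + unitvec i t -> x - y = unitvec i (- t).
  by move=> ->; apply/ffunP => j; rewrite !ffunE; case: eqP; gen_ffun; lia.
split.
  case=> [/(emb_inj hflat)|[_ _]]; [by left|].
  case/flat_relI=> [|[sx sy d] h]; [by left|].
  case: h => [/fadj_edge [[[d1 _]|[_ _ [i di dj]]] _ _ ne]|[p hp hq]].
  - case: ne; apply/ffunP => i; have := d i; have := d1 i; gen_ffun; lia.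
  - right; split=> //; exists i, (y i - x i); split=> //; apply/ffunP => j; rewrite !ffunE.
    by case: eqP => [->|/eqP /dj]; gen_ffun; lia.
  have [_ /vx_emb [w ew]] := elen_vx fCS hp; rewrite ew in hp hq.
  have [_ /sqn_one [i di dj]] := iffLR (felen_sqn _ _ _) hp.
  have [_ /sqn_one [i' di' dj']] := iffLR (felen_sqn _ _ _) hq.
  have ii : i = i'.
    apply: contrapT => /eqP ii; have := dj' i ii; have := d i; move: di.
    by rewrite !ffunE; gen_ffun; lia.
  subst i'; have eqj j : j != i -> y j = x j.
    by move=> ji; have := dj j ji; have := dj' j ji; rewrite !ffunE; gen_ffun; lia.
  case: (eqVneq (y i) (x i)) => e; [left|right; split=> //].
    by apply/ffunP => j; case: (eqVneq j i) => [->|/eqj].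
  exists i, (y i - x i); split; first by have := d i; move: e; gen_ffun; lia.
  by apply/ffunP => j; rewrite !ffunE; case: eqP => [->|/eqP /eqj]; gen_ffun; lia.
case=> [->|[sx sy [i [t [ht ey]]]]]; [by left|right; split].
- by apply/flat_sp => //; apply: bc_special_vertex.
- by apply/flat_sp => //; apply: bc_special_vertex.
- apply/flat_relI; right; split=> // j; rewrite ey !ffunE.
  by case: eqP => _; gen_ffun; lia.
have ne : emb x <> emb y.
  by move/(emb_inj hflat)/ffunP/(_ i); rewrite ey !ffunE eqxx; gen_ffun; lia.
case: (boolP isB) => B; first by left; split=> //; rewrite ey; apply: (bc_double hflat).
right; pose s := if t == 2 then 1 else -1 : int.
have hs : `|s| = 1 /\ t = s + s by rewrite /s; case: eqP; lia.
have E z (r : int) : special z -> `|r| = 1 -> elen unit CS ed 1 (emb z) (emb (z + unitvec i r)).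
  move=> sz hr; apply/felen_sqn; split; last first.
    have -> : z - (z + unitvec i r) = unitvec i (- r); last by rewrite sqn_unitvec; lia.
    by apply/ffunP => j; rewrite !ffunE; case: eqP; gen_ffun; lia.
  apply: star_pair0 => // [j||B']; first by rewrite ffunE; case: eqP => _; lia.
    by exists i; rewrite ffunE eqxx; lia.
  by rewrite B' in B.
exists (emb (x + unitvec i s)); first by apply: E => //; case: hs.
have -> : x + unitvec i s = y + unitvec i (- s).
  by rewrite ey; apply/ffunP => j; rewrite !ffunE (proj2 hs); case: eqP; gen_ffun; lia.
by apply: E => //; case: hs; lia.
Qed.

Section Rigid.
Variable h : 'rV[R]_m -> 'rV[R]_m.
Hypothesis hh : simplicial_isometry CS ed CS ed h.
Local Notation fixed z := (h (emb z) = emb z).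

Lemma special_vx z : special z -> vx CS (emb z).
Proof. by move=> sz; apply/CS_vertexP; exists z => //; apply: bc_special_vertex. Qed.

Lemma h_rel1 p q : frel1 p q -> frel1 (h p) (h q).
Proof. by apply: rel1_map fCS (si_adj fCS hh) (si_sp _ _ _ fCS hh) _ _. Qed.

Lemma h_inj z w : special z -> special w -> h (emb z) = h (emb w) -> z = w.
Proof.
move=> sz sw /(si_inj hh (special_vx sz) (special_vx sw)); exact: (emb_inj hflat).
Qed.

Lemma special_unitvec z i t : special z -> `|t| = 2 -> special (z + unitvec i t).
Proof. by move=> sz ht; apply: special_add => // j; rewrite ffunE; case: eqP => _; lia. Qed.

Lemma fixed_neighbour z i t : special z -> fixed z -> `|t| = 2 ->
  exists a s, `|s| = 2 /\ h (emb (z + unitvec i t)) = emb (z + unitvec a s).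
Proof.
move=> sz fz ht; have sw := special_unitvec i sz ht.
have [w ew] := vx_emb (si_vx hh (special_vx sw)).
have : frel1 (emb z) (emb (z + unitvec i t)) by apply/flat_rel1; right; split=> //; exists i, t.
move/h_rel1; rewrite fz ew => /flat_rel1 [e|[_ _ [a [s [hs ->]]]]]; last by exists a, s.
have : z = z + unitvec i t by apply: h_inj => //; rewrite fz ew e.
by move/ffunP/(_ i); rewrite !ffunE eqxx; gen_ffun; lia.
Qed.

Lemma unitvec_eq z i t j s : `|t| = 2 -> z + unitvec i t = z + unitvec j s -> i = j.
Proof.
move=> ht /addrI /ffunP /(_ i); rewrite !ffunE eqxx; case: eqP => // _ e; lia.
Qed.

(* The only common neighbours of [z + unitvec i t] and [z + unitvec j t'] are [z] and the fourth corner of the square. *)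
Lemma fixed_square z i t j t' : special z -> fixed z -> `|t| = 2 -> `|t'| = 2 -> i != j ->
  fixed (z + unitvec i t) -> fixed (z + unitvec j t') -> fixed (z + unitvec i t + unitvec j t').
Proof.
move=> sz fz ht ht' ij f1 f2.
have s1 := special_unitvec i sz ht; have s2 := special_unitvec j sz ht'.
have s12 := special_unitvec j s1 ht'.
have [a [s [hs e1]]] := fixed_neighbour j s1 f1 ht'.
have [b [r [hr e2]]] := fixed_neighbour i s2 f2 ht.
rewrite e1; congr emb; congr (_ + _).
have e12 : z + unitvec i t + unitvec j t' = z + unitvec j t' + unitvec i t by rewrite addrAC.
have E : z + unitvec i t + unitvec a s = z + unitvec j t' + unitvec b r.
  by apply: (emb_inj hflat); rewrite -e1 -e2 e12.
have ne : z + unitvec i t + unitvec a s <> z.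
  move=> e; have : z + unitvec i t + unitvec j t' = z by apply: h_inj => //; rewrite e1 e fz.
  move/ffunP/(_ i); rewrite !ffunE eqxx (negPf ij); gen_ffun; lia.
have /ffunP E' := E; have Ei := E' i; have Ej := E' j.
have ji : j != i by rewrite eq_sym.
move: Ei Ej; rewrite !ffunE !eqxx (negPf ij) (negPf ji) => Ei Ej.
case: (eqVneq b i) => [bi|bi].
  move: Ej; rewrite bi (negPf ji); case: eqP => [ja|_] Ej; last by exfalso; move: Ej; gen_ffun; lia.
  by apply/ffunP => l; rewrite !ffunE -ja; case: eqP => // _; move: Ej; gen_ffun; lia.
case: ne; apply/ffunP => l; rewrite !ffunE; move: Ei; rewrite [i == b]eq_sym (negPf bi).
case: (eqVneq i a) => [<-|_] Ei; last by exfalso; move: Ei; gen_ffun; lia.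
by case: eqP => [->|_]; move: Ei; gen_ffun; lia.
Qed.

Definition fixed_star z := fixed z /\ forall i t, `|t| = 2 -> fixed (z + unitvec i t).

(** Among the neighbours of [z + unitvec i t], the lateral ones are fixed by [fixed_square], and so
    is [z]; the one straight ahead is then fixed by injectivity. *)
Lemma fixed_star_step z i t : special z -> `|t| = 2 -> fixed_star z -> fixed_star (z + unitvec i t).
Proof.
move=> sz ht [fz f1]; have f1' := f1 i t ht; split=> // j t' ht'.
have s1 := special_unitvec i sz ht.
case: (eqVneq i j) => [<-|ij]; last by apply: fixed_square => //; apply: f1.
have back : z + unitvec i t + unitvec i (- t) = z.
  by apply/ffunP => l; rewrite !ffunE; case: eqP; gen_ffun; lia.
have [->|et] : t' = - t \/ t' = t by lia.
  by rewrite back.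
have [a [s [hs e1]]] := fixed_neighbour i s1 f1' ht'.
case: (eqVneq a i) => [ai|ai].
  have [es|es] : s = t' \/ s = - t by lia.
    by rewrite e1 ai es.
  have : z + unitvec i t + unitvec i t' = z.
    by apply: h_inj => //; [exact: special_unitvec|rewrite e1 ai es back fz].
  by move=> ->.
have ia : i != a by rewrite eq_sym.
have fa : fixed (z + unitvec i t + unitvec a s) by apply: fixed_square => //; apply: f1.
have : z + unitvec i t + unitvec i t' = z + unitvec i t + unitvec a s.
  by apply: h_inj; [exact: special_unitvec|exact: special_unitvec|rewrite e1 fa].
by move=> ->.
Qed.

Variable z0 : vec.
Hypothesis sz0 : special z0.
Hypothesis fixed_chain : forall k, (k <= n)%N -> fixed (z0 + @chain n isB k).

Lemma other_ord (i : 'I_n) k : (1 < k <= n)%N -> exists l : 'I_n, l != i /\ (l < k)%N.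
Proof.
case/andP=> k1 kn; case: (eqVneq i (Ordinal n0)) => [->|i0].
  by exists (Ordinal (leq_trans k1 kn)).
by exists (Ordinal n0); rewrite eq_sym i0 (ltnW k1).
Qed.

(** The vertices of the chamber adjacent to a neighbour of [z0] reveal its direction and sign;
    [fixed_plus] recognizes images in this way. *)
Lemma chain_adj k a s : (0 < k <= n)%N -> (isB -> (1 < k)%N) -> `|s| = 2 ->
  fadj (emb (z0 + unitvec a s)) (emb (z0 + @chain n isB k)) <-> s = 2 /\ (a < k)%N.
Proof.
move=> /andP[k0 kn] kB hs.
have ch l : @chain n isB k l = ((l < k)%N)%:Z.
  by rewrite ffunE; case: (boolP isB) => //= B; rewrite gtn_eqF ?kB.
split.
  case/fadj_edge => [[[d1 _]|[B _ [i di dj]]] _ _ _].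
    by have := d1 a; rewrite !ffunE eqxx; have := ch a; rewrite ffunE => ->; gen_ffun; case: ltnP => _; lia.
  have [|l [li lk]] := @other_ord i k; first by rewrite kB.
  have := dj l li; rewrite !ffunE (_ : (if _ then _ else _) = 1).
    by case: eqP => _; gen_ffun; lia.
  by have := ch l; rewrite ffunE lk.
case=> es ak; rewrite es.
have -> : z0 + @chain n isB k = z0 + unitvec a 2 + (@chain n isB k - unitvec a 2).
  by apply/ffunP => l; rewrite !ffunE; gen_ffun; lia.
apply: star_pair0 => [|l||B]; first exact: special_unitvec.
- by rewrite ffunE ch !ffunE; case: (eqVneq l a) => [->|_]; rewrite ?ak //; case: ltnP.
- by exists a; rewrite ffunE ch !ffunE ak eqxx.
have [|l [la lk]] := @other_ord a k; first by rewrite kB.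
exists a, l; rewrite eq_sym la; split=> //; rewrite ffunE ch !ffunE ?ak ?lk ?eqxx ?(negPf la) //.
Qed.

Lemma fixed_z0 : fixed z0.
Proof.
have := fixed_chain (leq0n n); suff -> : @chain n isB 0 = 0 by rewrite addr0.
by apply/ffunP => i; rewrite !ffunE; case: isB.
Qed.

Lemma chain_special_vx k : (k <= n)%N -> vx CS (emb (z0 + @chain n isB k)).
Proof.
move=> kn; have [h1 _] := bc_chamber hflat sz0.
apply: faces_vx fCS h1 _; apply/imfsetP; exists (Ordinal (kn : (k < n.+1)%N)) => //.
Qed.

Lemma fixed_plus i : fixed (z0 + unitvec i 2).
Proof.
have h2 : `|2 : int| = 2 by [].
have [a [s [hs e]]] := fixed_neighbour i sz0 fixed_z0 h2.
have key k : (0 < k <= n)%N -> (isB -> (1 < k)%N) -> (s = 2 /\ (a < k)%N) <-> (i < k)%N.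
  move=> kk kB; rewrite -(chain_adj a kk kB hs).
  have /andP[_ kn] := kk.
  rewrite -[emb (z0 + @chain n isB k)](fixed_chain kn) -e.
  apply: (@iff_trans _ (fadj (emb (z0 + unitvec i 2)) (emb (z0 + @chain n isB k)))).
    split=> [|/(si_adj fCS hh) [] //]; apply: (si_adjV fCS hh); last exact: chain_special_vx.
    by apply/special_vx/special_unitvec.
  by rewrite chain_adj //; split=> [[]|].
have [s2 _] : s = 2 /\ (a < n)%N by apply/key; rewrite ?n0 ?leqnn ?ltn_ord.
rewrite e s2; congr emb; congr (_ + unitvec _ _); apply/val_inj => /=.
(* In type B the index [k = 1] is missing in [key], so the first two directions are not told apart.
   But [z0] plus twice the first unit vector is itself a vertex of the chamber. *)
have one : isB -> i = 0%N :> nat -> a = i.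
  move=> B i0; have : fixed (z0 + unitvec i 2).
    have := fixed_chain n0; suff -> : @chain n isB 1 = unitvec i 2 by [].
    apply/ffunP => l; rewrite !ffunE B /=; congr (if _ then _ else _).
    by rewrite -[RHS](inj_eq val_inj) /= i0.
  by rewrite e => /(emb_inj hflat) /esym /(unitvec_eq h2).
case: (boolP isB) => B.
  case: (eqVneq (nat_of_ord i) 0%N) => [i0|i0]; first by rewrite one.
  have [_ ai] : s = 2 /\ (a < i.+1)%N.
    apply/key => [|_|//]; first by rewrite /= ltn_ord.
    by rewrite ltnS lt0n.
  case: (eqVneq (nat_of_ord a) 0%N) => [a0|a0].
    have fa : fixed (z0 + unitvec a 2).
      have := fixed_chain n0; suff -> : @chain n isB 1 = unitvec a 2 by [].
      apply/ffunP => l; rewrite !ffunE B /=; congr (if _ then _ else _).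
      by rewrite -[RHS](inj_eq val_inj) /= a0.
    have : z0 + unitvec i 2 = z0 + unitvec a 2.
      by apply: h_inj; [exact: special_unitvec|exact: special_unitvec|rewrite e s2 fa].
    by move/(unitvec_eq h2) ->.
  have : (i < a.+1)%N.
    apply/key => [|_|//]; first by rewrite /= ltn_ord.
    by rewrite ltnS lt0n.
  by move: ai; lia.
have nb k : isB -> (1 < k)%N by move=> B'; rewrite B' in B.
have [_ ai] : s = 2 /\ (a < i.+1)%N.
  by apply/key => [|/nb //|//]; rewrite /= ltn_ord.
have : (i < a.+1)%N.
  by apply/key => [|/nb //|//]; rewrite /= ltn_ord.
by move: ai; lia.
Qed.

Lemma fixed_minus i : fixed (z0 + unitvec i (-2)).
Proof.
have h2 : `|2 : int| = 2 by []; have h2' : `|- 2 : int| = 2 by [].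
have [a [s [hs e]]] := fixed_neighbour i sz0 fixed_z0 h2'.
have smi := special_unitvec i sz0 h2'; have spa := special_unitvec a sz0 h2.
have [es|es] : s = 2 \/ s = -2 by lia.
  have : z0 + unitvec i (-2) = z0 + unitvec a 2 by apply: h_inj => //; rewrite e es fixed_plus.
  move=> e1; have ia := unitvec_eq h2' e1; move: e1; rewrite ia => /addrI /ffunP /(_ a).
  by rewrite !ffunE eqxx.
rewrite es in e; case: (eqVneq a i) => [ai|ai]; first by rewrite e ai.
(* The image of [z0 + unitvec i (-2) + unitvec a 2] is near both [z0 + unitvec a 2] and
   [z0 + unitvec a (-2)]. It must be [z0] or the latter, which contradicts injectivity. *)
have [q [r [hr e1]]] : exists q r, `|r| = 2 /\
    h (emb (z0 + unitvec i (-2) + unitvec a 2)) = emb (z0 + unitvec a 2 + unitvec q r).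
  have := fixed_neighbour i spa (fixed_plus a) h2'.
  by rewrite [z0 + unitvec a 2 + unitvec i (-2)]addrAC.
have sq := special_unitvec a smi h2.
have : frel1 (emb (z0 + unitvec i (-2))) (emb (z0 + unitvec i (-2) + unitvec a 2)).
  by apply/flat_rel1; right; split=> //; exists a, 2.
move/h_rel1; rewrite e e1 => /flat_rel1 H.
have E : z0 + unitvec a 2 + unitvec q r = z0 \/ z0 + unitvec a 2 + unitvec q r = z0 + unitvec a (-2).
  case: H => [|[_ _ [d [g [hg E]]]]]; [by right|left].
  have /ffunP E' := E; have := E' a; rewrite !ffunE !eqxx => Ea.
  have hb : q = a /\ r = -2.
    move: Ea; case: (eqVneq a q) => [eaq|ne].
      by case: (eqVneq a d) => [_|ne'] Ea; split=> //; move: Ea; gen_ffun; lia.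
    by case: (eqVneq a d) => [_|ne'] Ea; exfalso; move: Ea; gen_ffun; lia.
  by rewrite hb.1 hb.2; apply/ffunP => l; rewrite !ffunE; case: eqP; gen_ffun; lia.
exfalso; case: E => E.
  have : z0 + unitvec i (-2) + unitvec a 2 = z0.
    by apply: h_inj => //; rewrite e1 E fixed_z0.
  by move/ffunP/(_ a); rewrite !ffunE eqxx (negPf ai); gen_ffun; lia.
have : z0 + unitvec i (-2) + unitvec a 2 = z0 + unitvec i (-2).
  by apply: h_inj => //; rewrite e1 E e.
by move/ffunP/(_ a); rewrite !ffunE eqxx (negPf ai); gen_ffun; lia.
Qed.

Lemma fixed_class v : fixed (z0 + v *+ 2).
Proof.
suff H : special (z0 + v *+ 2) /\ fixed_star (z0 + v *+ 2) by case: H => _ [].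
move: v; apply: unitvec_ind => [|v i s hs [sv fv]].
  rewrite mul0rn addr0; split=> //; split; first exact: fixed_z0.
  move=> i t ht; have [->|->] : t = 2 \/ t = -2 by lia.
    exact: fixed_plus.
  exact: fixed_minus.
have hs2 : `|s + s| = 2 by lia.
have -> : z0 + (v + unitvec i s) *+ 2 = z0 + v *+ 2 + unitvec i (s + s).
  by apply/ffunP => j; rewrite !mulr2n !ffunE; case: eqP; gen_ffun; lia.
by split; [exact: special_unitvec|exact: fixed_star_step].
Qed.

(** Let [one] mark the coordinates whose parity differs from that in [z0]. Then [w + one] and
    [w - one] lie in the class of [z0] and are fixed. The relation of [w] to both determines the
    marked coordinates of its image, and comparison of lengths the others. *)
Lemma flat_rigid w : vertex w -> fixed w.
Proof.
move=> vw.
pose I i := ~~ (2 %| w i - z0 i)%Z.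
pose one : vec := [ffun i => if I i then 1 else 0].
have fs t : `|t| = 1 -> special (w + [ffun i => t * one i]) /\ fixed (w + [ffun i => t * one i]).
  move=> ht; pose v : vec := [ffun i => ((w i + t * one i - z0 i) %/ 2)%Z].
  have -> : w + [ffun i => t * one i] = z0 + v *+ 2.
    apply/ffunP => i; rewrite mulr2n !ffunE /I; have [->|->] : t = 1 \/ t = -1 by lia.
      by case: ifP; gen_ffun; lia.
    by case: ifP; gen_ffun; lia.
  split; last exact: fixed_class.
  by apply: special_add => // i; rewrite mulr2n ffunE; gen_ffun; lia.
have [sp1 fp] := fs 1 erefl; have [sm fm] := fs (-1) erefl.
case: (pselect (exists i, I i)) => [[i0 hi0]|hn]; last first.
  suff e : w + [ffun i => 1 * one i] = w by move: fp; rewrite e.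
  apply/ffunP => i; rewrite !ffunE; case: ifP => hi; last by rewrite mulr0 addr0.
  by case: hn; exists i.
have vW : vx CS (emb w) by apply/CS_vertexP; exists w.
have [w' ew'] := vx_emb (si_vx hh vW).
pose k := absz (sqn one).
have ek : sqn one = k%:Z by rewrite /k gez0_abs // sumr_ge0 // => i _; rewrite sqr_ge0.
have step t : `|t| = 1 -> special (w + [ffun i => t * one i]) -> fixed (w + [ffun i => t * one i]) ->
    (forall i, `|w' i - w i - t * one i| <= 1) /\ sqn (w + [ffun i => t * one i] - w') = k%:Z.
  move=> ht st ft; have ht' : t = 1 \/ t = -1 by lia.
  have : frelM k (emb (w + [ffun i => t * one i])) (emb w).
    apply/flat_relM; split=> // [i||].
    - by rewrite !ffunE; case: ifP => _; case: ht' => ->; gen_ffun; lia.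
    - by move/ffunP/(_ i0); rewrite !ffunE hi0; case: ht' => ->; gen_ffun; lia.
    - rewrite -ek; apply: eq_bigr => i _; rewrite !ffunE !expr2.
      by case: ifP => _; case: ht' => ->; gen_ffun; lia.
  move/(relM_map fCS (si_adj fCS hh) (si_sp _ _ _ fCS hh)); rewrite ft ew' => /flat_relM [_ _ d _ sq].
  by split=> // i; have := d i; rewrite !ffunE; gen_ffun; lia.
have [dp sqp] := step 1 erefl sp1 fp; have [dm sqm] := step (-1) erefl sm fm.
rewrite ew'; congr emb.
have eI i : I i -> w' i = w i.
  by move=> hi; have := dp i; have := dm i; rewrite !ffunE hi; gen_ffun; lia.
have := @sum_le_eq n (fun i => one i ^+ 2) (fun i => (w + [ffun i => 1 * one i] - w') i ^+ 2).
have H1 : forall i, one i ^+ 2 <= (w + [ffun i => 1 * one i] - w') i ^+ 2.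
  move=> i; rewrite !ffunE; case: ifP => hi; last by rewrite expr0n sqr_ge0.
  by rewrite eI // !expr2; gen_ffun; lia.
move/(_ H1); rewrite -/(sqn one) ek -sqp => /(_ erefl) H.
apply/ffunP => i; have := H i; rewrite !ffunE; case: ifP => hi; first by rewrite eI.
by rewrite mulr0 addr0 expr0n => /esym /eqP; rewrite expf_eq0 /= subr_eq0 => /eqP.
Qed.

End Rigid.

End FlatRelations.

(** * Buildings of types B and C *)

Section Building.
Variables (R : realType) (X : classical_type) (n : nat) (c : R).
Variables (T : choiceType) (D : peComplex R T) (apts : set (set {fset T})).
Hypothesis hD : euclidean_building X n c D apts.
Variable t0 : T.
Local Notation vec := {ffun 'I_n -> int}.
Local Notation F := ('rV[R]_(ambient X n)).
Local Notation Phi := (Defs.roots R X n c).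
Local Notation CS := (coxeter_simplex Phi).
Local Notation ed := (@edist R (ambient X n)).
Local Notation chart := (@Defs.chart R T X n c D).
Variables (isB : bool) (emb : vec -> F) (unit : nat -> R).
Hypothesis hflat : bc_flat isB Phi emb unit.
Hypothesis n0 : (0 < n)%N.
Hypothesis nB : isB -> (1 < n)%N.
Let fCS : faces CS := CS_faces hD.
Let fD : faces (simplex D) := @D_faces R T D.
Local Notation special := (@bc_special n isB).
Local Notation vertex := (@bc_vertex n isB).
Local Notation fadj := (adj CS).
Local Notation felen := (elen unit CS ed).
Local Notation fsp := (sp isB n unit CS ed).
Local Notation frelM := (relM isB n unit CS ed).
Local Notation frelI := (relI isB n unit CS ed).
Local Notation frel1 := (rel1 isB n unit CS ed).
Local Notation dadj := (adj (simplex D)).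
Local Notation delen := (elen unit (simplex D) (len D)).
Local Notation dsp := (sp isB n unit (simplex D) (len D)).
Local Notation drelM := (relM isB n unit (simplex D) (len D)).
Local Notation drelI := (relI isB n unit (simplex D) (len D)).
Local Notation drel1 := (rel1 isB n unit (simplex D) (len D)).
Implicit Types (z w a b : vec) (x y v : T).

Lemma special0 : special 0.
Proof. by split=> [i j|_ i]; rewrite !ffunE ?subrr; lia. Qed.

Lemma chamber_at Sg f z : apts Sg -> chart Sg f -> special z ->
  exists C, [/\ Sg C, flat_chamber c [fset f x | x in C]%fset, rigid c [fset f x | x in C]%fset
    & exists2 p, p \in C & f p = emb z].
Proof.
move=> hS hf sz; have [Q1 Q2] := bc_chamber hflat sz.
have [C SC eC] := chart_preim hS hf Q1; exists C.
have ch0 : @chain n isB 0 = 0 by apply/ffunP => i; rewrite !ffunE; case: isB.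
rewrite -eC; split=> //.
  move=> h hh hq p /(CS_vertexP hflat) [w vw ->]; apply: (flat_rigid hflat fCS n0 nB hh sz) => // k kn.
  by apply: hq; apply/imfsetP; exists (Ordinal (kn : (k < n.+1)%N)).
have : emb z \in [fset f x | x in C]%fset.
  by rewrite -eC; apply/imfsetP; exists ord0 => //; rewrite ch0 addr0.
by case/imfsetP => p /= pC e; exists p.
Qed.

(* [rho] is the retraction onto the apartment [Sg], read in the chart [f], centred at a chamber containing the vertex with coordinates [z]. *)
Definition retr Sg f z (rho : T -> F) :=
  (forall v, vx Sg v -> rho v = f v) /\
  forall s, simplex D s -> exists Sg' f' p, [/\ apts Sg', chart Sg' f', Sg' s, vx Sg' p
    & [/\ vx Sg p, f p = emb z, f' p = emb z & forall v, vx Sg' v -> rho v = f' v]].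

Lemma retr_ex Sg f z : apts Sg -> chart Sg f -> special z -> exists rho, retr Sg f z rho.
Proof.
move=> hS hf sz; have [C [SC fC rC [p pC ep]]] := chamber_at hS hf sz.
have [rho [h1 h2]] := retraction hD t0 hS hf SC fC rC; exists rho; split.
  by move=> v; apply: h1.
move=> s /h2 [S' [f' [hS' hf' S'C S's e]]]; exists S', f', p; split=> //.
  exact: (faces_vx (apt_faces hD hS') S'C pC).
split=> //; [exact: (faces_vx (apt_faces hD hS) SC pC)|by rewrite e|].
by move=> v; apply: h1.
Qed.

Lemma apt_full_sub Sg s : apts Sg -> simplex D s -> (forall x, x \in s -> vx Sg x) -> Sg s.
Proof.
move=> hS; have [f hf] := apt_chart hD hS; have [C [SC fC rC _]] := chamber_at hS hf special0.
exact: (apt_full hD t0 hS hf SC fC rC).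
Qed.

Section Chart.
Variables (Sg : set {fset T}) (f : T -> F).
Hypotheses (hS : apts Sg) (hf : chart Sg f).
Let fS : faces Sg := apt_faces hD hS.

Lemma apt_adjD x y : vx Sg x -> vx Sg y -> dadj x y <-> adj Sg x y.
Proof.
move=> vX vY; split=> -[h ne]; split=> //; last exact: (apt_simplex hD hS).
by apply: (apt_full_sub hS h) => u; rewrite !inE => /orP[]/eqP ->.
Qed.

Lemma apt_adj x y : vx Sg x -> vx Sg y -> dadj x y <-> fadj (f x) (f y).
Proof.
by move=> vX vY; rewrite (apt_adjD vX vY); split=> [/(si_adj fS hf) [] //|/(si_adjV fS hf vX vY)].
Qed.

Lemma apt_elen k x y : vx Sg x -> vx Sg y -> delen k x y <-> felen k (f x) (f y).
Proof.
move=> vX vY; split=> -[/(apt_adj vX vY) a e]; split=> //.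
  by move/(apt_adj vX vY): a => /(apt_adjD vX vY) /(si_adj fS hf) [_ ->].
by move: e; move/(apt_adjD vX vY): a => /(si_adj fS hf) [_ ->].
Qed.

Lemma apt_inv p : vx CS p -> exists2 x, vx Sg x & f x = p.
Proof. exact: (si_surj fS hf). Qed.

Lemma apt_inj x y : vx Sg x -> vx Sg y -> f x = f y -> x = y.
Proof. exact: (si_inj hf). Qed.

End Chart.

Lemma retr_adj Sg f z rho : retr Sg f z rho -> forall x y, dadj x y ->
  fadj (rho x) (rho y) /\ ed (rho x) (rho y) = len D x y.
Proof.
move=> [_ h] x y [/h [S' [f' [p [hS' hf' S's _ [_ _ _ e]]]]] ne].
have fS := apt_faces hD hS'.
rewrite !e; first exact: (si_adj fS hf').
  by apply: faces_vx fS S's _; rewrite !inE eqxx orbT.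
by apply: faces_vx fS S's _; rewrite !inE eqxx.
Qed.

(** A retraction maps an edge at [x] to an edge of the same length in the apartment; so conditions
    on the existence of neighbours can be tested in one apartment. *)
Lemma elen_lift Sg f k x y : apts Sg -> chart Sg f -> vx Sg x -> delen k x y -> exists2 y', vx Sg y' & delen k x y'.
Proof.
move=> hS hf vX [a e]; have [rho h] := retr_ex hS hf special0.
have [a' e'] := retr_adj h a; rewrite (h.1 _ vX) in a' e'.
have fl : felen k (f x) (rho y) by split; rewrite ?e'.
have [_ vY] := elen_vx fCS fl; have [y' vY' ey] := apt_inv hS hf vY.
by exists y' => //; apply/(apt_elen hS hf _ vX vY'); rewrite ey.
Qed.

Lemma apt_sp Sg f x : apts Sg -> chart Sg f -> vx Sg x -> dsp x <-> fsp (f x).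
Proof.
move=> hS hf vX.
have up k y : delen k x y -> exists p, felen k (f x) p.
  by case/(elen_lift hS hf vX) => y' vY /(apt_elen hS hf _ vX vY); exists (f y').
have dn k p : felen k (f x) p -> exists y, delen k x y.
  move=> e; have [_ vY] := elen_vx fCS e; have [y vY' ey] := apt_inv hS hf vY.
  by exists y; apply/(apt_elen hS hf _ vX vY'); rewrite ey.
split=> -[[y e] hB]; split.
- exact: up e.
- by move=> /hB [[y4 /up e4] no]; split=> // -[p /dn].
- exact: dn e.
- by move=> /hB [[y4 /dn e4] no]; split=> // -[p /up].
Qed.

Lemma retr_sp Sg f z rho : retr Sg f z rho -> forall x, vx (simplex D) x -> dsp x <-> fsp (rho x).
Proof.
move=> [_ h] x /h [S' [f' [p [hS' hf' S's _ [_ _ _ e]]]]].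
by rewrite e; [apply: (apt_sp hS' hf')|]; exact: S's.
Qed.

Lemma all_vx x : vx (simplex D) x. Proof. exact: simplex_vertex. Qed.

Lemma retr_relM Sg f z rho k x m : retr Sg f z rho -> drelM k x m -> frelM k (rho x) (rho m).
Proof. by move=> h; apply: (relM_map fD (retr_adj h) (retr_sp h)). Qed.

Lemma retr_relI Sg f z rho x y : retr Sg f z rho -> drelI x y -> frelI (rho x) (rho y).
Proof. by move=> h; apply: (relI_map fD (retr_adj h) (retr_sp h)). Qed.

Lemma retr_rel1 Sg f z rho x y : retr Sg f z rho -> drel1 x y -> frel1 (rho x) (rho y).
Proof. by move=> h; apply: (rel1_map fD (retr_adj h) (retr_sp h)). Qed.

Section ChartRelations.
Variables (Sg : set {fset T}) (f : T -> F).
Hypotheses (hS : apts Sg) (hf : chart Sg f).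

Lemma apt_relM k x m : vx Sg x -> vx Sg m -> drelM k x m <-> frelM k (f x) (f m).
Proof.
move=> vX vM; split=> -[s e b]; split.
- exact/(apt_sp hS hf).
- exact/(apt_elen hS hf).
- by move=> B /(apt_sp hS hf vM); apply: b.
- exact/(apt_sp hS hf).
- exact/(apt_elen hS hf).
- by move=> B /(apt_sp hS hf vM); apply: b.
Qed.

Lemma relM_lift k x q : vx Sg x -> frelM k (f x) q -> exists m, [/\ vx Sg m, f m = q & drelM k x m].
Proof.
move=> vX r; have [_ e _] := r; have [_ vM] := elen_vx fCS e.
have [m vM' em] := apt_inv hS hf vM; exists m; split=> //; apply/(apt_relM _ vX vM'); by rewrite em.
Qed.

(** The midpoint in [relI] may lie outside the apartment; the retraction moves it inside. *)
Lemma apt_relI x y : vx Sg x -> vx Sg y -> drelI x y <-> frelI (f x) (f y).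
Proof.
move=> vX vY; split.
  have [rho h] := retr_ex hS hf special0.
  by move/(retr_relI h); rewrite !h.1.
case=> [/(apt_inj hf vX vY)|[q r1 r2]]; [by left|right].
have [m [vM em r]] := relM_lift vX r1; exists m => //.
by apply/apt_relM => //; rewrite em.
Qed.

Lemma apt_rel1 x y : vx Sg x -> vx Sg y -> drel1 x y <-> frel1 (f x) (f y).
Proof.
move=> vX vY; split.
  have [rho h] := retr_ex hS hf special0.
  by move/(retr_rel1 h); rewrite !h.1.
case=> [/(apt_inj hf vX vY)|[s1 s2 r a]]; [by left|right; split].
- exact/(apt_sp hS hf).
- exact/(apt_sp hS hf).
- exact/apt_relI.
case: a => [/(apt_adj hS hf vX vY)|[q e1 e2]]; [by left|right].
have [_ vM] := elen_vx fCS e1; have [m vM' em] := apt_inv hS hf vM.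
by exists m; apply/(apt_elen hS hf) => //; rewrite em.
Qed.

End ChartRelations.

(** In scaled coordinates the vertices of one translation class differ by even vectors, hence the
    factor 2. *)
Definition dbl_frame Sg f z (phi : vec -> T) :=
  [/\ apts Sg, chart Sg f, special z & forall a, vx Sg (phi a) /\ f (phi a) = emb (z + a *+ 2)].

Definition bc_frame (phi : vec -> T) := exists Sg f z, dbl_frame Sg f z phi.

Lemma special_dbl z a : special z -> special (z + a *+ 2).
Proof. by move=> sz; apply: special_add => // i; rewrite mulr2n ffunE; lia. Qed.

Lemma emb_vx z : special z -> vx CS (emb z).
Proof. exact: (special_vx hflat). Qed.

Lemma frame_at Sg f z : apts Sg -> chart Sg f -> special z -> exists phi, dbl_frame Sg f z phi.
Proof.
move=> hS hf sz; have /choice [phi h] : forall a, exists x, vx Sg x /\ f x = emb (z + a *+ 2).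
  by move=> a; have [x vX e] := apt_inv hS hf (emb_vx (special_dbl a sz)); exists x.
by exists phi.
Qed.

Lemma frame_pt Sg f z phi x w : dbl_frame Sg f z phi -> vx Sg x -> f x = emb w ->
  (forall i, (2 %| w i - z i)%Z) -> phi [ffun i => ((w i - z i) %/ 2)%Z] = x.
Proof.
move=> [hS hf sz h] vX e ev; have [v1 e1] := h [ffun i => ((w i - z i) %/ 2)%Z].
apply: (apt_inj hf) => //; rewrite e1 e; congr emb.
by apply/ffunP => i; rewrite mulr2n !ffunE; have := ev i; gen_ffun; lia.
Qed.

Lemma frame_sp phi a : bc_frame phi -> dsp (phi a).
Proof.
move=> [Sg [f [z [hS hf sz h]]]]; have [v1 e1] := h a; apply/(apt_sp hS hf v1); rewrite e1.
apply/(flat_sp hflat fCS n0 nB); last exact: special_dbl.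
by apply: bc_special_vertex; apply: special_dbl.
Qed.

Lemma sp_coords Sg f x : apts Sg -> chart Sg f -> vx Sg x -> dsp x -> exists2 z, special z & f x = emb z.
Proof. by move=> hS hf vX /(apt_sp hS hf vX) /(flat_spE hflat fCS n0 nB). Qed.

Lemma framedP x : framed bc_frame x <-> dsp x.
Proof.
split=> [[phi [a [F <-]]]|sx]; first exact: frame_sp.
have [Sg hS SX] := apt_cover hD (all_vx x); have [f hf] := apt_chart hD hS.
have [z sz e] := sp_coords hS hf SX sx; have [phi F] := frame_at hS hf sz.
exists phi, [ffun i => ((z i - z i) %/ 2)%Z]; split; first by exists Sg, f, z.
by apply: (frame_pt F) => // i; rewrite subrr.
Qed.

Lemma walk_frelI k z q : walk frelI k (emb z) q ->
  exists w, q = emb w /\ (forall i, (2 %| w i - z i)%Z /\ `|w i - z i| <= k%:Z + k%:Z).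
Proof.
elim: k z => [|k IH] z.
  by move=> w; rewrite -(walk0P w); exists z; split=> // i; rewrite subrr.
move=> w; case: (walkSP w) => [<-|[p h {}w]]; first by exists z; split=> // i; rewrite subrr; split; lia.
have [u eu] : exists u, p = emb u.
  by case: h => [<-|[m _ /(relM_emb hflat fCS) [u [m' [-> _]]]]]; [exists z|exists u].
rewrite eu in h w; have [w' [e hw]] := IH _ w; exists w'; split=> // i; have := hw i.
case/(flat_relI hflat fCS n0 nB): h => [<-|[_ _ /(_ i)]]; first by gen_ffun; lia.
by gen_ffun; lia.
Qed.

Lemma drelI_sp x y : drelI x y -> dsp x -> dsp y.
Proof. by case=> [->|[m _ []]]. Qed.

Lemma drelI_refl x : drelI x x. Proof. by left. Qed.

Lemma same_coords Sg f x y z k : apts Sg -> chart Sg f -> vx Sg x -> vx Sg y -> f x = emb z ->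
  walk drelI k x y ->
  exists w, f y = emb w /\ (forall i, (2 %| w i - z i)%Z /\ `|w i - z i| <= k%:Z + k%:Z).
Proof.
move=> hS hf vX vY e w; have [rho h] := retr_ex hS hf special0.
have := walk_map (f := rho) (fun x y => retr_relI h) w; rewrite !h.1 // e; exact: walk_frelI.
Qed.

Lemma frame_dbl_rel1 Sg f z phi a i s : dbl_frame Sg f z phi -> `|s| = 1 ->
  drel1 (phi a) (phi (a + unitvec i s)).
Proof.
move=> [hS hf sz h] hs; have [v1 e1] := h a; have [v2 e2] := h (a + unitvec i s).
apply/(apt_rel1 hS hf v1 v2); rewrite e1 e2; apply/(flat_rel1 hflat fCS n0 nB); right.
split; [exact: special_dbl|exact: special_dbl|exists i, (s + s); split; first by lia].
by apply/ffunP => j; rewrite !mulr2n !ffunE; case: eqP; gen_ffun; lia.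
Qed.

Lemma frame_dbl_relI Sg f z phi a b : dbl_frame Sg f z phi -> (forall i, `|b i| <= 1) ->
  drelI (phi a) (phi (a + b)).
Proof.
move=> [hS hf sz h] hb; have [v1 e1] := h a; have [v2 e2] := h (a + b).
apply/(apt_relI hS hf v1 v2); rewrite e1 e2; apply/(flat_relI hflat fCS n0 nB); right.
split; [exact: special_dbl|exact: special_dbl|move=> i].
by rewrite !mulr2n !ffunE; have := hb i; gen_ffun; lia.
Qed.

Lemma frame_walk1 Sg f z phi a b k : dbl_frame Sg f z phi -> bc_le1 k (b - a) -> walk drel1 k (phi a) (phi b).
Proof.
move=> F; elim: k a => [|k IH] a h.
  by move/bc_le1_0: h => /subr0_eq ->; apply: walk_refl.
case: (pselect (exists i, (b - a) i <> 0)) => [[i bi]|hn]; last first.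
  suff -> : b = a by apply: walk_refl.
  apply/ffunP => i; apply: contrapT => e; apply: hn; exists i; rewrite !ffunE; move: e; gen_ffun; lia.
pose s := if 0 < (b - a) i then 1 else -1 : int.
have hs : `|s| = 1 by rewrite /s; case: ifP.
apply: walk_cons (frame_dbl_rel1 a i F hs) (IH _ _); move: h; rewrite /bc_le1.
have := @sum_drop n (fun j => `|(b - (a + unitvec i s)) j|) (fun j => `|(b - a) j|) i.
move=> H h; have {}H : \sum_j `|(b - (a + unitvec i s)) j| + 1 = \sum_j `|(b - a) j|.
  apply: H => [j /negPf ji|]; first by rewrite !ffunE ji addr0.
  by move: bi; rewrite /s !ffunE eqxx; case: ifP; gen_ffun; lia.
by move: H h; move: (\sum_j _) (\sum_j _) => p q; lia.
Qed.

Lemma frame_walkI Sg f z phi a b k : dbl_frame Sg f z phi -> bc_leI k (b - a) -> walk drelI k (phi a) (phi b).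
Proof.
move=> F; elim: k a => [|k IH] a h.
  suff -> : b = a by apply: walk_refl.
  by apply/ffunP => i; have := h i; rewrite !ffunE; gen_ffun; lia.
pose d : vec := [ffun i => if 0 < (b - a) i then 1 else if (b - a) i < 0 then -1 else 0].
apply: walk_cons (@frame_dbl_relI _ _ _ _ a d F _) (IH _ _) => i.
  by rewrite ffunE; case: ifP => _ //; case: ifP.
by have := h i; rewrite !ffunE; case: ifP; [|case: ifP]; gen_ffun; lia.
Qed.

Lemma frame_common Sg f x z : apts Sg -> chart Sg f -> vx Sg x -> dsp x -> f x = emb z ->
  exists phi, [/\ dbl_frame Sg f z phi, phi 0 = x
    & forall y, vx Sg y -> same drelI x y -> exists b, phi b = y].
Proof.
move=> hS hf vX sx e; have [z' sz' e'] := sp_coords hS hf vX sx.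
have ez : z = z' by apply: (emb_inj hflat); rewrite -e -e'.
have [phi F] := frame_at hS hf (eq_ind_r special sz' ez); exists phi; split=> //.
  have := frame_pt F vX e (fun i => ltac:(by rewrite subrr)); congr (phi _ = _).
  by apply/ffunP => i; rewrite !ffunE subrr.
move=> y vY [k w]; have [w' [ew hw]] := same_coords hS hf vX vY e w.
by exists [ffun i => ((w' i - z i) %/ 2)%Z]; apply: (frame_pt F vY ew) => i; case: (hw i).
Qed.

Lemma frame_both x y : dsp x -> same drelI x y -> exists phi a b, [/\ bc_frame phi, phi a = x & phi b = y].
Proof.
move=> sx s; have [Sg [hS Sx Sy]] := apt_common hD (all_vx x) (all_vx y).
have [f hf] := apt_chart hD hS; have [z sz e] := sp_coords hS hf Sx sx.
have [phi [F e0 /(_ y Sy s) [b eb]]] := frame_common hS hf Sx sx e.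
by exists phi, 0, b; split=> //; exists Sg, f, z.
Qed.

Lemma frame_retraction phi a : bc_frame phi -> exists rho : T -> vec,
  [/\ forall x y, same drelI (phi a) x -> drel1 x y -> bc_le1 1 (rho y - rho x),
      forall x y, same drelI (phi a) x -> drelI x y -> bc_leI 1 (rho y - rho x),
      forall b, bc_le1 0 (rho (phi b) - b)
    & forall v k, same drelI (phi a) v -> bc_le1 k (rho v - a) -> walk drel1 k (phi a) v].
Proof.
move=> [Sg [f [z [hS hf sz h]]]]; have [va ea] := h a.
have sz' := special_dbl a sz; have [rho hr] := retr_ex hS hf sz'.
have [coord hc] : exists coord : F -> vec, forall w, coord (emb w) = w.
  have /choice [coord hc] : forall p, exists w, (exists w', p = emb w') -> p = emb w.
    move=> p; case: (pselect (exists w', p = emb w')) => [[w' ->]|hn]; first by exists w'.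
    by exists 0.
  by exists coord => w; apply: (emb_inj hflat); apply/esym/hc; exists w.
pose r (v : T) : vec := [ffun i => ((coord (rho v) i - z i) %/ 2)%Z].
have rw x : same drelI (phi a) x -> exists w, rho x = emb w /\ forall i, (2 %| w i - z i)%Z.
  case=> k w; have := walk_map (f := rho) (fun x y => retr_relI hr) w.
  rewrite hr.1 // ea => /walk_frelI [w' [-> hw]]; exists w'; split=> // i.
  by have := (hw i).1; rewrite mulr2n !ffunE; gen_ffun; lia.
have sI x y : same drelI (phi a) x -> drelI x y -> same drelI (phi a) y.
  by case=> k w rxy; exists k.+1; apply: walk_rcons w rxy.
exists r; split.
- move=> x y sx rxy; have sy := sI _ _ sx (rel1_relI rxy).
  have [u [eu hu]] := rw _ sx; have [w [ew hw]] := rw _ sy.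
  have := retr_rel1 hr rxy; rewrite eu ew => /(flat_rel1 hflat fCS n0 nB) H.
  have [->|[i [s [hs es]]]] : r y - r x = 0 \/ exists i s, `|s| = 1 /\ r y - r x = unitvec i s.
    rewrite /r eu ew !hc; case: H => [->|[_ _ [i [t [ht ->]]]]]; first by left; rewrite subrr.
    have [s hs] : exists s : int, (t = 2 /\ s = 1) \/ (t = -2 /\ s = -1).
      have [->|->] : t = 2 \/ t = -2 by lia.
        by exists 1; left.
      by exists (-1); right.
    right; exists i, s; split; first by lia.
    by apply/ffunP => j; rewrite !ffunE; have := hu j; case: (j == i); gen_ffun; lia.
  + by rewrite /bc_le1 big1 // => i _; rewrite ffunE.
  rewrite es /bc_le1 (bigD1 i) //= big1 ?addr0; first by rewrite ffunE eqxx hs.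
  by move=> j /negPf ji; rewrite ffunE ji.
- move=> x y sx rxy i; have sy := sI _ _ sx rxy.
  have [u [eu hu]] := rw _ sx; have [w [ew hw]] := rw _ sy.
  have := retr_relI hr rxy; rewrite eu ew => /(flat_relI hflat fCS n0 nB) H.
  rewrite /r eu ew !ffunE !hc; have := hu i; have := hw i.
  case: H => [->|[_ _ /(_ i)]]; gen_ffun; lia.
- move=> b; have [vb eb] := h b; suff -> : r (phi b) - b = 0 by rewrite /bc_le1 big1 // => i _; rewrite ffunE.
  rewrite /r hr.1 // eb hc; apply/ffunP => i; rewrite mulr2n !ffunE; gen_ffun; lia.
- move=> v k sv; have [w [ew hw]] := rw _ sv.
  (* [S'] contains [v] and the centre, and the retraction restricts to a chart of it; a walk in this
     apartment realizes the gauge. *)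
  have [S' [f' [p [hS' hf' S'v vp' [vp ep ep' e']]]]] := hr.2 _ (all_vx v).
  have pa : p = phi a by apply: (apt_inj hf) => //; rewrite ep ea.
  subst p; have [phi' F] := frame_at hS' hf' sz.
  have e1 := frame_pt F S'v; rewrite -e' // in e1; have {}e1 := e1 _ ew hw.
  have e2 := frame_pt F vp' ep' (fun i => ltac:(rewrite mulr2n !ffunE; gen_ffun; lia)).
  move=> hk; rewrite -e2 -e1; apply: (frame_walk1 F); move: hk; rewrite /bc_le1.
  congr (_ <= _); apply: eq_bigr => i _; congr (`|_|); rewrite mulr2n !ffunE ew hc; gen_ffun; lia.
Qed.

Lemma bc_frame_axioms : frame_axioms (modelBC n) drel1 drelI bc_frame.
Proof.
split.
- exact: drelI_refl.
- exact: relI_sym.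
- by move=> x y; apply: rel1_relI.
- by move=> phi a b k [Sg [f [z F]]]; apply: (frame_walk1 F).
- by move=> phi a b k [Sg [f [z F]]]; apply: (frame_walkI F).
- by move=> x y /framedP; apply: frame_both.
- exact: frame_retraction.
Qed.

(** In type C adjacent special vertices differ by a full sign vector and lie in different classes,
    of which an apartment has two; in type B it has a single class. *)
Definition bc_Nb x y := x = y \/ [/\ dsp x, dsp y & dadj x y].

Lemma bc_Nb_sym x y : bc_Nb x y -> bc_Nb y x.
Proof. by case=> [->|[sx sy a]]; [left|right; split=> //; apply: adj_sym]. Qed.

Lemma bc_Nb_sp x y : dsp x -> bc_Nb x y -> dsp y.
Proof. by move=> sx [<-|[]]. Qed.

Lemma special_adj z w : special z -> special w -> fadj (emb z) (emb w) ->
  (~~ isB /\ forall i, `|w i - z i| = 1) \/ (isB /\ exists i t, `|t| = 2 /\ w - z = unitvec i t).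
Proof.
move=> [s1 s2] [s1' s2'] /(fadj_edge hflat fCS) [e _ _ ne].
case: e => [[d _]|[B ev [i di dj]]]; last first.
  right; split=> //; exists i, (w i - z i); split=> //; apply/ffunP => j.
  by rewrite !ffunE; case: (eqVneq j i) => [->//|/dj ->]; rewrite subrr.
left; case: (boolP isB) => B.
  case: ne; apply/ffunP => i; have := d i; have := s2 B i; have := s2' B i; gen_ffun; lia.
split=> // i; apply: contrapT => hi; apply: ne; apply/ffunP => j.
have := s1 i j; have := s1' i j; have := d i; have := d j; move: hi; gen_ffun; lia.
Qed.

Lemma adj_translate z w q : special z -> special w -> special q -> fadj (emb z) (emb w) ->
  fadj (emb q) (emb (q + (w - z))).
Proof.
move=> sz sw sq /(special_adj sz sw) [[B d]|[B [i [t [ht ->]]]]].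
  apply: (star_pair0 hflat fCS n0 nB) => // [i||B']; last by rewrite B' in B.
    by rewrite !ffunE d.
  by exists (Ordinal n0) => e; have := d (Ordinal n0); move: e; rewrite !ffunE => ->.
split; first exact: (bc_double hflat).
by move/(emb_inj hflat)/ffunP/(_ i); rewrite !ffunE eqxx; gen_ffun; lia.
Qed.

Lemma apt_special_adj Sg f x y z w : apts Sg -> chart Sg f -> vx Sg x -> vx Sg y -> special z -> special w ->
  f x = emb z -> f y = emb w -> fadj (emb z) (emb w) -> bc_Nb x y.
Proof.
move=> hS hf vX vY sz sw ex ey a; right; split.
- by apply/(apt_sp hS hf vX); rewrite ex; apply/(flat_sp hflat fCS n0 nB) => //; apply: bc_special_vertex.
- by apply/(apt_sp hS hf vY); rewrite ey; apply/(flat_sp hflat fCS n0 nB) => //; apply: bc_special_vertex.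
- by apply/(apt_adj hS hf vX vY); rewrite ex ey.
Qed.

Lemma same_even Sg f phi x y z w : dbl_frame Sg f z phi -> vx Sg x -> vx Sg y -> special z ->
  f x = emb z -> f y = emb w -> (forall i, (2 %| w i - z i)%Z) -> same drelI x y.
Proof.
move=> F vX vY sz ex ey ev; have e1 := frame_pt F vX ex (fun i => ltac:(by rewrite subrr)).
rewrite -e1 -(frame_pt F vY ey ev); apply: (frame_same bc_frame_axioms).
by exists Sg, f, z.
Qed.

(** Some apartment contains both the edge from [x] to [x'] and [z]; translating the edge to [z]
    gives [z']. *)
Lemma bc_Nb_lift (x z x' : T) : dsp x -> same drelI x z -> bc_Nb x x' -> exists2 z', same drelI x' z' & bc_Nb z z'.
Proof.
move=> sx [k wxz] [<-|[_ sx' a]]; first by exists z; [exists k|left].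
have [Sg [hS Sxx Sz]] := apt_common hD a.1 (all_vx z); have [f hf] := apt_chart hD hS.
have fS := apt_faces hD hS.
have vX : vx Sg x by apply: faces_vx fS Sxx _; rewrite !inE eqxx.
have vX' : vx Sg x' by apply: faces_vx fS Sxx _; rewrite !inE eqxx orbT.
have [p sp' ep] := sp_coords hS hf vX sx; have [p' sp'' ep'] := sp_coords hS hf vX' sx'.
have [q [eq hq]] := same_coords hS hf vX Sz ep wxz.
have a' : fadj (emb p) (emb p') by rewrite -ep -ep'; apply/(apt_adj hS hf).
have sq : special q.
  have -> : q = p + (q - p) by rewrite addrC subrK.
  by apply: special_add => // i; rewrite !ffunE; case: (hq i).
have sq' : special (q + (p' - p)).
  have -> : q + (p' - p) = p' + (q - p) by rewrite addrCA.
  by apply: special_add => // i; rewrite !ffunE; case: (hq i).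
have [z' vz' ez'] := apt_inv hS hf (emb_vx sq'); exists z'.
  have [phi F] := frame_at hS hf sp''.
  apply: (same_even F vX' vz' sp'' ep' ez') => i; have := (hq i).1; rewrite !ffunE; gen_ffun; lia.
exact: (apt_special_adj hS hf Sz vz' sq sq' eq ez' (adj_translate sp' sp'' sq a')).
Qed.

Lemma bc_Nb_bound Sg f z rho (b : nat) x y (p : vec) : retr Sg f z rho -> walk bc_Nb b x y -> rho x = emb p ->
  exists q, rho y = emb q /\ forall i, `|q i - p i| <= b%:Z + b%:Z.
Proof.
move=> h w; elim: w p => [k x0 p ->|k x0 y0 z0 hN _ IH p ep].
  by exists p; split=> // i; rewrite subrr; lia.
have [p1 [e1 d1]] : exists p1, rho y0 = emb p1 /\ forall i, `|p1 i - p i| <= 2.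
  case: hN => [<-|[_ _ /(retr_adj h) [a _]]]; first by exists p; split=> // i; rewrite subrr.
  have vY : vx CS (rho y0) by apply: faces_vx fCS a.1 _; rewrite !inE eqxx orbT.
  have [p1 e1] := vx_emb hflat vY; exists p1; split=> // i.
  move: a; rewrite ep e1 => /(fadj_edge hflat fCS) [e _ _ _].
  case: e => [[d _]|[_ _ [i0 d dj]]]; first by have := d i; gen_ffun; lia.
  by case: (eqVneq i i0) => [->|/dj ->]; rewrite ?d // subrr.
have [q [eq dq]] := IH _ e1; exists q; split=> // i.
by have := dq i; have := d1 i; gen_ffun; lia.
Qed.

(** An [Nb]-step changes each scaled coordinate by at most 2, so [b] steps change each of the [n]
    coordinates of the frame by at most [b]. *)
Lemma bc_Nb_proper (b : nat) : exists C, forall x z : T, dsp x -> same drelI x z -> walk bc_Nb b x z -> walk drel1 C x z.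
Proof.
exists (n * b)%N => x z sx s w; have [Sg [hS Sx Sz]] := apt_common hD (all_vx x) (all_vx z).
have [f hf] := apt_chart hD hS; have [p sp' ep] := sp_coords hS hf Sx sx.
have [phi [F e0 /(_ z Sz s) [a ea]]] := frame_common hS hf Sx sx ep.
have [rho h] := retr_ex hS hf special0.
have ep' : rho x = emb p by rewrite h.1.
have [q [eq dq]] := bc_Nb_bound h w ep'.
have ez : f z = emb (p + a *+ 2) by case: F => _ _ _ /(_ a) [_]; rewrite ea.
have eqa : q = p + a *+ 2 by apply: (emb_inj hflat); rewrite -eq -ez h.1.
rewrite -e0 -ea; apply: (frame_walk1 F); rewrite subr0 /bc_le1 PoszM -sum_const.
by apply: sum_le => i; have := dq i; rewrite eqa mulr2n !ffunE; gen_ffun; lia.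
Qed.

(** In an apartment containing [x], [x'] and [z'], translating [z'] by the edge from [x'] to [x]
    gives [z2], without any change of the gauges; and [z2] is two [Nb]-steps away from [z]. *)
Lemma bc_Nb_dist : exists C, forall x x' z z' : T, dsp x -> bc_Nb x x' -> bc_Nb z z' ->
    same drelI x z -> same drelI x' z' ->
    (forall k, walk drelI k x' z' -> walk drelI (k + C) x z) /\
    (forall k, walk drel1 k x' z' -> walk drel1 (k + C) x z).
Proof.
have [C hC] := bc_Nb_proper 2; exists C => x x' z z' sx nx nz s s'.
have sx' := bc_Nb_sp sx nx.
suff [z2 [s2 n2 hI h1]] : exists z2 : T, [/\ same drelI x z2, bc_Nb z2 z',
    forall k, walk drelI k x' z' -> walk drelI k x z2 & forall k, walk drel1 k x' z' -> walk drel1 k x z2].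
  have wz : walk drel1 C z2 z.
    apply: hC; [|exact: (same_trans (same_sym bc_frame_axioms s2) s)|].
      by case: s2 => k w2; apply: (walk_closed _ sx w2) => u v su /drelI_sp; apply.
    by apply: walk_cons n2 (walk1 (bc_Nb_sym nz)).
  by split=> k => [/hI w|/h1 w]; apply: walk_cat w _ => //; apply: sub_walk wz => u v; apply: rel1_relI.
case: nx => [e|[_ _ a]]; first by subst x'; exists z'; split=> //; left.
have [Sg [hS Sxx Sz]] := apt_common hD a.1 (all_vx z'); have [f hf] := apt_chart hD hS.
have fS := apt_faces hD hS.
have vX : vx Sg x by apply: faces_vx fS Sxx _; rewrite !inE eqxx.
have vX' : vx Sg x' by apply: faces_vx fS Sxx _; rewrite !inE eqxx orbT.
have [p sp' ep] := sp_coords hS hf vX sx; have [p' sp'' ep'] := sp_coords hS hf vX' sx'.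
have [phi [F e0 /(_ z' Sz s') [b eb]]] := frame_common hS hf vX' sx' ep'.
have [phi2 [F2 f0 _]] := frame_common hS hf vX sx ep.
have a' : fadj (emb p) (emb p') by rewrite -ep -ep'; apply/(apt_adj hS hf).
have sb := special_dbl b sp'; have sb' := special_dbl b sp''.
have [_ _ _ /(_ b) [_ ezb]] := F; rewrite eb in ezb.
have [_ _ _ /(_ b) [v2 e2]] := F2.
exists (phi2 b); split.
- by rewrite -f0; apply: (frame_same bc_frame_axioms); exists Sg, f, p.
- apply: (apt_special_adj hS hf v2 Sz sb sb' e2 ezb).
  have := adj_translate sp' sp'' sb a'; congr (fadj _ (emb _)).
  by rewrite addrC addrA subrK.
- move=> k; rewrite -e0 -f0 -eb => w; apply: (frame_walkI F2).
  by apply: (frame_distI bc_frame_axioms) w; exists Sg, f, p'.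
- move=> k; rewrite -e0 -f0 -eb => w; apply: (frame_walk1 F2).
  by apply: (frame_dist bc_frame_axioms) w; exists Sg, f, p'.
Qed.

Lemma bc_same_meet x y : dsp x -> dsp y -> exists2 y', same drelI x y' & bc_Nb y' y.
Proof.
move=> sx sy; have [Sg [hS Sx Sy]] := apt_common hD (all_vx x) (all_vx y).
have [f hf] := apt_chart hD hS; have [p sp' ep] := sp_coords hS hf Sx sx.
have [q sq eq] := sp_coords hS hf Sy sy; have [phi F] := frame_at hS hf sp'.
case: (boolP (2 %| q (Ordinal n0) - p (Ordinal n0))%Z) => e0.
  exists y; last by left.
  apply: (same_even F Sx Sy sp' ep eq) => i.
  by have := sq.1 i (Ordinal n0); have := sp'.1 i (Ordinal n0); move: e0; gen_ffun; lia.
have B : ~~ isB by apply/negP => B; move: e0; have := sq.2 B (Ordinal n0); have := sp'.2 B (Ordinal n0); gen_ffun; lia.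
pose one : vec := [ffun=> 1].
have s1 : special (q + one).
  split=> [i j|B']; last by rewrite B' in B.
  by have := sq.1 i j; rewrite !ffunE; gen_ffun; lia.
have [y' vY' ey'] := apt_inv hS hf (emb_vx s1); exists y'.
  apply: (same_even F Sx vY' sp' ep ey') => i; rewrite !ffunE.
  by have := sq.1 i (Ordinal n0); have := sp'.1 i (Ordinal n0); move: e0; gen_ffun; lia.
apply: bc_Nb_sym; apply: (apt_special_adj hS hf Sy vY' sq s1 eq ey').
apply: (star_pair0 hflat fCS n0 nB) => // [i||B']; [by rewrite ffunE|by exists (Ordinal n0); rewrite ffunE|].
by rewrite B' in B.
Qed.

Lemma frame_Nb phi a i s : bc_frame phi -> `|s| = 1 -> exists b : nat, walk bc_Nb b (phi a) (phi (a + unitvec i s)).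
Proof.
move=> [Sg [f [z [hS hf sz h]]]] hs.
have [v1 e1] := h a; have [v2 e2] := h (a + unitvec i s).
have s1 := special_dbl a sz; have s2 := special_dbl (a + unitvec i s) sz.
case: (boolP isB) => B.
  exists 1%N; apply: walk1; apply: (apt_special_adj hS hf v1 v2 s1 s2 e1 e2).
  have -> : z + (a + unitvec i s) *+ 2 = z + a *+ 2 + unitvec i (s + s).
    by apply/ffunP => j; rewrite !mulr2n !ffunE; case: (j == i); gen_ffun; lia.
  split; first by apply: (bc_double hflat) => //; lia.
  by move/(emb_inj hflat)/ffunP/(_ i); rewrite !mulr2n !ffunE eqxx; gen_ffun; lia.
(* In type C twice a signed unit vector is the sum of two full sign vectors that cancel outside
   [i]. *)
pose b : vec := [ffun j => if j == i then s else 1].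
have b1 j : `|b j| = 1 by rewrite ffunE; case: (j == i).
have s3 : special (z + a *+ 2 + b).
  split=> [j k|B']; last by rewrite B' in B.
  by have := s1.1 j k; have := b1 j; have := b1 k; rewrite !mulr2n !ffunE; gen_ffun; lia.
have [m vm em] := apt_inv hS hf (emb_vx s3); exists 2%N.
have full w (d : vec) : special w -> (forall j, `|d j| = 1) -> fadj (emb w) (emb (w + d)).
  move=> sw hd; apply: (star_pair0 hflat fCS n0 nB) => // [j||B']; [by rewrite hd| |by rewrite B' in B].
  by exists (Ordinal n0) => e; have := hd (Ordinal n0); rewrite e.
apply: (@walk_cons _ _ _ _ m); first exact: (apt_special_adj hS hf v1 vm s1 s3 e1 em (full _ _ s1 b1)).
apply: walk1; apply: (apt_special_adj hS hf vm v2 s3 s2 em e2).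
have -> : z + (a + unitvec i s) *+ 2 = z + a *+ 2 + b + (unitvec i (s + s) - b).
  by apply/ffunP => j; rewrite !mulr2n !ffunE; case: (j == i); gen_ffun; lia.
by apply: full => // j; rewrite !ffunE; case: (j == i); gen_ffun; lia.
Qed.

Lemma bc_Nb_connected x y : dsp x -> dsp y -> exists b : nat, walk bc_Nb b x y.
Proof.
move=> sx sy; have [y' s n1] := bc_same_meet sx sy.
have [phi [a [b [F <- eb]]]] := frame_both sx s.
suff [k w] : exists k, walk bc_Nb k (phi a) y' by exists k.+1; apply: walk_rcons w n1.
rewrite -eb -(subrK a b) addrC; move: (b - a); apply: unitvec_ind => [|v i t ht [k w]].
  by exists 0%N; rewrite addr0; apply: walk_refl.
by have [l w'] := frame_Nb (a + v) i F ht; exists (k + l)%N; rewrite addrA; apply: walk_cat w w'.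
Qed.

(* [m] is the midpoint of [v] and [w]; in type B it is not a vertex if [w - v] has a single non-zero coordinate, but then
   [v] and [w] are adjacent. The last clause forces the step from [v] to [m] to lead away from [u]. *)
Definition bc_Wit (u v w : T) := simplex D [fset v; w]%fset \/
  exists m k, [/\ drelM k v m, drelM k w m & forall s, drelM k s m -> drelI u s -> s = v].

Lemma frame_three Sg f (x v w : T) : apts Sg -> chart Sg f -> vx Sg x -> vx Sg v -> vx Sg w -> dsp x ->
  same drelI x v -> same drelI x w ->
  exists phi a b d, [/\ bc_frame phi, phi a = x, phi b = v & phi d = w].
Proof.
move=> hS hf vX vV vW sx sv sw; have [p sp' ep] := sp_coords hS hf vX sx.
have [phi [F e0 h]] := frame_common hS hf vX sx ep.
have [b eb] := h v vV sv; have [d ed'] := h w vW sw.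
by exists phi, 0, b, d; split=> //; exists Sg, f, p.
Qed.

(** Each vertex lies together with the centre in an apartment on which the retraction is a chart,
    and charts are injective. *)
Lemma retr_center Sg f z rho v x : chart Sg f -> retr Sg f z rho -> vx Sg v -> f v = emb z ->
  rho x = emb z -> x = v.
Proof.
move=> hf [_ h] vV ev; have [S' [f' [p [hS' hf' S'x S'p [vp ep ep' e]]]]] := h _ (all_vx x).
have -> : v = p by apply: (apt_inj hf) => //; rewrite ev ep.
by rewrite e // => ex; apply: (apt_inj hf') => //; rewrite ex ep'.
Qed.

(* An alternative position of [v] relative to [m], in a direction in which [m] is not farthest from the origin,
   would contradict the uniqueness of [v]. *)
Lemma wit_outward Sg f p phi (k l : nat) b m mm : dbl_frame Sg f p phi -> bc_leI k.+1 b ->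
  vx Sg m -> f m = emb mm -> drelM l (phi b) m ->
  (forall x, drelM l x m -> drelI (phi (bc_clip k b)) x -> x = phi b) ->
  forall i, mm i = p i + b i + b i \/ `|b i| = k.+1%:Z /\
    (mm i = p i + b i + b i + 1 /\ 0 < b i \/ mm i = p i + b i + b i - 1 /\ b i < 0).
Proof.
move=> F hb vM em r uniq i; have [hS hf sp' h] := F.
have [vv ev] := h b; have [vu eu] := h (bc_clip k b).
move: (r) => /(apt_relM hS hf l vv vM); rewrite ev em => /(flat_relM hflat fCS n0 nB) [sv vm d ne sq].
pose e := mm i - (p i + b i + b i).
case: (eqVneq e 0) => [e0|e0]; [left|right]; first by move: e0; rewrite /e; gen_ffun; lia.
have he : `|e| = 1 by have := d i; move: e0; rewrite /e mulr2n !ffunE; gen_ffun; lia.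
apply: contrapT => hn.
pose y : vec := p + b *+ 2 + unitvec i (e + e).
have sy : special y by apply: special_add => // j; rewrite ffunE; case: (j == i); lia.
have [x vX ex] := apt_inv hS hf (emb_vx sy).
have yj j : j != i -> y j = p j + b j + b j by move=> /negPf ji; rewrite /y mulr2n !ffunE ji addr0 addrA.
have bE j : (p + b *+ 2) j = p j + b j + b j by rewrite mulr2n !ffunE addrA.
have yi : y i = p i + b i + b i + e + e by rewrite /y mulr2n !ffunE eqxx; gen_ffun; lia.
have : x = phi b.
  apply: uniq.
    apply/(apt_relM hS hf l vX vM); rewrite ex em; apply/(flat_relM hflat fCS n0 nB); split=> // [j||].
    - have := d j; case: (eqVneq j i) => [->|ji]; rewrite ?yi ?(yj _ ji) mulr2n !ffunE; last by rewrite addrA.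
      by move: he; rewrite /e; gen_ffun; lia.
    - by move/ffunP/(_ i); rewrite yi; move: he; rewrite /e; gen_ffun; lia.
    - have sE (u u' : vec) j : (u - u') j = u j - u' j by rewrite !ffunE.
      rewrite -sq; apply: eq_bigr => j _; rewrite !sE bE.
      case: (eqVneq j i) => [->|ji]; last by rewrite (yj _ ji).
      by rewrite yi !expr2; move: e0; rewrite /e; have := d i; rewrite bE; gen_ffun; nia.
  apply/(apt_relI hS hf vu vX); rewrite eu ex; apply/(flat_relI hflat fCS n0 nB); right.
  split=> //; first exact: special_dbl.
  move=> j; have := hb j; case: (eqVneq j i) => [->|ji].
    rewrite yi mulr2n !ffunE /trunc; move: hn he; rewrite /e.
    by case: ifP; [|case: ifP]; gen_ffun; lia.
  rewrite (yj _ ji) mulr2n !ffunE /trunc; case: ifP; [|case: ifP]; gen_ffun; lia.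
move=> exv; move: ex; rewrite exv ev => /(emb_inj hflat) /ffunP /(_ i).
by rewrite yi mulr2n !ffunE; move: he; gen_ffun; lia.
Qed.

(** As [v] and [w] need not be adjacent, apartments are available only for the origin and either
    half of the step. Retracting [v] onto the one with the second half yields a vertex that
    uniqueness identifies with [v]. *)
Lemma bc_extend phi a b k (w : T) : bc_frame phi -> bc_leI k.+1 (b - a) -> drelI (phi b) w ->
  bc_Wit (phi (a + bc_clip k (b - a))) (phi b) w ->
  exists phi' a' b' d', [/\ bc_frame phi', phi' a' = phi a, phi' b' = phi b & phi' d' = w].
Proof.
move=> F hb rvw wit; set x := phi a; set v := phi b.
have sx : dsp x := frame_sp a F.
have sxv : same drelI x v := frame_same bc_frame_axioms a b F.
have sxw : same drelI x w by case: sxv => l hl; exists l.+1; apply: walk_rcons hl rvw.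
have wxv : walk drelI k.+1 x v by apply: (frameI bc_frame_axioms).
case: wit => [Dvw|[m [l [r1 r2 uniq]]]].
  have [Sg [hS Svw Sx]] := apt_common hD Dvw (all_vx x); have [f hf] := apt_chart hD hS.
  have fS := apt_faces hD hS; apply: (frame_three hS hf Sx) => //; apply: faces_vx fS Svw _; rewrite !inE eqxx ?orbT //.
have [_ [[Dvm _] _] _] := r1; have [_ [[Dwm _] _] _] := r2.
have [S1 [h1 Svm S1x]] := apt_common hD Dvm (all_vx x); have [f1 hf1] := apt_chart hD h1.
have fS1 := apt_faces hD h1.
have v1 : vx S1 v by apply: faces_vx fS1 Svm _; rewrite !inE eqxx.
have m1 : vx S1 m by apply: faces_vx fS1 Svm _; rewrite !inE eqxx orbT.
have [p sp' ep] := sp_coords h1 hf1 S1x sx.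
have [phi1 [F1 e0 /(_ v v1 sxv) [b1 eb1]]] := frame_common h1 hf1 S1x sx ep.
have B1 : bc_frame phi1 by exists S1, f1, p.
have hb1 : bc_leI k.+1 b1.
  by rewrite -[b1]subr0; apply: (frame_distI bc_frame_axioms B1); rewrite e0 eb1.
have eu : phi (a + bc_clip k (b - a)) = phi1 (bc_clip k b1).
  have := @clip_indep _ _ _ _ _ _ bc_frame_axioms phi a b phi1 0 b1 k F B1.
  by rewrite e0 eb1 subr0 add0r; apply.
rewrite eu in uniq.
have [mm emm] : exists mm, f1 m = emb mm by apply: (vx_emb hflat); apply: (si_vx hf1).
have [_ _ _ /(_ b1) [_ ev1]] := F1; rewrite eb1 in ev1.
have out i : mm i = p i + b1 i + b1 i \/ `|b1 i| = k.+1%:Z /\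
    (mm i = p i + b1 i + b1 i + 1 /\ 0 < b1 i \/ mm i = p i + b1 i + b1 i - 1 /\ b1 i < 0).
  by apply: (@wit_outward S1 f1 p phi1 k l b1 m mm) => //; rewrite eb1.
have sv1 := special_dbl b1 sp'.
(* Since [m] lies outwards from [v], uniqueness of [v] among the neighbours of the previous point
   becomes uniqueness in the whole ball about [x]. *)
have {}uniq y : drelM l y m -> walk drelI k.+1 x y -> y = v.
  have [rho hr] := retr_ex h1 hf1 sv1 => ry wy.
  apply: (retr_center hf1 hr v1 ev1).
  have := walk_map (f := rho) (fun x y => retr_relI hr) wy; rewrite hr.1 // ep => /walk_frelI [q [eq hq]].
  have := retr_relM hr ry; rewrite (hr.1 m) // emm eq => /(flat_relM hflat fCS n0 nB) [_ _ d _ _].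
  congr emb; apply/ffunP => i; rewrite mulr2n !ffunE; have := hq i; have := d i; have := out i; have := hb1 i.
  by gen_ffun; lia.
have [S2 [h2 Swm S2x]] := apt_common hD Dwm (all_vx x); have [f2 hf2] := apt_chart hD h2.
have fS2 := apt_faces hD h2.
have w2 : vx S2 w by apply: faces_vx fS2 Swm _; rewrite !inE eqxx.
have m2 : vx S2 m by apply: faces_vx fS2 Swm _; rewrite !inE eqxx orbT.
have [q sq eq] := sp_coords h2 hf2 S2x sx.
have [rho hr] := retr_ex h2 hf2 special0.
have := walk_map (f := rho) (fun x y => retr_relI hr) wxv; rewrite hr.1 // eq => /walk_frelI [y [ey hy]].
have sy : special y.
  have -> : y = q + (y - q) by rewrite addrC subrK.
  by apply: special_add => // i; rewrite !ffunE; case: (hy i).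
have [y' vy' ey'] := apt_inv h2 hf2 (emb_vx sy).
have ry' : drelM l y' m.
  by apply/(apt_relM h2 hf2 l vy' m2); have := retr_relM hr r1; rewrite ey' ey (hr.1 m).
have [phi2 F2] := frame_at h2 hf2 sq.
have yv : y' = v.
  apply: uniq => //; rewrite -(frame_pt F2 S2x eq (fun i => ltac:(by rewrite subrr))).
  have -> := esym (frame_pt F2 vy' ey' (fun i => (hy i).1)).
  apply: (frame_walkI F2) => i; have := hy i; rewrite !ffunE; gen_ffun; lia.
rewrite yv in vy'; exact: (frame_three h2 hf2 S2x).
Qed.

Lemma bc_frame_turn phi a b j : bc_frame phi -> ~ bc_leI j.+1 (b - a) ->
  bc_Wit (phi (a + bc_clip j (b - a))) (phi (a + bc_clip j.+1 (b - a))) (phi (a + bc_clip j.+2 (b - a))).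
Proof.
move=> [Sg [f [z [hS hf sz h]]]]; move: (b - a) => y hy.
pose A k := a + bc_clip k y; rewrite -/(A j) -/(A j.+1) -/(A j.+2).
pose e := A j.+2 - A j.+1; pose Z := z + A j.+1 *+ 2.
have he i : e i = 0 \/ `|e i| = 1 /\ A j.+1 i - A j i = e i.
  by rewrite !ffunE /trunc; repeat case: ifP; gen_ffun; lia.
have hd i : `|A j.+1 i - A j i| <= 1 by rewrite !ffunE /trunc; repeat case: ifP; gen_ffun; lia.
have [i0 ei0] : exists i, e i <> 0.
  apply: contrapT => hn; apply: hy => i; have : e i = 0 by apply: contrapT => ei; apply: hn; exists i.
  by rewrite !ffunE /trunc; repeat case: ifP; gen_ffun; lia.
have [vu eu] := h (A j); have [vv ev] := h (A j.+1); have [vw ew] := h (A j.+2).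
have ewZ : f (phi (A j.+2)) = emb (Z + e *+ 2).
  by rewrite ew; congr emb; rewrite /Z /e; apply/ffunP => i; rewrite !mulr2n !ffunE; gen_ffun; lia.
have sZ : special Z by apply: special_dbl.
(* In type B a step in a single coordinate is an edge; in all other cases the midpoint [Z + e] is a
   vertex. *)
case: (pselect (isB /\ forall i, i != i0 -> e i = 0)) => [[B h1]|h1].
  left; suff : dadj (phi (A j.+1)) (phi (A j.+2)) by case.
  apply/(apt_adj hS hf vv vw); rewrite ev ewZ.
  have -> : e *+ 2 = unitvec i0 (e i0 + e i0).
    by apply/ffunP => i; rewrite mulr2n !ffunE; case: (eqVneq i i0) => [->//|/h1]; rewrite !ffunE => ->.
  have e2 : `|e i0 + e i0| = 2 by have := he i0; move: ei0; gen_ffun; lia.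
  split; first exact: (bc_double hflat).
  by move/(emb_inj hflat)/ffunP/(_ i0); rewrite !ffunE eqxx -/(e i0); move: e2; rewrite !ffunE; gen_ffun; lia.
have vm : vertex (Z + e).
  move=> B i odd; have [i1 i10 ei1] : exists2 i, i != i0 & e i <> 0.
    apply: contrapT => hn; apply: h1; split=> // i2 hi2; apply: contrapT => e2; apply: hn; by exists i2.
  have O l : e l <> 0 -> ~~ (2 %| (Z + e) l)%Z.
    by have := sZ.2 B l; have := he l; rewrite [(Z + e) l]ffunE; gen_ffun; lia.
  case: (eqVneq i i0) => [->|ii]; first by exists i1; rewrite ?O.
  by exists i0; rewrite 1?eq_sym // O.
pose l := absz (sqn e).
have el : sqn e = l%:Z by rewrite /l gez0_abs // sumr_ge0 // => i _; rewrite sqr_ge0.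
have vM : vx CS (emb (Z + e)) by apply/(CS_vertexP hflat); exists (Z + e).
have [m vm' em] := apt_inv hS hf vM; right; exists m, l; split.
- apply/(apt_relM hS hf l vv vm'); rewrite ev em; apply/(flat_relM hflat fCS n0 nB); split=> // [i||].
  + by rewrite [(Z + e) i]ffunE; have := he i; gen_ffun; lia.
  + by move/ffunP/(_ i0); rewrite [(Z + e) i0]ffunE; move: ei0; gen_ffun; lia.
  + by rewrite -el; apply: eq_bigr => i _; rewrite opprD addNKr ffunE sqrrN.
- apply/(apt_relM hS hf l vw vm'); rewrite ewZ em; apply/(flat_relM hflat fCS n0 nB); split=> // [|i||].
  + exact: special_dbl.
  + by rewrite mulr2n [(Z + e) i]ffunE [(Z + _) i]ffunE [(e + e) i]ffunE; have := he i; gen_ffun; lia.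
  + by move/ffunP/(_ i0); rewrite mulr2n [(Z + e) i0]ffunE [(Z + _) i0]ffunE [(e + e) i0]ffunE; move: ei0; gen_ffun; lia.
  + by rewrite -el; congr sqn; rewrite mulr2n opprD addrACA subrr add0r addrK.
(* Where [e i] is not zero, [m] lies beyond [v] as seen from the previous point; elsewhere [m] and
   [v] agree and parity decides. Either way the coordinates of the image of [x] are those of [v]. *)
move=> x rx ru; have [rho hr] := retr_ex hS hf sZ.
apply: (retr_center hf hr vv ev).
have := retr_relM hr rx; rewrite (hr.1 m) // em => rM.
have [q [_ [eq _]]] := relM_emb hflat fCS rM; rewrite eq in rM *.
have [_ _ d _ _] := iffLR (flat_relM hflat fCS n0 nB _ _ _) rM.
have := retr_relI hr ru; rewrite hr.1 // eu eq => /(flat_relI hflat fCS n0 nB) H.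
congr emb; apply/ffunP => i; have := d i; have := he i; have := hd i.
have {}H : `|q i - (z i + A j i + A j i)| = 0 \/ `|q i - (z i + A j i + A j i)| = 2.
  case: H => [<-|[_ _ /(_ i)]]; first by left; rewrite mulr2n !ffunE addrA subrr.
  by rewrite mulr2n [(z + _) i]ffunE [(A j + _) i]ffunE addrA.
move: H; rewrite [(Z + e) i]ffunE /Z mulr2n ![(_ + (A _ + _)) i]ffunE ![(A _ + A _) i]ffunE.
by gen_ffun; lia.
Qed.

Lemma bc_combing_axioms : combing_axioms (modelBC n) drel1 drelI bc_Nb bc_frame bc_Wit.
Proof.
split.
- exact: bc_Nb_sym.
- by move=> x y /framedP sx /(bc_Nb_sp sx) /framedP.
- by move=> x z x' /framedP; apply: bc_Nb_lift.
- have [C hC] := bc_Nb_dist; exists C => x x' z z' /framedP; exact: hC.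
- move=> b; have [C hC] := bc_Nb_proper b; exists C => x z /framedP; exact: hC.
- by move=> phi a b k w F hk _; apply: bc_extend.
- by move=> phi a b j F; apply: bc_frame_turn.
Qed.

End Building.

(** * The flats of type A *)

Section FlatA.
Variables (R : realType) (n : nat) (c : R).
Hypothesis hc : 0 < c.
Local Notation vec := {ffun 'I_n.+1 -> int}.
Local Notation Phi := (Defs.roots R TypeA n c).
Local Notation CS := (coxeter_simplex Phi).
Implicit Types (z w a b : vec) (X Y : 'I_n.+1 -> R).

Definition mean X := (\sum_i X i) / n.+1%:R.
(** Subtracting the mean projects onto the hyperplane of sum zero, so coordinates count only modulo
    constants; after division by [c] the roots measure differences of coordinates. *)
Definition a_pt X : 'rV[R]_n.+1 := \row_i ((X i - mean X) / c).
Definition a_emb z := a_pt (fun i => (z i)%:~R).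

Let c0 : c != 0. Proof. by rewrite gt_eqF. Qed.

Lemma dot_pt X (i j : 'I_n.+1) : dot (a_pt X) (c *: (eps R n.+1 i - eps R n.+1 j)) = X i - X j.
Proof.
rewrite dotZr dotDr dotNr !dot_eps !mxE -mulrBl mulrC divfK //.
by rewrite opprD opprK addrACA addNr addr0.
Qed.

Lemma a_pt_eq X Y : a_pt X = a_pt Y <-> forall i j, X i - X j = Y i - Y j.
Proof.
split=> [e i j|h]; first by rewrite -!dot_pt e.
have e i : X i = Y i + (X ord0 - Y ord0) by have := h i ord0; lra.
apply/rowP => i; rewrite !mxE; congr (_ / _).
have -> : mean X = mean Y + (X ord0 - Y ord0); last by rewrite e; lra.
rewrite /mean (eq_bigr _ (fun i _ => e i)) big_split /= mulrDl; congr (_ + _).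
by rewrite sumr_const card_ord -[(X ord0 - Y ord0) *+ _]mulr_natr mulfK // pnatr_eq0.
Qed.

Lemma a_root (i j : 'I_n.+1) : i != j -> Phi (c *: (eps R n.+1 i - eps R n.+1 j)).
Proof. by move=> ij; exists (eps R n.+1 i - eps R n.+1 j) => //; exists i, j. Qed.

Lemma a_span v : span_of Phi v <-> \sum_i v 0 i = 0.
Proof.
split=> [[s [a [hs ->]]]|h].
  under eq_bigr do rewrite summxE.
  rewrite exchange_big /= big_seq big1 // => r /hs [r' [i [j [_ ->]]] ->].
  under eq_bigr do rewrite !mxE.
  rewrite -!mulr_sumr sumrB (bigD1 i) //= eqxx big1 => [|l /negPf li]; last by rewrite [(_ == _)%N]li.
  rewrite (bigD1 j) //= eqxx big1 => [|l /negPf lj]; last by rewrite [(_ == _)%N]lj.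
  by rewrite !addr0 subrr !mulr0.
suff -> : v = \sum_(i < n) (v 0 (lift ord0 i) / c) *: (c *: (eps R n.+1 (lift ord0 i) - eps R n.+1 (ord0 : 'I_n.+1))).
  by apply: (@span_sum R n.+1 _ Phi) => i; apply: (@a_root (lift ord0 i) ord0).
have -> : \sum_(i < n) (v 0 (lift ord0 i) / c) *: (c *: (eps R n.+1 (lift ord0 i) - eps R n.+1 (ord0 : 'I_n.+1))) =
    \sum_(i < n.+1) v 0 i *: (eps R n.+1 i - eps R n.+1 (ord0 : 'I_n.+1)).
  rewrite [RHS]big_ord_recl subrr scaler0 add0r; apply: eq_bigr => i _.
  by rewrite scalerA divfK.
under eq_bigr do rewrite scalerBr.
by rewrite sumrB -scaler_suml h scale0r subr0 {1}[v]row_eps_sum.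
Qed.

Lemma a_pt_span X : span_of Phi (a_pt X).
Proof.
apply/a_span; under eq_bigr do rewrite mxE.
rewrite -mulr_suml sumrB sumr_const card_ord -[_ *+ _]mulr_natr /mean divfK ?pnatr_eq0 //.
by rewrite subrr mul0r.
Qed.

Lemma a_pt_surj v : span_of Phi v -> v = a_pt (fun i => c * v 0 i).
Proof.
move/a_span => h; apply/rowP => i; rewrite mxE /mean -mulr_sumr h mulr0 mul0r subr0.
by rewrite mulrC mulKf.
Qed.

Definition a_cell X Y := forall i j (k : int), side (X i - X j) (Y i - Y j) k%:~R.

Lemma a_closed_cellP X Y : closed_cell Phi (a_pt X) (a_pt Y) <-> a_cell X Y.
Proof.
split=> [[_ h] i j k|h].
  case: (eqVneq i j) => [->|ij]; first by rewrite !subrr.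
  by have := h _ k (a_root ij); rewrite !dot_pt.
split; first exact: a_pt_span.
by move=> r k [r' [i [j [ij ->]]] ->]; rewrite !dot_pt; apply: h.
Qed.

Lemma a_emb_eq z w : a_emb z = a_emb w <-> forall i j, z i - w i = z j - w j.
Proof.
rewrite a_pt_eq; split=> h i j; last by rewrite -!intrB; congr (_%:~R); have := h i j; lia.
by have := h i j; rewrite -!intrB => /eqP; rewrite eqr_int => /eqP; lia.
Qed.

Lemma a_cell_int z Y : a_cell (fun i => (z i)%:~R) Y -> a_pt Y = a_emb z.
Proof.
move=> h; apply/a_pt_eq => i j; have [h1 h2] := h i j (z i - z j).
by apply/le_anti; rewrite -intrB h1 ?h2 // -intrB.
Qed.

Lemma a_vertexP p : coxeter_vertex Phi p <-> exists z, p = a_emb z.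
Proof.
split=> [[sp' hp]|[z ->]]; last first.
  split; first exact: a_pt_span.
  move=> y hy; have sy := hy.1; rewrite (a_pt_surj sy); apply: a_cell_int.
  by move: hy; rewrite {1}(a_pt_surj sy) => /a_closed_cellP.
(* Rounding all coordinates down respects every wall [x_i - x_j = k], so the rounded point lies in
   the closed cell. *)
exists [ffun i => Num.floor (c * p 0 i)]; apply/esym/hp.
rewrite {1}(a_pt_surj sp'); apply/a_closed_cellP => i j k; rewrite !ffunE /side -!intrB !ler_int.
have f1 := floor_le (c * p 0 i); have f2 := floorD1_gt (c * p 0 i).
have f3 := floor_le (c * p 0 j); have f4 := floorD1_gt (c * p 0 j).
set fi := Num.floor _ in f1 f2 *; set fj := Num.floor _ in f3 f4 *; move: f1 f2 f3 f4.
rewrite !intrD => f1 f2 f3 f4; split=> h.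
  suff : fi < k + fj + 1 by lia.
  by rewrite -(ltr_int R) !intrD; lra.
suff : k + fj < fi + 1 by lia.
by rewrite -(ltr_int R) !intrD; lra.
Qed.

Definition a_star (l : 'I_n.+1 -> nat) a := forall i j, (l j <= l i)%N -> 0 <= a i - a j <= 1.

Lemma a_level_simplex z (l : 'I_n.+1 -> nat) q s : (forall i, (l i < q)%N) ->
  (forall p, p \in s <-> exists2 a, a_star l a & p = a_emb (z + a)) -> CS s.
Proof.
move=> lq hs; have q0 : 0 < q%:R :> R by rewrite ltr0n; apply: leq_ltn_trans (lq ord0).
pose t i : R := (l i)%:R / q%:R.
exists (a_pt (fun i => (z i)%:~R + t i)); first exact: a_pt_span.
have t01 i : 0 <= t i < 1.
  by rewrite divr_ge0 ?ler0n //= ltr_pdivrMr // mul1r ltr_nat.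
have tl i j : (l j <= l i)%N -> t j <= t i by move=> h; rewrite ler_pM2r ?invr_gt0 // ler_nat.
have tl' i j : (l j < l i)%N -> t j < t i by move=> h; rewrite ltr_pM2r ?invr_gt0 // ltr_nat.
move=> p; rewrite hs; split=> [[a ha ->]|[/a_vertexP [w ->] /a_closed_cellP h]].
  split; first by apply/a_vertexP; exists (z + a).
  apply/a_closed_cellP => i j k; rewrite !ffunE /side.
  have eqc : (l i < l j)%N \/ l i = l j \/ (l j < l i)%N by lia.
  have /andP[ti0 ti1] := t01 i; have /andP[tj0 tj1] := t01 j.
  rewrite -intrB !ler_int; split=> hk.
    case: eqc => [lt|[e|lt]].
    - have /andP[h1 h2] := ha j i (ltnW lt); have := tl' _ _ lt => tlt.
      suff : z i - z j < k + 1 by move: h1; clear; gen_ffun; lia.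
      by rewrite -(ltr_int R) intrB intrD; lra.
    - have := ha i j; have := ha j i; rewrite e leqnn => /(_ isT) h1 /(_ isT) h2.
      have et : t i = t j by rewrite /t e.
      suff : z i - z j < k + 1 by move: h1 h2; clear; gen_ffun; lia.
      by rewrite -(ltr_int R) intrB intrD; lra.
    - have /andP[h1 h2] := ha i j (ltnW lt); have := tl' _ _ lt => tlt.
      suff : z i - z j < k by move: h2; clear; gen_ffun; lia.
      by rewrite -(ltr_int R) intrB; lra.
  case: eqc => [lt|[e|lt]].
  - have /andP[h1 h2] := ha j i (ltnW lt); have := tl' _ _ lt => tlt.
    suff : k < z i - z j by move: h2; clear; gen_ffun; lia.
    by rewrite -(ltr_int R) intrB; lra.
  - have := ha i j; have := ha j i; rewrite e leqnn => /(_ isT) h1 /(_ isT) h2.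
    have et : t i = t j by rewrite /t e.
    suff : k < z i - z j + 1 by move: h1 h2; clear; gen_ffun; lia.
    by rewrite -(ltr_int R) intrD intrB; lra.
  - have /andP[h1 h2] := ha i j (ltnW lt); have := tl' _ _ lt => tlt.
    suff : k < z i - z j + 1 by move: h1; clear; gen_ffun; lia.
    by rewrite -(ltr_int R) intrD intrB; lra.
exists (w - z); last by rewrite addrC subrK.
move=> i j lij; have := tl _ _ lij => tij; have [h1 h2] := h i j (z i - z j).
have [h3 h4] := h i j (z i - z j + 1).
have /andP[ti0 ti1] := t01 i; have /andP[tj0 tj1] := t01 j; rewrite !ffunE.
have a1 : z i - z j <= w i - w j by rewrite -(ler_int R) [X in _ <= X]intrB; apply: h2; rewrite intrB; lra.
have a2 : w i - w j <= z i - z j + 1.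
  by rewrite -(ler_int R) [X in X <= _]intrB; apply: h3; rewrite intrD intrB; lra.
by move: a1 a2; clear; gen_ffun; lia.
Qed.

Lemma a_edge_bound s z w : CS s -> a_emb z \in s -> a_emb w \in s -> a_leI 1 (w - z).
Proof.
move=> [x sx hs] /hs [_ hz] /hs [_ hw]; rewrite (a_pt_surj sx) in hz hw.
move/a_closed_cellP: hz => hz; move/a_closed_cellP: hw => hw i j.
pose S := c * x 0 i - c * x 0 j; pose k := Num.floor S.
have f1 : k%:~R <= S := floor_le S.
have f2 : S <= (k + 1)%:~R := ltW (floorD1_gt S).
have := (hz i j k).2 f1; have := (hz i j (k + 1)).1 f2; have := (hw i j k).2 f1; have := (hw i j (k + 1)).1 f2.
rewrite -!intrB !ler_int !ffunE; gen_ffun; lia.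
Qed.

Lemma a_pair z w : a_leI 1 (w - z) -> CS [fset a_emb z; a_emb w]%fset.
Proof.
have [d ew] : exists d, w = z + d by exists (w - z); rewrite addrC subrK.
move=> h; have {}h : a_leI 1 d by move: h; rewrite ew addrC addKr.
have [[i0 e0] h0] := vminP d.
(* Modulo constants [d] is the indicator function of the coordinates above its minimum. *)
apply: (@a_level_simplex z (fun i => d i != vmin d) 2) => [i|p]; first by case: (_ != _).
have dv i : d i = vmin d + (d i != vmin d)%:Z.
  have := h i i0; have := h0 i; rewrite e0; case: eqP => /= e; move: e; gen_ffun; lia.
split.
  rewrite !inE => /orP[/eqP ->|/eqP ->].
    by exists 0; rewrite ?addr0 // => i j _; rewrite !ffunE subrr.
  exists d; last by rewrite -ew.
  by move=> i j; have := dv i; have := dv j; case: (d i != vmin d); case: (d j != vmin d) => //=; gen_ffun; lia.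
case=> a ha ->; case: (pselect (forall i j, a i = a j)) => [hc'|hn].
  by rewrite !inE; apply/orP; left; apply/eqP/a_emb_eq => i j; rewrite !ffunE (hc' i j); gen_ffun; lia.
have [i1 [j1 lt]] : exists i j, a j < a i.
  apply: contrapT => hn'; apply: hn => i j; apply/le_anti/andP; split; rewrite leNgt; apply/negP => lt; apply: hn'; [by exists i, j|by exists j, i].
have E i j : (d i != vmin d) = (d j != vmin d) -> a i = a j.
  by move=> e; have := ha i j; have := ha j i; rewrite e leqnn => /(_ isT) + /(_ isT); gen_ffun; lia.
have lj : (d j1 != vmin d) = false.
  apply/negbTE/negP => hj; have := ha j1 i1; rewrite hj; case: (d i1 != vmin d) => /(_ isT); move: lt; gen_ffun; lia.
have li : (d i1 != vmin d) = true.
  by apply: contrapT => /negP hi; move: lt; rewrite (E i1 j1) ?ltxx // lj; apply/negbTE.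
have a1 : a i1 = a j1 + 1.
  by have := ha i1 j1; rewrite li lj => /(_ isT); move: lt; gen_ffun; lia.
rewrite !inE; apply/orP; right; apply/eqP; rewrite ew; apply/a_emb_eq.
suff H i : (z + a) i - (z + d) i = a j1 - vmin d by move=> i j; rewrite !H.
rewrite !ffunE (dv i); case E': (d i != vmin d).
  have -> : a i = a i1 by apply: E; rewrite li.
  by rewrite a1 /=; gen_ffun; lia.
have -> : a i = a j1 by apply: E; rewrite lj.
by rewrite /=; gen_ffun; lia.
Qed.

(** [l] ranks the coordinates; the alcoves containing [z], with [z] as first vertex, are given by
    the rankings. *)
Definition a_chain z (l : 'I_n.+1 -> 'I_n.+1) (k : nat) : vec := z + [ffun i => ((l i < k)%N : nat)%:Z].

Lemma a_chain_last (l : 'I_n.+1 -> 'I_n.+1) : injective l -> forall k : 'I_n.+1, exists i, l i = k.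
Proof. by move=> il k; exists (invF il k); apply: f_invF. Qed.

Lemma a_chain_inj z l (k k' : 'I_n.+1) : injective l -> a_emb (a_chain z l k) = a_emb (a_chain z l k') -> k = k'.
Proof.
move=> il; wlog kk : k k' / (k <= k')%N.
  by move=> H; case: (leqP k k') => [|/ltnW] h; [apply: H|move/esym/(H _ _ h)].
move/a_emb_eq => e; apply/val_inj/eqP; rewrite /= eqn_leq kk leqNgt; apply/negP => lt.
have [i li] := a_chain_last il k; have [j lj] := a_chain_last il ord_max.
have := e i j; rewrite !ffunE li lj /= ltnn lt.
have -> : (n < k)%N = false by apply/negbTE; rewrite -leqNgt -ltnS.
have -> : (n < k')%N = false by apply/negbTE; rewrite -leqNgt -ltnS.
by gen_ffun; lia.
Qed.

Lemma a_chamber z l : injective l ->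
  CS [fset a_emb (a_chain z l (nat_of_ord k)) | k in 'I_n.+1]%fset /\
  #|` [fset a_emb (a_chain z l (nat_of_ord k)) | k in 'I_n.+1]%fset| = n.+1.
Proof.
move=> il; split; last first.
  rewrite card_imfset /=; first by rewrite -cardE card_ord.
  by move=> k k'; apply: a_chain_inj.
apply: (@a_level_simplex z (fun i => n - l i)%N n.+1) => [i|p]; first by rewrite ltnS leq_subr.
have ln i : (l i <= n)%N by rewrite -ltnS ltn_ord.
split.
  case/imfsetP => k /= _ ->; exists [ffun i => ((l i < k)%N : nat)%:Z] => // i j.
  by have := ln i; have := ln j; rewrite !ffunE; case: ltnP; case: ltnP; lia.
case=> a ha ->; have [i0 l0] := a_chain_last il ord0.
have top i : 0 <= a i0 - a i <= 1 by apply: ha; rewrite l0 /= subn0 leq_subr.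
case: (pselect (exists i, a i <> a i0)) => [[i1 h1]|hn]; last first.
  apply/imfsetP; exists ord0 => //=; apply/a_emb_eq.
  have E i : a i = a i0 by apply: contrapT => h; apply: hn; exists i.
  by move=> i j; rewrite !ffunE !ltn0 (E i) (E j); gen_ffun; lia.
have P1 : (a i1 != a i0) by apply/eqP.
(* [l i2] is the rank at which [a] drops from its maximum; by [a_star] it drops only by one and
   stays there. *)
case: (@arg_minnP _ i1 (fun i => a i != a i0) (fun i => nat_of_ord (l i)) P1) => i2 /eqP h2 min2.
apply/imfsetP; exists (l i2) => //=; apply/a_emb_eq.
suff E i : a i - (((l i < l i2)%N : nat)%:Z : int) = a i0 - 1.
  by move=> i j; have := E i; have := E j; rewrite !ffunE; gen_ffun; lia.
case: (ltnP (l i) (l i2)) => h.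
  suff -> : a i = a i0 by [].
  by apply: contrapT => /eqP /min2; rewrite leqNgt h.
have := ha i2 i; rewrite leq_sub2l // => /(_ isT); have := top i; have := top i2; move: h2; rewrite /=; gen_ffun; lia.
Qed.

End FlatA.

Ltac gen_vec := gen_ffun; repeat match goal with |- context [vmin ?v] =>
  let x := fresh "x" in set x := vmin v; move: x => ? end.

Lemma multiple_between (s q m : int) : 0 < s < m -> s = q * m -> False.
Proof.
case/andP => s0 sm e; have h : q <= 0 \/ 1 <= q by lia.
by case: h => h; nia.
Qed.

(** * Types of vertices as proper colourings *)

Section Colourings.
Variable n : nat.
Local Notation vec := {ffun 'I_n.+1 -> int}.
Implicit Types (z w p v : vec) (i j : 'I_n.+1).

(** The type of a vertex. It is well defined modulo constants, which change the sum by multiples of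
    [n.+1]. *)
Definition csum z : 'I_n.+1 := inord (absz ((\sum_i z i) %% n.+1%:Z)%Z).

Lemma csumP z w : csum z = csum w <-> (n.+1 %| \sum_i z i - \sum_i w i)%Z.
Proof.
have N0 : n.+1%:Z != 0 by [].
have b v : (0 <= (\sum_i v i) %% n.+1%:Z < n.+1%:Z)%Z by rewrite modz_ge0 // ltz_pmod.
rewrite -eqz_mod_dvd; split=> [e|/eqP e]; last by rewrite /csum e.
have /andP[z0 z1] := b z; have /andP[w0 w1] := b w.
have := congr1 (@nat_of_ord _) e; rewrite !inordK; try by rewrite -ltz_nat gez0_abs.
by move=> h; apply/eqP; rewrite -(gez0_abs z0) -(gez0_abs w0) h.
Qed.

Definition nadj z w := a_leI 1 (w - z) /\ ~ (forall i j, (w - z) i = (w - z) j).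

Lemma sum_excess v : \sum_i v i = \sum_i (v i - vmin v) + n.+1%:Z * vmin v.
Proof. by rewrite sumrB sum_const subrK. Qed.

Lemma excess_bound v : a_leI 1 v -> ~ (forall i j, v i = v j) -> 0 < \sum_i (v i - vmin v) < n.+1%:Z.
Proof.
move=> h hn; have [[i0 e0] h0] := vminP v.
have [i1 lt] : exists i, vmin v < v i.
  apply: contrapT => hn'; apply: hn => i j.
  have E k : v k = vmin v by apply/le_anti; rewrite h0 andbT leNgt; apply/negP => lt; apply: hn'; exists k.
  by rewrite !E.
have ge0 i : 0 <= v i - vmin v by rewrite subr_ge0.
have := @le_sum_term n.+1 (fun i => v i - vmin v) i1 ge0.
have := @sum_le n.+1 (fun i => v i - vmin v) (fun i => if i == i0 then 0 else 1).
have := @sum_drop n.+1 (fun i => if i == i0 then 0 else 1) (fun=> 1) i0.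
rewrite sum_const eqxx add0r mulr1 => A B.
have {}A : \sum_i (if i == i0 then 0 else 1) + 1 = n.+1%:Z :> int.
  by apply: A => // i /negPf ->.
have {}B : \sum_i (v i - vmin v) <= \sum_i (if i == i0 then 0 else 1).
  apply: B => i; case: eqP => [->|_]; first by rewrite e0 subrr.
  by have := h i i0; rewrite e0.
by move: A B lt => /=; move: (\sum_i _) (\sum_i (v i - _)) => x y; gen_vec; lia.
Qed.

(** Modulo [n.+1] the sum of [w - z] equals its excess over the minimum, which lies strictly between
    0 and [n.+1]. *)
Lemma nadj_csum z w : nadj z w -> csum z <> csum w.
Proof.
move=> [h hn] /esym /csumP; have := excess_bound h hn.
have -> : \sum_i w i - \sum_i z i = \sum_i (w - z) i by rewrite -sumrB; apply: eq_bigr => i _; rewrite !ffunE.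
rewrite sum_excess; move: (\sum_i _) => s; rewrite rpredDr ?dvdz_mulr //.
by move=> s0n /dvdzP [q]; apply: multiple_between s0n.
Qed.

(** The excess of [w - z] is congruent to 1 modulo [n.+1], hence equal to 1, so [w - z] is a unit
    vector modulo constants. *)
Lemma nadj_step z w i : nadj z w -> csum w = csum (z + unitvec i 1) ->
  exists j, forall a b, w a - (z + unitvec j 1) a = w b - (z + unitvec j 1) b.
Proof.
move=> [h hn] /csumP; have eb := excess_bound h hn.
have -> : \sum_i w i - \sum_j (z + unitvec i 1) j = \sum_j (w - z) j - 1.
  have -> : \sum_j (z + unitvec i 1) j = \sum_j z j + 1.
    have := @sum_drop n.+1 (fun j => z j) (fun j => (z + unitvec i 1) j) i.
    by move=> H; apply/esym/H => [j /negPf ji|]; rewrite !ffunE ?ji ?addr0 ?eqxx.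
  rewrite opprD addrA -sumrB; congr (_ - 1); apply: eq_bigr => j _; by rewrite !ffunE.
rewrite sum_excess addrAC rpredDr ?dvdz_mulr // => /dvdzP [q e].
set v := w - z in h hn eb e *; have e1 : \sum_i (v i - vmin v) = 1.
  move: eb e; move: (\sum_i _) => s sb e; apply: contrapT => s1.
  by apply: (multiple_between _ e); lia.
have [_ h0] := vminP v.
have ge0 a : 0 <= v a - vmin v by rewrite subr_ge0.
have [j lt] : exists j, vmin v < v j.
  apply: contrapT => hn'; apply: hn => a b.
  have E k : v k = vmin v by apply/le_anti; rewrite h0 andbT leNgt; apply/negP => lt; apply: hn'; exists k.
  by rewrite !E.
have E a : v a - vmin v = if a == j then 1 else 0.
  have := @sum_le_eq n.+1 (fun a => if a == j then 1 else 0) (fun a => v a - vmin v).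
  rewrite e1 => H; apply/esym; apply: H a => [a|].
    by case: eqP => [->|_] //; move: lt; lia.
  by rewrite (bigD1 j) //= eqxx big1 // => a /negPf ->.
exists j; suff H a : w a - (z + unitvec j 1) a = vmin v by move=> a b; rewrite !H.
by have := E a; rewrite !ffunE; case: (a == j); gen_vec; lia.
Qed.

Lemma nadj_chain z l (k k' : 'I_n.+1) : injective l -> (k < k')%N -> nadj (a_chain z l k) (a_chain z l k').
Proof.
move=> il kk; split=> [i j|].
  rewrite !ffunE; case: (ltnP (l i) k) => h1; case: (ltnP (l i) k') => h2;
    case: (ltnP (l j) k) => h3; case: (ltnP (l j) k') => h4; gen_ffun; lia.
have [i li] := a_chain_last il k; have [j lj] := a_chain_last il ord_max.
move/(_ i j); rewrite !ffunE li lj /= ltnn kk.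
have -> : (n < k)%N = false by apply/negbTE; rewrite -leqNgt -ltnS.
have -> : (n < k')%N = false by apply/negbTE; rewrite -leqNgt -ltnS.
by gen_ffun; lia.
Qed.

Section Proper.
Variable kappa : vec -> 'I_n.+1.
Hypothesis proper : forall z w, nadj z w -> kappa z <> kappa w.
Hypothesis kappa_const : forall z w, (forall i j, z i - w i = z j - w j) -> kappa z = kappa w.

Lemma proper_chain z l : injective l -> injective (fun k : 'I_n.+1 => kappa (a_chain z l k)).
Proof.
move=> il k k' e; apply/val_inj/eqP; case: (ltngtP k k') => // lt; exfalso.
  exact: (proper (nadj_chain z il lt)).
exact: (proper (nadj_chain z il lt)).
Qed.

Lemma order_from i j : i != j -> exists2 l : 'I_n.+1 -> 'I_n.+1, injective l & l i = 0%N :> nat /\ l j = 1%N :> nat.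
Proof.
move=> ij; have n1 : (1 < n.+1)%N.
  have := leq_ltn_trans (leq0n i) (ltn_ord i); rewrite ltnS; case: (posnP n) => // n0.
  by move: ij; rewrite -val_eqE /=; have := ltn_ord i; have := ltn_ord j; lia.
pose o1 : 'I_n.+1 := Ordinal n1.
exists (fun x => tperm (tperm i ord0 j) o1 (tperm i ord0 x)).
  by move=> x y /perm_inj /perm_inj.
split; last by rewrite tpermL.
rewrite tpermL tpermD //.
apply/eqP => e; move/eqP: ij; apply.
by apply: (@perm_inj _ (tperm i ord0)); rewrite tpermL e.
Qed.

(* Exchanging the first two coordinates in the order [l] changes a single vertex of the chamber, so its colour is forced. *)
Lemma colour_swap p i j : kappa (p + unitvec i 1) = kappa (p + unitvec j 1).
Proof.
case: (eqVneq i j) => [->//|ij]; have [l il [li lj]] := order_from ij.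
pose l' x := l (tperm i j x); have il' : injective l' by move=> x y /il /perm_inj.
have n1 : (1 < n.+1)%N by rewrite -lj ltn_ord.
have one (q : 'I_n.+1 -> 'I_n.+1) x : injective q -> q x = 0%N :> nat -> a_chain p q 1 = p + unitvec x 1.
  move=> iq qx; congr (_ + _); apply/ffunP => y; rewrite !ffunE ltnS leqn0.
  case: (eqVneq y x) => [->|yx]; first by rewrite qx.
  by case: eqP => // qy; case/eqP: yx; apply/iq/val_inj; rewrite /= qx.
have li' : l' j = 0%N :> nat by rewrite /l' tpermR.
rewrite -(one l) // -(one l') //.
have same k : k <> 1%N -> a_chain p l' k = a_chain p l k.
  move=> k1; congr (_ + _); apply/ffunP => y; rewrite !ffunE /l'.
  case: tpermP => [->|->|//]; rewrite li lj; congr (Posz (nat_of_bool _)); lia.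
have [g gK Kg] := injF_bij (proper_chain (z := p) il).
have e : kappa (a_chain p l (g (kappa (a_chain p l' 1)))) = kappa (a_chain p l' 1) by exact: Kg.
move: e; set k := g _ => e; case: (eqVneq (nat_of_ord k) 1%N) => [k1|/eqP k1]; first by rewrite -e k1.
have := @proper_chain p l' il' k (Ordinal n1) _; rewrite /= (same _ k1) e => /(_ erefl) ek.
by case: k1; rewrite ek.
Qed.

(** A vector of sum zero is a sum of differences of unit vectors, and by [colour_swap] each of these
    leaves the colour unchanged. *)
Lemma colour_sum0 k v z : \sum_i `|v i| <= k%:Z -> \sum_i v i = 0 -> kappa (z + v) = kappa z.
Proof.
elim: k v z => [|k IH] v z hk h0.
  by rewrite (bc_le1_0 (v := v)) ?addr0.
case: (pselect (exists i, 0 < v i)) => [[i vi]|hn]; last first.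
  suff -> : v = 0 by rewrite addr0.
  have H := @sum_le_eq n.+1 (fun i => v i) (fun=> 0); apply/ffunP => i; rewrite ffunE; apply: H => [j|].
    by rewrite leNgt; apply/negP => lt; apply: hn; exists j.
  by rewrite h0 big1.
have [j vj] : exists j, v j < 0.
  apply: contrapT => hn; have := @le_sum_term n.+1 (fun i => v i) i; rewrite h0 => H.
  have {}H := H (fun j => ltac:(by rewrite leNgt; apply/negP => lt; apply: hn; exists j)).
  by move: vi; rewrite ltNge H.
have ij : i != j by apply/eqP => e; move: vi vj; rewrite e; lia.
pose v' : vec := v - unitvec i 1 + unitvec j 1.
have e1 : z + v = z + (v - unitvec i 1) + unitvec i 1 by vec_lia.
have e2 : z + v' = z + (v - unitvec i 1) + unitvec j 1 by rewrite /v'; vec_lia.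
rewrite e1 (colour_swap _ i j) -e2; apply: IH.
  have := @sum_drop n.+1 (fun x => `|(v - unitvec i 1) x|) (fun x => `|v x|) i.
  have := @sum_drop n.+1 (fun x => `|v' x|) (fun x => `|(v - unitvec i 1) x|) j.
  move=> A B; have {}A := A (fun x xj => ltac:(by rewrite !ffunE (negPf xj) addr0)).
  have {}B := B (fun x xi => ltac:(by rewrite !ffunE (negPf xi) subr0)).
  move: A; rewrite !ffunE eqxx (_ : (j == i) = false) ?subr0; last by rewrite eq_sym (negPf ij).
  move: B; rewrite !ffunE eqxx => B A.
  have {}A := A ltac:(by move: vj; gen_ffun; lia); have {}B := B ltac:(by move: vi; gen_ffun; lia).
  by move: A B hk; move: (\sum_i _) (\sum_i _) (\sum_i _) => x y w; lia.
have := @sum_drop n.+1 (fun x => (v - unitvec i 1) x) (fun x => v x) i.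
have := @sum_drop n.+1 (fun x => (v - unitvec i 1) x) (fun x => v' x) j.
move=> A B; have {}A := A (fun x xj => ltac:(by rewrite !ffunE (negPf xj) addr0)).
have {}B := B (fun x xi => ltac:(by rewrite !ffunE (negPf xi) subr0)).
have {}A := A ltac:(by rewrite !ffunE eqxx).
have {}B := B ltac:(by rewrite !ffunE eqxx; gen_ffun; lia).
by move: A B h0; move: (\sum_i _) (\sum_i _) (\sum_i _) => x y w; lia.
Qed.

Lemma colour_csum z w : csum z = csum w -> kappa z = kappa w.
Proof.
move/csumP/dvdzP => [d e]; pose z' : vec := z - [ffun=> d].
have -> : kappa z = kappa z' by apply: kappa_const => i j; rewrite !ffunE; gen_ffun; lia.
rewrite -(subrK w z') addrC; apply: (@colour_sum0 (absz (\sum_i `|(z' - w) i|))).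
  by rewrite gez0_abs // sumr_ge0.
under eq_bigr do rewrite !ffunE.
by rewrite !sumrB sum_const mulrC; move: e; move: (\sum_i z i) (\sum_i w i) (d * _) => x y t; lia.
Qed.

(** By [colour_csum] the colouring factors through [csum], so its values at one vertex of each type
    determine it. *)
Lemma colour_eq_csum (q : 'I_n.+1 -> vec) : injective (fun k => csum (q k)) ->
  (forall k, kappa (q k) = csum (q k)) -> forall w, kappa w = csum w.
Proof.
move=> iq h w; have [g gK Kg] := injF_bij iq.
have e : csum (q (g (csum w))) = csum w by exact: Kg.
by rewrite -[RHS]e -h; apply: colour_csum.
Qed.

End Proper.

Lemma csum_const z w : (forall i j, z i - w i = z j - w j) -> csum z = csum w.
Proof.
move=> h; apply/csumP; rewrite -sumrB (eq_bigr (fun=> z ord0 - w ord0)) => [|i _]; last exact: h.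
by rewrite sum_const dvdz_mulr.
Qed.

Lemma csum_chain z l : injective l -> injective (fun k : 'I_n.+1 => csum (a_chain z l k)).
Proof. by apply: proper_chain => z' w; apply: nadj_csum. Qed.

Lemma csum_unitvec z w i j : csum z = csum w -> csum (z + unitvec i 1) = csum (w + unitvec j 1).
Proof.
have E v x : \sum_y (v + unitvec x 1) y = \sum_y v y + 1.
  have := @sum_drop n.+1 (fun y => v y) (fun y => (v + unitvec x 1) y) x.
  by move=> H; apply/esym/H => [y /negPf yx|]; rewrite !ffunE ?yx ?addr0 ?eqxx.
by move/csumP => h; apply/csumP; rewrite !E opprD addrACA subrr addr0.
Qed.

Lemma nadj_unitvec z i : (0 < n)%N -> nadj z (z + unitvec i 1).
Proof.
move=> n0; rewrite /nadj; have -> : z + unitvec i 1 - z = unitvec i 1 by rewrite addrC addKr.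
split=> [a b|]; first by rewrite !ffunE; case: (a == i); case: (b == i).
have [j ji] : exists j, j != i.
  case: (eqVneq i ord0) => [->|i0]; last by exists ord0; rewrite eq_sym.
  by exists ord_max; rewrite -val_eqE /= -lt0n.
by move/(_ i j); rewrite !ffunE eqxx (negPf ji).
Qed.

End Colourings.

(** * Rigidity of chambers in type A *)

Section RigidA.
Variables (R : realType) (n : nat) (c : R).
Hypotheses (hc : 0 < c) (n0 : (0 < n)%N).
Local Notation vec := {ffun 'I_n.+1 -> int}.
Local Notation Phi := (Defs.roots R TypeA n c).
Local Notation CS := (coxeter_simplex Phi).
Local Notation ed := (@edist R n.+1).
Hypothesis fCS : faces CS.
Local Notation emb := (@a_emb R n c).
Local Notation fadj := (adj CS).
Implicit Types (z w : vec).

Lemma a_vxP p : vx CS p <-> exists z, p = emb z.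
Proof.
rewrite -(a_vertexP hc); split=> [[x sx hx]|vp].
  by have /hx [] : p \in [fset p]%fset by rewrite inE.
have [_ hp] := vp; have [sp' _] := vp.
exists p => // y; rewrite inE; split=> [/eqP ->|[_ /hp ->//]].
by split=> //; split=> // r k _; split.
Qed.

Lemma a_emb_vx z : vx CS (emb z). Proof. by apply/a_vxP; exists z. Qed.

Definition a_coord (p : 'rV[R]_n.+1) : vec := xget 0 [set z | p = emb z].

Lemma a_coordK p : vx CS p -> emb (a_coord p) = p.
Proof. by move/a_vxP => h; apply/esym; exact: (@xgetPex _ 0 [set z | p = emb z] h). Qed.

Definition colour p := csum (a_coord p).

Lemma colour_emb z : colour (emb z) = csum z.
Proof.
apply: csum_const; apply/(a_emb_eq hc); rewrite a_coordK //; exact: a_emb_vx.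
Qed.

Lemma fadj_nadj z w : fadj (emb z) (emb w) <-> nadj z w.
Proof.
split=> -[h ne]; split.
- by apply: (a_edge_bound hc h); rewrite !inE eqxx ?orbT.
- by move=> h'; apply: ne; apply/(a_emb_eq hc) => i j; have := h' i j; rewrite !ffunE; gen_vec; lia.
- exact: a_pair.
- by move/(a_emb_eq hc) => h'; apply: ne => i j; have := h' i j; rewrite !ffunE; gen_vec; lia.
Qed.

Lemma fadj_colour p q : fadj p q -> colour p <> colour q.
Proof.
move=> a; have vp : vx CS p by apply: faces_vx fCS a.1 _; rewrite !inE eqxx.
have vq : vx CS q by apply: faces_vx fCS a.1 _; rewrite !inE eqxx orbT.
move: a; rewrite -(a_coordK vp) -(a_coordK vq) => /fadj_nadj /nadj_csum.
by rewrite !colour_emb.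
Qed.

Section Rigid.
Variable h : 'rV[R]_n.+1 -> 'rV[R]_n.+1.
Hypothesis hh : simplicial_isometry CS ed CS ed h.
Variables (z0 : vec) (l : 'I_n.+1 -> 'I_n.+1).
Hypothesis il : injective l.
Hypothesis h0 : forall k : 'I_n.+1, h (emb (a_chain z0 l k)) = emb (a_chain z0 l k).
Local Notation fixed z := (h (emb z) = emb z).

Lemma h_emb z : exists w, h (emb z) = emb w.
Proof. by apply/a_vxP/(si_vx hh)/a_emb_vx. Qed.

(** The isometry turns the types into another proper colouring, and the two agree on the fixed
    chamber. *)
Lemma h_colour z : colour (h (emb z)) = csum z.
Proof.
apply: (@colour_eq_csum n (fun z => colour (h (emb z)))) (@csum_chain n z0 l il) _ z.
- by move=> z w /fadj_nadj /(si_adj fCS hh) [/fadj_colour].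
- by move=> z w e; congr (colour (h _)); apply/(a_emb_eq hc).
- by move=> k /=; rewrite h0 colour_emb.
Qed.

Lemma h_embI z w : h (emb z) = h (emb w) -> emb z = emb w.
Proof. by apply: (si_inj hh); apply: a_emb_vx. Qed.

Lemma h_step z w i : h (emb z) = emb w -> exists j, h (emb (z + unitvec i 1)) = emb (w + unitvec j 1).
Proof.
move=> e; have [w' e'] := h_emb (z + unitvec i 1).
have [] := si_adj fCS hh (iffRL (fadj_nadj _ _) (@nadj_unitvec n z i n0)).
rewrite e e' => /(iffLR (fadj_nadj _ _)) a _.
have [|j ej] := nadj_step (i := i) a.
  rewrite -(colour_emb w') -e' h_colour; apply: csum_unitvec.
  by rewrite -(colour_emb w) -e h_colour.
by exists j; apply/(a_emb_eq hc).
Qed.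

Lemma emb_addI z i j : emb (z + unitvec i 1) = emb (z + unitvec j 1) -> i = j.
Proof.
move/(a_emb_eq hc) => e; apply: contrapT => /eqP ij; have ji : j != i by rewrite eq_sym.
have := e i j; rewrite !ffunE !eqxx (negPf ij) (negPf ji).
by gen_vec; lia.
Qed.

Lemma a_pairP z w : CS [fset emb z; emb w]%fset <-> a_leI 1 (w - z).
Proof. by split=> [s|]; [apply: (a_edge_bound hc s); rewrite !inE eqxx ?orbT|exact: a_pair]. Qed.

Lemma start_adj i (k : 'I_n.+1) : (0 < k)%N ->
  CS [fset emb (z0 + unitvec i 1)%R; emb (a_chain z0 l k)]%fset <-> (l i < k)%N.
Proof.
move=> k0; rewrite a_pairP; have [x lx] := a_chain_last il ord0.
have E y : (a_chain z0 l k - (z0 + unitvec i 1)) y = ((l y < k)%N : nat)%:Z - (if y == i then 1 else 0).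
  by rewrite !ffunE; case: (y == i); case: (l y < k)%N; gen_vec; lia.
split=> [H|ik y y']; last first.
  rewrite !E; case: (eqVneq y i) => [->|_]; case: (eqVneq y' i) => [->|_]; rewrite ?ik;
  by case: (l _ < k)%N => //; case: (l _ < k)%N.
rewrite ltnNge; apply/negP => ki; have := H x i; rewrite !E lx /= k0 eqxx ltnNge ki.
by case: eqP => [e|_] //; move: ki; rewrite -e lx leqNgt k0.
Qed.

(** A neighbour [z0 + unitvec i 1] is recognized by the vertices of the chamber with which it spans
    a simplex. *)
Lemma start_fixed : fixed z0 /\ forall i, fixed (z0 + unitvec i 1).
Proof.
have f0 : fixed z0.
  have := h0 ord0; suff -> : a_chain z0 l (ord0 : 'I_n.+1) = z0 by [].
  by apply/ffunP => i; rewrite !ffunE ltn0 addr0.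
split=> // i; have [j ej] := h_step i f0; rewrite ej; congr (emb (_ + unitvec _ _)).
have key (k : 'I_n.+1) : (0 < k)%N -> (l j < k)%N = (l i < k)%N.
  move=> k0; apply/idP/idP => /(start_adj _ k0).
    rewrite -ej -(h0 k) => /(si_pairV fCS hh (a_emb_vx _) (a_emb_vx _)) H; exact/(start_adj _ k0).
  by move/(si_pair hh); rewrite ej h0 => H; apply/(start_adj _ k0).
apply/il/val_inj => /=; have lj := ltn_ord (l j); have li := ltn_ord (l i).
apply/eqP; rewrite eqn_leq; apply/andP; split; rewrite leqNgt; apply/negP => lt.
  have lt0 : (0 < l j)%N by apply: leq_ltn_trans lt.
  by have := key (l j) lt0; rewrite ltnn lt.
have lt0 : (0 < l i)%N by apply: leq_ltn_trans lt.
by have := key (l i) lt0; rewrite ltnn lt.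
Qed.

Definition a_fixed_star z := fixed z /\ forall i, fixed (z + unitvec i 1).

(** For distinct directions the image is one step from two fixed vertices; comparing coordinate sums
    removes the ambiguity by a constant. The remaining direction is settled by injectivity. *)
Lemma a_fixed_star_step z i : a_fixed_star z -> a_fixed_star (z + unitvec i 1).
Proof.
move=> [fz f1]; split=> // j.
have off x y : x != y -> fixed (z + unitvec x 1 + unitvec y 1).
  move=> xy; have [s es] := h_step y (f1 x); have [r er] := h_step x (f1 y).
  have e2 : emb (z + unitvec y 1 + unitvec r 1) = emb (z + unitvec x 1 + unitvec s 1).
    by rewrite -es -er addrAC.
  have e := iffLR (a_emb_eq hc _ _) e2.
  rewrite es; congr (emb (_ + unitvec _ _)); apply: contrapT => /eqP sy.
  have yx : y != x by rewrite eq_sym.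
  have S0 : \sum_k ((z + unitvec y 1 + unitvec r 1) k - (z + unitvec x 1 + unitvec s 1) k) = 0.
    rewrite sumrB; apply/eqP; rewrite subr_eq0; apply/eqP.
    have U (v : vec) (t : 'I_n.+1) : \sum_k (v + unitvec t 1) k = \sum_k v k + 1.
      have := @sum_drop n.+1 (fun k => v k) (fun k => (v + unitvec t 1) k) t.
      by move=> H; apply/esym/H => [k /negPf ka|]; rewrite !ffunE ?ka ?addr0 ?eqxx.
    by rewrite !U.
  have C k : (z + unitvec y 1 + unitvec r 1) k - (z + unitvec x 1 + unitvec s 1) k = 0.
    have := S0; rewrite (eq_bigr _ (fun a _ => e a k)) sum_const; set t := _ - _.
    by move=> /eqP; rewrite mulf_eq0 /= => /eqP.
  have := C y; rewrite !ffunE !eqxx (negPf yx) [y == s]eq_sym (negPf sy).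
  by case: (y == r); gen_vec; lia.
case: (eqVneq i j) => [<-|]; last exact: off.
have [s es] := h_step i (f1 i); rewrite es.
case: (eqVneq s i) => [->//|si].
have fs := off i s ltac:(by rewrite eq_sym).
have := h_embI (etrans es (esym fs)) => /emb_addI e.
by rewrite -e eqxx in si.
Qed.

(** Modulo constants every vertex is [z0] plus a non-negative vector, so it is reached by steps
    along positive unit vectors. *)
Lemma a_rigid w : fixed w.
Proof.
have pos k (v : vec) : (forall i, 0 <= v i) -> \sum_i v i <= k%:Z -> a_fixed_star (z0 + v).
  elim: k v => [|k IH] v v0 hk.
    have -> : v = 0.
      apply: (@bc_le1_0 n.+1); apply: le_trans hk; apply: sum_le => i; by rewrite ger0_norm.
    by rewrite addr0; exact: start_fixed.
  case: (pselect (exists i, 0 < v i)) => [[i vi]|hn]; last first.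
    have -> : v = 0; last by rewrite addr0; exact: start_fixed.
    by apply/ffunP => i; rewrite ffunE; apply/le_anti; rewrite v0 andbT leNgt; apply/negP => lt; apply: hn; exists i.
  have -> : z0 + v = z0 + (v - unitvec i 1) + unitvec i 1 by rewrite -addrA subrK.
  apply: a_fixed_star_step; apply: IH => [j|].
    by rewrite !ffunE; case: eqP => [->|_]; have := v0 j; move: vi; gen_vec; lia.
  have := @sum_drop n.+1 (fun x => (v - unitvec i 1) x) (fun x => v x) i.
  move=> H; have {}H := H (fun x xi => ltac:(by rewrite !ffunE (negPf xi) subr0)).
  have {}H := H ltac:(by rewrite !ffunE eqxx subrK).
  by move: H hk; move: (\sum_i _) (\sum_i _) => x y; lia.
have [m hm] : exists m, forall i, m <= (w - z0) i by exists (vmin (w - z0)); apply: (vminP _).2.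
pose v : vec := w - z0 - [ffun=> m].
have v0 i : 0 <= v i by have := hm i; rewrite !ffunE; gen_vec; lia.
have [f _] := pos (absz (\sum_i v i)) v v0 ltac:(by rewrite gez0_abs // sumr_ge0).
suff <- : emb (z0 + v) = emb w by [].
by apply/(a_emb_eq hc) => i j; rewrite !ffunE; gen_vec; lia.
Qed.

End Rigid.
End RigidA.

(** * Buildings of type A *)

Section BuildingA.
Variables (R : realType) (n : nat) (c : R) (T : choiceType) (D : peComplex R T) (apts : set (set {fset T})).
Hypotheses (hc : 0 < c) (n0 : (0 < n)%N).
Hypothesis hD : euclidean_building TypeA n c D apts.
Variable t0 : T.
Local Notation vec := {ffun 'I_n.+1 -> int}.
Local Notation F := 'rV[R]_n.+1.
Local Notation Phi := (Defs.roots R TypeA n c).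
Local Notation CS := (coxeter_simplex Phi).
Local Notation ed := (@edist R n.+1).
Local Notation chart := (@Defs.chart R T TypeA n c D).
Let fCS : faces CS := CS_faces hD.
Let fD : faces (simplex D) := @D_faces R T D.
Local Notation emb := (@a_emb R n c).
Local Notation colour := (@colour R n c).
Local Notation fadj := (adj CS).
Local Notation dadj := (adj (simplex D)).
Implicit Types (z w a b : vec) (x y v : T) (i j : 'I_n.+1).

Let idI : injective (@id 'I_n.+1) := fun i j e => e.
Local Notation std z k := (a_chain z (@id 'I_n.+1) k).

(** Agreement on a whole chamber, and not only at the centre, is recorded because it carries types
    from one apartment to another. *)
Definition a_retr Sg f z (rho : T -> F) :=
  (forall v, vx Sg v -> rho v = f v) /\
  forall s, simplex D s -> exists Sg' f', [/\ apts Sg', chart Sg' f', Sg' s, forall v, vx Sg' v -> rho v = f' v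
    & forall k : 'I_n.+1, exists p, [/\ vx Sg p, vx Sg' p, f p = emb (std z k) & f' p = emb (std z k)]].

Lemma a_chamber_at Sg f z : apts Sg -> chart Sg f ->
  exists C, [/\ Sg C, @flat_chamber R TypeA n c [fset f x | x in C]%fset, @rigid R TypeA n c [fset f x | x in C]%fset
    & forall k : 'I_n.+1, exists2 p, p \in C & f p = emb (std z k)].
Proof.
move=> hS hf; have [Q1 Q2] := a_chamber hc z idI.
have [C SC eC] := chart_preim hS hf Q1; exists C; rewrite -eC; split=> //.
  move=> h hh hq p /(a_vxP hc) [w ->]; apply: (a_rigid hc n0 fCS hh idI (z0 := z)) => k.
  by apply: hq; apply/imfsetP; exists k.
move=> k; have : emb (std z k) \in [fset f x | x in C]%fset by rewrite -eC; apply/imfsetP; exists k.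
by case/imfsetP => p /= pC e; exists p.
Qed.

Lemma a_retr_ex Sg f z : apts Sg -> chart Sg f -> exists rho, a_retr Sg f z rho.
Proof.
move=> hS hf; have [C [SC fC rC hC]] := a_chamber_at z hS hf.
have [rho [h1 h2]] := retraction hD t0 hS hf SC fC rC; exists rho; split.
  by move=> v; apply: h1.
move=> s /h2 [S' [f' [hS' hf' S'C S's e]]]; exists S', f'; split=> //.
  by move=> v; apply: h1.
move=> k; have [p pC ep] := hC k; exists p; split=> //; last by rewrite e.
  exact: (faces_vx (apt_faces hD hS) SC pC).
exact: (faces_vx (apt_faces hD hS') S'C pC).
Qed.

Lemma a_full Sg s : apts Sg -> simplex D s -> (forall x, x \in s -> vx Sg x) -> Sg s.
Proof.
move=> hS; have [f hf] := apt_chart hD hS; have [C [SC fC rC _]] := a_chamber_at 0 hS hf.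
exact: (apt_full hD t0 hS hf SC fC rC).
Qed.

Lemma a_apt_adj Sg f x y : apts Sg -> chart Sg f -> vx Sg x -> vx Sg y -> dadj x y <-> fadj (f x) (f y).
Proof.
move=> hS hf vX vY; have fS := apt_faces hD hS; split=> [[h ne]|].
  have SXY : Sg [fset x; y]%fset by apply: (a_full hS h) => u; rewrite !inE => /orP[]/eqP ->.
  by case: (si_adj fS hf (conj SXY ne)).
by case/(si_adjV fS hf vX vY) => h ne; split=> //; apply: (apt_simplex hD hS).
Qed.

Lemma a_retr_adj Sg f z rho : a_retr Sg f z rho -> forall x y, dadj x y -> fadj (rho x) (rho y).
Proof.
move=> [_ h] x y [/h [S' [f' [hS' hf' S's e _]]] ne]; have fS := apt_faces hD hS'.
rewrite !e; first by case: (si_adj fS hf' (conj S's ne)).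
  by apply: faces_vx fS S's _; rewrite !inE eqxx orbT.
by apply: faces_vx fS S's _; rewrite !inE eqxx.
Qed.

Variables (Sg0 : set {fset T}) (f0 : T -> F) (rho0 : T -> F).
Hypotheses (hS0 : apts Sg0) (hf0 : chart Sg0 f0) (hr0 : a_retr Sg0 f0 0 rho0).

Definition vertex_type x := colour (rho0 x).

Lemma vertex_type_adj x y : dadj x y -> vertex_type x <> vertex_type y.
Proof. by move/(a_retr_adj hr0)/(fadj_colour hc n0 fCS). Qed.

(* The charts that respect the types of vertices; a chart of an apartment may be composed with a symmetry of the flat that does not. *)
Definition good Sg f := [/\ apts Sg, chart Sg f & forall x, vx Sg x -> vertex_type x = colour (f x)].

Lemma a_inv Sg f z : apts Sg -> chart Sg f -> exists2 x, vx Sg x & f x = emb z.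
Proof. by move=> hS hf; apply: (si_surj (apt_faces hD hS) hf); apply: a_emb_vx. Qed.

(* A proper colouring of the flat by the [n.+1] types agrees with the standard one as soon as it does so on a chamber. *)
Lemma good_chamber Sg f (q : 'I_n.+1 -> T) : apts Sg -> chart Sg f -> (forall k, vx Sg (q k)) ->
  (forall k k', k <> k' -> dadj (q k) (q k')) -> (forall k, vertex_type (q k) = colour (f (q k))) -> good Sg f.
Proof.
move=> hS hf vq aq tq; split=> // x vX.
have /choice [g hg] : forall z, exists x, vx Sg x /\ f x = emb z.
  by move=> z; have [y vY ey] := a_inv z hS hf; exists y.
have vC v : vx Sg v -> vx CS (f v) by apply: (si_vx hf).
have gK v : vx Sg v -> g (a_coord c (f v)) = v.
  move=> vV; have [v1 e1] := hg (a_coord c (f v)); apply: (si_inj hf) => //.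
  by rewrite e1 (a_coordK hc) //; apply: vC.
rewrite -[x in LHS]gK //; apply: (@colour_eq_csum n (fun z => vertex_type (g z)) _ _ (fun k => a_coord c (f (q k)))).
- move=> z w /(fadj_nadj hc n0) a; apply: vertex_type_adj; have [v1 e1] := hg z; have [v2 e2] := hg w.
  by apply/(a_apt_adj hS hf v1 v2); rewrite e1 e2.
- move=> z w /(a_emb_eq hc) e; congr vertex_type; have [v1 e1] := hg z; have [v2 e2] := hg w.
  by apply: (si_inj hf) => //; rewrite e1 e2.
- move=> k k' e; apply: contrapT => /aq a; apply: (vertex_type_adj a); by rewrite !tq.
- by move=> k; rewrite gK.
Qed.

Lemma good_transfer Sg f Sg' f' z : good Sg f -> apts Sg' -> chart Sg' f' ->
  (forall k : 'I_n.+1, exists p, [/\ vx Sg p, vx Sg' p, f p = emb (std z k) & f' p = emb (std z k)]) -> good Sg' f'.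
Proof.
move=> [hS hf hg] hS' hf' /choice [q hq]; apply: (good_chamber (q := q)) => // [k|k k' ne|k].
- by case: (hq k).
- have [v1 v1' e1 _] := hq k; have [v2 v2' e2 _] := hq k'; apply/(a_apt_adj hS hf v1 v2); rewrite e1 e2.
  apply/(fadj_nadj hc n0); case: (ltngtP k k') => [lt|lt|/val_inj//].
    exact: (nadj_chain z idI lt).
  have := nadj_chain z idI lt; move=> /(fadj_nadj hc n0) /adj_sym; exact: (iffLR (fadj_nadj hc n0 _ _)).
- by have [v1 v1' e1 e2] := hq k; rewrite hg // e1 e2.
Qed.

Lemma good0 s : simplex D s -> exists Sg f, [/\ good Sg f, Sg s, forall v, vx Sg v -> rho0 v = f v
  & forall k : 'I_n.+1, exists p, [/\ vx Sg0 p, vx Sg p, f0 p = emb (std 0 k) & f p = emb (std 0 k)]].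
Proof.
move=> /hr0.2 [S' [f' [hS' hf' S's e q]]]; exists S', f'; split=> //; split=> // x vX.
by rewrite /vertex_type e.
Qed.

(** An apartment containing both simplices may miss the base chamber. One of its chambers [C] lies
    in a good apartment, whose chart is pulled back by an isometry fixing [C]. *)
Lemma good_ex s s' : simplex D s -> simplex D s' -> exists Sg f, [/\ good Sg f, Sg s & Sg s'].
Proof.
move=> Ds Ds'; have [Sg [hS Ss Ss']] := apt_common hD Ds Ds'; have [f hf] := apt_chart hD hS.
have [C [SC fC _ hC]] := a_chamber_at 0 hS hf.
have cC : #|` C| = n.+1 by rewrite -fC.2 (si_card (apt_faces hD hS) hf).
have [S' [f' [[hS' hf' hg'] S'C _ _]]] := good0 (apt_simplex hD hS SC).
have [g [hg g1]] := Defs.apt_isometry hD hS hS' SC S'C cC.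
exists Sg, (f' \o g); split=> //; have /choice [q hq] : forall k : 'I_n.+1, exists p, p \in C /\ f p = emb (std 0 k).
  by move=> k; have [p pC ep] := hC k; exists p.
have vq k : vx Sg (q k) by apply: (faces_vx (apt_faces hD hS) SC (hq k).1).
have vq' k : vx S' (q k) by apply: (faces_vx (apt_faces hD hS') S'C (hq k).1).
apply: (good_chamber (q := q)) => // [|k k' ne|k].
- exact: chart_comp hf' hg.
- apply/(a_apt_adj hS hf) => //; rewrite (hq k).2 (hq k').2.
  apply/(fadj_nadj hc n0); case: (ltngtP k k') => [lt|lt|/val_inj//].
    exact: (nadj_chain 0 idI lt).
  have := nadj_chain 0 idI lt; move=> /(fadj_nadj hc n0) /adj_sym; exact: (iffLR (fadj_nadj hc n0 _ _)).
- rewrite /= g1; [|exact: vq|exact: vq']; apply: hg'; exact: vq'.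
Qed.

Definition a_R1 x y := dadj x y /\ exists z, vertex_type x = csum z /\ vertex_type y = csum (z + unitvec ord0 1).
Definition a_RI x y := x = y \/ dadj x y.
Definition a_frame (phi : vec -> T) := exists Sg f, good Sg f /\ forall a, vx Sg (phi a) /\ f (phi a) = emb a.
(** Here [RI]-steps are edges, so some apartment always contains the origin and the next step. *)
Definition a_Wit (x y z : T) := True.

Lemma frame_good Sg f : good Sg f -> exists2 phi, a_frame phi &
  [/\ forall a, vx Sg (phi a), forall a, f (phi a) = emb a & forall x, vx Sg x -> phi (a_coord c (f x)) = x].
Proof.
move=> [hS hf hg]; have /choice [phi h] : forall z, exists x, vx Sg x /\ f x = emb z.
  by move=> z; have [y vY ey] := a_inv z hS hf; exists y.
exists phi; first by exists Sg, f.
split=> [a|a|x vX]; try by case: (h a).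
have [v1 e1] := h (a_coord c (f x)); apply: (si_inj hf) => //; rewrite e1 (a_coordK hc) //.
exact: (si_vx hf).
Qed.

Lemma a_R1P x y z i : a_R1 x y -> vertex_type x = csum z -> vertex_type y = csum (z + unitvec i 1).
Proof. by move=> [_ [w [ex ->]]] ez; apply: csum_unitvec; rewrite -ex. Qed.

Lemma a_frame_adj phi a b : a_frame phi -> dadj (phi a) (phi b) <-> nadj a b.
Proof.
move=> [Sg [f [[hS hf hg] h]]]; have [v1 e1] := h a; have [v2 e2] := h b.
by rewrite (a_apt_adj hS hf v1 v2) e1 e2; exact: (fadj_nadj hc n0).
Qed.

Lemma a_frame_type phi a : a_frame phi -> vertex_type (phi a) = csum a.
Proof.
by move=> [Sg [f [[hS hf hg] h]]]; have [v1 e1] := h a; rewrite hg // e1 colour_emb.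
Qed.

Lemma a_frame_eq phi a b : a_frame phi -> (forall i j : 'I_n.+1, a i - b i = a j - b j) -> phi a = phi b.
Proof.
move=> [Sg [f [[hS hf hg] h]]] e; have [v1 e1] := h a; have [v2 e2] := h b.
by apply: (si_inj hf) => //; rewrite e1 e2; apply/(a_emb_eq hc).
Qed.

Lemma a_frame_R1 phi a i : a_frame phi -> a_R1 (phi a) (phi (a + unitvec i 1)).
Proof.
move=> F; split; first exact/(a_frame_adj _ _ F)/nadj_unitvec.
by exists a; rewrite !a_frame_type //; split=> //; apply: csum_unitvec.
Qed.

Lemma a_frame_RI phi a b : a_frame phi -> a_leI 1 (b - a) -> a_RI (phi a) (phi b).
Proof.
move=> F h; case: (pselect (forall i j : 'I_n.+1, (b - a) i = (b - a) j)) => e.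
  by left; apply: (a_frame_eq F) => i j; have := e i j; rewrite !ffunE; gen_vec; lia.
by right; apply/(a_frame_adj _ _ F).
Qed.

Lemma a_frame_walk1 phi a b k : a_frame phi -> a_le1 k (b - a) -> walk a_R1 k (phi a) (phi b).
Proof.
move=> F; elim: k a => [|k IH] a h.
  have -> : phi a = phi b; last exact: walk_refl.
  by apply: (a_frame_eq F) => i j; have := a_le1_0 h i j; rewrite !ffunE; gen_vec; lia.
set d := b - a in h; have [[i1 e1] hmin] := vminP d.
case: (pselect (exists i, vmin d < d i)) => [[i lt]|hn]; last first.
  have -> : phi a = phi b; last exact: walk_refl.
  have E i : d i = vmin d by apply/le_anti; rewrite hmin andbT leNgt; apply/negP => lt; apply: hn; exists i.
  by apply: (a_frame_eq F) => i j; have := E i; have := E j; rewrite !ffunE; gen_vec; lia.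
(* A step along a coordinate above the minimum lowers the excess of the remaining difference by
   one. *)
apply: walk_cons (a_frame_R1 a i F) (IH _ _).
apply: (@a_le1I _ k (vmin d)) => [j|].
  by have := hmin j; rewrite !ffunE; case: eqP => [->|_]; move: lt; rewrite !ffunE; gen_vec; lia.
have := @sum_drop n.+1 (fun j => (b - (a + unitvec i 1)) j - vmin d) (fun j => d j - vmin d) i.
move=> H; have {}H : \sum_j ((b - (a + unitvec i 1)) j - vmin d) + 1 = \sum_j (d j - vmin d).
  by apply: H => [j /negPf ji|]; rewrite !ffunE ?ji ?eqxx; gen_vec; lia.
by move: H h; rewrite /a_le1; move: (\sum_j _) (\sum_j _) => x y; lia.
Qed.

Lemma a_frame_walkI phi a b k : a_frame phi -> a_leI k (b - a) -> walk a_RI k (phi a) (phi b).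
Proof.
move=> F; elim: k a => [|k IH] a h.
  have -> : phi a = phi b; last exact: walk_refl.
  by apply: (a_frame_eq F) => i j; have := h i j; have := h j i; rewrite !ffunE; gen_vec; lia.
set d := b - a in h; have [[i1 e1] hmin] := vminP d.
pose s : vec := [ffun i => if vmin d < d i then 1 else 0].
apply: (@walk_cons _ _ _ _ (phi (a + s))).
  apply: (a_frame_RI F); rewrite addrC addKr => i j.
  by rewrite !ffunE; case: ifP; case: ifP.
apply: IH => i j; have := h i j; have := h i i1; rewrite e1; have := hmin i; have := hmin j.
have -> : b - (a + s) = d - s by rewrite /d opprD addrA.
rewrite ![(d - s) _]ffunE ![(- s) _]ffunE ![s _]ffunE.
by case: ifP; case: ifP; gen_vec; lia.
Qed.

Lemma a_common x y : exists phi a b, [/\ a_frame phi, phi a = x & phi b = y].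
Proof.
have [Sg [f [G Sx Sy]]] := good_ex (simplex_vertex D x) (simplex_vertex D y).
have [phi F [_ _ h]] := frame_good G.
by exists phi, (a_coord c (f x)), (a_coord c (f y)); rewrite !h.
Qed.

Lemma a_retraction phi a : a_frame phi -> exists rho : T -> vec,
  [/\ forall x y, same a_RI (phi a) x -> a_R1 x y -> a_le1 1 (rho y - rho x),
      forall x y, same a_RI (phi a) x -> a_RI x y -> a_leI 1 (rho y - rho x),
      forall b, a_le1 0 (rho (phi b) - b)
    & forall v k, same a_RI (phi a) v -> a_le1 k (rho v - a) -> walk a_R1 k (phi a) v].
Proof.
move=> F; have [Sg [f [G h]]] := F; have [hS hf hg] := G.
have [rho hr] := a_retr_ex a hS hf.
have vr x : vx CS (rho x).
  have [S' [f' [hS' hf' S'x e _]]] := hr.2 _ (simplex_vertex D x).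
  by rewrite e //; apply: (si_vx hf').
have tr x : vertex_type x = colour (rho x).
  have [S' [f' [hS' hf' S'x e q]]] := hr.2 _ (simplex_vertex D x).
  by have [_ _ ->] := good_transfer G hS' hf' q; rewrite ?e.
pose r x := a_coord c (rho x).
have er x : emb (r x) = rho x by apply: a_coordK.
have ar x y : dadj x y -> nadj (r x) (r y).
  by move/(a_retr_adj hr); rewrite -!er => /(fadj_nadj hc n0).
have ct x : vertex_type x = csum (r x) by rewrite tr -er colour_emb.
exists r; split.
(* The retraction preserves types, so by [nadj_step] an [R1]-step becomes a unit vector modulo
   constants. *)
- move=> x y _ R1xy; have := a_R1P ord0 R1xy (ct x); rewrite ct => e.
  have [j hj] := nadj_step (ar _ _ R1xy.1) e.
  apply: (@a_le1I _ 1 (r y ord0 - (r x + unitvec j 1) ord0)) => [k|].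
    by have := hj k ord0; rewrite !ffunE; case: (k == j); gen_vec; lia.
  rewrite (eq_bigr (fun k => unitvec j 1 k)) => [|k _].
    by rewrite (bigD1 j) //= big1 => [|k /negPf kj]; rewrite ffunE ?eqxx ?kj.
  by have := hj k ord0; rewrite !ffunE; gen_vec; lia.
- move=> x y _ [->|/ar []//]; by rewrite subrr => i j; rewrite !ffunE.
- move=> b; apply: a_le1_0I => i j; have [vb eb] := h b.
  by have := iffLR (a_emb_eq hc (r (phi b)) b) _ i j; rewrite er hr.1 // eb => /(_ erefl); rewrite !ffunE; gen_vec; lia.
- move=> v k _ hk; have [S' [f' [hS' hf' S'v e q]]] := hr.2 _ (simplex_vertex D v).
  have G' := good_transfer G hS' hf' q; have [phi' F' [vp ep hp]] := frame_good G'.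
  have e1 : phi' (r v) = v by rewrite /r e // hp.
  have [p [vp0 vp' ep0 ep']] := q ord0.
  have s0 : std a (ord0 : 'I_n.+1) = a by apply/ffunP => i; rewrite !ffunE ltn0 addr0.
  have e2 : phi' a = phi a.
    have -> : phi a = p by have [va ea] := h a; apply: (si_inj hf) => //; rewrite ea ep0 s0.
    by apply: (si_inj hf') => //; rewrite ep ep' s0.
  by rewrite -e2 -e1; apply: a_frame_walk1.
Qed.

Lemma a_RI_sym x y : a_RI x y -> a_RI y x.
Proof. by case=> [->|/adj_sym]; [left|right]. Qed.

Lemma a_frame_axioms : frame_axioms (modelA n) a_R1 a_RI a_frame.
Proof.
split.
- by left.
- exact: a_RI_sym.
- by move=> x y []; right.
- by move=> phi a b k; apply: a_frame_walk1.
- by move=> phi a b k; apply: a_frame_walkI.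
- by move=> x y _ _; apply: a_common.
- exact: a_retraction.
Qed.

Lemma a_framed x : framed a_frame x.
Proof. by have [phi [a [b [F e _]]]] := a_common x x; exists phi, a. Qed.

Lemma a_same x y : same a_RI x y.
Proof. by have [phi [a [b [F <- <-]]]] := a_common x y; apply: (frame_same a_frame_axioms). Qed.

Lemma a_RI_walk x y : a_RI x y -> walk a_R1 n x y.
Proof.
move=> h; have [phi [a [b [F ea eb]]]] := a_common x y.
have : a_leI 1 (b - a) by apply: (frame_distI a_frame_axioms F); rewrite ea eb; apply: walk1.
move=> hI; rewrite -ea -eb; apply: a_frame_walk1 => //.
case: (pselect (forall i j : 'I_n.+1, (b - a) i = (b - a) j)) => e.
  exact: le1_mono (modelA n) _ _ _ (leq0n n) (a_le1_0I e).
by have /andP[_] := excess_bound hI e; rewrite /a_le1; move: (\sum_i _) => s; lia.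
Qed.

Lemma a_walk_R1 (b : nat) x y : walk a_RI b x y -> walk a_R1 (b * n) x y.
Proof.
elim=> [k u|k u v w h _ IH]; first exact: walk_refl.
by rewrite mulSn; apply: walk_cat (a_RI_walk h) IH.
Qed.

Lemma a_combing_axioms : combing_axioms (modelA n) a_R1 a_RI a_RI a_frame a_Wit.
Proof.
split.
- exact: a_RI_sym.
- by move=> x y _ _; apply: a_framed.
- move=> x z x' _ _ _; exists z; [exact: a_same|by left].
(* An [Nb]-step is one [RI]-step and at most [n] steps of [R1]; one such step is added at each
   end. *)
- exists (2 * n + 2)%N => x x' z z' _ nx nz _ _; split=> k w.
    by apply: walk_mono (walk_cat (walk1 nx) (walk_cat w (walk1 (a_RI_sym nz)))); lia.
  by apply: walk_mono (walk_cat (a_RI_walk nx) (walk_cat w (a_RI_walk (a_RI_sym nz)))); lia.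
- by move=> b; exists (b * n)%N => x z _ _; exact: a_walk_R1.
- move=> phi a b k w F _ _ h _.
  have Dbw : simplex D [fset phi b; w]%fset.
    by case: h => [->|[]//]; rewrite fsetUid; apply: simplex_vertex.
  have [Sg [f [G Sa Sbw]]] := good_ex (simplex_vertex D (phi a)) Dbw; have [hS _ _] := G.
  have [phi' F' [_ _ hp]] := frame_good G; have fS := apt_faces hD hS.
  exists phi', (a_coord c (f (phi a))), (a_coord c (f (phi b))), (a_coord c (f w)).
  by rewrite !hp //; apply: (faces_vx fS Sbw); rewrite !inE eqxx ?orbT.
- by [].
Qed.

Lemma a_connected x y : exists b : nat, walk a_RI b x y.
Proof. exact: a_same. Qed.

End BuildingA.

(** * Orderings of the flat and the edges along unit vectors *)

Section FlatOrdering.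
Variables (R : realType) (n : nat) (c : R).
Hypotheses (hc : 0 < c) (n0 : (0 < n)%N).
Local Notation vec := {ffun 'I_n.+1 -> int}.
Local Notation Phi := (Defs.roots R TypeA n c).
Local Notation CS := (coxeter_simplex Phi).
Local Notation emb := (@a_emb R n c).
Implicit Types (z w : vec) (i j : 'I_n.+1).

Lemma c_neq0 : c != 0. Proof. by rewrite gt_eqF. Qed.

Lemma a_emb0 : emb 0 = 0.
Proof.
apply/rowP => i; rewrite !mxE ffunE /mean big1 ?mul0r ?subr0 ?mul0r // => j _.
by rewrite ffunE.
Qed.

Lemma a_embD z w : emb (z + w) = emb z + emb w.
Proof.
apply/rowP => i; rewrite !mxE -mulrDl ffunE intrD; congr (_ / _).
rewrite [RHS]addrACA -opprD; congr (_ - _); rewrite /mean -mulrDl -big_split /=; congr (_ / _).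
by apply: eq_bigr => j _; rewrite ffunE intrD.
Qed.

Lemma a_dot_emb z r : Phi r -> exists k : int, dot (emb z) r = k%:~R.
Proof.
by move=> [r' [i [j [_ ->]]] ->]; exists (z i - z j); rewrite (dot_pt hc) intrB.
Qed.

Lemma a_special z : coxeter_special Phi (emb z).
Proof.
split=> [|r hr]; first by apply/(a_vertexP hc); exists z.
by have [k ek] := a_dot_emb z hr; exists k; split=> //; apply: (a_pt_span hc).
Qed.

Lemma a_quasi_special z w : nadj z w -> coxeter_quasi_special Phi (emb z) (emb w).
Proof.
move/(fadj_nadj hc n0) => [s ne]; have e : coxeter_edge Phi (emb z) (emb w) by [].
split=> //; exists (emb z), (emb w); split.
- by split; [exact: a_special|exact: a_special|move=> p sp'; right; exists (emb z), (emb w)].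
- by exists 0; rewrite ?lexx ?ler01 // scale0r addr0.
- by exists 1; rewrite ?lexx ?ler01 // scale1r addrC subrK.
Qed.

Lemma a_translation z : extended_affine_weyl Phi (fun v => v + emb z).
Proof.
exists id, (emb z); split=> //; first exact: weyl_id.
by split; [exact: (a_pt_span hc)|move=> r /(a_dot_emb z)].
Qed.

Lemma a_reflection i : i != ord0 -> exists g, [/\ extended_affine_weyl Phi g, g (emb 0) = emb 0
  & g (emb (unitvec ord0 1)) = emb (unitvec i 1)].
Proof.
move=> i0; have i0' : ord0 != i by rewrite eq_sym.
set r := c *: (eps R n.+1 (ord0 : 'I_n.+1) - eps R n.+1 i).
have rr : dot r r = c * c * 2.
  have -> : dot r r = \sum_j (if j == ord0 then c * c else if j == i then c * c else 0).
    apply: eq_bigr => j _; rewrite !mxE; case: (eqVneq j ord0) => [->|j0].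
      by rewrite eqxx [(_ == _)%N](negPf i0') subr0 !mulr1.
    rewrite [(_ == _)%N](negPf j0); case: (eqVneq j i) => [->|ji].
      by rewrite eqxx sub0r mulrN1 mulrNN.
    by rewrite [(_ == _)%N](negPf ji) subr0 mulr0 mul0r.
  rewrite (bigD1 ord0) //= (bigD1 i) //= (negPf i0) eqxx big1 ?addr0; first by rewrite mulr2n mulrDr mulr1.
  by move=> j /andP[/negPf -> /negPf ->].
exists (reflection r); split.
- exists (reflection r \o id), 0; split=> [||v]; last by rewrite addr0.
    by apply: weyl_refl; [exact: a_root|exact: weyl_id].
  split; first by rewrite -a_emb0; apply: (a_pt_span hc).
  by move=> r' hr'; rewrite -a_emb0; apply: a_dot_emb.
- by rewrite /reflection (dot_pt hc) !ffunE subrr mulr0 mul0r scale0r subr0.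
rewrite /reflection (dot_pt hc) rr !ffunE eqxx (negPf i0) subr0 mulr1.
have c1 := c_neq0.
have -> : 2 / (c * c * 2) = (c * c)^-1.
  by rewrite invfM mulrCA mulfV ?pnatr_eq0 // mulr1.
have em : mean (fun j => (unitvec ord0 1 j)%:~R : R) = mean (fun j => (unitvec i 1 j)%:~R : R).
  rewrite /mean; congr (_ / _).
  rewrite (bigD1 ord0) //= [RHS](bigD1 i) //= !ffunE !eqxx !big1 // => j /negPf jj; by rewrite ffunE jj.
apply/rowP => j; rewrite !mxE em; set m := mean _.
have -> : (c * c)^-1 * (c * ((j == ord0)%:R - (j == i :> nat)%:R)) = ((j == ord0)%:R - (j == i)%:R) / c.
  by rewrite invfM -mulrA mulKf // mulrC.
rewrite -mulrBl; congr (_ / _); rewrite !ffunE.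
by case: (j == ord0); case: (j == i); rewrite ?mulr1n ?mulr0n; lra.
Qed.

Section Ordering.
Variable sigma : 'rV[R]_n.+1 -> 'rV[R]_n.+1 -> 'I_n.
Hypothesis hs : @coxeter_ordering R n.+1 n Phi sigma.

(** The extended affine Weyl group contains the translations by all vertices and the exchanges of
    two coordinates, so it is transitive on the edges along unit vectors. *)
Lemma sigma_unitvec z i : sigma (emb z) (emb (z + unitvec i 1)) = sigma (emb 0) (emb (unitvec ord0 1)).
Proof.
have [_ inv _] := hs.
have q k : coxeter_quasi_special Phi (emb 0) (emb (unitvec k 1)).
  by have := @nadj_unitvec n 0 k n0; rewrite add0r => /a_quasi_special.
have := inv _ _ _ (a_translation z) (q i); rewrite -!a_embD add0r addrC => ->.
case: (eqVneq i ord0) => [->//|i0].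
have [g [hg e0 e1]] := a_reflection i0.
by have := inv _ _ _ hg (q ord0); rewrite e0 e1.
Qed.

(** The ranking begins with [i] and has [I] as an initial segment; its alcove contains both of the
    vertices that [sigma_first] compares. *)
Lemma order_of_set (I : pred 'I_n.+1) i i1 : I i -> ~~ I i1 -> exists l : 'I_n.+1 -> 'I_n.+1,
  injective l /\ l i = 0%N :> nat /\ exists k : 'I_n.+1, forall j, (l j < k)%N = I j.
Proof.
move=> Ii Ii1; pose A := i :: [seq j <- enum 'I_n.+1 | I j && (j != i)].
pose B := [seq j <- enum 'I_n.+1 | ~~ I j]; pose s := A ++ B.
have inA j : (j \in A) = I j.
  by rewrite inE mem_filter mem_enum andbT; case: eqVneq => [->|_]; rewrite ?Ii // andbT.
have ins j : j \in s by rewrite mem_cat inA mem_filter mem_enum andbT orbN.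
have us : uniq s.
  rewrite cat_uniq cons_uniq filter_uniq ?enum_uniq // filter_uniq ?enum_uniq // mem_filter eqxx andbF !andbT /=.
  by apply/hasPn => j; rewrite mem_filter mem_enum andbT /= -/A => h; rewrite inA.
have ss : (size s <= n.+1)%N.
  by have := uniq_leq_size us (s2 := enum 'I_n.+1) (fun j _ => mem_enum _ j); rewrite size_enum_ord.
have li j : (index j s < n.+1)%N by apply: leq_trans ss; rewrite index_mem.
exists (fun j => Ordinal (li j)); split.
  move=> x y /(congr1 val) e; have {}e : index x s = index y s := e.
  by rewrite -(nth_index x (ins x)) e nth_index.
split; first by rewrite /= eqxx.
have kA : (size A < n.+1)%N.
  apply: leq_ltn_trans (li i1); rewrite index_cat inA (negPf Ii1); exact: leq_addr.
exists (Ordinal kA) => j; change ((index j s < size A)%N = I j); rewrite index_cat.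
case: (boolP (j \in A)) => h; first by rewrite index_mem h -inA.
by rewrite ltnNge leq_addr -inA (negPf h).
Qed.

(** Some alcove at [z] contains [w] and also the end of an edge along a unit vector, which has the
    same value; bijectivity on the edges of this alcove identifies the two. *)
Lemma sigma_first z w : nadj z w -> sigma (emb z) (emb w) = sigma (emb 0) (emb (unitvec ord0 1)) ->
  exists i, emb w = emb (z + unitvec i 1).
Proof.
move=> a es; have [hI hn] := a; set v := w - z in hI hn.
have [[i1 e1] h1] := vminP v.
have [i lt] : exists i, vmin v < v i.
  apply: contrapT => hn'; apply: hn => i j.
  have E k : v k = vmin v by apply/le_anti; rewrite h1 andbT leNgt; apply/negP => lt; apply: hn'; exists k.
  by rewrite !E.
have [l [il [l0 [k hk]]]] := @order_of_set (fun j => vmin v < v j) i i1 lt ltac:(by rewrite /= e1 ltxx).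
have [Q1 Q2] := a_chamber hc z il; have [bij _ _] := hs.
exists i; have n1 : (1 < n.+1)%N by [].
have ch k' : emb (a_chain z l (nat_of_ord (k' : 'I_n.+1))) \in [fset emb (a_chain z l (nat_of_ord k)) | k in 'I_n.+1]%fset.
  by apply/imfsetP; exists k'.
have c0 : emb z = emb (a_chain z l (ord0 : 'I_n.+1)).
  by congr emb; apply/ffunP => j; rewrite !ffunE ltn0 addr0.
have c1 : emb (z + unitvec i 1) = emb (a_chain z l (Ordinal n1)).
  congr (emb (_ + _)); apply/ffunP => j; rewrite !ffunE /= ltnS leqn0.
  case: (eqVneq j i) => [->|ji]; first by rewrite l0.
  by case: eqP => // lj; case/eqP: ji; apply/il/val_inj; rewrite /= lj l0.
have c2 : emb w = emb (a_chain z l k).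
  apply/(a_emb_eq hc); suff E j : w j - a_chain z l k j = vmin v by move=> x y; rewrite !E.
  rewrite !ffunE hk; have := hI j i1; rewrite e1; have := h1 j.
  have -> : w j = z j + v j by rewrite !ffunE; gen_vec; lia.
  by case: ltP; gen_vec; lia.
have zc : emb z \in [fset emb (a_chain z l (nat_of_ord k)) | k in 'I_n.+1]%fset by rewrite c0.
have [y [hy uy]] := bij _ _ Q1 Q2 zc (a_special z) (sigma (emb 0) (emb (unitvec ord0 1))).
have ne z' : nadj z z' -> emb z' <> emb z.
  by move=> /(fadj_nadj hc n0) [_ h] /esym.
rewrite -(uy (emb w)); last by split; [rewrite c2|exact: ne|].
by apply: uy; split; [rewrite c1|apply/ne/nadj_unitvec|exact: sigma_unitvec].
Qed.

End Ordering.

Lemma first_coweight (w : 'I_n -> 'rV[R]_(ambient TypeA n)) : fundamental_coweights c w ->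
  w (Ordinal n0) = emb (unitvec ord0 1).
Proof.
move=> /(_ (Ordinal n0)) [sw hw].
rewrite (a_pt_surj hc sw); apply/(a_pt_eq hc).
set v := w (Ordinal n0) in sw hw *.
have step (k : nat) (h : (k < n)%N) (h1 : (k < n.+1)%N) (h2 : (k.+1 < n.+1)%N) :
    c * v 0 (Ordinal h1) - c * v 0 (Ordinal h2) = (k == 0)%:R.
  have := hw (Ordinal h); rewrite /simple_root /= dotZr dotDr dotNr.
  rewrite -[eps R n.+1 k]/(eps R n.+1 (Ordinal h1)) -[eps R n.+1 k.+1]/(eps R n.+1 (Ordinal h2)) !dot_eps mulrBr => ->.
  by rewrite -val_eqE /= eq_sym.
have E (k : nat) (h : (k < n.+1)%N) : c * v 0 (Ordinal h) = c * v 0 ord0 - (k != 0)%:R.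
  elim: k h => [|k IH] h; first by rewrite subr0; congr (_ * v _ _); apply/val_inj.
  have h1 : (k < n.+1)%N by apply: ltnW.
  have := step k h h1 h; rewrite IH; case: (k == 0)%N => /=; lra.
have E' i : c * v 0 i = c * v 0 ord0 - (i != ord0)%:R.
  by case: i => k h; rewrite E; congr (_ - _%:R).
by move=> i j; rewrite E' (E' j) !ffunE; case: (i == ord0); case: (j == ord0) => /=; lra.
Qed.

(** Only the first simple root involves the first coordinate, so the coefficient is at most 1; it is
    at least 1 because the sum of the simple roots is a root. *)
Lemma first_coef (h : 'I_n -> R) : highest_root_coefs TypeA c h -> h (Ordinal n0) = 1.
Proof.
move=> [[r' [a [b [ab ->]]] e] hmax]; apply/le_anti/andP; split; last first.
  apply: (hmax (fun=> 1)); exists (eps R n.+1 (ord0 : 'I_n.+1) - eps R n.+1 (ord_max : 'I_n.+1)).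
    by exists ord0, ord_max; split=> //; rewrite -val_eqE /= eq_sym -lt0n.
  under eq_bigr do rewrite scale1r /simple_root /=.
  rewrite -scaler_sumr; congr (_ *: _).
  rewrite -(big_mkord xpredT (fun i : nat => eps R n.+1 i - eps R n.+1 i.+1)).
  rewrite (eq_bigr (fun i : nat => - (eps R n.+1 i.+1 - eps R n.+1 i))) => [|i _]; last by rewrite opprB.
  by rewrite sumrN telescope_sumr // opprB.
have := congr1 (fun v : 'rV[R]_n.+1 => v 0 ord0) e; rewrite /= summxE.
rewrite (bigD1 (Ordinal n0)) //= big1 => [|i ni].
  rewrite !mxE /= subr0 mulr1 addr0 => eh; have : c * h (Ordinal n0) <= c.
    rewrite mulrC eh ger_pMr // lerBlDr; case: (_ == _); case: (_ == _) => /=; lra.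
  by rewrite ger_pMr.
rewrite !mxE /=; have -> : (0 == i)%N = false by apply/negbTE; rewrite eq_sym.
by rewrite subrr !mulr0.
Qed.

End FlatOrdering.

(** * Automorphisms of buildings of type A *)

Section TypeAAction.
Variables (R : realType) (n : nat) (c : R) (T : choiceType) (D : peComplex R T) (apts : set (set {fset T})).
Hypotheses (hc : 0 < c) (n0 : (0 < n)%N).
Hypothesis hD : euclidean_building TypeA n c D apts.
Variable t0 : T.
Local Notation vec := {ffun 'I_n.+1 -> int}.
Local Notation F := 'rV[R]_n.+1.
Local Notation Phi := (Defs.roots R TypeA n c).
Local Notation CS := (coxeter_simplex Phi).
Local Notation chart := (@Defs.chart R T TypeA n c D).
Local Notation emb := (@a_emb R n c).
Local Notation dadj := (adj (simplex D)).
Let fCS : faces CS := CS_faces hD.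
Variables (Sg0 : set {fset T}) (f0 : T -> F) (rho0 : T -> F).
Hypotheses (hS0 : apts Sg0) (hf0 : chart Sg0 f0) (hr0 : a_retr c D apts Sg0 f0 0 rho0).
Local Notation R1 := (a_R1 c D rho0).
Local Notation vertex_type := (vertex_type c rho0).

Lemma a_dadj_quasi u v : dadj u v -> quasi_special TypeA n c D apts u v.
Proof.
move=> a; have [Sg [f [[hS hf _] Suv _ _]]] := good0 hr0 a.1.
have fS := apt_faces hD hS.
have vu : vx Sg u by apply: faces_vx fS Suv _; rewrite !inE eqxx.
have vv : vx Sg v by apply: faces_vx fS Suv _; rewrite !inE eqxx orbT.
exists Sg, f; split=> //; have [z ez] := iffLR (a_vxP hc _) (si_vx hf vu).
have [w ew] := iffLR (a_vxP hc _) (si_vx hf vv); rewrite ez ew; apply: (a_quasi_special hc n0).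
by apply/(fadj_nadj hc n0); rewrite -ez -ew; apply/(a_apt_adj hc n0 hD t0 hS hf).
Qed.

Lemma a_R1_order (tau : T -> T -> 'I_n) (w : 'I_n -> 'rV[R]_(ambient TypeA n)) (h : 'I_n -> R) :
  building_ordering TypeA c D apts tau -> fundamental_coweights c w -> highest_root_coefs TypeA c h ->
  (forall i u v, Sg0 [fset u; v]%fset -> f0 u = 0 -> f0 v = (h i)^-1 *: w i -> tau u v = i) ->
  forall u v, dadj u v -> R1 u v <-> tau u v = Ordinal n0.
Proof.
move=> ho hw hh h0 u v a; have [Sg [f [[hS hf hg] Suv e q]]] := good0 hr0 a.1.
have [sigma hs ts] := ho _ _ hS hf; have fS := apt_faces hD hS.
have vu : vx Sg u by apply: faces_vx fS Suv _; rewrite !inE eqxx.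
have vv : vx Sg v by apply: faces_vx fS Suv _; rewrite !inE eqxx orbT.
have edge x y z z' : vx Sg x -> vx Sg y -> f x = emb z -> f y = emb z' -> nadj z z' -> tau x y = sigma (emb z) (emb z').
  move=> vX vY ex ey az; rewrite -ex -ey; apply: ts.
    apply: (si_pairV fS hf vX vY); rewrite ex ey.
    by have [] := iffRL (fadj_nadj hc n0 z z') az.
  by rewrite ex ey; apply: (a_quasi_special hc n0).
(* [Sg] shares the base chamber with [Sg0], where the standard ordering prescribes the value of the
   first edge. *)
have s0 : sigma (emb 0) (emb (unitvec ord0 1)) = Ordinal n0.
  have n1 : (1 < n.+1)%N by [].
  have [p [vp0 vp ep0 ep]] := q ord0; have [p' [vp0' vp' ep0' ep']] := q (Ordinal n1).
  have E0 : a_chain 0 (@id 'I_n.+1) (ord0 : 'I_n.+1) = 0 by apply/ffunP => i; rewrite !ffunE addr0.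
  have E1 : a_chain 0 (@id 'I_n.+1) (Ordinal n1) = unitvec ord0 1.
    by apply/ffunP => i; rewrite !ffunE add0r /= ltnS leqn0 -val_eqE; case: eqP.
  rewrite E0 in ep0 ep; rewrite E1 in ep0' ep'.
  have a01 : nadj (0 : vec) (unitvec ord0 1) by have := @nadj_unitvec n 0 ord0 n0; rewrite add0r.
  rewrite -(edge p p') //; apply: h0.
  - apply: (si_pairV (apt_faces hD hS0) hf0 vp0 vp0'); rewrite ep0 ep0'.
    by have [] := iffRL (fadj_nadj hc n0 _ _) a01.
  - by rewrite ep0 a_emb0.
  - by rewrite ep0' (first_coef hc n0 hh) (first_coweight hc n0 hw) invr1 scale1r.
have [z ez] := iffLR (a_vxP hc _) (si_vx hf vu); have [z' ez'] := iffLR (a_vxP hc _) (si_vx hf vv).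
have az : nadj z z'.
  by apply/(fadj_nadj hc n0); rewrite -ez -ez'; apply/(a_apt_adj hc n0 hD t0 hS hf).
have tu : vertex_type u = csum z by rewrite hg // ez colour_emb.
have tv : vertex_type v = csum z' by rewrite hg // ez' colour_emb.
rewrite (edge u v z z') //; split=> [r|es].
  have := a_R1P ord0 r tu; rewrite tv => /(nadj_step az) [j /(a_emb_eq hc) ->].
  by rewrite (sigma_unitvec hc n0 hs).
have [|j ej] := sigma_first hc n0 hs az; first by rewrite es s0.
split=> //; exists z; rewrite tu; split=> //; rewrite tv.
have -> : csum z' = csum (z + unitvec j 1) by apply: csum_const; apply/(a_emb_eq hc).
exact: csum_unitvec.
Qed.

(** Inside an apartment the types of the images form a proper colouring, hence a function of the
    type; the function is always the same, because the apartments used share the base chamber. *)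
Lemma vertex_type_perm g : simplicial_isometry (simplex D) (len D) (simplex D) (len D) g ->
  exists2 pi : 'I_n.+1 -> 'I_n.+1, injective pi & forall x, vertex_type (g x) = pi (vertex_type x).
Proof.
move=> hg; have idI : injective (@id 'I_n.+1) by [].
have /choice [P hP] : forall k : 'I_n.+1, exists x, vx Sg0 x /\ f0 x = emb (a_chain 0 (@id 'I_n.+1) k).
  by move=> k; have [x vX ex] := a_inv hc hD (a_chain 0 (@id 'I_n.+1) k) hS0 hf0; exists x.
have [k kK Kk] := injF_bij (csum_chain (z := 0) idI).
have g_adj x y : dadj x y -> dadj (g x) (g y) by case/(si_adj (@D_faces R T D) hg).
exists (fun j => vertex_type (g (P (k j)))).
  move=> i j e; apply: contrapT => ij.
  have kij : k i <> k j by move=> e'; apply: ij; rewrite -(Kk i) -(Kk j) e'.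
  have a : dadj (P (k i)) (P (k j)).
    apply/(a_apt_adj hc n0 hD t0 hS0 hf0); [exact: (hP _).1|exact: (hP _).1|rewrite (hP _).2 (hP _).2].
    apply/(fadj_nadj hc n0); case: (ltngtP (k i) (k j)) => [lt|lt|/val_inj//].
      exact: (nadj_chain 0 idI lt).
    have := nadj_chain 0 idI lt; move=> /(fadj_nadj hc n0) /adj_sym; exact: (iffLR (fadj_nadj hc n0 _ _)).
  by have := vertex_type_adj hc n0 hD hr0 (g_adj _ _ a).
move=> x; have [Sg [f [[hS hf ht] Sx e q]]] := good0 hr0 (simplex_vertex D x).
have /choice [r hr] : forall z, exists x, vx Sg x /\ f x = emb z.
  by move=> z; have [y vY ey] := a_inv hc hD z hS hf; exists y.
have rq z y : vx Sg y -> f y = emb z -> r z = y.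
  by move=> vY ey; have [v1 e1] := hr z; apply: (si_inj hf) => //; rewrite e1 ey.
have [z ez] := iffLR (a_vxP hc _) (si_vx hf Sx).
have tx : vertex_type x = csum z by rewrite ht // ez colour_emb.
have := @colour_csum n (fun z => vertex_type (g (r z))) _ _ z (a_chain 0 (@id 'I_n.+1) (k (csum z))).
rewrite (rq z x) // tx => ->.
- congr (vertex_type (g _)); have [p [vp0 vp ep0 ep]] := q (k (csum z)); rewrite (rq _ p) //.
  by apply: (si_inj hf0) => //; [exact: (hP _).1|rewrite ep0 (hP _).2].
- move=> y y' /(fadj_nadj hc n0) a; apply: (vertex_type_adj hc n0 hD hr0); apply: g_adj.
  by apply/(a_apt_adj hc n0 hD t0 hS hf); [exact: (hr _).1|exact: (hr _).1|rewrite !(hr _).2].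
- move=> y y' /(a_emb_eq hc) ey; congr (vertex_type (g _)); apply: rq; first exact: (hr _).1.
  by rewrite (hr _).2.
- by apply/esym; exact: (Kk (csum z)).
Qed.

End TypeAAction.

(** * Group actions *)

Section Subgroups.
Variables (G : groupType) (S : {pred G}).
Hypothesis hS : (1%g \in S) /\ forall x y, x \in S -> y \in S -> (x / y)%g \in S.

Inductive subgroup := Subgroup x of x \in S.
Definition sgval u := let: Subgroup x _ := u in x.
HB.instance Definition _ := [isSub for sgval].
HB.instance Definition _ := [Choice of subgroup by <:].
HB.instance Definition _ := SubChoice_isSubGroup.Build G S subgroup hS.
Definition subgroup_of : subGroupType S := subgroup.

End Subgroups.

Section Actions.
Variables (R : realType) (T : choiceType) (D : peComplex R T) (G : groupType) (act : G -> T -> T).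
Hypothesis hact : isometric_action D act.
Hypothesis hfree : free_action D act.
Hypothesis hcoc : cocompact_action D act.
Local Notation dadj := (adj (simplex D)).

Lemma act_one x : act 1%g x = x. Proof. by case: hact. Qed.
Lemma act_mul g h x : act (g * h)%g x = act g (act h x). Proof. by case: hact. Qed.
Lemma act_iso g : simplicial_isometry (simplex D) (len D) (simplex D) (len D) (act g).
Proof. by case: hact. Qed.
Lemma act_inv g x : act g (act g^-1%g x) = x. Proof. by rewrite -act_mul mulgV act_one. Qed.
Lemma act_invK g x : act g^-1%g (act g x) = x. Proof. by rewrite -act_mul mulVg act_one. Qed.

Lemma act_stab g x : act g x = x -> g = 1%g.
Proof.
(* Freeness is assumed for points; a vertex is the point with barycentric coordinate 1 there. *)
move=> gx; apply: (hfree (p := fun y => (y == x)%:R)); last first.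
  apply/funext => y /=; congr (_%:R); congr nat_of_bool; apply/eqP/eqP => [e|->].
    by rewrite -gx -e act_inv.
  by rewrite -{1}gx act_invK.
exists [fset x]%fset; split; first exact: simplex_vertex.
- by move=> y; rewrite inE => ->; rewrite ltr01.
- by move=> y; rewrite inE => /negPf ->.
- by rewrite big_seq_fset1 eqxx.
Qed.

Lemma orbit_reps : exists O : seq T, forall x, exists2 o, o \in O & exists g, x = act g o.
Proof.
have [r hr] := hcoc; exists (flatten [seq enum_fset t | t <- r]) => x.
have [t [g [tr _ e]]] := hr _ (simplex_vertex D x).
have : x \in [fset x]%fset by rewrite inE.
rewrite e => /imfsetP [o /= ot ->]; exists o; last by exists g.
by apply/flattenP; exists (enum_fset t) => //; apply: map_f.
Qed.

(* A simplex containing [x] is the translate of one of finitely many simplices, by an element that is determined by the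
   vertex sent to [x]. *)
Lemma neighbours x : exists s : seq T, forall y, dadj x y -> y \in s.
Proof.
have [r hr] := hcoc.
have /choice [gam hg] : forall o, exists g, (exists h, x = act h o) -> x = act g o.
  by move=> o; case: (pselect (exists h, x = act h o)) => [[h e]|hn]; [exists h|exists 1%g].
exists [seq act (gam p.1) p.2 | p <- flatten [seq [seq (o, y) | o <- enum_fset t, y <- enum_fset t] | t <- r]] => y [Dxy _].
have [t [g [tr _ e]]] := hr _ Dxy.
have : x \in [fset x; y]%fset by rewrite !inE eqxx.
have : y \in [fset x; y]%fset by rewrite !inE eqxx orbT.
rewrite e => /imfsetP [y' /= yt ey] /imfsetP [o /= ot eo].
apply/mapP; exists (o, y').
  apply/flattenP; exists [seq (o, y) | o <- enum_fset t, y <- enum_fset t]; first exact: (map_f (fun t : {fset T} => [seq (o, y) | o <- enum_fset t, y <- enum_fset t])).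
  by apply/allpairsP; exists (o, y').
rewrite /= ey; congr (act _ _).
have e' := hg o (ex_intro _ g eo).
have : ((gam o)^-1 * g)%g = 1%g by apply: (@act_stab _ o); rewrite act_mul -eo {1}e' act_invK.
by move/(congr1 (fun h => gam o * h)%g); rewrite mulgA mulgV mul1g mulg1.
Qed.

Lemma ball_finite k x : exists s : seq T, forall y, walk dadj k x y -> y \in s.
Proof.
elim: k x => [|k IH] x; first by exists [:: x] => y w; rewrite -(walk0P w) inE.
have [s hs] := neighbours x; have /choice [b hb] := IH.
exists (x :: flatten [seq b z | z <- s]) => y w; rewrite inE.
case: (walkSP w) => [->|[z /hs zs wz]]; first by rewrite eqxx.
by apply/orP; right; apply/flattenP; exists (b z); [apply: map_f|apply: hb].
Qed.

Theorem cocompact_combing N (M : flat_model N) (R1 RI Nb : T -> T -> Prop) (Fr : ({ffun 'I_N -> int} -> T) -> Prop)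
    (Wit : T -> T -> T -> Prop) :
  frame_axioms M R1 RI Fr -> combing_axioms M R1 RI Nb Fr Wit ->
  (forall g x y, R1 x y -> R1 (act g x) (act g y)) ->
  (forall g x y, RI x y -> RI (act g x) (act g y)) ->
  (forall g x y, Nb x y -> Nb (act g x) (act g y)) ->
  (forall g x y z, Wit x y z -> Wit (act g x) (act g y) (act g z)) ->
  (forall g x, framed Fr x -> framed Fr (act g x)) ->
  (forall x y, RI x y \/ Nb x y -> walk dadj 2 x y) ->
  (forall x y, framed Fr x -> framed Fr y -> exists b, walk Nb b x y) ->
  (forall x y, framed Fr x -> framed Fr y -> exists2 y', same RI x y' & Nb y' y) ->
  (exists x, framed Fr x) -> biautomatic G.
Proof.
move=> fa ax h1 hI hN hW hF hb hc hm [x fx].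
have [O hO] := orbit_reps; pose O' := [seq o <- O | `[< framed Fr o >]].
have cov y : framed Fr y -> exists2 o, o \in O' & exists g, y = act g o.
  move=> fy; have [o oO [g e]] := hO y; exists o; last by exists g.
  rewrite mem_filter oO andbT; apply/asboolP.
  by rewrite -(act_invK g o) -e; apply: hF.
have [o oO _] := cov x fx.
apply: (@combed_biautomatic N M T R1 RI Nb Fr Wit fa ax G act act_one act_mul h1 hI hN hW hF _ O' _ cov _ hc hm o oO).
- by move=> g y _; apply: act_stab.
- by move=> y; rewrite mem_filter => /andP[/asboolP].
- by move=> y _; have [s hs] := ball_finite 2 y; exists s => z /hb /hs.
Qed.

Lemma restrict_action (S : {pred G}) (H : subGroupType S) :
  isometric_action D (fun h : H => act (val h)) /\ free_action D (fun h : H => act (val h)).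
Proof.
split.
  split=> [x|g h x|g]; first by rewrite gmulf1 act_one.
    by rewrite gmulfM act_mul.
  exact: act_iso.
move=> h p hp e; apply/val_inj; rewrite gmulf1; apply: hfree hp _.
by rewrite -gmulfV.
Qed.

Lemma restrict_cocompact (S : {pred G}) (H : subGroupType S) : finite_index S ->
  cocompact_action D (fun h : H => act (val h)).
Proof.
move=> [rs hrs]; have [r hr] := hcoc.
(* If [g * a] belongs to the subgroup, the translate of [t] by [g] is the translate of [move a t] by
   [g * a]. *)
pose move a (t : {fset T}) := [fset act a^-1%g x | x in t]%fset.
exists [seq move a t | t <- r, a <- rs] => s /hr [t [g [tr Dt ->]]].
have [a ar aS] := hrs g^-1%g.
have [h vh] : exists h : H, val h^-1%g = (g * a)%g.
  exists (Sub (a^-1 * g^-1)%g aS); rewrite gmulfV -[RHS]invgK; congr (_^-1)%g.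
  by rewrite invgM; exact: SubK.
exists (move a t), h^-1%g; split.
- exact: (allpairs_f (fun t a => move a t) tr ar).
- by have := si_simplex (act_iso a^-1%g) Dt.
apply/fsetP => y; apply/imfsetP/imfsetP => /= [[x xt ->]|[z /imfsetP [x /= xt ->] ->]].
  exists (act a^-1%g x); first by apply/imfsetP; exists x.
  by rewrite vh -act_mul -mulgA mulgV mulg1.
exists x => //.
by rewrite vh -act_mul -mulgA mulgV mulg1.
Qed.

End Actions.

(** * Biautomaticity of groups acting on buildings *)

Section BuildingsBC.
Variables (R : realType) (X : classical_type) (n : nat) (c : R).
Variables (T : choiceType) (D : peComplex R T) (apts : set (set {fset T})).
Hypothesis hD : euclidean_building X n c D apts.
Variables (isB : bool) (emb : {ffun 'I_n -> int} -> 'rV[R]_(ambient X n)) (unit : nat -> R).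
Hypothesis hflat : bc_flat isB (Defs.roots R X n c) emb unit.
Hypotheses (n0 : (0 < n)%N) (nB : isB -> (1 < n)%N).
Variables (G : groupType) (act : G -> T -> T).
Hypotheses (hact : isometric_action D act) (hfree : free_action D act) (hcoc : cocompact_action D act).

Theorem bc_biautomatic : biautomatic G.
Proof.
have [Sg hS] := apt_nonempty hD; have [f hf] := apt_chart hD hS.
have fD := @D_faces R T D; have hh := act_iso hact.
have s0 : bc_special isB (0 : {ffun 'I_n -> int}) by split=> [i j|_ i]; rewrite !ffunE ?subrr.
have [t0 v0 e0] := si_surj (apt_faces hD hS) hf (special_vx hflat s0).
have spP g x : sp isB n unit (simplex D) (len D) x -> sp isB n unit (simplex D) (len D) (act g x).
  by move/(iffLR (si_sp isB n unit fD (hh g) (all_vx D x))).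
have MP g k x m : relM isB n unit (simplex D) (len D) k x m ->
    relM isB n unit (simplex D) (len D) k (act g x) (act g m).
  by apply: relM_map fD (si_adj fD (hh g)) (si_sp _ _ _ fD (hh g)) _ _ _.
have IP g x y : relI isB n unit (simplex D) (len D) x y ->
    relI isB n unit (simplex D) (len D) (act g x) (act g y).
  by apply: relI_map fD (si_adj fD (hh g)) (si_sp _ _ _ fD (hh g)) _ _.
apply: (cocompact_combing hact hfree hcoc (bc_frame_axioms hD t0 hflat n0 nB) (bc_combing_axioms hD t0 hflat n0 nB)).
- move=> g x y; exact: (rel1_map fD (si_adj fD (hh g)) (si_sp _ _ _ fD (hh g))).
- exact: IP.
- move=> g x y [->|[sx sy a]]; [by left|right; split; [exact: spP|exact: spP|]].
  by case: (si_adj fD (hh g) a).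
- move=> g x y z [s|[m [k [r1 r2 u]]]]; first by left; apply: (si_pair (hh g)).
  right; exists (act g m), k; split; [exact: MP|exact: MP|move=> s /(MP g^-1%g) + /(IP g^-1%g)].
  by rewrite !(act_invK hact) => r r'; rewrite -(u _ r r') (act_inv hact).
- by move=> g x /(framedP hD t0 hflat n0 nB) /(spP g) /(framedP hD t0 hflat n0 nB).
- move=> x y [[->|[m [_ [a _] _] [_ [a' _] _]]]|[->|[_ _ a]]]; try exact: walk_refl.
    by apply: walk_cons a (walk1 (adj_sym a')).
  by apply: walk_mono (walk1 a).
- by move=> x y /(framedP hD t0 hflat n0 nB) sx /(framedP hD t0 hflat n0 nB); apply: (bc_Nb_connected hD t0 hflat n0 nB).
- by move=> x y /(framedP hD t0 hflat n0 nB) sx /(framedP hD t0 hflat n0 nB); apply: (bc_same_meet hD t0 hflat n0 nB).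
have [phi F] := frame_at hD hflat n0 nB hS hf s0.
by exists (phi 0), phi, 0; split=> //; exists Sg, f, 0.
Qed.

End BuildingsBC.

Section BuildingsA.
Variables (R : realType) (n : nat) (c : R) (T : choiceType) (D : peComplex R T) (apts : set (set {fset T})).
Hypotheses (hc : 0 < c) (n0 : (0 < n)%N).
Hypothesis hD : euclidean_building TypeA n c D apts.
Variable t0 : T.
Variables (Sg0 : set {fset T}) (f0 : T -> 'rV[R]_n.+1) (rho0 : T -> 'rV[R]_n.+1).
Hypothesis hr0 : a_retr c D apts Sg0 f0 0 rho0.
Variables (G : groupType) (act : G -> T -> T).
Hypotheses (hact : isometric_action D act) (hfree : free_action D act) (hcoc : cocompact_action D act).
Hypothesis hR1 : forall g x y, a_R1 c D rho0 x y -> a_R1 c D rho0 (act g x) (act g y).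

Theorem a_biautomatic : biautomatic G.
Proof.
have fD := @D_faces R T D; have hh := act_iso hact.
have IP g x y : a_RI D x y -> a_RI D (act g x) (act g y).
  by case=> [->|/(si_adj fD (hh g)) []]; [left|right].
apply: (cocompact_combing hact hfree hcoc (a_frame_axioms hc n0 hD t0 hr0) (a_combing_axioms hc n0 hD t0 hr0)) => //.
- by move=> g x _; apply: (a_framed hc n0 hD t0 hr0).
- by move=> x y [] [->|a]; try exact: walk_refl; apply: walk_mono (walk1 a).
- by move=> x y _ _; apply: (a_connected hc n0 hD t0 hr0).
- by move=> x y _ _; exists y; [exact: (a_same hc n0 hD t0 hr0)|left].
- by exists t0; apply: (a_framed hc n0 hD t0 hr0).
Qed.

End BuildingsA.

Lemma finite_index_predT (G : groupType) : finite_index (predT : {pred G}).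
Proof. by exists [:: 1%g] => g; exists 1%g; rewrite ?inE. Qed.

Lemma a_type_preserving (R : realType) (n : nat) (c : R) (T : choiceType) (D : peComplex R T)
    (rho0 : T -> 'rV[R]_n.+1) (g : T -> T) :
  simplicial_isometry (simplex D) (len D) (simplex D) (len D) g ->
  (forall x, vertex_type c rho0 (g x) = vertex_type c rho0 x) ->
  forall x y, a_R1 c D rho0 x y -> a_R1 c D rho0 (g x) (g y).
Proof.
move=> hg ht x y [a [z [ex ey]]]; split; first by case: (si_adj (@D_faces R T D) hg a).
by exists z; rewrite !ht.
Qed.

(** Elements inducing the same permutation of the types lie in one coset, so one representative for
    each permutation that occurs suffices. *)
Lemma types_finite_index (n : nat) (T : choiceType) (ty : T -> 'I_n.+1) (G : groupType)
    (act : G -> T -> T) (S : {pred G}) :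
  (forall g h x, act (g * h)%g x = act g (act h x)) -> (forall x, act 1%g x = x) ->
  (forall g, exists2 pi : 'I_n.+1 -> 'I_n.+1, injective pi & forall x, ty (act g x) = pi (ty x)) ->
  (forall g, g \in S <-> forall x, ty (act g x) = ty x) -> finite_index S.
Proof.
move=> am a1 hpi hS.
have /choice [pi hp] : forall g, exists p : {ffun 'I_n.+1 -> 'I_n.+1}, injective p /\ forall x, ty (act g x) = p (ty x).
  move=> g; have [p ip hp] := hpi g; exists (finfun p); split=> [i j|x]; rewrite !ffunE //; exact: ip.
have /choice [rep hr] : forall p : {ffun 'I_n.+1 -> 'I_n.+1}, exists g, (exists h, pi h = p) -> pi g = p.
  by move=> p; case: (pselect (exists h, pi h = p)) => [[h e]|hn]; [exists h|exists 1%g].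
exists [seq rep p | p <- enum {: {ffun 'I_n.+1 -> 'I_n.+1}}] => g.
exists (rep (pi g)); first by apply: map_f; rewrite mem_enum.
apply/hS => x; have e := hr (pi g) (ex_intro _ g erefl).
have [ip hp'] := hp (rep (pi g)); apply: ip.
by rewrite -hp' -am mulgA mulgV mul1g (hp g).2 e.
Qed.

Theorem a_order_biautomatic (R : realType) (n : nat) (c : R) (T : choiceType) (D : peComplex R T)
    (apts : set (set {fset T})) (tau : T -> T -> 'I_n) (G : groupType) (act : G -> T -> T) :
  0 < c -> (0 < n)%N -> euclidean_building TypeA n c D apts -> standard_ordering TypeA c D apts tau ->
  isometric_action D act -> (forall g, order_preserving TypeA c D apts tau (act g)) ->
  free_action D act -> cocompact_action D act -> biautomatic G.
Proof.
move=> hc n0 hD [ho [Sg [f [w [h [hS hf hw hh htau]]]]]] hact hord hfree hcoc.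
have [t0 _ _] := a_inv hc hD 0 hS hf.
have [rho hr] := a_retr_ex hc n0 hD t0 0 hS hf.
have E := a_R1_order hc n0 hD t0 hS hf hr ho hw hh htau.
apply: (a_biautomatic hc n0 hD t0 hr hact hfree hcoc) => g x y r.
have a := r.1; have [a' _] := si_adj (@D_faces R T D) (act_iso hact g) a.
apply/(E _ _ a'); rewrite hord; first exact/(E _ _ a).
exact: (a_dadj_quasi hc n0 hD t0 hr).
Qed.

Theorem a_virtually_biautomatic (R : realType) (n : nat) (c : R) (T : choiceType) (D : peComplex R T)
    (apts : set (set {fset T})) (G : groupType) (act : G -> T -> T) :
  0 < c -> (0 < n)%N -> euclidean_building TypeA n c D apts ->
  isometric_action D act -> free_action D act -> cocompact_action D act -> virtually_biautomatic G.
Proof.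
move=> hc n0 hD hact hfree hcoc.
have [Sg hS] := apt_nonempty hD; have [f hf] := apt_chart hD hS.
have [t0 _ _] := a_inv hc hD 0 hS hf.
have [rho hr] := a_retr_ex hc n0 hD t0 0 hS hf.
pose S : {pred G} := [pred g | `[< forall x, vertex_type c rho (act g x) = vertex_type c rho x >]].
have SP g : g \in S <-> forall x, vertex_type c rho (act g x) = vertex_type c rho x.
  by split=> [/asboolP|h]; [|apply/asboolP].
have clS : (1%g \in S) /\ forall g h, g \in S -> h \in S -> (g / h)%g \in S.
  split=> [|g h /SP hg /SP hh]; apply/SP => x; first by rewrite (act_one hact).
  by rewrite (act_mul hact) hg -[RHS](congr1 _ (act_inv hact h x)) hh.
have fin : finite_index S.
  apply: (types_finite_index (ty := vertex_type c rho) (act_mul hact) (act_one hact) _ SP) => g.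
  exact: (vertex_type_perm hc n0 hD t0 hS hf hr (act_iso hact g)).
exists S, (subgroup_of clS); split=> //.
have [hact' hfree'] := restrict_action hact hfree (subgroup_of clS).
apply: (a_biautomatic hc n0 hD t0 hr hact' hfree' (restrict_cocompact hact hcoc _ fin)) => g.
by apply: a_type_preserving; [exact: (act_iso hact)|apply/SP; exact: (valP g)].
Qed.

Theorem bc_building_biautomatic (R : realType) (X : classical_type) (n : nat) (c : R) (T : choiceType)
    (D : peComplex R T) (apts : set (set {fset T})) (G : groupType) (act : G -> T -> T) :
  X <> TypeA -> rank_ok X n -> 0 < c -> euclidean_building X n c D apts ->
  isometric_action D act -> free_action D act -> cocompact_action D act -> biautomatic G.
Proof.
case: X => // _ hn hc hD hact hfree hcoc; have n0 : (0 < n)%N := ltnW hn.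
  exact: (bc_biautomatic hD (flat_B n hc) n0 (fun=> hn) hact hfree hcoc).
by apply: (bc_biautomatic hD (flat_C n hc) n0 _ hact hfree hcoc).
Qed.

Theorem mainTheorem1 (R : realType) (X : classical_type) (n : nat) (c : R)
    (T : choiceType) (D : peComplex R T) (apts : set (set {fset T}))
    (hn : rank_ok X n) (hc : 0 < c)
    (hD : euclidean_building X n c D apts) :
  (forall tau : T -> T -> 'I_n, standard_ordering X c D apts tau ->
   forall (G : groupType) (act : G -> T -> T),
     isometric_action D act ->
     (forall g, order_preserving X c D apts tau (act g)) ->
     free_action D act -> cocompact_action D act ->
     biautomatic G)
  /\
  (forall (G : groupType) (act : G -> T -> T),
     isometric_action D act ->
     free_action D act -> cocompact_action D act ->
     virtually_biautomatic G).
Proof.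
case: (pselect (X = TypeA)) => [e|nA].
  subst X; split=> [tau ht G act hact hord|G act]; first exact: (a_order_biautomatic hc hn hD ht).
  by move=> hact hfree hcoc; exact: (a_virtually_biautomatic hc hn hD hact hfree hcoc).
split=> [tau _ G act hact _|G act hact] hfree hcoc.
  exact: (bc_building_biautomatic nA hn hc hD hact hfree hcoc).
(* In types B and C the whole group, packaged as a subgroup of itself, is biautomatic. *)
pose S : {pred G} := predT.
have cl : (1%g \in S) /\ forall g h, g \in S -> h \in S -> (g / h)%g \in S by [].
have fin : finite_index S := finite_index_predT G.
exists S, (subgroup_of cl); split=> //.
have [hact' hfree'] := restrict_action hact hfree (subgroup_of cl).
exact: (bc_building_biautomatic nA hn hc hD hact' hfree' (restrict_cocompact hact hcoc _ fin)).
Qed.
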